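(* Let $\mathcal{C} > 1$, $\theta \in (0,1)$, $d \geq 1$, and let $K : [1,\infty) \to [1,\infty)$ be a nondecreasing function with $\int_1^\infty \frac{\ln K(t)}{t^2}\,dt < \infty$. For all sufficiently small $\epsilon > 0$ (depending on $\mathcal{C}$, $\theta$, $d$, and $K$) there exists a real-valued, compactly supported $C^\infty$ function $\eta$ on $\mathbb{R}^d$ with the following properties: (1) $\eta(x)$ is even as a function of each coordinate $x_i$ and invariant under permutations of the $x_i$. In particular, for any tile $T$, the set of functions $\{\eta_{T,k}\}_{k \in \mathbb{Z}^d}$ depends only on the tile set $T_\square$. (2) Whenever $\mathcal{T}_*$ is an admissible tiling of $\mathbb{R}^d$ with respect to $(\mathcal{C},\theta,K)$, $$(1-\epsilon)\|f\|^2 \leq \sum_{T \in \mathcal{T}_*}\sum_{k \in \mathbb{Z}^d} |\langle f,\eta_{T,k}\rangle|^2 \leq (\mathcal{C}+\epsilon)\|f\|^2$$ for all $f \in L^2(\mathbb{R}^d)$.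
   Context: $|\cdot|$ denotes the $\ell^\infty$ norm on $\mathbb{R}^d$, and on matrices the operator norm $\ell^\infty \to \ell^\infty$; $\|\cdot\|$ and $\langle\cdot,\cdot\rangle$ are the $L^2(\mathbb{R}^d)$ norm and inner product. Tiles. A tile is a pair $T = (D,\xi) \in GL_d(\mathbb{R})\times\mathbb{R}^d$. Its tile set is $T_\square := \{\eta \in \mathbb{R}^d : |D^{-1}(\eta-\xi)| \leq \tfrac12\}$. For $t>0$, $tT := (tD,\xi)$, and $\dot T := (D,0)$. For a function $\varphi$ on $\mathbb{R}^d$, $T=(D,\xi)$ and $k \in \mathbb{R}^d$, $\varphi_{T,k}(x) := e^{2\pi i\xi\cdot x}\sqrt{|\det D|}\,\varphi(k + D^t x)$, with $D^t$ the transpose. Distance. For tiles $T_i = (D_i,\xi_i)$, $d(T_1,T_2) := \log_2\max\{|D_1^{-1}D_2|,|D_2^{-1}D_1|\}$. This depends only on the origin-centered tile sets $(\dot T_1)_\square,(\dot T_2)_\square$, and gives a metric on the space of origin-centered tile sets (the tile sets of tiles of the form $(D,0)$). Admissible tilings. Given $\mathcal{C}>1$, $\theta\in(0,1)$ and a nondecreasing function $K$ on $[1,\infty)$ with $K(1)\geq 1$ and $\int_1^\infty \frac{\ln K(t)}{t^2}dt<\infty$, a collection of tiles $\mathcal{T}_*$ is an admissible tiling of $\mathbb{R}^d$ with respect to $(\mathcal{C},\theta,K)$ when: (1) (Covering) Almost every $\xi\in\mathbb{R}^d$ belongs to $((1-\theta)T)_\square$ for some $T\in\mathcal{T}_*$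 and does not belong to $T_\square$ for more than $\mathcal{C}$ distinct tiles $T\in\mathcal{T}_*$. (2) (Regularity) There exists a function $\rho:\mathcal{T}_*\to[1,\infty)$ such that (a) if $T_1,T_2\in\mathcal{T}_*$ and the tile sets of $T_2$ and $\rho(T_1)T_1$ intersect, then $d(\dot T_1,\dot T_2)\leq\mathcal{C}$; and (b) for each $t\geq1$, the set $\{\dot T_\square : T\in\mathcal{T}_*,\ \rho(T)\leq t\}$ can be covered by no more than $K(t)$ metric balls of radius $\mathcal{C}$ (in the space of origin-centered tile sets with metric $d$). *)

(* Defs.v *)
From HB Require Import structures.
From mathcomp Require Import all_boot all_order all_algebra perm.
From mathcomp Require Import complex.
From mathcomp Require Import all_classical all_reals all_analysis.

Set Implicit Arguments.
Unset Strict Implicit.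
Unset Printing Implicit Defensive.
Import Order.TTheory GRing.Theory Num.Theory.
Import numFieldNormedType.Exports.
Import Normc.

Local Open Scope classical_set_scope.
Local Open Scope ring_scope.
Local Open Scope complex_scope.

(* Product sigma-algebra on column vectors; for T = R it is the Borel one. *)
Definition measure_cV_display : measure_display -> measure_display.
Proof. exact. Qed.

Section measurable_cV.
Context {d} {T : measurableType d}.
Variable n : nat.

Let coors : 'I_n -> 'cV[T]_n -> T := fun i x => x i ord0.

Let cV_set0 : g_sigma_preimage coors set0.
Proof. exact: sigma_algebra0. Qed.

Let cV_setC A : g_sigma_preimage coors A -> g_sigma_preimage coors (~` A).
Proof. exact: sigma_algebraC. Qed.

Let cV_bigcup (F : _^nat) : (forall i, g_sigma_preimage coors (F i)) ->
  g_sigma_preimage coors (\bigcup_i (F i)).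
Proof. exact: sigma_algebra_bigcup. Qed.

HB.instance Definition _ := @isMeasurable.Build (measure_cV_display d)
  'cV[T]_n (g_sigma_preimage coors) cV_set0 cV_setC cV_bigcup.

End measurable_cV.

Lemma measurable_coord d (T : measurableType d) n (i : 'I_n) :
  measurable_fun [set: 'cV[T]_n] (fun x : 'cV[T]_n => x i ord0).
Proof.
move=> _ Y mY; rewrite setTI; apply: sub_sigma_algebra => /=.
rewrite -bigcup_seq/=; exists i => /=; first by rewrite mem_index_enum.
by exists Y => //; rewrite setTI.
Qed.

Lemma measurable_fun_cV d1 d2 (T1 : measurableType d1) (T2 : measurableType d2)
    n (f : T1 -> 'cV[T2]_n) :
  (forall i, measurable_fun [set: T1] (fun x => f x i ord0)) ->
  measurable_fun [set: T1] f.
Proof.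
move=> mf _ A mA.
suff : image_set_system setT f measurable A by [].
apply: (smallest_sub _ _ mA).
  exact/sigma_algebra_image/sigma_algebra_measurable.
rewrite -bigcup_seq => B [/= i _ [Y mY <-]].
by rewrite /image_set_system /= !setTI -[X in measurable X]setTI; exact: mf.
Qed.

Section lebesgue_cV.
Context {R : realType}.

Definition cons_cV n (p : measurableTypeR R * 'cV[R]_n) : 'cV[R]_n.+1 :=
  \col_i if unlift ord0 i is Some j then p.2 j ord0 else p.1.

Lemma measurable_cons_cV n : measurable_fun setT (@cons_cV n).
Proof.
apply: measurable_fun_cV => i; rewrite /cons_cV.
under eq_fun do rewrite mxE.
case: (unlift ord0 i) => [j|]; last exact: measurable_fst.
apply: (@measurableT_comp _ _ _ _ _ _ (fun x : 'cV[R]_n => x j ord0)).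
  exact: measurable_coord.
exact: measurable_snd.
Qed.

Definition uncons_cV n (x : 'cV[R]_n.+1) : measurableTypeR R * 'cV[R]_n :=
  (x ord0 ord0, \col_i x (lift ord0 i) ord0).

Lemma measurable_uncons_cV n : measurable_fun setT (@uncons_cV n).
Proof.
apply/measurable_fun_pairP; split; first exact: (@measurable_coord _ R _ ord0).
apply: measurable_fun_cV => i; rewrite /uncons_cV/=.
under eq_fun do rewrite mxE.
exact: measurable_coord.
Qed.

Lemma cons_cVK n : cancel (@cons_cV n) (@uncons_cV n).
Proof.
move=> [a x]; rewrite /cons_cV /uncons_cV mxE unlift_none; congr pair.
by apply/matrixP => i j; rewrite !mxE liftK (ord1 j).
Qed.

Section step.
Variables (n : nat) (m : {sigma_finite_measure set 'cV[R]_n -> \bar R}).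
Local Open Scope ereal_scope.

Definition lebesgue_cV_step : set 'cV[R]_n.+1 -> \bar R :=
  pushforward (@lebesgue_measure R \x m) (@cons_cV n).

Let step0 : lebesgue_cV_step set0 = 0.
Proof. by rewrite /lebesgue_cV_step /pushforward preimage_set0 measure0. Qed.

Let step_ge0 A : 0 <= lebesgue_cV_step A.
Proof. by rewrite /lebesgue_cV_step /pushforward measure_ge0. Qed.

Let step_sigma_additive : semi_sigma_additive lebesgue_cV_step.
Proof.
have mcons B : measurable B -> measurable (@cons_cV n @^-1` B).
  by move=> mB; rewrite -[X in measurable X]setTI; exact: measurable_cons_cV.
move=> F mF tF mUF; rewrite /lebesgue_cV_step /pushforward preimage_bigcup.
apply: measure_semi_sigma_additive.
- by move=> k; exact: mcons.
- apply/trivIsetP => /= i j _ _ ij; rewrite -preimage_setI.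
  by move/trivIsetP : tF => /(_ _ _ _ _ ij) ->//; rewrite preimage_set0.
- by rewrite -preimage_bigcup; exact: mcons.
Qed.

HB.instance Definition _ := isMeasure.Build _ _ _
  lebesgue_cV_step step0 step_ge0 step_sigma_additive.

Let step_sigma_finite : sigma_finite setT lebesgue_cV_step.
Proof.
have /sigma_finiteP[F [TF ndF Foo]] := sigma_finiteT (@lebesgue_measure R).
have /sigma_finiteP[G [TG ndG Goo]] := sigma_finiteT m.
exists (fun k => @uncons_cV n @^-1` (F k `*` G k)).
  rewrite -preimage_bigcup (_ : \bigcup_k _ = setT) ?preimage_setT//.
  rewrite -setXTT TF TG predeqE => -[x y]; split=> [[k _ []/= ? ?]|].
    by split; exists k.
  move=> [/= [k _ Fx] [l _ Gy]]; exists (maxn k l) => //; split.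
  - by move: x Fx; exact/subsetPset/ndF/leq_maxl.
  - by move: y Gy; exact/subsetPset/ndG/leq_maxr.
move=> k; have [mF Fk] := Foo k; have [mG Gk] := Goo k; split.
  rewrite -[X in measurable X]setTI; apply: measurable_uncons_cV => //.
  exact: measurableX.
rewrite /lebesgue_cV_step /pushforward -comp_preimage.
rewrite (_ : _ \o _ = id) ?preimage_id; last first.
  by apply/funext => x; exact: cons_cVK.
by rewrite product_measure1E// lte_mul_pinfty// ge0_fin_numE.
Qed.

HB.instance Definition _ := Measure_isSigmaFinite.Build _ _ _
  lebesgue_cV_step step_sigma_finite.

End step.

(* [lebesgue_measure] lives on [measurableTypeR R], whose sigma-algebra is
   convertible to the one of [R]; in dimension 0 we get the unit mass. *)
Fixpoint lebesgue_cV n : {sigma_finite_measure set 'cV[R]_n -> \bar R} :=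
  if n is k.+1 return {sigma_finite_measure set 'cV[R]_n -> \bar R}
  then lebesgue_cV_step (lebesgue_cV k)
  else \d_(0%R : 'cV[R]_0).

Lemma lebesgue_cV_box n (A : 'I_n -> set R) :
  (forall i, measurable (A i)) ->
  lebesgue_cV n [set x : 'cV[R]_n | forall i, A i (x i ord0)] =
  (\prod_i @lebesgue_measure R (A i))%E.
Proof.
elim: n A => [|n IHn] A mA.
  rewrite big_ord0 /= diracE mem_set// => -[] //.
have mbox k (B : 'I_k -> set R) : (forall i, measurable (B i)) ->
    measurable [set x : 'cV[R]_k | forall i, B i (x i ord0)].
  move=> mB; rewrite (_ : mkset _ =
      \bigcap_(i in [set: 'I_k]) ((fun x : 'cV[R]_k => x i ord0) @^-1` B i)).
    apply: fin_bigcap_measurable => // i _.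
    by rewrite -[X in measurable X]setTI; exact: measurable_coord.
  by apply/seteqP; split => [x xB i _|x xB i]; exact: xB.
rewrite big_ord_recl -IHn; last by move=> i; exact: mA.
rewrite -product_measure1E; [|exact: mA|by apply: (mbox n (fun i => A (lift ord0 i)))].
rewrite /= /lebesgue_cV_step /pushforward; congr (product_measure1 _ _ _).
apply/seteqP; split => -[a x] /=.
  move=> Ax; split; first by have := Ax ord0; rewrite mxE unlift_none.
  by move=> i; have := Ax (lift ord0 i); rewrite mxE liftK.
move=> [Aa Ax] i; rewrite mxE; case: unliftP => [j ->|->//].
exact: Ax.
Qed.

End lebesgue_cV.
Arguments lebesgue_cV R n : clear implicits.

Section tiles.
Context {R : realType} {d : nat}.
Implicit Types (T : 'M[R]_d * 'cV[R]_d).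

(* The library norm of a column vector is the l^oo norm, but its norm of a
   matrix is the largest entry, not the operator norm. *)
Definition opnorm (M : 'M[R]_d) : R :=
  sup [set `|M *m x| | x in [set x : 'cV[R]_d | `|x| <= 1]].

(* A pair (D, xi) is a tile when D is invertible. *)
Definition is_tile T : Prop := T.1 \in unitmx.

Definition tile_set T : set 'cV[R]_d :=
  [set eta : 'cV[R]_d | `|invmx T.1 *m (eta - T.2)| <= 2^-1].

Definition tile_scale (t : R) T : 'M[R]_d * 'cV[R]_d := (t *: T.1, T.2).

Definition tile_center T : 'M[R]_d * 'cV[R]_d := (T.1, 0).

Definition tile_dist T1 T2 : R :=
  ln (Num.max (opnorm (invmx T1.1 *m T2.1)) (opnorm (invmx T2.1 *m T1.1))) /
  ln 2.

(* Closed ball, in the space of origin-centered tile sets, around the tile set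
   of [tile_center T]. *)
Definition tile_ball T (r : R) : set (set 'cV[R]_d) :=
  [set tile_set (tile_center T') |
     T' in [set T' | is_tile T' /\
                     tile_dist (tile_center T) (tile_center T') <= r]].

Definition covered_by_balls (A : set (set 'cV[R]_d)) (N r : R) : Prop :=
  exists s : seq ('M[R]_d * 'cV[R]_d),
    [/\ (size s)%:R <= N, forall T, T \in s -> is_tile T &
        A `<=` \bigcup_(T in [set` s]) tile_ball T r].

Definition tiling_covering (C theta : R)
    (Ts : set ('M[R]_d * 'cV[R]_d)) : Prop :=
  {ae lebesgue_cV R d, forall xi : 'cV[R]_d,
     (exists2 T, Ts T & tile_set (tile_scale (1 - theta) T) xi) /\
     (counting [set T | Ts T /\ tile_set T xi] <= C%:E)%E}.

Definition tiling_regularity (C : R) (K : R -> R)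
    (Ts : set ('M[R]_d * 'cV[R]_d)) : Prop :=
  exists rho : 'M[R]_d * 'cV[R]_d -> R,
    [/\ forall T, Ts T -> 1 <= rho T,
        forall T1 T2, Ts T1 -> Ts T2 ->
          tile_set T2 `&` tile_set (tile_scale (rho T1) T1) !=set0 ->
          tile_dist (tile_center T1) (tile_center T2) <= C &
        forall t, 1 <= t ->
          covered_by_balls
            [set tile_set (tile_center T) | T in [set T | Ts T /\ rho T <= t]]
            (K t) C].

Definition admissible_tiling (C theta : R) (K : R -> R)
    (Ts : set ('M[R]_d * 'cV[R]_d)) : Prop :=
  [/\ Ts `<=` is_tile, tiling_covering C theta Ts & tiling_regularity C K Ts].

End tiles.

Section functions.
Context {R : realType} {d : nat}.
Implicit Types (x xi k : 'cV[R]_d) (f g phi : 'cV[R]_d -> R[i]).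

Definition dotp xi x : R := \sum_i xi i ord0 * x i ord0.

Definition expi (t : R) : R[i] := cos t +i* sin t.

Definition packet phi (T : 'M[R]_d * 'cV[R]_d) k : 'cV[R]_d -> R[i] :=
  fun x => expi (2 * pi * dotp T.2 x) * (Num.sqrt `|\det T.1|)%:C *
           phi (k + T.1^T *m x).

Definition of_Zd (k : 'cV[int]_d) : 'cV[R]_d := map_mx intr k.

Definition L2norm f : \bar R := 'N[lebesgue_cV R d]_2%:E[EFin \o (@normc R \o f)].

(* Borel measurability loses nothing: every Lebesgue measurable function is
   a.e. equal to a Borel one. *)
Definition in_L2 f : Prop :=
  [/\ measurable_fun setT (@complex.Re R \o f),
      measurable_fun setT (@complex.Im R \o f) & (L2norm f < +oo)%E].

Definition inner f g : R[i] :=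
  (\int[lebesgue_cV R d]_x complex.Re (f x * (g x)^*))%R +i*
  (\int[lebesgue_cV R d]_x complex.Im (f x * (g x)^*))%R.

Definition partial (i : 'I_d) (h : 'cV[R]_d -> R) : 'cV[R]_d -> R :=
  fun x => 'D_(delta_mx i ord0) h x.

Definition smooth (h : 'cV[R]_d -> R) : Prop :=
  forall s : seq 'I_d, continuous (foldr partial h s) /\
    forall (i : 'I_d) x, derivable (foldr partial h s) x (delta_mx i ord0).

Definition compactly_supported (h : 'cV[R]_d -> R) : Prop :=
  compact (closure [set x : 'cV[R]_d | h x != 0]).

Definition flip (i : 'I_d) x : 'cV[R]_d :=
  \col_j if j == i then - x j ord0 else x j ord0.

Definition even_coords (h : 'cV[R]_d -> R) : Prop :=
  forall i x, h (flip i x) = h x.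

Definition perm_invariant (h : 'cV[R]_d -> R) : Prop :=
  forall (s : 'S_d) x, h (row_perm s x) = h x.

End functions.

(* Main.v *)
(** [eta (x) = \prod_i h (x_i)] where [h] is the cosine transform of an even window
    [w] with [1 - delta <= w <= 1] on [|z| <= (1 - theta) / 2] and [w <= delta] on
    [|z| >= (1 - theta / 2) / 2].  The window is the indicator function of an interval
    mollified by [phi0 (s) * \prod_j sinc (2^(1-j) s)^(2 m_j)]; the transform of each
    [sinc] factor is supported in an interval of length proportional to [2^-j], so [h]
    has compact support as soon as [\sum_j m_j / 2^j] converges, while [w] is at most
    [delta * 4^-m_j] beyond distance about [2^j].  Convergence of the integral of
    [ln K (t) / t^2] is exactly what allows [4^m_j] to beat [2^(j d) * K (2^j)].

    Expanding the coefficients of [f] along the packets of one tile [T] as Fourier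
    coefficients, Parseval's identity for the periodized function gives
    [\sum_k |<f, eta_(T,k)>|^2 = \int |f^|^2 Phi_T^2] up to the cross terms between
    distinct lattice translates, where [Phi (z) = \prod_i w (z_i)] and [Phi_T] is [Phi]
    in the coordinates of [T].  Summing over [T], the main term lies between
    [(1 - delta)^(2 d)] and [C + O(delta)] by the covering condition.  The tails and the
    cross terms are [O(delta)]: if [T] comes within [2^j] (in its own coordinates) of
    [xi], then regularity bounds the shapes of such [T] by [1 + K (2^(j+1))] classes, and
    comparing volumes bounds the number of tiles in each class by [O(2^(j d))].  Both
    bounds extend from bounded functions of bounded support to [L^2] by truncation. *)

Require Import Defs.
From mathcomp Require Import all_boot all_order all_algebra perm complex.
From mathcomp Require finmap.
From mathcomp Require Import all_classical all_reals all_analysis.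
From mathcomp Require Import measurable_realfun lebesgue_integral_differentiation.
From mathcomp Require Import zify ring lra.

Set Implicit Arguments.
Unset Strict Implicit.
Unset Printing Implicit Defensive.
Import Order.TTheory GRing.Theory Num.Theory.
Import numFieldNormedType.Exports.
Import Normc.

Local Open Scope classical_set_scope.
Local Open Scope ring_scope.
Local Open Scope complex_scope.

(** * Complex-valued integrals *)

(** The bounds [1] and [C] are reached up to [eps] because, at almost every frequency, one tile has
    [Phi] close to 1 and at most [C] tiles have it large, and these enter only through
    [Phi ^+ 2 <= Phi <= 1]; everything else carries a factor [delta], which is fixed last. The
    obstacle is that a cross term couples values of f^ at two different points, so it is not an
    integral of |f^|^2. A Schur test removes the coupling: it charges a pair of lattice translates
    to the two squares separately, with weight [Phi z] times the sum of [Phi] over the other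
    translates of [z]. This weight is small for two different reasons. When [z] is near 0, all other
    translates are far. When [z] is far from 0, the other translates sum to [O(1)] only, but then
    [Phi z] is a tail, and tails stay summable over the tiling. Products of [sinc] factors are the
    classical device of Ingham: the logarithmic integral decides whether a prescribed decay is
    compatible with a compactly supported transform. Plancherel is needed only for bounded functions
    of bounded support, so everything rests on Parseval for the circle, proved with the Fejer
    kernel. *)

Notation cRe := (@complex.Re _).
Notation cIm := (@complex.Im _).

(* The infix [^*] is [conjc] or [Num.conj] depending on the interpretation scope. *)
Definition cj {R : realType} (z : R[i]) : R[i] := conjc z.
Arguments cj : simpl never.

Section complex_facts.
Context {R : realType}.
Implicit Types (z w : R[i]).

Lemma normc_ge0 z : 0 <= normc z.
Proof. by case: z => a b; exact: sqrtr_ge0. Qed.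

Lemma normc_sqr z : normc z ^+ 2 = cRe z ^+ 2 + cIm z ^+ 2.
Proof. by case: z => a b /=; rewrite sqr_sqrtr// addr_ge0// sqr_ge0. Qed.

Lemma cReM z w : cRe (z * w) = cRe z * cRe w - cIm z * cIm w.
Proof. by case: z w => [a b] [c d]. Qed.

Lemma cImM z w : cIm (z * w) = cRe z * cIm w + cIm z * cRe w.
Proof. by case: z w => [a b] [c d]. Qed.

Lemma cReD z w : cRe (z + w) = cRe z + cRe w.
Proof. by case: z w => [a b] [c d]. Qed.

Lemma cImD z w : cIm (z + w) = cIm z + cIm w.
Proof. by case: z w => [a b] [c d]. Qed.

Lemma cReN z : cRe (- z) = - cRe z.
Proof. by case: z. Qed.

Lemma cImN z : cIm (- z) = - cIm z.
Proof. by case: z. Qed.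

Lemma cReJ z : cRe ((cj z)) = cRe z.
Proof. by case: z. Qed.

Lemma cImJ z : cIm ((cj z)) = - cIm z.
Proof. by case: z. Qed.

Lemma cRe_sum I (r : seq I) (P : pred I) (F : I -> R[i]) :
  cRe (\sum_(i <- r | P i) F i) = \sum_(i <- r | P i) cRe (F i).
Proof. by apply: (big_morph _ cReD). Qed.

Lemma cIm_sum I (r : seq I) (P : pred I) (F : I -> R[i]) :
  cIm (\sum_(i <- r | P i) F i) = \sum_(i <- r | P i) cIm (F i).
Proof. by apply: (big_morph _ cImD). Qed.

Lemma complexP z w : cRe z = cRe w -> cIm z = cIm w -> z = w.
Proof. by case: z w => [a b] [c d] /= -> ->. Qed.

Lemma cconjM z w : (cj (z * w)) = (cj z) * (cj w).
Proof. exact: (rmorphM (@conjc R)). Qed.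

Lemma cconj_sum I (r : seq I) (P : pred I) (F : I -> R[i]) :
  (cj (\sum_(i <- r | P i) F i)) = \sum_(i <- r | P i) (cj (F i)).
Proof. exact: (rmorph_sum (@conjc R)). Qed.

Lemma cj_real (a : R) : cj a%:C = a%:C.
Proof. exact: conjc_real. Qed.

Lemma cjK z : cj (cj z) = z.
Proof. exact: conjcK. Qed.

Lemma mulcJ z : z * (cj z) = (normc z ^+ 2)%:C.
Proof. by apply: complexP; rewrite /= ?cReM ?cImM ?cReJ ?cImJ ?normc_sqr; ring. Qed.

Lemma normcJ' z : normc ((cj z)) = normc z.
Proof. by case: z => a b /=; rewrite sqrrN. Qed.

Lemma normcR (a : R) : normc (a%:C) = `|a|.
Proof. by rewrite /= expr0n/= addr0 sqrtr_sqr. Qed.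

Lemma normr_Re z : `|cRe z| <= normc z.
Proof.
rewrite -(ler_sqr (x := `|_|)) ?nnegrE ?normc_ge0// normc_sqr real_normK ?num_real//.
by rewrite lerDl sqr_ge0.
Qed.

Lemma normr_Im z : `|cIm z| <= normc z.
Proof.
rewrite -(ler_sqr (x := `|_|)) ?nnegrE ?normc_ge0// normc_sqr real_normK ?num_real//.
by rewrite lerDr sqr_ge0.
Qed.

Lemma normc_le_ReIm z : normc z <= `|cRe z| + `|cIm z|.
Proof.
rewrite -ler_sqr ?nnegrE ?normc_ge0 ?addr_ge0//.
rewrite normc_sqr sqrrD !real_normK ?num_real// lerD2r lerDl.
by rewrite mulrn_wge0// mulr_ge0.
Qed.

Lemma normc_sum_le I (r : seq I) (P : pred I) (F : I -> R[i]) :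
  normc (\sum_(i <- r | P i) F i) <= \sum_(i <- r | P i) normc (F i).
Proof.
elim/big_rec2 : _ => [|i x y _ h]; first by rewrite normc0.
by rewrite (le_trans (le_normcD _ _))// lerD2l.
Qed.

Lemma cReMJ z : cRe (z * (cj z)) = normc z ^+ 2.
Proof. by rewrite cReM cReJ cImJ normc_sqr; ring. Qed.

Lemma normc_expi (t : R) : normc (expi t) = 1.
Proof. by rewrite /= cos2Dsin2 sqrtr1. Qed.

Lemma expiD (s t : R) : expi (s + t) = expi s * expi t.
Proof. by apply: complexP; rewrite /= ?cosD ?sinD; ring. Qed.

Lemma expi0 : expi (0 : R) = 1.
Proof. by rewrite /expi cos0 sin0. Qed.

Lemma expiN (t : R) : expi (- t) = (cj (expi t)).
Proof. by rewrite /expi cosN sinN. Qed.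

Lemma expi_2piz (t : R) (k : int) : expi (t + 2 * pi * k%:~R) = expi t.
Proof.
have expi2pi n : expi (2 * pi * n%:R : R) = 1.
  elim: n => [|n IH]; first by rewrite mulr0 expi0.
  rewrite -[n.+1]addn1 natrD mulrDr expiD IH mul1r mulr1 /expi.
  rewrite mulr_natl cos2pi sin2pi //.
rewrite expiD; case: k => n; first by rewrite -pmulrn expi2pi mulr1.
by rewrite NegzE mulrNz mulrN expiN -pmulrn expi2pi (_ : cj 1 = 1) ?mulr1//; exact: conjc1.
Qed.

End complex_facts.

Section cvg_complex.
Context {R : realType}.
Implicit Types (u : nat -> R[i]).

Definition ccvg u (l : R[i]) :=
  ((fun n => cRe (u n)) @ \oo --> cRe l) /\ ((fun n => cIm (u n)) @ \oo --> cIm l).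

Lemma ccvg_normc_sqr u l : ccvg u l ->
  (fun n => normc (u n) ^+ 2) @ \oo --> normc l ^+ 2.
Proof.
move=> [h1 h2]; under eq_fun do rewrite normc_sqr.
rewrite normc_sqr; apply: cvgD; rewrite expr2; under eq_fun do rewrite expr2;
  exact: cvgM.
Qed.

Lemma ccvgM (c : R[i]) u l : ccvg u l -> ccvg (fun n => c * u n) (c * l).
Proof.
move=> [h1 h2]; split.
  under eq_fun do rewrite cReM; rewrite cReM.
  by apply: cvgB; apply: cvgMr.
under eq_fun do rewrite cImM; rewrite cImM.
by apply: cvgD; apply: cvgMr.
Qed.

Lemma ccvg_unique u l l' : ccvg u l -> ccvg u l' -> l = l'.
Proof.
move=> [h1 h2] [h3 h4]; apply: complexP; [exact: (cvg_unique _ h1 h3)|].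
exact: (cvg_unique _ h2 h4).
Qed.

End cvg_complex.

Lemma measurable_fun_eq d d' (T : measurableType d) (T' : measurableType d')
  (f g : T -> T') : f =1 g -> measurable_fun setT f -> measurable_fun setT g.
Proof. by move=> /funext ->. Qed.

Section Rint.
Context d (T : measurableType d) (R : realType) (mu : {measure set T -> \bar R}).
Implicit Types f g : T -> R.

Definition intg f := mu.-integrable setT (EFin \o f).

Lemma intg_meas f : intg f -> measurable_fun setT f.
Proof. by move=> /integrableP[/measurable_EFinP]. Qed.

Lemma intg_le f g : measurable_fun setT f -> (forall x, `|f x| <= g x) ->
  intg g -> intg f.
Proof.
move=> mf fg ig; apply: (le_integrable _ _ _ ig) => //; first exact/measurable_EFinP.
move=> x _ /=; rewrite lee_fin.
exact: le_trans (fg x) (ler_norm _).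
Qed.

Lemma intgD f g : intg f -> intg g -> intg (f \+ g).
Proof. by move=> f1 g1; rewrite /intg; exact: (integrableD _ f1 g1). Qed.

Lemma intgB f g : intg f -> intg g -> intg (f \- g).
Proof. by move=> f1 g1; rewrite /intg; exact: (integrableB _ f1 g1). Qed.

Lemma intgZ r f : intg f -> intg (fun x => r * f x).
Proof. by move=> f1; rewrite /intg; exact: (integrableZl _ r f1). Qed.

Lemma intg_norm f : intg f -> intg (fun x => `|f x|).
Proof.
by move=> h; apply: (@integrable_norm _ _ _ mu setT f).
Qed.

Lemma intg_sum I (r : seq I) (P : pred I) (F : I -> T -> R) :
  (forall i, P i -> intg (F i)) -> intg (fun x => \sum_(i <- r | P i) F i x).
Proof.
move=> h; elim: r => [|i r IH].
  apply: (intg_le (g := fun=> 0)).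
  - rewrite (_ : (fun _ => _) = cst 0); first exact: measurable_cst.
    by apply/funext => x; rewrite big_nil.
  - by move=> x; rewrite big_nil normr0.
  - by apply: integrable0.
under eq_fun do rewrite big_cons.
by case: (boolP (P i)) => // Pi; apply: (intgD (h _ Pi) IH).
Qed.

Lemma intg_ge0_lty f : measurable_fun setT f -> (forall x, 0 <= f x) ->
  (\int[mu]_x (f x)%:E < +oo)%E -> intg f.
Proof.
move=> mf f0 foo; apply/integrableP; split; first exact/measurable_EFinP.
by under eq_integral do rewrite /= ger0_norm//.
Qed.

Lemma RintegralE f : intg f -> (\int[mu]_x f x)%:E = (\int[mu]_x (f x)%:E)%E.
Proof.
by move=> h; rewrite /Rintegral fineK//; exact: integrable_fin_num.
Qed.

End Rint.

Section cmeas.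
Context d (T : measurableType d) (R : realType).
Implicit Types f g : T -> R[i].

Definition cmeas f := measurable_fun setT (fun x => cRe (f x)) /\
  measurable_fun setT (fun x => cIm (f x)).

Lemma cmeasD f g : cmeas f -> cmeas g -> cmeas (fun x => f x + g x).
Proof.
move=> [f1 f2] [g1 g2]; split.
  by under eq_fun do rewrite cReD; exact: measurable_funD.
by under eq_fun do rewrite cImD; exact: measurable_funD.
Qed.

Lemma cmeasN f : cmeas f -> cmeas (fun x => - f x).
Proof.
move=> [f1 f2]; split.
  by under eq_fun do rewrite cReN; exact: measurableT_comp.
by under eq_fun do rewrite cImN; exact: measurableT_comp.
Qed.

Lemma cmeasB f g : cmeas f -> cmeas g -> cmeas (fun x => f x - g x).
Proof. by move=> hf hg; apply: cmeasD => //; exact: cmeasN. Qed.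

Lemma cmeasM f g : cmeas f -> cmeas g -> cmeas (fun x => f x * g x).
Proof.
move=> [f1 f2] [g1 g2]; split.
  under eq_fun do rewrite cReM; apply: measurable_funB; exact: measurable_funM.
under eq_fun do rewrite cImM; apply: measurable_funD; exact: measurable_funM.
Qed.

Lemma cmeasJ f : cmeas f -> cmeas (fun x => (cj (f x))).
Proof.
move=> [f1 f2]; split; first by under eq_fun do rewrite cReJ.
by under eq_fun do rewrite cImJ; exact: measurableT_comp.
Qed.

Lemma cmeas_cst (c : R[i]) : cmeas (fun=> c).
Proof. by split; exact: measurable_cst. Qed.

Lemma cmeas_real (f : T -> R) : measurable_fun setT f -> cmeas (fun x => (f x)%:C).
Proof. by split. Qed.

Lemma cmeas_expi (f : T -> R) : measurable_fun setT f -> cmeas (fun x => expi (f x)).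
Proof.
move=> mf; split => /=; apply: measurableT_comp => //.
  by apply: continuous_measurable_fun; exact: continuous_cos.
by apply: continuous_measurable_fun; exact: continuous_sin.
Qed.

Lemma cmeas_sum I (r : seq I) (P : pred I) (F : I -> T -> R[i]) :
  (forall i, P i -> cmeas (F i)) -> cmeas (fun x => \sum_(i <- r | P i) F i x).
Proof.
move=> h; elim: r => [|i r IH].
  by under eq_fun do rewrite big_nil; exact: cmeas_cst.
under eq_fun do rewrite big_cons.
case: (boolP (P i)) => // Pi.
by apply: cmeasD => //; exact: h.
Qed.

Lemma cmeas_normc f : cmeas f -> measurable_fun setT (fun x => normc (f x)).
Proof.
move=> [f1 f2].
apply: (measurable_fun_eq (f := fun x => Num.sqrt (cRe (f x) ^+ 2 + cIm (f x) ^+ 2))).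
  by move=> x; case: (f x).
have ms := continuous_measurable_fun (@sqrt_continuous R).
apply: (measurableT_comp ms).
by apply: measurable_funD; exact: measurable_funX.
Qed.

Lemma cmeas_normc2 f : cmeas f -> measurable_fun setT (fun x => normc (f x) ^+ 2).
Proof. by move=> /cmeas_normc h; exact: measurable_funX. Qed.

Lemma cmeas_cvg (f_ : nat -> T -> R[i]) f : (forall n, cmeas (f_ n)) ->
  (forall x, ccvg (f_ ^~ x) (f x)) -> cmeas f.
Proof.
move=> mf cf; split.
  apply: (measurable_fun_cvg (h := fun n x => cRe (f_ n x))) => //.
    by move=> n; have [] := mf n.
  by move=> x _; have [] := cf x.
apply: (measurable_fun_cvg (h := fun n x => cIm (f_ n x))) => //.
  by move=> n; have [] := mf n.
by move=> x _; have [] := cf x.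
Qed.

End cmeas.

Lemma cmeas_comp d d' (T : measurableType d) (T' : measurableType d')
    (R : realType) (f : T' -> R[i]) (p : T -> T') :
  cmeas f -> measurable_fun setT p -> cmeas (f \o p).
Proof.
move=> [f1 f2] mp; split; [exact: (measurableT_comp f1)|].
exact: (measurableT_comp f2).
Qed.

Section cint.
Context d (T : measurableType d) (R : realType) (mu : {measure set T -> \bar R}).
Implicit Types f g : T -> R[i].

Definition cint f : R[i] :=
  (\int[mu]_x cRe (f x)) +i* (\int[mu]_x cIm (f x)).

Definition cL1 f := cmeas f /\ intg mu (fun x => normc (f x)).

Lemma eq_cint f g : f =1 g -> cint f = cint g.
Proof. by move=> /funext ->. Qed.

Lemma cL1_le f (g : T -> R) : cmeas f -> (forall x, normc (f x) <= g x) ->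
  intg mu g -> cL1 f.
Proof.
move=> mf fg ig; split => //; apply: intg_le ig; first exact: cmeas_normc.
by move=> x; rewrite ger0_norm// normc_ge0.
Qed.

Lemma cL1_Re f : cL1 f -> intg mu (fun x => cRe (f x)).
Proof. by move=> [[mf _]]; apply: intg_le => // x; exact: normr_Re. Qed.

Lemma cL1_Im f : cL1 f -> intg mu (fun x => cIm (f x)).
Proof. by move=> [[_ mf]]; apply: intg_le => // x; exact: normr_Im. Qed.

Lemma cL1_le_c f g : cmeas f -> (forall x, normc (f x) <= normc (g x)) ->
  cL1 g -> cL1 f.
Proof. by move=> mf fg [_ ig]; exact: (cL1_le mf fg). Qed.

Lemma cL1Z c f : cL1 f -> cL1 (fun x => c * f x).
Proof.
move=> [f1 f2]; apply: (cL1_le (g := fun x => normc c * normc (f x))).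
- by apply: cmeasM => //; exact: cmeas_cst.
- by move=> x; rewrite normcM.
- exact: intgZ.
Qed.

Lemma cL1_sum I (r : seq I) (P : pred I) (F : I -> T -> R[i]) :
  (forall i, P i -> cL1 (F i)) -> cL1 (fun x => \sum_(i <- r | P i) F i x).
Proof.
move=> h; apply: (cL1_le (g := fun x => \sum_(i <- r | P i) normc (F i x))).
- by apply: cmeas_sum => i /h[].
- by move=> x; exact: normc_sum_le.
- by apply: intg_sum => i /h[].
Qed.

Lemma cintD f g : cL1 f -> cL1 g -> cint (fun x => f x + g x) = cint f + cint g.
Proof.
move=> f1 g1; apply: complexP; rewrite /cint /= ?cReD ?cImD.
  under eq_Rintegral do rewrite cReD.
  by rewrite RintegralD//; exact: cL1_Re.
under eq_Rintegral do rewrite cImD.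
by rewrite RintegralD//; exact: cL1_Im.
Qed.

Lemma cintZ c f : cL1 f -> cint (fun x => c * f x) = c * cint f.
Proof.
move=> f1; have fR := cL1_Re f1; have fI := cL1_Im f1.
apply: complexP; rewrite /cint /= ?cReM ?cImM /=.
  under eq_Rintegral do rewrite cReM.
  rewrite RintegralB//; [|exact: intgZ|exact: intgZ].
  by rewrite !RintegralZl.
under eq_Rintegral do rewrite cImM.
rewrite RintegralD//; [|exact: intgZ|exact: intgZ].
by rewrite !RintegralZl.
Qed.

Lemma cintZr c f : cL1 f -> cint (fun x => f x * c) = cint f * c.
Proof.
by move=> f1; rewrite mulrC -cintZ//; apply: eq_cint => x; rewrite mulrC.
Qed.

Lemma cint0 : cint (fun=> 0) = 0.
Proof. by rewrite /cint /= /Rintegral integral0. Qed.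

Lemma cintN f : cL1 f -> cint (fun x => - f x) = - cint f.
Proof.
by move=> f1; rewrite -mulN1r -cintZ//; apply: eq_cint => x; rewrite mulN1r.
Qed.

Lemma cL1N f : cL1 f -> cL1 (fun x => - f x).
Proof.
move=> f1; rewrite (_ : (fun x => - f x) = (fun x => -1 * f x)); first exact: cL1Z.
by apply/funext => x; rewrite mulN1r.
Qed.

Lemma cintB f g : cL1 f -> cL1 g -> cint (fun x => f x - g x) = cint f - cint g.
Proof. by move=> f1 g1; rewrite cintD// ?cintN//; exact: cL1N. Qed.

Lemma cint_sum I (r : seq I) (P : pred I) (F : I -> T -> R[i]) :
  (forall i, P i -> cL1 (F i)) ->
  cint (fun x => \sum_(i <- r | P i) F i x) = \sum_(i <- r | P i) cint (F i).
Proof.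
move=> h; elim: r => [|i r IH].
  by rewrite big_nil -[RHS]cint0; apply: eq_cint => x; rewrite big_nil.
rewrite big_cons; case: ifPn => Pi.
  rewrite -IH -cintD//; [|exact: h|exact: cL1_sum].
  by apply: eq_cint => x; rewrite big_cons Pi.
by rewrite -IH; apply: eq_cint => x; rewrite big_cons (negbTE Pi).
Qed.

Lemma cintJ f : cL1 f -> cint (fun x => (cj (f x))) = (cj (cint f)).
Proof.
move=> f1; apply: complexP; rewrite /cint ?cReJ ?cImJ /=.
  by apply: eq_Rintegral => x _; rewrite cReJ.
under eq_Rintegral do rewrite cImJ -mulN1r.
by rewrite RintegralZl// ?mulN1r//; exact: cL1_Im.
Qed.

Lemma cint_real (f : T -> R) : cint (fun x => (f x)%:C) = (\int[mu]_x f x)%:C.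
Proof. by apply: complexP => //=; rewrite /Rintegral integral0. Qed.

(* With [a = cint f], [|a|^2 = Re (conj a * cint f) <= |a| * int |f|]. *)
Lemma normc_cint f : cL1 f -> normc (cint f) <= \int[mu]_x normc (f x).
Proof.
move=> f1; set a := cint f; have [a0|a0] := eqVneq (normc a) 0.
  by rewrite a0; apply: Rintegral_ge0 => x _; exact: normc_ge0.
have apos : 0 < normc a by rewrite lt_def a0 normc_ge0.
rewrite -(ler_pM2l apos) -expr2 -cReMJ mulrC -cintZ//.
rewrite -RintegralZl//; last by have [] := f1.
apply: le_Rintegral => //.
- exact/cL1_Re/cL1Z.
- by apply: intgZ; have [] := f1.
move=> x _; rewrite -(normcJ' a) -normcM.
exact: le_trans (ler_norm _) (normr_Re _).
Qed.

Lemma normc_cint_le f (g : T -> R) : cmeas f -> (forall x, normc (f x) <= g x) ->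
  intg mu g -> normc (cint f) <= \int[mu]_x g x.
Proof.
move=> mf fg ig; have f1 : cL1 f by exact: cL1_le mf fg ig.
apply: (le_trans (normc_cint f1)); apply: le_Rintegral => //.
by have [] := f1.
Qed.

Lemma Rint_dominated (f_ : nat -> T -> R) (f g : T -> R) :
  (forall n, measurable_fun setT (f_ n)) ->
  (forall x, f_ ^~ x @ \oo --> f x) ->
  (forall n x, `|f_ n x| <= g x) -> intg mu g ->
  (fun n => \int[mu]_x f_ n x) @ \oo --> \int[mu]_x f x.
Proof.
move=> mf cf fg ig.
have mf' : measurable_fun setT f.
  by apply: (measurable_fun_cvg mf) => x _; exact: cf.
have [|||||if' _ h] := @dominated_convergence _ _ _ mu setT measurableT
    (fun n => EFin \o f_ n) (EFin \o f) (EFin \o g).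
- by move=> n; exact/measurable_EFinP.
- exact/measurable_EFinP.
- by apply: aeW => x _ /=; apply/fine_cvgP; split; [exact: nearW|exact: cf].
- by [].
- by apply: aeW => x n _ /=; rewrite lee_fin.
have if2 : intg mu f by exact: if'.
by move: h; rewrite /comp -(RintegralE if2) => /fine_cvgP[].
Qed.

Lemma cint_dominated (f_ : nat -> T -> R[i]) f (g : T -> R) :
  (forall n, cmeas (f_ n)) -> (forall x, ccvg (f_ ^~ x) (f x)) ->
  (forall n x, normc (f_ n x) <= g x) -> intg mu g ->
  ccvg (fun n => cint (f_ n)) (cint f).
Proof.
move=> mf cf fg ig; split.
  apply: (Rint_dominated (g := g)) => //.
  - by move=> n; have [] := mf n.
  - by move=> x; have [] := cf x.
  - by move=> n x; rewrite (le_trans (normr_Re _)).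
apply: (Rint_dominated (g := g)) => //.
- by move=> n; have [] := mf n.
- by move=> x; have [] := cf x.
- by move=> n x; rewrite (le_trans (normr_Im _)).
Qed.

End cint.

Section cfubini.
Context d1 d2 (T1 : measurableType d1) (T2 : measurableType d2) (R : realType).
Variables (m1 : {sigma_finite_measure set T1 -> \bar R})
  (m2 : {sigma_finite_measure set T2 -> \bar R}).

(** Domination by a product [a x * b y] is available at every later use of Fubini, so integrability
    of the two factors replaces any hypothesis on the product measure. *)
Lemma intg_prod (f : T1 * T2 -> R) (a : T1 -> R) (b : T2 -> R) :
  measurable_fun setT f ->
  (forall x y, `|f (x, y)| <= a x * b y) -> (forall x, 0 <= a x) ->
  (forall y, 0 <= b y) -> intg m1 a -> intg m2 b -> intg (m1 \x m2)%E f.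
Proof.
move=> mf fab a0 b0 ia ib; apply/integrable12ltyP; first exact/measurable_EFinP.
have iby := integrable_fin_num measurableT ib.
have bE := RintegralE ib.
apply: (@le_lt_trans _ _ (\int[m1]_x (a x * \int[m2]_y b y)%:E)%E).
  apply: ge0_le_integral => //.
  - by move=> x _; apply: integral_ge0.
  - apply: (measurable_fun_fubini_tonelli_F (fun z => `|(f z)%:E|)%E) => //.
    by apply: measurableT_comp => //; exact/measurable_EFinP.
  - apply/measurable_EFinP; apply: measurable_funM => //; exact: intg_meas ia.
  - move=> x _; rewrite EFinM bE -ge0_integralZl//; last 3 first.
    + by have /integrableP[] := ib.
    + by move=> y _; rewrite lee_fin.
    + by rewrite lee_fin.
    apply: ge0_le_integral => //.
    + apply: measurableT_comp => //; apply/measurable_EFinP.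
      by apply: (measurableT_comp mf); exact: pair1_measurable.
    + by apply/measurable_EFinP/measurable_funM => //; exact: intg_meas ib.
    + by move=> y _; rewrite -EFinM lee_fin; exact: fab.
rewrite -RintegralE ?ltry//.
by under eq_fun do rewrite mulrC; exact: intgZ.
Qed.

Lemma cL1_prod (f : T1 * T2 -> R[i]) (a : T1 -> R) (b : T2 -> R) :
  cmeas f ->
  (forall x y, normc (f (x, y)) <= a x * b y) -> (forall x, 0 <= a x) ->
  (forall y, 0 <= b y) -> intg m1 a -> intg m2 b -> cL1 (m1 \x m2)%E f.
Proof.
move=> mf fab a0 b0 ia ib; split => //; apply: (intg_prod (a := a) (b := b)) => //.
  exact: cmeas_normc.
by move=> x y; rewrite ger0_norm// normc_ge0.
Qed.

Lemma Rint_fubini (f : T1 * T2 -> R) (a : T1 -> R) (b : T2 -> R) :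
  measurable_fun setT f ->
  (forall x y, `|f (x, y)| <= a x * b y) -> (forall x, 0 <= a x) ->
  (forall y, 0 <= b y) -> intg m1 a -> intg m2 b ->
  \int[(m1 \x m2)%E]_z f z = \int[m1]_x \int[m2]_y f (x, y) /\
  \int[(m1 \x m2)%E]_z f z = \int[m2]_y \int[m1]_x f (x, y).
Proof.
move=> mf fab a0 b0 ia ib; have fi := intg_prod mf fab a0 b0 ia ib.
split; rewrite /Rintegral.
  rewrite -integral12_prod_meas1//; congr fine; apply: eq_integral => x _.
  apply/esym/RintegralE; apply: (intg_le (g := fun y => a x * b y)) => //.
  - by apply: (measurableT_comp mf); exact: pair1_measurable.
  - exact: intgZ.
rewrite -integral21_prod_meas1//; congr fine; apply: eq_integral => y _.
apply/esym/RintegralE; apply: (intg_le (g := fun x => b y * a x)) => //.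
- by apply: (measurableT_comp mf); exact: pair2_measurable.
- by move=> x; rewrite mulrC.
- exact: intgZ.
Qed.

Lemma cint_fubini (f : T1 * T2 -> R[i]) (a : T1 -> R) (b : T2 -> R) :
  cmeas f ->
  (forall x y, normc (f (x, y)) <= a x * b y) -> (forall x, 0 <= a x) ->
  (forall y, 0 <= b y) -> intg m1 a -> intg m2 b ->
  cint (m1 \x m2)%E f = cint m1 (fun x => cint m2 (fun y => f (x, y))) /\
  cint (m1 \x m2)%E f = cint m2 (fun y => cint m1 (fun x => f (x, y))).
Proof.
move=> [mf1 mf2] fab a0 b0 ia ib.
have [|r1 r2] := Rint_fubini mf1 _ a0 b0 ia ib.
  by move=> x y; exact: le_trans (normr_Re _) (fab x y).
have [|i1 i2] := Rint_fubini mf2 _ a0 b0 ia ib.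
  by move=> x y; exact: le_trans (normr_Im _) (fab x y).
by split; apply: complexP.
Qed.

(** The inner integral is [fine] of a difference of two Tonelli integrals, each measurable in the
    parameter; this holds even where it diverges, so integrability is not assumed. *)
Lemma measurable_Rint_param (f : T1 * T2 -> R) : measurable_fun setT f ->
  measurable_fun setT (fun x => \int[m2]_y f (x, y)).
Proof.
move=> mf; apply: (measurableT_comp (fine_measurable measurableT)).
have mf' : measurable_fun setT (EFin \o f) by exact/measurable_EFinP.
pose F1 x := (\int[m2]_y (EFin \o f)^\+ (x, y))%E.
pose F2 x := (\int[m2]_y (EFin \o f)^\- (x, y))%E.
apply: (measurable_fun_eq (f := fun x => (F1 x - F2 x)%E)).
  move=> x; rewrite [RHS]integralE; congr (_ - _)%E; apply: eq_integral => y _.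
    by rewrite !funeposE.
  by rewrite !funenegE.
apply: emeasurable_funB.
  by apply: measurable_fun_fubini_tonelli_F => //; exact: measurable_funepos.
by apply: measurable_fun_fubini_tonelli_F => //; exact: measurable_funeneg.
Qed.

Lemma cmeas_cint_param (f : T1 * T2 -> R[i]) : cmeas f ->
  cmeas (fun x => cint m2 (fun y => f (x, y))).
Proof.
by move=> [mf1 mf2]; split; [exact: (measurable_Rint_param mf1)|exact: (measurable_Rint_param mf2)].
Qed.

End cfubini.

(** * Lebesgue measure on column vectors *)

Definition measure_pushforward d1 d2 (T1 : measurableType d1) (T2 : measurableType d2)
    (R : realType) (mu : {measure set T1 -> \bar R}) (phi : T1 -> T2)
    (mphi : measurable_fun setT phi) : {measure set T2 -> \bar R} :=
  measure_function_pushforward__canonical__measure_function_Measure mu mphi.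

Lemma integral_measure_pushforward d1 d2 (T1 : measurableType d1) (T2 : measurableType d2)
    (R : realType) (mu : {measure set T1 -> \bar R}) (phi : T1 -> T2)
    (mphi : measurable_fun setT phi) (f : T2 -> \bar R) :
  measurable_fun setT f -> (forall x, 0 <= f x)%E ->
  (\int[measure_pushforward mu mphi]_y f y = \int[mu]_x f (phi x))%E.
Proof.
move=> mf f0; rewrite -[RHS]/(\int[mu]_(x in phi @^-1` setT) (f \o phi) x)%E.
by rewrite -(ge0_integral_pushforward mphi).
Qed.

Section affine1.
Context {R : realType}.
Local Notation mu := (@lebesgue_measure R).

Lemma measurable_affine1 (a b : R) :
  measurable_fun setT (fun s : measurableTypeR R => a * s + b : measurableTypeR R).
Proof.
apply: measurable_funD => //; apply: measurable_funM => //.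
Qed.

(** Uniqueness of Lebesgue measure reduces this to half-open intervals. For [a < 0] the preimage is
    closed at the other end, which leaves its length unchanged. *)
Lemma lebesgue_measure_affine (a b : R) (A : set R) : a != 0 -> measurable A ->
  (`|a|%:E * mu ((fun s => (a * s + b)%R) @^-1` A) = mu A)%E.
Proof.
move=> a0 mA.
have a0' : 0 < `|a| by rewrite normr_gt0.
have mf := measurable_affine1 a b; set f := (fun s => _) in mf.
pose nu : {measure set _ -> \bar R} :=
  mscale (NngNum (ltW a0')) (measure_pushforward mu mf).
apply/esym; rewrite -[RHS]/(nu A).
apply: lebesgue_measure_unique mA => _ [[x y]] _ <-.
rewrite -[RHS]/(`|a|%:E * mu ((fun s : R => (a * s + b)%R) @^-1` `]x, y]))%E.
have [ap|an|/eqP] := ltgtP 0 a; last by rewrite eq_sym (negbTE a0).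
  have -> : (fun s : R => a * s + b) @^-1` `]x, y] = `](x - b) / a, (y - b) / a]%classic.
    apply/seteqP; split => s /=; rewrite !in_itv/= ltr_pdivrMr// ler_pdivlMr//;
      by rewrite ltrBlDr lerBrDr mulrC.
  rewrite !lebesgue_measure_itv/= !lte_fin ltr_pM2r ?invr_gt0// ltrD2r.
  case: ifPn => xy; last by rewrite mule0.
  rewrite -!EFinB -EFinM gtr0_norm//; congr _%:E; field; exact: a0.
have -> : (fun s : R => a * s + b) @^-1` `]x, y] = `[(y - b) / a, (x - b) / a[%classic.
  apply/seteqP; split => s /=; rewrite !in_itv/= ltr_ndivlMr// ler_ndivrMr//;
    by rewrite ltrBlDr lerBrDr mulrC andbC.
rewrite !lebesgue_measure_itv/= !lte_fin ltr_nM2r ?invr_lt0// ltrD2r.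
case: ifPn => xy; last by rewrite mule0.
rewrite -!EFinB -EFinM ltr0_norm//; congr _%:E; field; exact: a0.
Qed.

Lemma ge0_integral_affine1 (a b : R) (g : R -> \bar R) : a != 0 ->
  measurable_fun setT g -> (forall x, 0 <= g x)%E ->
  (`|a|%:E * \int[mu]_s g (a * s + b)%R = \int[mu]_s g s)%E.
Proof.
move=> a0 mg g0; have a0' : 0 < `|a| by rewrite normr_gt0.
have mf := measurable_affine1 a b; set f := (fun s => _) in mf.
rewrite -(integral_measure_pushforward mu mf mg g0).
rewrite -(ge0_integral_mscale (measure_pushforward mu mf) measurableT (NngNum (ltW a0')) mg)//.
apply: eq_measure_integral => A mA _.
by rewrite -[LHS]/(`|a|%:E * mu (_ @^-1` A))%E; exact: lebesgue_measure_affine.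
Qed.

Lemma intg_affine1 (a b : R) (g : R -> R) : a != 0 ->
  intg mu g -> intg mu (fun s => g (a * s + b)).
Proof.
move=> a0 ig; have mg := intg_meas ig; have /integrableP[_ goo] := ig.
have mg' : measurable_fun setT (fun s => g (a * s + b)).
  exact: (measurableT_comp mg (measurable_affine1 a b)).
apply/integrableP; split; first exact/measurable_EFinP.
have h : (`|a|%:E * \int[mu]_s `|g (a * s + b)%R|%:E = \int[mu]_s `|g s|%:E)%E.
  apply: (ge0_integral_affine1 _ (g := fun s => `|g s|%:E)) => //.
  by apply/measurable_EFinP/measurableT_comp.
move: goo; rewrite /= -h => h2.
rewrite ltey; apply/eqP => h3; move: h2; rewrite h3 gt0_muley//.
by rewrite lte_fin normr_gt0.
Qed.

Lemma Rint_affine1 (a b : R) (g : R -> R) : a != 0 -> intg mu g ->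
  `|a| * \int[mu]_s g (a * s + b) = \int[mu]_s g s.
Proof.
move=> a0 ig; have ig' := intg_affine1 b a0 ig.
have mg : measurable_fun setT (EFin \o g) by have /integrableP[] := ig.
pose gp := (EFin \o g)^\+%E; pose gn := (EFin \o g)^\-%E.
have ep : (`|a|%:E * \int[mu]_s gp (a * s + b)%R = \int[mu]_s gp s)%E.
  apply: (ge0_integral_affine1 _ (g := gp)) => //.
    exact: (measurable_funepos mg).
  by move=> s; exact: funepos_ge0.
have en : (`|a|%:E * \int[mu]_s gn (a * s + b)%R = \int[mu]_s gn s)%E.
  apply: (ge0_integral_affine1 _ (g := gn)) => //.
    exact: (measurable_funeneg mg).
  by move=> s; exact: funeneg_ge0.
apply: EFin_inj; rewrite EFinM RintegralE// RintegralE// [RHS]integralE [in LHS]integralE.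
rewrite -[RHS]/(\int[mu]_s gp s - \int[mu]_s gn s)%E -ep -en -muleBr; [|by []|].
  congr (_ * (_ - _))%E.
    by apply: eq_integral => s _; rewrite /gp !funeposE.
  by apply: eq_integral => s _; rewrite /gn !funenegE.
have -> : (\int[mu]_s gn (a * s + b)%R = \int[mu]_s (EFin \o (fun s => g (a * s + b)%R))^\- s)%E.
  by apply: eq_integral => s _; rewrite /gn !funenegE.
rewrite fin_num_adde_defl// fin_numN; exact: (integrable_neg_fin_num measurableT ig').
Qed.

End affine1.

Section step_cV.
Context {R : realType}.
Local Notation mu := (@lebesgue_measure R).
Local Notation leb n := (lebesgue_cV R n).

Lemma measurable_consl n (y : 'cV[R]_n) :
  measurable_fun setT (fun a : measurableTypeR R => cons_cV (a, y)).
Proof. exact: (measurableT_comp (@measurable_cons_cV R n) (@pair2_measurable _ _ _ _ y)). Qed.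

Lemma measurable_consr n (a : measurableTypeR R) :
  measurable_fun setT (fun y : 'cV[R]_n => cons_cV (a, y)).
Proof. exact: (measurableT_comp (@measurable_cons_cV R n) (@pair1_measurable _ _ _ _ a)). Qed.

Lemma uncons_cVK n : cancel (@uncons_cV R n) (@cons_cV R n).
Proof.
move=> x; apply/matrixP => i j; rewrite /cons_cV /uncons_cV mxE (ord1 j).
by case: unliftP => [k ->|->] /=; rewrite ?mxE.
Qed.

Lemma ge0_integral_cV_prod n (g : 'cV[R]_n.+1 -> \bar R) :
  measurable_fun setT g -> (forall x, 0 <= g x)%E ->
  (\int[leb n.+1]_x g x = \int[mu \x leb n]_p g (cons_cV p))%E.
Proof.
move=> mg g0; rewrite -(integral_measure_pushforward _ (@measurable_cons_cV R n))//.
Qed.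

Lemma ge0_integral_cV n (g : 'cV[R]_n.+1 -> \bar R) :
  measurable_fun setT g -> (forall x, 0 <= g x)%E ->
  (\int[leb n.+1]_x g x = \int[mu]_a \int[leb n]_y g (cons_cV (a, y)))%E.
Proof.
move=> mg g0; rewrite ge0_integral_cV_prod//.
rewrite (fubini_tonelli1 (fun p => g (cons_cV p)))//.
exact: (measurableT_comp mg (@measurable_cons_cV R n)).
Qed.

Lemma ge0_integral_cVr n (g : 'cV[R]_n.+1 -> \bar R) :
  measurable_fun setT g -> (forall x, 0 <= g x)%E ->
  (\int[leb n.+1]_x g x = \int[leb n]_y \int[mu]_a g (cons_cV (a, y)))%E.
Proof.
move=> mg g0; rewrite ge0_integral_cV_prod//.
rewrite (fubini_tonelli2 (fun p => g (cons_cV p)))//.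
exact: (measurableT_comp mg (@measurable_cons_cV R n)).
Qed.

Lemma ge0_integral_cV0 (g : 'cV[R]_0 -> \bar R) :
  measurable_fun setT g -> (\int[leb 0]_x g x = g 0%R)%E.
Proof. by move=> mg; rewrite /= integral_dirac// diracT mul1e. Qed.

Lemma measurable_affine_cV n (D : 'M[R]_n) (b : 'cV[R]_n) :
  measurable_fun setT (fun x : 'cV[R]_n => D *m x + b).
Proof.
apply: measurable_fun_cV => i; apply: (measurable_fun_eq
  (f := fun x : 'cV[R]_n => \sum_j D i j * x j ord0 + b i ord0)).
  by move=> x; rewrite !mxE.
apply: measurable_funD => //; apply: measurable_sum => j.
by apply: measurable_funM => //; exact: measurable_coord.
Qed.

(** Change of variables as a property of the matrix alone, for all shifts at once: it becomes
    multiplicative, and the block cases can absorb shifts that depend on the other coordinates. *)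
Definition cov_affine n (D : 'M[R]_n) := forall (b : 'cV[R]_n) (g : 'cV[R]_n -> \bar R),
  measurable_fun setT g -> (forall x, 0 <= g x)%E ->
  (`|\det D|%:E * \int[leb n]_x g (D *m x + b)%R = \int[leb n]_x g x)%E.

Lemma cov_affine_mul n (A B : 'M[R]_n) : cov_affine A -> cov_affine B -> cov_affine (A *m B).
Proof.
move=> gA gB b g mg g0; rewrite det_mulmx normrM EFinM -muleA.
rewrite -(gA b g)//; congr (_ * _)%E.
rewrite -(gB 0 (fun y => g (A *m y + b)))//; last first.
  exact: (measurableT_comp mg (measurable_affine_cV A b)).
by congr (_ * _)%E; apply: eq_integral => x _; rewrite addr0 mulmxA.
Qed.

Lemma cons_cVE n (a : R) (y : 'cV[R]_n) : cons_cV (a, y) = col_mx (a%:M : 'M[R]_1) y.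
Proof.
apply/matrixP => i j; rewrite (ord1 j) /cons_cV mxE.
case: unliftP => [k ->|->] /=.
  have -> : lift ord0 k = rshift 1 (k : 'I_n) by exact/val_inj.
  exact: (esym (col_mxEd _ _ _ _)).
transitivity ((a%:M : 'M[R]_1) ord0 0); first by rewrite mxE eqxx mulr1n.
have -> : ord0 = lshift n (ord0 : 'I_1) by exact/val_inj.
exact: (esym (col_mxEu _ _ _ _)).
Qed.

Lemma block_cons n (a : R) (r : 'rV[R]_n) (c : 'cV[R]_n) (M : 'M[R]_n)
    (s b : R) (y b' : 'cV[R]_n) :
  (block_mx (a%:M : 'M[R]_1) r c M : 'M[R]_n.+1) *m cons_cV (s, y) + cons_cV (b, b') =
  cons_cV (a * s + ((r *m y) ord0 ord0 + b), s *: c + M *m y + b').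
Proof.
rewrite !cons_cVE.
have H : (block_mx (a%:M : 'M[R]_1) r c M : 'M[R]_(1 + n)) *m col_mx s%:M y +
    col_mx b%:M b' = col_mx (a * s + ((r *m y) ord0 ord0 + b))%:M (s *: c + M *m y + b').
  rewrite mul_block_col add_col_mx; congr col_mx.
    apply/matrixP => i j; rewrite (ord1 i) (ord1 j) !mxE/= big_ord1 !mxE eqxx.
    by rewrite !mulr1n addrA.
  congr (_ + _ + _); apply/matrixP => i j.
  by rewrite (ord1 j) !mxE big_ord1 !mxE eqxx mulr1n mulrC.
exact: H.
Qed.

(** With the first coordinate integrated innermost, a fixed [y] leaves an affine map of slope [a]
    whose shift depends on [y] and disappears. What remains is the change of variables for [M]. *)
Lemma cov_affine_ublock n (a : R) (r : 'rV[R]_n) (M : 'M[R]_n) : a != 0 ->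
  cov_affine M -> cov_affine (block_mx (a%:M : 'M[R]_1) r 0 M : 'M[R]_n.+1).
Proof.
move=> a0 gM b g mg g0.
rewrite (det_ublock (a%:M : 'M[R]_1) r M) det_scalar expr1 normrM EFinM -muleA.
rewrite -(uncons_cVK b); case: (uncons_cV b) => b0 b'.
have mgD : measurable_fun setT (fun x => g ((block_mx (a%:M : 'M[R]_1) r 0 M : 'M[R]_n.+1) *m x + cons_cV (b0, b'))).
  exact: (measurableT_comp mg (measurable_affine_cV _ _)).
rewrite ge0_integral_cVr//.
have -> : (\int[leb n]_y \int[mu]_s g (((block_mx (a%:M : 'M[R]_1) r 0 M : 'M[R]_n.+1) *m
    cons_cV (s, y) + cons_cV (b0, b'))%R))%E =
  (\int[leb n]_y (`|a|^-1%:E * \int[mu]_s g (cons_cV (s, (M *m y + b')%R))))%E.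
  apply: eq_integral => y _.
  rewrite -(ge0_integral_affine1 ((r *m y) ord0 ord0 + b0) (a := a)
    (g := fun s => g (cons_cV (s, (M *m y + b')%R))))//; last first.
    exact: (measurableT_comp mg (measurable_consl _)).
  rewrite muleA -EFinM mulVf ?normr_eq0// mul1e.
  by apply: eq_integral => s _; rewrite block_cons scaler0 add0r.
have mF : measurable_fun setT (fun y : 'cV[R]_n => \int[mu]_s g (cons_cV (s, y)))%E.
  apply: (measurable_fun_fubini_tonelli_G (m1 := mu) (fun p => g (cons_cV p))) => //.
  exact: (measurableT_comp mg (@measurable_cons_cV R n)).
rewrite ge0_integralZl//; last 2 first.
- by apply: (measurableT_comp mF (measurable_affine_cV _ _)).
- by move=> y _; apply: integral_ge0.
rewrite [(`|\det M|%:E * (_ * _))%E]muleCA muleA -EFinM mulfV ?normr_eq0// mul1e.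
rewrite (gM b' (fun y => \int[mu]_s g (cons_cV (s, y)))%E)//.
- by rewrite ge0_integral_cVr.
- by move=> y; exact: integral_ge0.
Qed.

(** The opposite order of integration: for a fixed first coordinate [s] the remaining ones are
    merely translated, by [s *: c + b']. *)
Lemma cov_affine_lblock n (c : 'cV[R]_n) : cov_affine (1%:M : 'M[R]_n) ->
  cov_affine (block_mx (1%:M : 'M[R]_1) 0 c 1%:M : 'M[R]_n.+1).
Proof.
move=> gM b g mg g0.
rewrite (det_lblock (1%:M : 'M[R]_1) c 1%:M) !det1 mulr1 normr1 mul1e.
rewrite -(uncons_cVK b); case: (uncons_cV b) => b0 b'.
rewrite ge0_integral_cV//; last exact: (measurableT_comp mg (measurable_affine_cV _ _)).
have -> : (\int[mu]_s \int[leb n]_y g (((block_mx (1%:M : 'M[R]_1) 0 c 1%:M : 'M[R]_n.+1) *m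
    cons_cV (s, y) + cons_cV (b0, b'))%R))%E =
  (\int[mu]_s (\int[leb n]_y g (cons_cV ((1 * s + b0)%R, y))))%E.
  apply: eq_integral => s _.
  rewrite -(gM (s *: c + b') (fun y => g (cons_cV ((1 * s + b0)%R, y))))//; last first.
    exact: (measurableT_comp mg (measurable_consr _)).
  rewrite det1 normr1 mul1e.
  apply: eq_integral => y _; rewrite block_cons mul0mx mxE add0r.
  by rewrite addrCA addrA.
have := @ge0_integral_affine1 R 1 b0 (fun s => \int[leb n]_y g (cons_cV (s, y)))%E.
rewrite normr1 mul1e => -> //.
- by rewrite ge0_integral_cV.
- apply: (measurable_fun_fubini_tonelli_F (m2 := leb n) (fun p => g (cons_cV p))) => //.
  exact: (measurableT_comp mg (@measurable_cons_cV R n)).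
- by move=> y; exact: integral_ge0.
Qed.

(* Block elimination; a zero pivot is first repaired by adding a row. *)
Lemma cov_affine_unit n (D : 'M[R]_n) : D \in unitmx -> cov_affine D.
Proof.
elim: n D => [|n IH] D uD.
  move=> b g mg g0; rewrite det_mx00 normr1 mul1e; apply: eq_integral => x _.
  by congr g; apply/matrixP => -[].
have I1 : cov_affine (1%:M : 'M[R]_n) by exact/IH/unitmx1.
have pivot (E : 'M[R]_n.+1) : E \in unitmx -> E ord0 ord0 != 0 -> cov_affine E.
  move=> uE a0; pose a := E ord0 ord0.
  pose E' : 'M[R]_(1 + n) := E.
  have ulE : ulsubmx E' = a%:M.
    apply/matrixP => i j; rewrite (ord1 i) (ord1 j) !mxE eqxx mulr1n /a.
    by congr (E _ _); exact/val_inj.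
  (* The Schur complement of the pivot: [E] is a lower unitriangular block matrix times an upper
     block matrix with diagonal blocks [a] and [M]. *)
  pose M := drsubmx E' - a^-1 *: (dlsubmx E' *m ursubmx E').
  have defE : E = (block_mx (1%:M : 'M[R]_1) 0 (a^-1 *: dlsubmx E') 1%:M : 'M[R]_n.+1) *m
      (block_mx (a%:M : 'M[R]_1) (ursubmx E') 0 M : 'M[R]_n.+1).
    rewrite (mulmx_block (1%:M : 'M[R]_1) 0 (a^-1 *: dlsubmx E') 1%:M a%:M).
    rewrite !mul1mx !mul0mx !addr0 mul_mx_scalar scalerA mulfV// scale1r -ulE.
    rewrite -scalemxAl [X in block_mx _ _ _ X](_ : _ = drsubmx E'); last by rewrite /M addrC subrK.
    exact: (esym (submxK E')).
  have uM : M \in unitmx.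
    move: uE; rewrite defE unitmx_mul => /andP[_].
    rewrite !unitmxE (det_ublock (a%:M : 'M[R]_1) (ursubmx E') M) det_scalar expr1.
    by rewrite unitrM => /andP[].
  rewrite defE; apply: cov_affine_mul; first exact: cov_affine_lblock.
  by apply: cov_affine_ublock => //; exact: IH.
have [D0|] := eqVneq (D ord0 ord0) 0; last exact: pivot.
have [j Dj] : exists j : 'I_n, D (lift ord0 j) ord0 != 0.
  apply/existsP; apply: contraT; rewrite negb_exists => /forallP h.
  suff : col ord0 D = 0.
    move=> /(congr1 (mulmx (invmx D))); rewrite colE mulmxA mulVmx// mul1mx mulmx0.
    move/matrixP => /(_ ord0 ord0); rewrite !mxE !eqxx/= => /eqP.
    by rewrite oner_eq0.
  apply/matrixP => i k; rewrite !mxE; case: (unliftP ord0 i) => [l ->|->//].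
  by have := h l; rewrite negbK => /eqP.
pose U (e : R) : 'M[R]_n.+1 :=
  block_mx (1%:M : 'M[R]_1) (e *: delta_mx ord0 j) 0 (1%:M : 'M[R]_n).
have gU e : cov_affine (U e) by apply: cov_affine_ublock => //; rewrite oner_neq0.
have UE l : U 1 ord0 (lift ord0 l) = (l == j)%:R.
  have -> : lift ord0 l = rshift 1 (l : 'I_n) by exact/val_inj.
  have -> : ord0 = lshift n (ord0 : 'I_1) by exact/val_inj.
  by apply: (etrans (block_mxEur _ _ _ _ _ _)); rewrite !mxE eqxx mul1r.
have UU : U (-1) *m U 1 = 1%:M.
  rewrite /U (mulmx_block (1%:M : 'M[R]_1) _ 0 1%:M 1%:M).
  rewrite !mul1mx !mulmx0 !mul0mx !mulmx1 !addr0 !add0r scaleN1r scale1r subrr.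
  by rewrite -scalar_mx_block.
have defD : D = U (-1) *m (U 1 *m D) by rewrite mulmxA UU mul1mx.
rewrite defD; apply: cov_affine_mul => //; apply: pivot.
  by rewrite unitmx_mul uD andbT; have /mulmx1_unit[] := UU.
rewrite mxE (bigD1 ord0)//= (bigD1 (lift ord0 j))//= D0 mulr0 add0r.
rewrite big1 ?addr0; last first.
  move=> i /andP[i0 ij]; case: (unliftP ord0 i) i0 ij => [l ->|-> //] _ lj.
  rewrite UE (_ : l == j = false) ?mul0r//.
  by apply: contraNF lj => /eqP ->.
by rewrite UE eqxx mul1r.
Qed.

Lemma ge0_integral_affine n (D : 'M[R]_n) (b : 'cV[R]_n) (g : 'cV[R]_n -> \bar R) :
  D \in unitmx -> measurable_fun setT g -> (forall x, 0 <= g x)%E ->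
  (`|\det D|%:E * \int[leb n]_x g (D *m x + b)%R = \int[leb n]_x g x)%E.
Proof. by move=> uD; exact: cov_affine_unit. Qed.

End step_cV.

(** * Sums of nonnegative terms over countable types *)

Section countable_sums.
Context {R : realType}.
Local Open Scope ereal_scope.

(** Codes without a preimage contribute 0. This form lets monotone convergence for series act on
    sums indexed by the lattice. *)
Lemma esum_pickle (I : countType) (a : I -> \bar R) : (forall i, 0 <= a i) ->
  \esum_(i in [set: I]) a i = \sum_(0 <= n <oo) oapp a 0 (pickle_inv n : option I).
Proof.
move=> a0; pose b n := oapp a 0 (pickle_inv n : option I).
have b0 n : 0 <= b n by rewrite /b; case: pickle_inv.
rewrite nneseries_esumT//.
have -> : \esum_(i in [set: I]) a i = \esum_(i in [set: I]) b (pickle i).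
  by apply: eq_esum => i _; rewrite /b pickleK_inv.
rewrite -(esum_image setT (@pickle I) b); last first.
  by move=> i j _ _; exact: (pcan_inj pickleK).
rewrite esum_mkcond; apply: eq_esum => n _; case: ifPn => //.
rewrite notin_setE /b /= => h; case E : (pickle_inv n : option I) => [i|//].
exfalso; apply: h; exists i => //.
by have := @pickle_invK I n; rewrite E.
Qed.

Lemma integral_esum d (T : measurableType d) (mu : {measure set T -> \bar R})
    (I : countType) (f : I -> T -> \bar R) :
  (forall i, measurable_fun setT (f i)) -> (forall i x, 0 <= f i x) ->
  \int[mu]_x (\esum_(i in [set: I]) f i x) = \esum_(i in [set: I]) \int[mu]_x f i x.
Proof.
move=> mf f0; rewrite esum_pickle; last by move=> i; exact: integral_ge0.
under eq_integral do rewrite esum_pickle//.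
rewrite integral_nneseries//.
- apply: eq_eseriesr => n _; case: pickle_inv => [i|] //=.
  by rewrite integral0.
- by move=> n; case: pickle_inv => [i|] //=; exact: measurable_cst.
- by move=> n x _; case: pickle_inv => /=.
Qed.

Lemma measurable_esum d (T : measurableType d) (I : countType) (f : I -> T -> \bar R) :
  (forall i, measurable_fun setT (f i)) -> (forall i x, 0 <= f i x) ->
  measurable_fun setT (fun x => \esum_(i in [set: I]) f i x).
Proof.
move=> mf f0; under eq_fun do rewrite esum_pickle//.
apply: ge0_emeasurable_sum.
- by move=> n x _ _; case: pickle_inv => /=.
- by move=> n _; case: pickle_inv => [i|] //=; exact: measurable_cst.
Qed.

Lemma esum_le_fin (I : choiceType) (A : set I) (a : I -> \bar R) (M : \bar R) :
  (forall r : seq I, uniq r -> (forall i, i \in r -> A i) -> \sum_(i <- r) a i <= M) ->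
  \esum_(i in A) a i <= M.
Proof.
move=> h; apply: ub_ereal_sup => _ [X [fX XA] <-].
rewrite (fsbig_finite _ _ fX) /=; apply: h; first exact: finmap.fset_uniq.
by move=> i; rewrite in_fset_set// inE; exact: XA.
Qed.

Lemma esum_ge_fin (I : choiceType) (A : set I) (a : I -> \bar R) (r : seq I) :
  uniq r -> (forall i, i \in r -> A i) -> \sum_(i <- r) a i <= \esum_(i in A) a i.
Proof.
move=> ur rA; apply: esum_ge; exists [set` r].
  by split; [exact: finite_seq|move=> i /= /rA].
by rewrite fsbig_seq.
Qed.

Lemma esumZl (I : choiceType) (A : set I) (a : I -> \bar R) (c : R) : (0 <= c)%R ->
  (forall i, 0 <= a i) ->
  \esum_(i in A) (c%:E * a i) = c%:E * \esum_(i in A) a i.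
Proof.
move=> c0 a0; have [->|cN0] := eqVneq c 0%R.
  rewrite mul0e; apply: (@esum1 _ _ _ _) => i _; rewrite mul0e//.
have cp : (0 < c)%R by rewrite lt_def cN0.
apply/eqP; rewrite eq_le; apply/andP; split.
  apply: esum_le_fin => r ur rA.
  rewrite -ge0_sume_distrr//; apply: lee_wpmul2l; first by rewrite lee_fin.
  exact: esum_ge_fin.
rewrite muleC -lee_pdivlMr//; apply: esum_le_fin => r ur rA.
rewrite lee_pdivlMr// muleC ge0_sume_distrr//.
exact: esum_ge_fin.
Qed.

End countable_sums.

(** * Integer translates of the unit cube *)

Section cubes.
Context {R : realType}.
Local Notation mu := (@lebesgue_measure R).
Local Notation leb n := (lebesgue_cV R n).

(** Half-open, so that the integer translates partition space exactly and [floor_cV] selects the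
    translate containing a point. *)
Definition unit_cube n : set 'cV[R]_n := [set x | forall i, 0 <= x i ord0 < 1].

Lemma measurable_box n (A : 'I_n -> set R) : (forall i, measurable (A i)) ->
  measurable [set x : 'cV[R]_n | forall i, A i (x i ord0)].
Proof.
move=> mA; rewrite (_ : mkset _ =
    \bigcap_(i in [set: 'I_n]) ((fun x : 'cV[R]_n => x i ord0) @^-1` A i)).
  apply: fin_bigcap_measurable => // i _.
  by rewrite -[X in measurable X]setTI; exact: measurable_coord.
by apply/seteqP; split => [x xA i _|x xA i]; exact: xA.
Qed.

Lemma unit_cubeE n :
  @unit_cube n = [set x : 'cV[R]_n | forall i, `[0, 1[%classic (x i ord0)].
Proof. by apply/seteqP; split => x h i; move: (h i); rewrite /= in_itv. Qed.

Lemma measurable_unit_cube n : measurable (@unit_cube n).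
Proof. by rewrite unit_cubeE; apply: (measurable_box (A := fun=> `[0, 1[%classic)). Qed.

Lemma lebesgue_unit_cube n : leb n (@unit_cube n) = 1%E.
Proof.
rewrite unit_cubeE (lebesgue_cV_box (A := fun=> `[0, 1[%classic))//.
by rewrite big1// => i _; rewrite lebesgue_measure_itv/= lte_fin ltr01 oppr0 adde0.
Qed.

Definition floor_cV n (x : 'cV[R]_n) : 'cV[int]_n := \col_i Num.floor (x i ord0).

Lemma unit_cube_floor n (x : 'cV[R]_n) (m : 'cV[int]_n) :
  @unit_cube n (x - of_Zd m) <-> m = floor_cV x.
Proof.
split=> [h|-> i].
  apply/matrixP => i j; rewrite (ord1 j) mxE; apply/esym/floor_def.
  move: (h i); rewrite !mxE => /andP[h1 h2]; rewrite -subr_ge0 h1/=.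
  by rewrite intrD -ltrBlDl.
rewrite !mxE subr_ge0 floor_le_tmp ltrBlDl.
by rewrite -[X in _ + X]/(1%:~R) -intrD floorD1_gt.
Qed.

Lemma measurable_translate n (b : 'cV[R]_n) :
  measurable_fun setT (fun x : 'cV[R]_n => x + b).
Proof.
apply: (measurable_fun_eq (f := fun x : 'cV[R]_n => 1%:M *m x + b)).
  by move=> x; rewrite mul1mx.
exact: measurable_affine_cV.
Qed.

Lemma ge0_integral_translate n (b : 'cV[R]_n) (g : 'cV[R]_n -> \bar R) :
  measurable_fun setT g -> (forall x, 0 <= g x)%E ->
  (\int[leb n]_x g (x + b)%R = \int[leb n]_x g x)%E.
Proof.
move=> mg g0; have := ge0_integral_affine b (unitmx1 R n) mg g0.
by rewrite det1 normr1 mul1e => <-; apply: eq_integral => x _; rewrite mul1mx.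
Qed.

Local Open Scope ereal_scope.

(** Every point lies in exactly one translate of the cube; each piece is translated back to the
    cube. The sum under the integral is the periodization of [g]. *)
Lemma ge0_integral_cubes n (g : 'cV[R]_n -> \bar R) :
  measurable_fun setT g -> (forall x, 0 <= g x) ->
  \int[leb n]_x g x =
  \int[leb n]_x \esum_(m in [set: 'cV[int]_n])
     ((\1_(@unit_cube n) x)%:E * g (x + of_Zd m)%R).
Proof.
move=> mg g0.
have mG m : measurable_fun setT (fun x => (\1_(@unit_cube n) x)%:E * g (x + of_Zd m)%R).
  apply: emeasurable_funM.
    by apply/measurable_EFinP; by apply: measurable_indic; exact: measurable_unit_cube.
  exact: (measurableT_comp mg (measurable_translate _)).
have G0 m x : 0 <= (\1_(@unit_cube n) x)%:E * g (x + of_Zd m)%R.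
  by rewrite mule_ge0// lee_fin.
rewrite integral_esum//.
transitivity (\esum_(m in [set: 'cV[int]_n])
    \int[leb n]_x ((\1_(@unit_cube n) (x - of_Zd m)%R)%:E * g x)); last first.
  apply: eq_esum => m _; rewrite -(ge0_integral_translate (- of_Zd m)%R (mG m))//.
  by apply: eq_integral => x _; rewrite subrK.
have mH m : measurable_fun setT (fun x : 'cV[R]_n => (\1_(@unit_cube n) (x - of_Zd m)%R)%:E * g x).
  apply: emeasurable_funM => //; apply/measurable_EFinP.
  apply: (measurableT_comp _ (measurable_translate _)).
  by apply: measurable_indic; exact: measurable_unit_cube.
rewrite -integral_esum//; last by move=> m x; rewrite mule_ge0// lee_fin.
apply: eq_integral => x _.
rewrite (esumID [set floor_cV x]); last by move=> m _; rewrite mule_ge0// lee_fin.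
rewrite setTI esum_set1; last by rewrite mule_ge0// lee_fin.
rewrite [X in _ + X]esum1 ?adde0; last first.
  move=> m [_ /= mx]; rewrite indicE memNset ?mul0e// => /unit_cube_floor.
  exact: mx.
by rewrite indicE mem_set ?mul1e//; exact/unit_cube_floor.
Qed.

End cubes.

(** * Parseval's identity for periodic functions *)

Section FTC.
Context {R : realType}.
Local Notation mu := (@lebesgue_measure R).

Lemma Rint_indic d (T : measurableType d) (nu : {measure set T -> \bar R})
    (D : set T) (f : T -> R) :
  \int[nu]_x (\1_D x * f x) = \int[nu]_(x in D) f x.
Proof.
rewrite [RHS]Rintegral_mkcond; apply: eq_Rintegral => x _.
by rewrite patchE indicE; case: ifP => _; rewrite ?mul1r ?mul0r.
Qed.

Lemma FTC_itv (f F : R -> R) (a b : R) : a < b ->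
  (forall x : R, is_derive x 1 F (f x)) -> continuous f ->
  \int[mu]_(x in `[a, b]) f x = F b - F a.
Proof.
move=> ab dF cf.
have cF : continuous F.
  by move=> x; apply/differentiable_continuous/derivable1_diffP; have := dF x.
rewrite /Rintegral (@continuous_FTC2 _ f F)//.
- exact: continuous_subspaceT.
- split; first by move=> x _.
  + exact/cvg_at_right_filter/cF.
  + exact/cvg_at_left_filter/cF.
- by move=> x _; rewrite derive1E derive_val.
Qed.

Lemma Rint_cos (w a b : R) : a < b -> w != 0 ->
  \int[mu]_(x in `[a, b]) cos (w * x) = (sin (w * b) - sin (w * a)) / w.
Proof.
move=> ab w0.
have dF x : is_derive x (1 : R) (fun x => sin (w * x) / w) (cos (w * x)).
  have h1 : is_derive x 1 (fun x : R => w * x) w.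
    by apply: is_derive_eq; rewrite scaler1.
  by apply: is_derive_eq; rewrite /= /GRing.scale/=; field.
have cf : continuous (fun x => cos (w * x)).
  move=> x; apply: continuous_comp; first exact: mulrl_continuous.
  exact: continuous_cos.
by have -> := FTC_itv ab dF cf; rewrite -mulrBl.
Qed.

Lemma Rint_sin (w a b : R) : a < b -> w != 0 ->
  \int[mu]_(x in `[a, b]) sin (w * x) = (cos (w * a) - cos (w * b)) / w.
Proof.
move=> ab w0.
have dF x : is_derive x (1 : R) (fun x => - cos (w * x) / w) (sin (w * x)).
  have h1 : is_derive x 1 (fun x : R => w * x) w.
    by apply: is_derive_eq; rewrite scaler1.
  by apply: is_derive_eq; rewrite /= /GRing.scale/=; field.
have cf : continuous (fun x => sin (w * x)).
  move=> x; apply: continuous_comp; first exact: mulrl_continuous.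
  exact: continuous_sin.
by have -> := FTC_itv ab dF cf; rewrite !mulNr opprK addrC -mulrBl.
Qed.

End FTC.

Lemma cvge0_le {R : realType} (u : nat -> \bar R) : (forall n, 0 <= u n)%E ->
  u @ \oo --> 0%E -> forall e : R, 0 < e ->
  exists n0, forall n, (n0 <= n)%N -> (u n <= e%:E)%E.
Proof.
move=> u0 /fine_cvgP[[k _ ufin] /cvgrPdist_le uc] e /uc[n _ hn].
exists (maxn k n) => m; rewrite geq_max => /andP[km nm].
rewrite -(fineK (ufin _ km)) lee_fin; have := hn _ nm; rewrite /= sub0r normrN.
exact: le_trans (ler_norm _).
Qed.

Section parseval1.
Context {R : realType}.
Local Notation mu := (@lebesgue_measure R).

Definition ek (k : int) (x : R) : R[i] := expi (2 * pi * (k%:~R * x)).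

Lemma ekD k l x : ek (k + l) x = ek k x * ek l x.
Proof. by rewrite /ek -expiD rmorphD/=; congr expi; ring. Qed.

Lemma ekDr k x y : ek k (x + y) = ek k x * ek k y.
Proof. by rewrite /ek -expiD; congr expi; ring. Qed.

Lemma ekN k x : ek (- k) x = (cj (ek k x)).
Proof. by rewrite /ek -expiN rmorphN/=; congr expi; ring. Qed.

Lemma ekNr k x : ek k (- x) = (cj (ek k x)).
Proof. by rewrite /ek -expiN; congr expi; ring. Qed.

Lemma ek0 x : ek 0 x = 1.
Proof. by rewrite /ek mul0r mulr0 expi0. Qed.

Lemma normc_ek k x : normc (ek k x) = 1. Proof. exact: normc_expi. Qed.

Lemma ek_nat (n : nat) x : ek n%:Z x = ek 1 x ^+ n.
Proof.
elim: n => [|n IH]; first by rewrite ek0 expr0.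
by rewrite -[n.+1]add1n PoszD ekD IH exprS.
Qed.

Lemma cmeas_ek k : cmeas (ek k : measurableTypeR R -> R[i]).
Proof.
apply: cmeas_expi; apply: measurable_funM => //; exact: measurable_funM.
Qed.

(** The open interval keeps each of its points at positive distance from both ends, which
    [fdefect_cvg0] uses; [parseval1] passes to the half-open interval. *)
Let U : R -> R := \1_(`]0, 1[).

Lemma intg_indic_itv (a b : bool) (x y : R) :
  intg mu (\1_([set` Interval (BSide a x) (BSide b y)])).
Proof. exact: integrable_indic_itv. Qed.

Let iU : intg mu U. Proof. exact: intg_indic_itv. Qed.
Let U0 x : 0 <= U x. Proof. by rewrite /U indicE. Qed.
Let UU x : U x * U x = U x.
Proof. by rewrite /U indicE; case: (_ \in _); rewrite ?mulr1 ?mulr0. Qed.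
Let U01 x : U x = 1 \/ U x = 0.
Proof. by rewrite /U indicE; case: (_ \in _); [left|right]. Qed.
Let U1_itv x : U x = 1 -> 0 < x /\ x < 1.
Proof.
rewrite /U indicE; case: (boolP (x \in _)) => [|_ /eqP]; last by rewrite eq_sym oner_eq0.
by rewrite inE /= in_itv/= => /andP[].
Qed.
Let mU : measurable_fun setT U. Proof. exact: intg_meas iU. Qed.
Let iU1 : \int[mu]_x U x = 1.
Proof.
rewrite -[X in Rintegral _ _ X](_ : (fun x => U x * 1) = _); last first.
  by apply/funext => x; rewrite mulr1.
rewrite Rint_indic Rintegral_cst//= lebesgue_measure_itv/= lte_fin ltr01.
by rewrite oppr0 adde0 mul1r.
Qed.

Lemma Rint_indic01 (f : R -> R) (b : R) : measurable_fun setT f ->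
  (forall x, `|f x| <= b) ->
  \int[mu]_x (U x * f x) = \int[mu]_(x in `[0, 1]) f x.
Proof.
move=> mf fb.
have intf (a1 a2 : bool) :
    mu.-integrable [set` Interval (BSide a1 0) (BSide a2 1)] (EFin \o f).
  apply: measurable_bounded_integrable => //.
  - have := @lebesgue_measure_itv R (Interval (BSide a1 0) (BSide a2 1)).
    by rewrite /= lte_fin ltr01 => ->; exact: ltry.
  - exact: measurable_funTS.
  - by exists b; split; [exact: num_real|move=> M bM x _; exact: le_trans (fb x) (ltW bM)].
 rewrite Rint_indic.
rewrite -Rintegral_itv_bndo_bndc; last exact: intf.
by rewrite -Rintegral_itv_obnd_cbnd//; exact: intf.
Qed.

Lemma orthog_ek k : cint mu (fun x => (U x)%:C * ek k x) = (k == 0)%:R.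
Proof.
have [->|k0] := eqVneq k 0.
  rewrite -[RHS]/((1 : R)%:C) -iU1 -cint_real; apply: eq_cint => x.
  by rewrite ek0 mulr1.
have w0 : 2 * pi * k%:~R != 0 :> R.
  by rewrite !mulf_neq0// ?intr_eq0// ?pnatr_eq0// gt_eqF// pi_gt0.
have e1 : expi (2 * pi * k%:~R) = 1 :> R[i].
  by rewrite -[2 * pi * _]add0r expi_2piz expi0.
have [c1 s1] : cos (2 * pi * k%:~R) = 1 :> R /\ sin (2 * pi * k%:~R) = 0 :> R.
  by case: e1.
apply: complexP; rewrite /cint /=.
- under eq_Rintegral do rewrite mul0r subr0 mulrA.
  rewrite (Rint_indic01 (b := 1)); last 2 first.
    apply: measurableT_comp; last exact: measurable_funM.
    by apply: continuous_measurable_fun; exact: continuous_cos.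
    by move=> x; exact: cos_max.
  by rewrite Rint_cos// mulr1 mulr0 s1 sin0 subr0 mul0r.
- under eq_Rintegral do rewrite mul0r addr0 mulrA.
  rewrite (Rint_indic01 (b := 1)); last 2 first.
    apply: measurableT_comp; last exact: measurable_funM.
    by apply: continuous_measurable_fun; exact: continuous_sin.
    by move=> x; exact: sin_max.
  by rewrite Rint_sin// mulr1 mulr0 c1 cos0 subrr mul0r.
Qed.

Section coef.
Variables (P : R -> R[i]) (B : R).
Hypotheses (mP : cmeas (P : measurableTypeR R -> R[i]))
  (PB : forall x, normc (P x) <= B * U x).

Let B0 : 0 <= B.
Proof.
have := PB 2^-1; have -> : U 2^-1 = 1.
  by rewrite /U indicE mem_set//= in_itv/= invr_gt0 ltr0n invf_lt1 ?ltr1n.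
by rewrite mulr1; apply: le_trans; exact: normc_ge0.
Qed.

Let PU x : P x * (U x)%:C = P x.
Proof.
have := PB x; rewrite /U indicE; case: (_ \in _); first by rewrite !mulr1.
rewrite !mulr0 => h; have : normc (P x) = 0 by apply/eqP; rewrite eq_le h normc_ge0.
by move=> /eq0_normc ->.
Qed.

Lemma cL1_bounded01 (f : R -> R[i]) (b : R) :
  cmeas (f : measurableTypeR R -> R[i]) -> (forall x, normc (f x) <= b * U x) ->
  cL1 mu f.
Proof. by move=> mf fb; apply: (cL1_le mf fb); exact: intgZ. Qed.

Definition fcoef k := cint mu (fun x => P x * (cj (ek k x))).

Let mPe k : cmeas (fun x : measurableTypeR R => P x * (cj (ek k x))).
Proof. by apply: cmeasM => //; apply: cmeasJ; exact: cmeas_ek. Qed.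

Let iPe k : cL1 mu (fun x => P x * (cj (ek k x))).
Proof. by apply: cL1_bounded01 (mPe k) _ => x; rewrite normcM normcJ' normc_ek mulr1. Qed.

Let mUe k : cmeas (fun x : measurableTypeR R => (U x)%:C * ek k x).
Proof. by apply: cmeasM; [exact: cmeas_real|exact: cmeas_ek]. Qed.

Let iUe k : cL1 mu (fun x => (U x)%:C * ek k x).
Proof.
apply: (cL1_bounded01 (b := 1) (mUe k)) => x.
by rewrite normcM normc_ek mulr1 normcR ger0_norm ?mul1r.
Qed.

(** With [Q] the partial Fourier sum cut off to []0, 1[], orthogonality gives [<P, Q>] and [<Q, Q>]
    the same value, so the integral of [|P - Q|^2] is the difference of the two sides. *)
Lemma bessel1 (r : seq int) : uniq r ->
  \sum_(k <- r) normc (fcoef k) ^+ 2 <= \int[mu]_x normc (P x) ^+ 2.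
Proof.
move=> ur.
pose Q x := \sum_(k <- r) fcoef k * ((U x)%:C * ek k x).
have iQ : cL1 mu Q by apply: cL1_sum => k _; exact: cL1Z.
have mQ : cmeas (Q : measurableTypeR R -> R[i]) by have [] := iQ.
have QB x : normc (Q x) <= (\sum_(k <- r) normc (fcoef k)) * U x.
  rewrite (le_trans (normc_sum_le _ _ _))// mulr_suml; apply: ler_sum => k _.
  by rewrite !normcM normc_ek mulr1 normcR ger0_norm.
have b1 f g bf bg : cmeas (f : measurableTypeR R -> R[i]) ->
    cmeas (g : measurableTypeR R -> R[i]) -> (forall x, normc (f x) <= bf * U x) ->
    (forall x, normc (g x) <= bg * U x) -> cL1 mu (fun x => f x * (cj (g x))).
  move=> mf mg fb gb; apply: (cL1_bounded01 (b := bf * bg)).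
    by apply: cmeasM => //; exact: cmeasJ.
  move=> x; rewrite normcM normcJ' -UU mulrACA.
  by apply: ler_pM; rewrite ?normc_ge0.
have PQ : cint mu (fun x => P x * (cj (Q x))) = (\sum_(k <- r) normc (fcoef k) ^+ 2)%:C.
  transitivity (cint mu (fun x => \sum_(k <- r) (cj (fcoef k)) * (P x * (cj (ek k x))))).
    apply: eq_cint => x; rewrite /Q cconj_sum mulr_sumr; apply: eq_bigr => k _.
    by rewrite !cconjM cj_real -[in RHS](PU x); ring.
  rewrite cint_sum; last by move=> k _; exact: cL1Z.
  rewrite rmorph_sum; apply: eq_bigr => k _; rewrite cintZ// -/(fcoef k).
  by rewrite mulrC mulcJ.
have QQ : cint mu (fun x => Q x * (cj (Q x))) = (\sum_(k <- r) normc (fcoef k) ^+ 2)%:C.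
  transitivity (cint mu (fun x => \sum_(k <- r) \sum_(l <- r)
      fcoef k * (cj (fcoef l)) * ((U x)%:C * ek (k - l) x))).
    apply: eq_cint => x; rewrite /Q cconj_sum mulr_suml; apply: eq_bigr => k _.
    rewrite mulr_sumr; apply: eq_bigr => l _.
    by rewrite !cconjM cj_real ekD ekN -[in RHS](UU x) rmorphM/=; ring.
  rewrite cint_sum; last by move=> k _; apply: cL1_sum => l _; exact: cL1Z.
  rewrite rmorph_sum big_seq [RHS]big_seq; apply: eq_bigr => k kr.
  rewrite cint_sum; last by move=> l _; exact: cL1Z.
  rewrite (bigD1_seq k)//= big1 ?addr0; last first.
    by move=> l lk; rewrite cintZ// orthog_ek subr_eq0 eq_sym (negbTE lk) mulr0.
  by rewrite cintZ// orthog_ek subrr eqxx mulr1 mulcJ.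
have : 0 <= \int[mu]_x normc (P x - Q x) ^+ 2.
  by apply: Rintegral_ge0 => x _; exact: sqr_ge0.
have iPP := b1 _ _ _ _ mP mP PB PB; have iQQ := b1 _ _ _ _ mQ mQ QB QB.
have iPQ := b1 _ _ _ _ mP mQ PB QB.
have -> : \int[mu]_x normc (P x - Q x) ^+ 2 =
  \int[mu]_x (normc (P x) ^+ 2 + (cRe (Q x * (cj (Q x))) - 2 * cRe (P x * (cj (Q x))))).
  apply: eq_Rintegral => x _; rewrite cReMJ !normc_sqr cReM cReJ cImJ !cReD !cImD cReN cImN.
  by ring.
rewrite RintegralD//; last 2 first.
  by under eq_fun do rewrite -cReMJ; exact: cL1_Re iPP.
  by apply: intgB; [exact: cL1_Re iQQ|apply: intgZ; exact: cL1_Re iPQ].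
rewrite RintegralB//; [|exact: cL1_Re iQQ|by apply: intgZ; exact: cL1_Re iPQ].
rewrite RintegralZl//; last exact: cL1_Re iPQ.
by move: PQ QQ => [-> _] [-> _]; lra.
Qed.

End coef.

(** * The Fejer kernel *)

Section fejer.
Variable N : nat.

(** As a squared modulus the kernel is visibly nonnegative; [fejerE] gives the expansion in
    characters with [x] and [y] separated. *)
Definition fejer (x y : R) : R := normc (\sum_(j < N.+1) ek j (x - y)) ^+ 2 / N.+1%:R.

Lemma fejer_ge0 x y : 0 <= fejer x y.
Proof. by rewrite divr_ge0// sqr_ge0. Qed.

Lemma fejer_sym x y : fejer x y = fejer y x.
Proof.
rewrite /fejer -normcJ' cconj_sum; congr (normc _ ^+ 2 / _); apply: eq_bigr => j _.
by rewrite -ekNr opprB.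
Qed.

Lemma fejerE x y : (fejer x y)%:C = (N.+1%:R^-1)%:C *
  \sum_(j < N.+1) \sum_(l < N.+1) ek (j%:Z - l%:Z) x * cj (ek (j%:Z - l%:Z) y).
Proof.
rewrite /fejer mulrC rmorphM/= -mulcJ; congr (_ * _).
rewrite cconj_sum mulr_suml; apply: eq_bigr => j _.
rewrite mulr_sumr; apply: eq_bigr => l _.
by rewrite -ekN -ekD -[in RHS]ekNr -ekDr.
Qed.

Lemma measurable_fejer :
  measurable_fun setT (fun p : measurableTypeR R * measurableTypeR R => fejer p.1 p.2).
Proof.
apply: measurable_funM => //; apply: cmeas_normc2; apply: cmeas_sum => j _.
apply: cmeas_expi; apply: measurable_funM => //; apply: measurable_funM => //.
by apply: measurable_funB; [exact: measurable_fst|exact: measurable_snd].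
Qed.

Lemma measurable_fejerr x :
  measurable_fun setT (fun y : measurableTypeR R => fejer x y).
Proof. exact: (measurableT_comp measurable_fejer (@pair1_measurable _ _ _ _ x)). Qed.

Lemma fejer_le x y : fejer x y <= N.+1%:R.
Proof.
rewrite ler_pdivrMr// -expr2 ler_sqr ?nnegrE ?normc_ge0//.
rewrite (le_trans (normc_sum_le _ _ _))//.
under eq_bigr do rewrite normc_ek.
by rewrite sumr_const card_ord.
Qed.

(** Only the [N + 1] diagonal terms of [fejerE] survive integration, each with weight
    [1 / (N + 1)]. *)
Lemma fejer_mass x : \int[mu]_y (U y * fejer x y) = 1.
Proof.
apply: (@complexI R); rewrite -cint_real.
transitivity (cint mu (fun y => \sum_(j < N.+1) \sum_(l < N.+1)
    (N.+1%:R^-1)%:C * ek (j%:Z - l%:Z) x * ((U y)%:C * ek (l%:Z - j%:Z) y))).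
  apply: eq_cint => y; rewrite rmorphM/= fejerE mulrCA mulr_sumr mulr_sumr.
  apply: eq_bigr => j _; rewrite !mulr_sumr; apply: eq_bigr => l _.
  by rewrite -ekN opprB; ring.
have iUe k : cL1 mu (fun x => (U x)%:C * ek k x).
  apply: (@cL1_le _ _ _ mu _ U) => //.
    by apply: cmeasM; [exact: cmeas_real|exact: cmeas_ek].
  by move=> y; rewrite normcM normc_ek mulr1 normcR ger0_norm.
rewrite cint_sum; last by move=> j _; apply: cL1_sum => l _; exact: cL1Z.
transitivity (\sum_(j < N.+1) (N.+1%:R^-1 : R)%:C).
  apply: eq_bigr => j _; rewrite cint_sum; last by move=> l _; exact: cL1Z.
  rewrite (bigD1 j)//= big1 ?addr0; last first.
    move=> l lj; rewrite cintZ// orthog_ek subr_eq0 eqz_nat.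
    by rewrite -[(l : nat) == j]/(l == j) (negbTE lj) mulr0.
  by rewrite cintZ// orthog_ek !subrr eqxx mulr1 ek0 mulr1.
rewrite -rmorph_sum sumr_const card_ord; congr (_%:C).
by rewrite -[LHS]mulr_natr mulVf.
Qed.

(* [|1 - e(z)|^2 = 2 - 2 cos (2 pi z)] stays away from 0 when [z] stays away from the integers. *)
Lemma fejer_far (dl x y : R) : 0 < dl -> dl <= `|x - y| <= 1 - dl ->
  fejer x y <= 4 / (2 - 2 * cos (2 * pi * dl)) / N.+1%:R.
Proof.
move=> d0 /andP[d1 d2]; rewrite /fejer ler_pM2r ?invr_gt0//.
set z := x - y in d1 d2 *.
have pi0 := pi_gt0 R.
have q (t : R) : 0 <= t <= 2^-1 -> 2 * pi * t \in `[0, pi].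
  by move=> /andP[t0 t1]; rewrite in_itv/=; apply/andP; split; nra.
have qd : 0 <= dl <= 2^-1 by apply/andP; split; lra.
have cmono (t : R) : dl <= t <= 2^-1 -> cos (2 * pi * t) <= cos (2 * pi * dl).
  move=> /andP[t0 t1]; rewrite leNgt ltr_cos ?q//; last by apply/andP; split; lra.
  by rewrite -leNgt; nra.
have cz : cos (2 * pi * z) <= cos (2 * pi * dl) /\ cos (2 * pi * dl) < 1.
  have -> : cos (2 * pi * z) = cos (2 * pi * `|z|).
    by rewrite -cos_norm !normrM (gtr0_norm pi0) ger0_norm.
  split; last first.
    have h0 : (0 : R) \in `[0, pi] by rewrite in_itv/= lexx pi_ge0.
    by have := ltr_cos h0 (q _ qd); rewrite cos0 => ->; rewrite !mulr_gt0.
  have [h|h] := leP `|z| 2^-1; first by apply: cmono; rewrite d1.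
  have -> : cos (2 * pi * `|z|) = cos (2 * pi * (1 - `|z|)).
    rewrite -[LHS]cosN -[LHS]cosD2pi; congr cos; ring.
  by apply: cmono; apply/andP; split; lra.
have c0 : 0 < 2 - 2 * cos (2 * pi * dl) by lra.
rewrite ler_pdivlMr//.
have e1 : normc (ek 1 z - 1) ^+ 2 = 2 - 2 * cos (2 * pi * z).
  rewrite normc_sqr cReD cImD cReN cImN /= mul1r oppr0 addr0.
  rewrite sqrrB sin2cos2; ring.
(* Geometric sum: the kernel sum times [ek 1 z - 1] is [ek 1 z ^+ N.+1 - 1], of modulus at most 2,
   whence the 4 in the numerator. *)
have := congr1 (fun w => normc w ^+ 2) (subrX1 (ek 1 z) N.+1).
rewrite normcM exprMn e1 => e2.
under eq_bigr do rewrite ek_nat.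
have bnd : normc (ek 1 z ^+ N.+1 - 1) ^+ 2 <= 4.
  rewrite -ek_nat (_ : 4 = 2 ^+ 2); last by rewrite expr2; lra.
  rewrite ler_sqr ?nnegrE ?normc_ge0// (le_trans (le_normcD _ _))//.
  by rewrite normcN normc_ek normc1.
apply: le_trans bnd; rewrite e2 mulrC; apply: ler_wpM2r; first exact: sqr_ge0.
by case: cz; lra.
Qed.

End fejer.

Local Open Scope ereal_scope.

(** Fejer average of the oscillation of [f]. It bounds the error made when [P] is replaced by its
    Cesaro means, and it is stable in [L^1], so it can be estimated through continuous functions. *)
Definition fdefect N (f : R -> R) :=
  \int[mu]_x \int[mu]_y (U x * (U y * (fejer N x y * `|f x - f y|)))%:E.

Lemma measurable_defect N (f : R -> R) : measurable_fun setT f ->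
  measurable_fun setT (fun p : measurableTypeR R * measurableTypeR R =>
    (U p.1 * (U p.2 * (fejer N p.1 p.2 * `|f p.1 - f p.2|)))%:E).
Proof.
move=> mf; apply/measurable_EFinP.
have m1 : measurable_fun setT (fun p : measurableTypeR R * measurableTypeR R => U p.1).
  by apply: (measurableT_comp mU); exact: measurable_fst.
have m2 : measurable_fun setT (fun p : measurableTypeR R * measurableTypeR R => U p.2).
  by apply: (measurableT_comp mU); exact: measurable_snd.
have m3 : measurable_fun setT (fun p : measurableTypeR R * measurableTypeR R => f p.1).
  by apply: (measurableT_comp mf); exact: measurable_fst.
have m4 : measurable_fun setT (fun p : measurableTypeR R * measurableTypeR R => f p.2).
  by apply: (measurableT_comp mf); exact: measurable_snd.
apply: measurable_funM => //; apply: measurable_funM => //.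
apply: measurable_funM; first exact: measurable_fejer.
by apply: measurableT_comp => //; exact: measurable_funB.
Qed.

Lemma defect_ge0 N (f : R -> R) x y :
  (0 <= U x * (U y * (fejer N x y * `|f x - f y|)))%R.
Proof. by do 3 (apply: mulr_ge0 => //; rewrite ?fejer_ge0//). Qed.

Lemma fejer_mass_e N x : \int[mu]_y (U y * fejer N x y)%:E = 1.
Proof.
rewrite -RintegralE ?fejer_mass//.
apply: (@intg_le _ _ _ mu _ (fun y => N.+1%:R * U y)%R).
- by apply: measurable_funM => //; exact: measurable_fejerr.
- move=> y; have h : (0 <= U y * fejer N x y)%R by apply: mulr_ge0 => //; exact: fejer_ge0.
  by rewrite ger0_norm// mulrC ler_wpM2r// fejer_le.
- exact: intgZ.
Qed.

Lemma fejer_weight N (h : R -> R) : measurable_fun setT h -> (forall x, 0 <= h x)%R ->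
  \int[mu]_x \int[mu]_y (U x * h x * (U y * fejer N x y))%:E =
  \int[mu]_x (U x * h x)%:E.
Proof.
move=> mh h0; apply: eq_integral => x _.
under eq_integral do rewrite EFinM.
rewrite ge0_integralZl//.
- by rewrite fejer_mass_e mule1.
- by apply/measurable_EFinP/measurable_funM => //; exact: measurable_fejerr.
- by move=> y _; rewrite lee_fin mulr_ge0 ?fejer_ge0.
- by rewrite lee_fin mulr_ge0.
Qed.

(** Triangle inequality through [g x] and [g y]. The kernel has mass 1 in either variable, the
    second case by symmetry, so each of the two errors integrates to the [L^1] distance. *)
Lemma fdefect_triangle N (f g : R -> R) :
  measurable_fun setT f -> measurable_fun setT g ->
  fdefect N f <= fdefect N g + 2%:E * \int[mu]_x (U x * `|f x - g x|)%:E.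
Proof.
move=> mf mg; pose h x := `|f x - g x|%R.
have mh : measurable_fun setT h.
  by apply: measurableT_comp => //; exact: measurable_funB.
have h0 x : (0 <= h x)%R by exact: normr_ge0.
pose H1 (p : measurableTypeR R * measurableTypeR R) := (U p.1 * h p.1 * (U p.2 * fejer N p.1 p.2))%R.
pose H2 (p : measurableTypeR R * measurableTypeR R) := (U p.2 * h p.2 * (U p.1 * fejer N p.2 p.1))%R.
have mH1 : measurable_fun setT H1.
  apply: measurable_funM; apply: measurable_funM.
  - by apply: (measurableT_comp mU); exact: measurable_fst.
  - by apply: (measurableT_comp mh); exact: measurable_fst.
  - by apply: (measurableT_comp mU); exact: measurable_snd.
  - exact: measurable_fejer.
have mH2 : measurable_fun setT H2.
  apply: measurable_funM; apply: measurable_funM.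
  - by apply: (measurableT_comp mU); exact: measurable_snd.
  - by apply: (measurableT_comp mh); exact: measurable_snd.
  - by apply: (measurableT_comp mU); exact: measurable_fst.
  - apply: (measurable_fun_eq _ (measurable_fejer N)) => p; exact: fejer_sym.
have H10 p : (0 <= H1 p)%R by apply: mulr_ge0; apply: mulr_ge0 => //; exact: fejer_ge0.
have H20 p : (0 <= H2 p)%R by apply: mulr_ge0; apply: mulr_ge0 => //; exact: fejer_ge0.
have mD := measurable_defect N mg.
have I1 : \int[mu]_x \int[mu]_y (H1 (x, y))%:E = \int[mu]_x (U x * h x)%:E.
  exact: fejer_weight.
have I2 : \int[mu]_x \int[mu]_y (H2 (x, y))%:E = \int[mu]_x (U x * h x)%:E.
  rewrite -(fejer_weight N mh h0).
  rewrite (fubini_tonelli (fun p => (H2 p)%:E))//; first exact/measurable_EFinP.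
apply: (@le_trans _ _ (\int[mu]_x \int[mu]_y
  ((U x * (U y * (fejer N x y * `|g x - g y|)))%:E + ((H1 (x, y))%:E + (H2 (x, y))%:E)))).
  have m' : measurable_fun setT (fun p : measurableTypeR R * measurableTypeR R =>
     ((U p.1 * (U p.2 * (fejer N p.1 p.2 * `|g p.1 - g p.2|)))%:E + ((H1 p)%:E + (H2 p)%:E))).
    by apply: emeasurable_funD => //; apply: emeasurable_funD; exact/measurable_EFinP.
  have p' p : 0 <= ((U p.1 * (U p.2 * (fejer N p.1 p.2 * `|g p.1 - g p.2|)))%:E + ((H1 p)%:E + (H2 p)%:E)).
    by rewrite adde_ge0 ?adde_ge0// lee_fin ?defect_ge0.
  apply: ge0_le_integral => //.
  - by move=> x _; apply: integral_ge0 => y _; rewrite lee_fin defect_ge0.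
  - apply: (measurable_fun_fubini_tonelli_F _ (measurable_defect N mf)) => p.
    by rewrite lee_fin defect_ge0.
  - exact: (measurable_fun_fubini_tonelli_F _ m' p').
  move=> x _; apply: ge0_le_integral => //.
  - by move=> y _; rewrite lee_fin defect_ge0.
  - exact: (measurableT_comp (measurable_defect N mf) (@pair1_measurable _ _ _ _ x)).
  - exact: (measurableT_comp m' (@pair1_measurable _ _ _ _ x)).
  move=> y _; rewrite -!EFinD lee_fin /H1 /H2 /= (fejer_sym _ y x).
  have -> : (U x * (U y * (fejer N x y * `|g x - g y|)) +
     (U x * h x * (U y * fejer N x y) + U y * h y * (U x * fejer N x y)) =
     U x * (U y * (fejer N x y * (`|g x - g y| + h x + h y))))%R by ring.
  apply: ler_wpM2l => //; apply: ler_wpM2l => //.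
  apply: ler_wpM2l; first exact: fejer_ge0.
  rewrite /h (_ : f x - f y = (g x - g y) + (f x - g x) + (g y - f y))%R; last by ring.
  by rewrite (le_trans (ler_normD _ _))// lerD// ?(distrC (g y))// ler_normD.
have mx (F : measurableTypeR R * measurableTypeR R -> \bar R) x :
    measurable_fun setT F -> measurable_fun setT (fun y => F (x, y)).
  by move=> mF; exact: (measurableT_comp mF (@pair1_measurable _ _ _ _ x)).
have -> : \int[mu]_x \int[mu]_y
  ((U x * (U y * (fejer N x y * `|g x - g y|)))%:E + ((H1 (x, y))%:E + (H2 (x, y))%:E)) =
  fdefect N g + (\int[mu]_x \int[mu]_y (H1 (x, y))%:E + \int[mu]_x \int[mu]_y (H2 (x, y))%:E).
  have mF (F : measurableTypeR R * measurableTypeR R -> \bar R) :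
     measurable_fun setT F -> (forall p, 0 <= F p) ->
     measurable_fun setT (fun x => \int[mu]_y F (x, y)).
    exact: measurable_fun_fubini_tonelli_F.
  have mH1' : measurable_fun setT (EFin \o H1) by exact/measurable_EFinP.
  have mH2' : measurable_fun setT (EFin \o H2) by exact/measurable_EFinP.
  rewrite -ge0_integralD//; last 4 first.
  - by move=> x _; apply: integral_ge0 => y _; rewrite lee_fin.
  - by apply: (mF (EFin \o H1)) => // p; rewrite lee_fin.
  - by move=> x _; apply: integral_ge0 => y _; rewrite lee_fin.
  - by apply: (mF (EFin \o H2)) => // p; rewrite lee_fin.
  rewrite -ge0_integralD//; last 4 first.
  - by move=> x _; apply: integral_ge0 => y _; rewrite lee_fin defect_ge0.
  - by apply: (mF _ mD) => // p; rewrite lee_fin defect_ge0.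
  - by move=> x _; rewrite adde_ge0//; apply: integral_ge0 => y _; rewrite lee_fin.
  - by apply: emeasurable_funD; [apply: (mF (EFin \o H1))|apply: (mF (EFin \o H2))] => // p; rewrite lee_fin.
  apply: eq_integral => x _.
  rewrite -ge0_integralD//; last 4 first.
  - by move=> y _; rewrite lee_fin.
  - exact: (mx (EFin \o H1)).
  - by move=> y _; rewrite lee_fin.
  - exact: (mx (EFin \o H2)).
  rewrite -ge0_integralD//.
  - by move=> y _; rewrite lee_fin defect_ge0.
  - exact: (mx _ x mD).
  - by move=> y _; rewrite adde_ge0// lee_fin.
  - by apply: emeasurable_funD; [exact: (mx (EFin \o H1))|exact: (mx (EFin \o H2))].
rewrite I1 I2 leeD2l// -[2%R]/(1 + 1)%R EFinD ge0_muleDl ?lee_fin//.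
by rewrite mul1e.
Qed.

Definition fdefect_in N (f : R -> R) x :=
  \int[mu]_y (U x * (U y * (fejer N x y * `|f x - f y|)))%:E.

Lemma measurable_fdefect_in N (f : R -> R) : measurable_fun setT f ->
  measurable_fun setT (fdefect_in N f : measurableTypeR R -> \bar R).
Proof.
move=> mf; apply: (measurable_fun_fubini_tonelli_F _ (measurable_defect N mf)) => p.
by rewrite lee_fin defect_ge0.
Qed.

Lemma fdefect_in_ge0 N f x : 0 <= fdefect_in N f x.
Proof. by apply: integral_ge0 => y _; rewrite lee_fin defect_ge0. Qed.

Lemma measurable_defectr N (f : R -> R) x : measurable_fun setT f ->
  measurable_fun setT (fun y : measurableTypeR R =>
    (U x * (U y * (fejer N x y * `|f x - f y|)))%:E).
Proof.
move=> mf.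
exact: (measurableT_comp (measurable_defect N mf) (@pair1_measurable _ _ _ _ x)).
Qed.

(** Both the kernel and [U] have mass 1, so the pointwise bound integrates to [a + b]. Here [a]
    serves the points near [x], where [f] varies little, and [b] those where the kernel is small. *)
Lemma fdefect_in_le N (f : R -> R) (M a b x : R) : measurable_fun setT f ->
  (0 <= a)%R -> (0 <= b)%R ->
  (forall y, U y = 1%R -> fejer N x y * `|f x - f y| <= a * fejer N x y + b)%R ->
  fdefect_in N f x <= (U x * (a + b))%:E.
Proof.
move=> mf a0 b0 h.
have mUf : measurable_fun setT (fun y : measurableTypeR R => (U y * fejer N x y)%:E).
  by apply/measurable_EFinP/measurable_funM => //; exact: measurable_fejerr.
have mU' : measurable_fun setT (fun y : measurableTypeR R => (U y)%:E) by exact/measurable_EFinP.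
have Uf0 y : 0 <= (U y * fejer N x y)%:E.
  by rewrite lee_fin mulr_ge0// fejer_ge0.
apply: (@le_trans _ _ (\int[mu]_y ((U x * a)%:E * (U y * fejer N x y)%:E + (U x * b)%:E * (U y)%:E))).
  apply: ge0_le_integral => //.
  - by move=> y _; rewrite lee_fin defect_ge0.
  - exact: measurable_defectr.
  - by apply: emeasurable_funD; apply: emeasurable_funM.
  - move=> y _; rewrite -!EFinM -EFinD lee_fin; move: (h y); set F := fejer N x y => hy.
    have -> : (U x * a * (U y * F) + U x * b * U y = U x * (U y * (a * F + b)))%R by ring.
    rewrite ler_wpM2l//; have [Uy|Uy] := U01 y; rewrite Uy ?mul0r//.
    by rewrite !mul1r; exact: hy.
rewrite ge0_integralD//; last 4 first.
- by move=> y _; rewrite mule_ge0// lee_fin mulr_ge0.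
- exact: emeasurable_funM.
- by move=> y _; rewrite mule_ge0// lee_fin ?mulr_ge0.
- exact: emeasurable_funM.
rewrite ge0_integralZl//; last by rewrite lee_fin mulr_ge0.
rewrite ge0_integralZl//; last 2 first.
- by move=> y _; rewrite lee_fin.
- by rewrite lee_fin mulr_ge0.
by rewrite fejer_mass_e -RintegralE// iU1 !mule1 -EFinD -mulrDr.
Qed.

Lemma fdefect_in_bound N (f : R -> R) (M x : R) : measurable_fun setT f ->
  (forall y, `|f y| <= M)%R -> fdefect_in N f x <= (U x * (2 * M))%:E.
Proof.
move=> mf fM; have M0 : (0 <= M)%R by exact: le_trans (fM 0%R).
rewrite -[(2 * M)%R]addr0; apply: fdefect_in_le => //; first by rewrite mulr_ge0.
move=> y _; rewrite addr0 mulrC ler_wpM2r ?fejer_ge0//.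
by rewrite (le_trans (ler_normB _ _))// mulr_natl mulr2n lerD.
Qed.

(** Dominated convergence in [x]. For fixed [x] the integral over [y] splits at [|x - y| = dl]:
    inside, continuity bounds the oscillation by [e / 2]; outside, [fejer_far] makes the kernel
    [O(1 / N)]. *)
Lemma fdefect_cvg0 (f : R -> R) (M : R) : continuous f ->
  (forall y, `|f y| <= M)%R -> fdefect N f @[N --> \oo] --> 0.
Proof.
move=> cf fM; have mf : measurable_fun setT f by exact: continuous_measurable_fun.
have M0 : (0 <= M)%R by exact: le_trans (fM 0%R).
have [] := @dominated_convergence _ _ _ mu setT measurableT
    (fun N => fdefect_in N f) (cst 0) (fun x => (U x * (2 * M))%:E); last 1 first.
- by move=> _ _; rewrite integral0.
- by move=> N; exact: measurable_fdefect_in.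
- exact: measurable_cst.
- apply: aeW => x _ /=; have [Ux|Ux] := U01 x.
  + apply/fine_cvgP; split.
      apply: nearW => N; rewrite ge0_fin_numE ?fdefect_in_ge0//.
      by apply: le_lt_trans (fdefect_in_bound N x mf fM) _; exact: ltry.
    apply/cvgrPdist_le => e e0.
    have [x0 x1] : (0 < x /\ x < 1)%R by exact: U1_itv.
    have e2 : (0 < e / 2)%R by lra.
    have := cf x; move/cvgrPdist_le => /(_ _ e2); rewrite near_nbhs => /nbhs_ballP[dl0 /= dl00 hdl].
    (* Staying below the distance from [x] to both ends ensures [|x - y| <= 1 - dl] for every [y] in
       the interval, the upper half of the hypothesis of [fejer_far]. *)
    pose dl := (Num.min dl0 (Num.min x (1 - x)) / 2)%R.
    have dl_gt0 : (0 < dl)%R by rewrite divr_gt0// !lt_min dl00 x0/= subr_gt0.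
    have [d1 d2 d3] : [/\ (dl < dl0), (dl < x) & (dl < 1 - x)]%R.
      have m0 : (0 < Num.min dl0 (Num.min x (1 - x)))%R by rewrite !lt_min dl00 x0/= subr_gt0.
      have h : (dl < Num.min dl0 (Num.min x (1 - x)))%R by rewrite /dl; lra.
      by move: h; rewrite !lt_min => /and3P[].
    pose c := (2 - 2 * cos (2 * pi * dl))%R.
    near=> N.
    rewrite sub0r normrN ger0_norm ?fine_ge0 ?fdefect_in_ge0//.
    rewrite -lee_fin fineK; last first.
      rewrite ge0_fin_numE ?fdefect_in_ge0//.
      by apply: le_lt_trans (fdefect_in_bound N x mf fM) _; exact: ltry.
    apply: (@le_trans _ _ (U x * (e / 2 + `|(4 / c) * (2 * M)| / N.+1%:R))%:E).
      apply: fdefect_in_le => //; first exact: ltW.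
      move=> y Uy; have [y0 y1] : (0 < y /\ y < 1)%R by exact: U1_itv.
      have [xy|xy] := ltP (`|(x : R) - y|%R) dl.
        rewrite -[leLHS]addr0 lerD// ?divr_ge0// mulrC ler_wpM2r ?fejer_ge0//.
        by apply: hdl; rewrite /ball/=; apply: lt_trans d1.
      rewrite -[leLHS]add0r lerD//; first by rewrite mulr_ge0 ?fejer_ge0// ltW.
      have far : (dl <= `|x - y| <= 1 - dl)%R.
        rewrite xy/=.
          have : (forall u v : R, dl < u -> dl < 1 - u -> 0 < v -> v < 1 -> `|u - v| <= 1 - dl)%R.
            by move=> u v *; rewrite ler_norml; apply/andP; split; lra.
          exact.
      apply: (@le_trans _ _ (4 / c / N.+1%:R * (2 * M))%R).
        apply: ler_pM; rewrite ?fejer_ge0//; first exact: fejer_far.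
        by rewrite (le_trans (ler_normB _ _))// mulr_natl mulr2n lerD.
      by rewrite mulrAC ler_wpM2r// ler_norm.
    rewrite Ux mul1r lee_fin [leRHS]splitr lerD2l.
    rewrite ler_pdivrMr// -ler_pdivrMl//.
    apply: (@le_trans _ _ N%:R%R); last by rewrite ler_nat.
    near: N; exact: nbhs_infty_ger.
  + rewrite (_ : (fun N => _) = cst 0); first exact: cvg_cst.
    apply/funext => N; rewrite /fdefect_in.
    by under eq_integral do rewrite Ux mul0r; rewrite integral0.
- by under eq_fun do rewrite mulrC; exact: intgZ.
- apply: aeW => x N _; rewrite gee0_abs ?fdefect_in_ge0//.
  exact: fdefect_in_bound.
Unshelve. all: by end_near. Qed.

Lemma fdefect_ge0 N (f : R -> R) : 0 <= fdefect N f.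
Proof. by apply: integral_ge0 => x _; exact: fdefect_in_ge0. Qed.

(** Density of continuous functions: an approximant within [e / 4] in [L^1] costs [e / 2] by
    [fdefect_triangle], and its own defect is eventually at most [e / 2]. *)
Lemma fdefect_small (f : R -> R) (M : R) : measurable_fun setT f ->
  (forall y, `|f y| <= M)%R -> forall e : R, (0 < e)%R ->
  exists n0, forall N, (n0 <= N)%N -> fdefect N f <= e%:E.
Proof.
move=> mf fM e e0; have M0 : (0 <= M)%R by exact: le_trans (fM 0%R).
have [|||g_ [cg ig ag]] := @approximation_continuous_integrable R `]0%R, 1%R[ f.
- by [].
- have := @lebesgue_measure_itv R `]0%R, 1%R[.
  by rewrite /= lte_fin ltr01 => ->; exact: ltry.
- apply: measurable_bounded_integrable => //.
  + have := @lebesgue_measure_itv R `]0%R, 1%R[.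
    by rewrite /= lte_fin ltr01 => ->; exact: ltry.
  + exact: measurable_funTS.
  + by exists M; split; [exact: num_real|move=> b Mb x _; exact: le_trans (fM x) (ltW Mb)].
have e4 : (0 < e / 4)%R by rewrite divr_gt0.
(* This clamps the approximants to [[-M, M]]: they acquire the uniform bound required by
   [fdefect_cvg0] and do not move away from [f]. *)
pose g k x := ((`|g_ k x + M| - `|g_ k x - M|) / 2)%R.
have cgk k : continuous (g k).
  move=> x; apply: cvgMl; apply: cvgB; apply: cvg_norm.
    by apply: cvgD; [exact: cg|exact: cvg_cst].
  by apply: cvgB; [exact: cg|exact: cvg_cst].
have gM k x : (`|g k x| <= M)%R.
  rewrite /g; move: (g_ k x) => t; rewrite ler_norml.
  by have [?|?] := ger0P (t + M)%R; have [?|?] := ger0P (t - M)%R; apply/andP; split; lra.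
have fg k x : (`|f x - g k x| <= `|f x - g_ k x|)%R.
  rewrite /g; move: (g_ k x) (fM x) => t; rewrite ler_norml => /andP[? ?].
  have [?|?] := ger0P (t + M)%R; have [?|?] := ger0P (t - M)%R;
  have [?|?] := ger0P (f x - t)%R;
  by rewrite ler_norml; apply/andP; split; lra.
have [k hk] : exists k, \int[mu]_x (U x * `|f x - g k x|)%:E <= (e / 4)%:E.
  have /fine_cvgP[[k1 _ kfin] /cvgrPdist_lt/(_ _ e4)[k2 _ kfine]] := ag.
  pose k := maxn k1 k2; exists k.
  have := kfine k (leq_maxr _ _); rewrite sub0r normrN /= => h.
  have fink := kfin k (leq_maxl _ _).
  apply: (@le_trans _ _ (\int[mu]_(z in `]0%R, 1%R[) `|(f z - g_ k z)%:E|)).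
    rewrite [leRHS]integral_mkcond; apply: ge0_le_integral => //.
    - by move=> x _; rewrite lee_fin mulr_ge0.
    - apply/measurable_EFinP; apply: measurable_funM => //.
      apply: measurableT_comp => //; apply: measurable_funB => //.
      exact: continuous_measurable_fun.
    - apply/(measurable_restrictT _ _).1 => //.
      apply: measurable_funTS; apply/measurable_EFinP.
      apply: measurableT_comp => //; apply: measurable_funB => //.
      exact: continuous_measurable_fun.
    - move=> x _; rewrite patchE /U indicE; case: (x \in _).
        by rewrite mul1r lee_fin; exact: fg.
      by rewrite mul0r.
  rewrite -[leLHS]fineK// lee_fin; apply: ltW; apply: le_lt_trans h.
  exact: ler_norm.
have e2 : (0 < e / 2)%R by rewrite divr_gt0.
have [n0 hn0] := cvge0_le (fdefect_ge0 ^~ (g k)) (fdefect_cvg0 (cgk k) (gM k)) e2.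
exists n0 => N /hn0 h.
apply: (le_trans (fdefect_triangle N mf (continuous_measurable_fun (cgk k)))).
rewrite (_ : e = e / 2 + 2 * (e / 4))%R; last by field.
rewrite [leRHS]EFinD (EFinM 2); apply: leeD => //.
by apply: lee_wpmul2l => //; rewrite lee_fin.
Qed.

Local Close Scope ereal_scope.

(** * The lower half of Parseval's identity, by Cesaro means *)

Section lower.
Variables (P : R -> R[i]) (B : R).
Hypotheses (mP : cmeas (P : measurableTypeR R -> R[i]))
  (PB : forall x, normc (P x) <= B * U x).

Let c k := fcoef P k.

Let B0 : 0 <= B.
Proof.
have := PB 2^-1; have -> : U 2^-1 = 1.
  by rewrite /U indicE mem_set//= in_itv/= invr_gt0 ltr0n invf_lt1 ?ltr1n.
by rewrite mulr1; apply: le_trans; exact: normc_ge0.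
Qed.

Let PU x : P x * (U x)%:C = P x.
Proof.
have := PB x; have [->|->] := U01 x; first by rewrite !mulr1.
rewrite !mulr0 => h; have : normc (P x) = 0 by apply/eqP; rewrite eq_le h normc_ge0.
by move=> /eq0_normc ->.
Qed.

Let PB' x : normc (P x) <= B.
Proof. by apply: le_trans (PB x) _; have [->|->] := U01 x; rewrite ?mulr1 ?mulr0. Qed.

Let iPe k : cL1 mu (fun x => P x * cj (ek k x)).
Proof.
apply: (cL1_bounded01 (b := B)).
  by apply: cmeasM => //; apply: cmeasJ; exact: cmeas_ek.
by move=> x; rewrite normcM normcJ' normc_ek mulr1.
Qed.

(** The Cesaro mean of the Fourier series of the conjugate of [P]. *)
Let Tf N x := cint mu (fun y => cj (P y) * (fejer N x y)%:C).

Let TfE N x : Tf N x = (N.+1%:R^-1)%:C *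
  \sum_(j < N.+1) \sum_(l < N.+1) ek (j%:Z - l%:Z) x * cj (c (l%:Z - j%:Z)).
Proof.
have iJ k : cL1 mu (fun y => cj (P y) * ek k y).
  apply: (cL1_bounded01 (b := B)).
    by apply: cmeasM; [exact: cmeasJ|exact: cmeas_ek].
  by move=> y; rewrite normcM normcJ' normc_ek mulr1.
transitivity (cint mu (fun y => (N.+1%:R^-1)%:C *
   \sum_(j < N.+1) \sum_(l < N.+1) ek (j%:Z - l%:Z) x * (cj (P y) * ek (l%:Z - j%:Z) y))).
  apply: eq_cint => y; rewrite fejerE mulrCA mulr_sumr; congr (_ * _).
  apply: eq_bigr => j _; rewrite mulr_sumr; apply: eq_bigr => l _.
  by rewrite -ekN opprB; ring.
rewrite cintZ; last by apply: cL1_sum => j _; apply: cL1_sum => l _; exact: cL1Z.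
congr (_ * _); rewrite cint_sum; last by move=> j _; apply: cL1_sum => l _; exact: cL1Z.
apply: eq_bigr => j _; rewrite cint_sum; last by move=> l _; exact: cL1Z.
apply: eq_bigr => l _; rewrite cintZ//; congr (_ * _).
rewrite /c /fcoef -cintJ//; apply: eq_cint => y.
by rewrite cconjM cjK.
Qed.

Let SN N := N.+1%:R^-1 * \sum_(j < N.+1) \sum_(l < N.+1) normc (c (l%:Z - j%:Z)) ^+ 2.

Let mTf N : cmeas (Tf N : measurableTypeR R -> R[i]).
Proof.
rewrite (funext (TfE N)).
apply: cmeasM; first exact: cmeas_cst.
apply: cmeas_sum => j _; apply: cmeas_sum => l _.
by apply: cmeasM; [exact: cmeas_ek|exact: cmeas_cst].
Qed.

Let PT N : cint mu (fun x => P x * Tf N x) = (SN N)%:C.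
Proof.
transitivity (cint mu (fun x => (N.+1%:R^-1)%:C *
   \sum_(j < N.+1) \sum_(l < N.+1) cj (c (l%:Z - j%:Z)) * (P x * cj (ek (l%:Z - j%:Z) x)))).
  apply: eq_cint => x; rewrite TfE mulrCA mulr_sumr; congr (_ * _).
  apply: eq_bigr => j _; rewrite mulr_sumr; apply: eq_bigr => l _.
  by rewrite -ekN opprB; ring.
rewrite cintZ; last by apply: cL1_sum => j _; apply: cL1_sum => l _; exact: cL1Z.
rewrite /SN rmorphM/=; congr (_ * _).
rewrite cint_sum; last by move=> j _; apply: cL1_sum => l _; exact: cL1Z.
rewrite rmorph_sum; apply: eq_bigr => j _.
rewrite cint_sum; last by move=> l _; exact: cL1Z.
rewrite rmorph_sum; apply: eq_bigr => l _.
by rewrite cintZ// mulrC mulcJ.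
Qed.

(** For each [j] the differences [l - j] are distinct, so every inner sum is a finite subsum of the
    series, and [SN] averages [N + 1] of them. *)
Let SN_le N : ((SN N)%:E <= \esum_(k in [set: int]) (normc (c k) ^+ 2)%:E)%E.
Proof.
set S := (\esum_(k in _) _)%E.
have S0 : (0 <= S)%E by apply: esum_ge0 => k _; rewrite lee_fin sqr_ge0.
have hj (j : 'I_N.+1) : ((\sum_(l < N.+1) normc (c (l%:Z - j%:Z)) ^+ 2)%:E <= S)%E.
  rewrite -sumEFin;
  rewrite -(big_map (fun l : 'I_N.+1 => l%:Z - j%:Z) predT (fun k => (normc (c k) ^+ 2)%:E)).
  apply: esum_ge_fin => //; rewrite map_inj_uniq ?index_enum_uniq//.
  by move=> l l' /addIr [] /ord_inj.
case: S S0 hj => [s| |]// S0 hj; last by rewrite leey.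
rewrite lee_fin /SN mulrC ler_pdivrMr// mulr_natr.
rewrite -[X in _ <= s *+ X](card_ord N.+1) -sumr_const.
by apply: ler_sum => j _; have := hj j; rewrite lee_fin.
Qed.

(** Pair [P] with [Tf] instead of its conjugate: the result is [SN], at most the full series, and
    the error is at most [B] times the defects of the real and imaginary parts of [P], which tend to
    0. *)
Lemma parseval1_lower :
  ((\int[mu]_x normc (P x) ^+ 2)%:E <= \esum_(k in [set: int]) (normc (c k) ^+ 2)%:E)%E.
Proof.
set S := (\esum_(k in _) _)%E.
pose f1 x := cRe (P x); pose f2 x := cIm (P x).
have [mf1 mf2] : measurable_fun setT f1 /\ measurable_fun setT f2 by [].
have f1B x : `|f1 x| <= B by apply: le_trans (PB' x); exact: normr_Re.
have f2B x : `|f2 x| <= B by apply: le_trans (PB' x); exact: normr_Im.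
pose a (f : R -> R) N x := fine (fdefect_in N f x).
have aE (f : R -> R) N x : measurable_fun setT f -> (forall y, `|f y| <= B) ->
    (a f N x)%:E = fdefect_in N f x.
  move=> mf fB; rewrite /a fineK// ge0_fin_numE ?fdefect_in_ge0//.
  by apply: le_lt_trans (fdefect_in_bound N x mf fB) _; exact: ltry.
have ia (f : R -> R) N : measurable_fun setT f -> (forall y, `|f y| <= B) -> intg mu (a f N).
  move=> mf fB; apply: (@intg_le _ _ _ mu _ (fun x => 2 * B * U x)).
  - apply: (measurableT_comp (fine_measurable measurableT)).
    exact: measurable_fdefect_in.
  - move=> x; rewrite ger0_norm ?fine_ge0 ?fdefect_in_ge0// -lee_fin aE// mulrC.
    exact: fdefect_in_bound.
  - exact: intgZ.
have ifin (f : R -> R) N : measurable_fun setT f -> (forall y, `|f y| <= B) ->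
    (\int[mu]_x a f N x)%:E = fdefect N f.
  by move=> mf fB; rewrite RintegralE ?ia//; apply: eq_integral => x _; rewrite aE.
have iPP : cL1 mu (fun x => P x * cj (P x)).
  apply: (cL1_bounded01 (b := B * B)); first by apply: cmeasM => //; exact: cmeasJ.
  by move=> x; rewrite normcM normcJ' mulrAC; apply: ler_pM; rewrite ?normc_ge0.
have key N : \int[mu]_x normc (P x) ^+ 2 <= SN N + B * (\int[mu]_x a f1 N x + \int[mu]_x a f2 N x).
  have UF0 x y : 0 <= U y * fejer N x y by apply: mulr_ge0 => //; exact: fejer_ge0.
  have UFle x y : U y * fejer N x y <= N.+1%:R * U y by rewrite mulrC ler_wpM2r// fejer_le.
  have iT x : cL1 mu (fun y => (U y * fejer N x y)%:C).
    apply: (cL1_bounded01 (b := N.+1%:R)).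
      by apply: cmeas_real; apply: measurable_funM => //; exact: measurable_fejerr.
    by move=> y; rewrite normcR ger0_norm.
  have iJP x : cL1 mu (fun y => cj (P y) * (fejer N x y)%:C).
    apply: (cL1_bounded01 (b := B * N.+1%:R)).
      apply: cmeasM; first exact: cmeasJ.
      by apply: cmeas_real; exact: measurable_fejerr.
    move=> y; rewrite normcM normcJ' normcR ger0_norm ?fejer_ge0// mulrAC.
    by apply: ler_pM; rewrite ?normc_ge0 ?fejer_ge0 ?fejer_le.
  have iPT : cL1 mu (fun x => P x * Tf N x).
    apply: (cL1_bounded01 (b := B * (B * N.+1%:R))).
    - exact: cmeasM.
    - move=> x; rewrite normcM [leRHS]mulrAC; apply: ler_pM; rewrite ?normc_ge0//.
      apply: (le_trans (normc_cint (iJP x))).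
      apply: (@le_trans _ _ (\int[mu]_y (B * N.+1%:R * U y))); last first.
        by rewrite RintegralZl// iU1 mulr1.
      apply: le_Rintegral => //; [by have [] := iJP x|exact: intgZ|].
      move=> y _; rewrite normcM normcJ' normcR ger0_norm ?fejer_ge0// mulrAC.
      by apply: ler_pM; rewrite ?normc_ge0 ?fejer_ge0 ?fejer_le.
  have -> : SN N = \int[mu]_x cRe (P x * Tf N x) by have := PT N => -[->].
  have i1 := ia f1 N mf1 f1B; have i2 := ia f2 N mf2 f2B.
  rewrite -RintegralD// -RintegralZl//; last exact: intgD.
  rewrite -RintegralD//; [|exact: cL1_Re iPT|by apply: intgZ; exact: intgD].
  apply: le_Rintegral => //.
  - by under eq_fun do rewrite -cReMJ; exact: cL1_Re iPP.
  - by apply: intgD; [exact: cL1_Re iPT|by apply: intgZ; exact: intgD].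
  move=> x _; rewrite -cReMJ -lerBlDl -cReN -cReD -mulrBr.
  pose Dx y := (U x)%:C * (cj (P x - P y) * (U y * fejer N x y)%:C).
  have iDx : cL1 mu Dx.
    apply: cL1Z; apply: (cL1_bounded01 (b := (B + B) * N.+1%:R)).
      apply: cmeasM; last by have [] := iT x.
      apply: cmeasJ; apply: cmeasB => //; exact: cmeas_cst.
    move=> y; rewrite normcM normcJ' normcR ger0_norm// -mulrA.
    apply: ler_pM; rewrite ?normc_ge0 ?UF0//.
      by rewrite (le_trans (le_normcD _ _))// normcN lerD.
  have -> : P x * (cj (P x) - Tf N x) = P x * cint mu Dx.
    rewrite /Dx cintZ; last first.
      apply: (cL1_bounded01 (b := (B + B) * N.+1%:R)).
        apply: cmeasM; last by have [] := iT x.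
        apply: cmeasJ; apply: cmeasB => //; exact: cmeas_cst.
      move=> y; rewrite normcM normcJ' normcR ger0_norm// -mulrA.
      apply: ler_pM; rewrite ?normc_ge0 ?UF0//.
        by rewrite (le_trans (le_normcD _ _))// normcN lerD.
      rewrite [in RHS]mulrA PU; congr (_ * _).
    have -> : cj (P x) = cint mu (fun y => cj (P x) * (U y * fejer N x y)%:C).
      by rewrite cintZ// cint_real fejer_mass mulr1.
    rewrite /Tf -cintB//; last exact: cL1Z.
    apply: eq_cint => y; rewrite -[in LHS](PU y) cconjM cj_real rmorphM /cj raddfB /=.
    by ring.
  apply: (le_trans (ler_norm _)); apply: (le_trans (normr_Re _)).
  rewrite normcM; apply: ler_pM; rewrite ?normc_ge0//.
  apply: (le_trans (normc_cint iDx)).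
  pose w (f : R -> R) y := U x * (U y * (fejer N x y * `|f x - f y|)).
  have iw (f : R -> R) : measurable_fun setT f -> (forall y, `|f y| <= B) -> intg mu (w f).
    move=> mf fB; apply/integrableP; split; first exact: measurable_defectr.
    under eq_integral do rewrite /= ger0_norm ?defect_ge0//.
    by apply: le_lt_trans (fdefect_in_bound N x mf fB) _; exact: ltry.
  have wE (f : R -> R) : measurable_fun setT f -> (forall y, `|f y| <= B) ->
      a f N x = \int[mu]_y w f y by [].
  rewrite wE// wE// -RintegralD//; [|exact: iw|exact: iw].
  apply: le_Rintegral => //; [by have [] := iDx|by apply: intgD; exact: iw|].
  move=> y _; rewrite /Dx /w !normcM normcJ' !normcR (ger0_norm (U0 x)) (ger0_norm (UF0 x y)).
  set F := fejer N x y.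
  have -> : U x * (U y * (F * `|f1 x - f1 y|)) + U x * (U y * (F * `|f2 x - f2 y|)) =
    U x * ((`|f1 x - f1 y| + `|f2 x - f2 y|) * (U y * F)) by ring.
  rewrite ler_wpM2l// ler_wpM2r//; first exact: UF0.
  by rewrite (le_trans (normc_le_ReIm _))// cReD cImD cReN cImN.
have l1 := fdefect_small mf1 f1B; have l2 := fdefect_small mf2 f2B.
have [s|s|s] : [\/ S = (fine S)%:E, S = +oo%E | S = -oo%E] by case: (S) => [s| |]; [apply: Or31|apply: Or32|apply: Or33].
- rewrite s lee_fin.
  apply/ler_addgt0Pr => e e0.
  (* Two defects, each multiplied by [B]; [B + 1] avoids dividing by 0 when [B = 0]. *)
  have e2 : 0 < e / (2 * (B + 1)) by rewrite divr_gt0// mulr_gt0// ltr_wpDl.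
  have small (A1 A2 : R) : A1 <= e / (2 * (B + 1)) -> A2 <= e / (2 * (B + 1)) ->
      B * (A1 + A2) <= e.
    move=> h1 h2; apply: (@le_trans _ _ (B * (e / (2 * (B + 1)) + e / (2 * (B + 1))))).
      by apply: ler_wpM2l => //; exact: lerD.
    have B1 : B + 1 != 0 by rewrite gt_eqF// ltr_wpDl.
    have -> : B * (e / (2 * (B + 1)) + e / (2 * (B + 1))) = e * (B / (B + 1)).
      by field; exact: B1.
    by rewrite ger_pMr// ler_pdivrMr ?mul1r ?lerDl// ltr_wpDl.
  have [n1 h1] := l1 _ e2; have [n2 h2] := l2 _ e2.
  pose N := maxn n1 n2.
  have k1 := h1 N (leq_maxl _ _); have k2 := h2 N (leq_maxr _ _).
  rewrite -(ifin _ _ mf1 f1B) lee_fin in k1; rewrite -(ifin _ _ mf2 f2B) lee_fin in k2.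
  apply: le_trans (key N) _; apply: lerD; last exact: small.
  by have := SN_le N; rewrite -/S s lee_fin.
- by rewrite s leey.
- have : (0 <= S)%E by apply: esum_ge0 => k _; rewrite lee_fin sqr_ge0.
  by rewrite s.
Qed.

Lemma parseval1_open : (\esum_(k in [set: int]) (normc (fcoef P k) ^+ 2)%:E =
  (\int[mu]_x normc (P x) ^+ 2)%:E)%E.
Proof.
apply/eqP; rewrite eq_le parseval1_lower andbT.
apply: esum_le_fin => r ur _; rewrite sumEFin lee_fin.
exact: bessel1 mP PB _ ur.
Qed.

End lower.
End parseval1.

Section parseval1_halfopen.
Context {R : realType}.
Local Notation mu := (@lebesgue_measure R).

Lemma cint_ae_point (f g : R -> R[i]) (a : R) :
  cmeas (f : measurableTypeR R -> R[i]) -> cmeas (g : measurableTypeR R -> R[i]) ->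
  (forall x, x != a -> f x = g x) -> cint mu f = cint mu g.
Proof.
move=> [mf1 mf2] [mg1 mg2] fg.
have h (u v : R -> R) : measurable_fun setT u -> measurable_fun setT v ->
    (forall x, x != a -> u x = v x) -> \int[mu]_x u x = \int[mu]_x v x.
  move=> mu' mv uv; rewrite /Rintegral; congr fine; apply: ae_eq_integral => //.
  - exact/measurable_EFinP.
  - exact/measurable_EFinP.
  exists [set a]; split => //; first exact: lebesgue_measure_set1.
  move=> x /= hx; apply/eqP; apply: contra_notT hx => xa _; rewrite uv//.
by apply: complexP; apply: h => // x /fg ->.
Qed.

(** The point 0 has measure zero, so the identity on []0, 1[] carries over to the half-open
    interval, whose translates tile the line. *)
Lemma parseval1 (P : R -> R[i]) (B : R) :
  cmeas (P : measurableTypeR R -> R[i]) -> (forall x, normc (P x) <= B) ->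
  (forall x, ~~ (0 <= x < 1) -> P x = 0) ->
  (\esum_(k in [set: int]) (normc (cint mu (fun x => P x * cj (ek k x))) ^+ 2)%:E =
  (\int[mu]_x normc (P x) ^+ 2)%:E)%E.
Proof.
move=> mP PB P0; pose U : R -> R := \1_(`]0, 1[).
have mU : measurable_fun setT U by exact: measurable_indic.
pose Q x := (U x)%:C * P x.
have mQ : cmeas (Q : measurableTypeR R -> R[i]) by apply: cmeasM => //; exact: cmeas_real.
have QP x : x != 0 -> Q x = P x.
  move=> x0; rewrite /Q /U indicE; case: (boolP (x \in _)) => [_|]; first by rewrite mul1r.
  rewrite notin_setE/= in_itv/= => /negP h; rewrite mul0r P0// lt_def.
  by move: h; rewrite !lt_def x0/=.
have QB x : normc (Q x) <= B * U x.
  rewrite normcM normcR mulrC ger0_norm; last by rewrite /U indicE.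
  by rewrite ler_wpM2r// /U indicE.
have mPe k : cmeas (fun x : measurableTypeR R => P x * cj (ek k x)).
  by apply: cmeasM => //; apply: cmeasJ; exact: cmeas_ek.
have mQe k : cmeas (fun x : measurableTypeR R => Q x * cj (ek k x)).
  by apply: cmeasM => //; apply: cmeasJ; exact: cmeas_ek.
have := parseval1_open mQ QB.
have -> : \int[mu]_x normc (Q x) ^+ 2 = \int[mu]_x normc (P x) ^+ 2.
  apply: (@complexI R); rewrite -!cint_real; apply: (@cint_ae_point _ _ 0).
  - by apply: cmeas_real; exact: cmeas_normc2.
  - by apply: cmeas_real; exact: cmeas_normc2.
  - by move=> x /QP ->.
move=> <-; apply: eq_esum => k _; congr ((normc _ ^+ 2)%:E).
by apply: (@cint_ae_point _ _ 0) => // x /QP ->.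
Qed.

End parseval1_halfopen.

(** * Plancherel's identity and sampling in dimension n *)

Section integrals_cV.
Context {R : realType}.
Local Notation mu := (@lebesgue_measure R).
Local Notation leb n := (lebesgue_cV R n).

Lemma Rint_cV_prod n (f : 'cV[R]_n.+1 -> R) : measurable_fun setT f ->
  \int[leb n.+1]_x f x = \int[(mu \x leb n)%E]_p f (cons_cV p).
Proof.
move=> mf; have mf' : measurable_fun setT (EFin \o f) by exact/measurable_EFinP.
rewrite /Rintegral; congr fine; rewrite integralE [RHS]integralE.
rewrite (ge0_integral_cV_prod (measurable_funepos mf'))//.
rewrite (ge0_integral_cV_prod (measurable_funeneg mf'))//.
by congr (_ - _)%E; apply: eq_integral => p _; rewrite ?funeposE ?funenegE.
Qed.

Lemma cint_cV_prod n (f : 'cV[R]_n.+1 -> R[i]) : cmeas f ->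
  cint (leb n.+1) f = cint (mu \x leb n)%E (fun p => f (cons_cV p)).
Proof. by move=> [mf1 mf2]; apply: complexP; rewrite /= Rint_cV_prod. Qed.

Lemma cint_cV0 (f : 'cV[R]_0 -> R[i]) : cmeas f -> cint (leb 0) f = f 0.
Proof.
move=> [mf1 mf2]; apply: complexP; rewrite /cint /= /Rintegral.
  by rewrite integral_dirac ?diracT ?mul1e//; exact/measurable_EFinP.
by rewrite integral_dirac ?diracT ?mul1e//; exact/measurable_EFinP.
Qed.

Lemma Rint_affine n (D : 'M[R]_n) (b : 'cV[R]_n) (g : 'cV[R]_n -> R) :
  D \in unitmx -> measurable_fun setT g -> intg (leb n) g ->
  `|\det D| * \int[leb n]_x g (D *m x + b) = \int[leb n]_x g x.
Proof.
move=> uD mg ig.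
have detD : \det D != 0 by move: uD; rewrite unitmxE unitfE.
have mg' : measurable_fun setT (EFin \o g) by exact/measurable_EFinP.
have mgD : measurable_fun setT (fun x => g (D *m x + b)).
  exact: (measurableT_comp mg (measurable_affine_cV _ _)).
have igD : intg (leb n) (fun x => g (D *m x + b)).
  apply/integrableP; split; first exact/measurable_EFinP.
  have /integrableP[_] := ig.
  rewrite -(ge0_integral_affine b uD)//; last by apply: measurableT_comp.
  move=> h; rewrite ltey; apply/eqP => h3; move: h; rewrite h3 gt0_muley//.
  by rewrite lte_fin normr_gt0.
apply: EFin_inj; rewrite EFinM RintegralE// RintegralE// [RHS]integralE [in LHS]integralE.
rewrite -(ge0_integral_affine b uD (measurable_funepos mg'))//.
rewrite -(ge0_integral_affine b uD (measurable_funeneg mg'))//.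
rewrite -muleBr; [|by []|].
  congr (_ * (_ - _))%E.
    by apply: eq_integral => s _; rewrite !funeposE.
  by apply: eq_integral => s _; rewrite !funenegE.
have -> : (\int[leb n]_x (EFin \o g)^\- (D *m x + b)%R =
    \int[leb n]_x (EFin \o (fun x => g (D *m x + b)%R))^\- x)%E.
  by apply: eq_integral => s _; rewrite !funenegE.
rewrite fin_num_adde_defl// fin_numN; exact: (integrable_neg_fin_num measurableT igD).
Qed.

Lemma cint_affine n (D : 'M[R]_n) (b : 'cV[R]_n) (g : 'cV[R]_n -> R[i]) :
  D \in unitmx -> cL1 (leb n) g ->
  (`|\det D|)%:C * cint (leb n) (fun x => g (D *m x + b)) = cint (leb n) g.
Proof.
move=> uD ig; have [[mg1 mg2] _] := ig.
apply: complexP; rewrite ?cReM ?cImM /= mul0r ?subr0 ?addr0.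
  by rewrite (Rint_affine b uD mg1)//; exact: cL1_Re ig.
by rewrite (Rint_affine b uD mg2)//; exact: cL1_Im ig.
Qed.

Lemma cint_translate n (b : 'cV[R]_n) (g : 'cV[R]_n -> R[i]) : cL1 (leb n) g ->
  cint (leb n) (fun x => g (x + b)) = cint (leb n) g.
Proof.
move=> ig; rewrite -(cint_affine b (unitmx1 R n) ig) det1 normr1 mul1r.
by apply: eq_cint => x; rewrite mul1mx.
Qed.

Lemma measurable_dotp n (xi : 'cV[R]_n) :
  measurable_fun setT (fun x : 'cV[R]_n => dotp xi x).
Proof.
apply: measurable_sum => i; apply: measurable_funM => //; exact: measurable_coord.
Qed.

Lemma measurable_dotp2 n :
  measurable_fun setT (fun p : 'cV[R]_n * 'cV[R]_n => dotp p.1 p.2).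
Proof.
apply: measurable_sum => i; apply: measurable_funM => //.
  by apply: (measurableT_comp (@measurable_coord _ R n i)); exact: measurable_fst.
by apply: (measurableT_comp (@measurable_coord _ R n i)); exact: measurable_snd.
Qed.

Lemma dotpD n (a x y : 'cV[R]_n) : dotp a (x + y) = dotp a x + dotp a y.
Proof. by rewrite /dotp -big_split; apply: eq_bigr => i _; rewrite mxE mulrDr. Qed.

Lemma dotpDl n (a b x : 'cV[R]_n) : dotp (a + b) x = dotp a x + dotp b x.
Proof. by rewrite /dotp -big_split; apply: eq_bigr => i _; rewrite mxE mulrDl. Qed.

Lemma dotpC n (a x : 'cV[R]_n) : dotp a x = dotp x a.
Proof. by apply: eq_bigr => i _; rewrite mulrC. Qed.

Lemma dotp_mul n (a x : 'cV[R]_n) (D : 'M[R]_n) : dotp a (D *m x) = dotp (D^T *m a) x.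
Proof.
rewrite /dotp; under eq_bigr do rewrite mxE mulr_sumr.
rewrite exchange_big; apply: eq_bigr => i _; rewrite mxE mulr_suml.
by apply: eq_bigr => j _; rewrite mxE; ring.
Qed.

Lemma dotp_cons n (s a : R) (k y : 'cV[R]_n) :
  dotp (cons_cV (s, k)) (cons_cV (a, y)) = s * a + dotp k y.
Proof.
rewrite /dotp big_ord_recl; congr (_ + _).
  by rewrite /cons_cV !mxE unlift_none.
by apply: eq_bigr => i _; rewrite /cons_cV !mxE liftK.
Qed.

Definition ekd n (k : 'cV[int]_n) (x : 'cV[R]_n) : R[i] := expi (2 * pi * dotp (of_Zd k) x).

Lemma normc_ekd n (k : 'cV[int]_n) x : normc (ekd k x) = 1. Proof. exact: normc_expi. Qed.

Lemma cmeas_ekd n (k : 'cV[int]_n) : cmeas (ekd k).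
Proof. by apply: cmeas_expi; apply: measurable_funM => //; exact: measurable_dotp. Qed.

Lemma ekd_periodic n (k m : 'cV[int]_n) (x : 'cV[R]_n) : ekd k (x + of_Zd m) = ekd k x.
Proof.
rewrite /ekd dotpD mulrDr.
have -> : dotp (of_Zd k) (of_Zd m) = (\sum_i k i ord0 * m i ord0)%:~R :> R.
  by rewrite rmorph_sum; apply: eq_bigr => i _; rewrite rmorphM /= !mxE.
exact: expi_2piz.
Qed.

Definition consZ n (p : int * 'cV[int]_n) : 'cV[int]_n.+1 :=
  \col_i if unlift ord0 i is Some j then p.2 j ord0 else p.1.

Lemma of_Zd_cons n (p : int * 'cV[int]_n) :
  of_Zd (consZ p) = cons_cV (p.1%:~R, of_Zd p.2) :> 'cV[R]_n.+1.
Proof.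
apply/matrixP => i j; rewrite /cons_cV !mxE.
by case: unliftP => [l _|_] /=; rewrite ?mxE.
Qed.

Lemma consZ_bij n : set_bij [set: int * 'cV[int]_n] [set: 'cV[int]_n.+1] (@consZ n).
Proof.
split => //.
- move=> [a x] [b y] _ _ /matrixP h; congr (_, _).
    by have := h ord0 ord0; rewrite !mxE unlift_none.
  apply/matrixP => i j; have := h (lift ord0 i) ord0.
  by rewrite !mxE liftK (ord1 j).
- move=> x _; exists (x ord0 ord0, \col_i x (lift ord0 i) ord0) => //.
  apply/matrixP => i j; rewrite mxE (ord1 j).
  by case: unliftP => [l ->|->] /=; rewrite ?mxE.
Qed.

Lemma intg_unit_cube n : intg (leb n) (\1_(@unit_cube R n)).
Proof.
apply: intg_ge0_lty => //; first by apply: measurable_indic; exact: measurable_unit_cube.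
rewrite integral_indic//; last exact: measurable_unit_cube.
rewrite setIT; have := lebesgue_unit_cube (R := R) n; move=> /= ->; exact: ltry.
Qed.

Lemma Rint_unit_cube n : \int[leb n]_x \1_(@unit_cube R n) x = 1.
Proof.
rewrite /Rintegral integral_indic//; last exact: measurable_unit_cube.
rewrite setIT; exact: (congr1 fine (lebesgue_unit_cube n)).
Qed.

Lemma unit_cube_cons n (a : R) (y : 'cV[R]_n) :
  @unit_cube R n.+1 (cons_cV (a, y)) <-> 0 <= a < 1 /\ unit_cube y.
Proof.
split=> [h|[ha hy] i].
  split; first by have := h ord0; rewrite mxE unlift_none.
  by move=> i; have := h (lift ord0 i); rewrite mxE liftK.
by rewrite mxE; case: unliftP => [j _|_].
Qed.

Lemma dominated_cube n (P : 'cV[R]_n -> R[i]) (B : R) :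
  (forall x, normc (P x) <= B) -> (forall x, ~ unit_cube x -> P x = 0) ->
  forall x, normc (P x) <= B * \1_(@unit_cube R n) x.
Proof.
move=> PB P0 x; rewrite indicE; case: (boolP (x \in _)) => [_|].
  by rewrite mulr1.
by rewrite notin_setE => /P0 ->; rewrite normc0 mulr0.
Qed.

(** Induction on the dimension: Parseval in the first variable for each fixed [y], then in the
    others for each partial coefficient [C k]. Fubini identifies the coefficients of [C k] with
    those of [P] at the indices [consZ]. *)
Lemma parsevald n (P : 'cV[R]_n -> R[i]) (B : R) :
  cmeas P -> (forall x, normc (P x) <= B) -> (forall x, ~ unit_cube x -> P x = 0) ->
  (\esum_(k in [set: 'cV[int]_n]) (normc (cint (leb n) (fun x => P x * cj (ekd k x))) ^+ 2)%:E =
   \int[leb n]_x (normc (P x) ^+ 2)%:E)%E.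
Proof.
elim: n P => [|n IH] P mP PB P0.
  rewrite ge0_integral_cV0; last by apply/measurable_EFinP; exact: cmeas_normc2.
  have -> : [set: 'cV[int]_0] = [set 0].
    by apply/seteqP; split => // x _ /=; apply/matrixP => -[].
  rewrite esum_set1 ?lee_fin ?sqr_ge0// cint_cV0; last first.
    by apply: cmeasM => //; apply: cmeasJ; exact: cmeas_ekd.
  by rewrite normcM normcJ' normc_ekd mulr1.
have B0 : 0 <= B by apply: le_trans (PB 0); exact: normc_ge0.
pose Pc (p : measurableTypeR R * 'cV[R]_n) := P (cons_cV p).
have mPc : cmeas Pc by exact: (cmeas_comp mP (@measurable_cons_cV R n)).
pose I01 : R -> R := \1_(`[0, 1[).
have iI01 : intg mu I01 by exact: integrable_indic_itv.
have I010 a : 0 <= I01 a by rewrite /I01 indicE.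
have cube0 (y : 'cV[R]_n) : 0 <= \1_(@unit_cube R n) y :> R by rewrite indicE.
have Pdom a y : normc (Pc (a, y)) <= (B * I01 a) * \1_(@unit_cube R n) y.
  have := dominated_cube PB P0 (cons_cV (a, y)); rewrite /Pc => /le_trans; apply.
  rewrite -mulrA ler_wpM2l// /I01 !indicE.
  have [|_] := boolP (_ \in _); last by rewrite mulr_ge0.
  rewrite inE => /unit_cube_cons[ha hy].
  by rewrite !mem_set// ?mulr1//= in_itv.
have iB : intg mu (fun a => B * I01 a) by exact: intgZ.
have BI0 a : 0 <= B * I01 a by rewrite mulr_ge0.
have mPk k : cmeas (fun p : measurableTypeR R * 'cV[R]_n => Pc p * cj (ek k p.1)).
  apply: cmeasM => //; apply: cmeasJ.
  by apply: (cmeas_comp (cmeas_ek k)); exact: measurable_fst.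
have Pkdom k a y : normc (Pc (a, y) * cj (ek k a)) <= (B * I01 a) * \1_(@unit_cube R n) y.
  by rewrite normcM normcJ' normc_ek mulr1; exact: Pdom.
pose C k y := cint mu (fun a => Pc (a, y) * cj (ek k a)).
have mC k : cmeas (C k).
  apply: (@cmeas_cint_param _ _ _ _ _ mu (fun p : 'cV[R]_n * measurableTypeR R => Pc (p.2, p.1) * cj (ek k p.2))).
  apply: (cmeas_comp (mPk k) (p := fun p : 'cV[R]_n * measurableTypeR R => (p.2, p.1))).
  exact: measurable_swap.
have mPy y : cmeas (fun a : measurableTypeR R => Pc (a, y)).
  exact: (cmeas_comp mPc (@pair2_measurable _ _ _ _ y)).
have CB k y : normc (C k y) <= B * \1_(@unit_cube R n) y.
  apply: (le_trans (@normc_cint_le _ _ _ mu _ (fun a => (B * \1_(@unit_cube R n) y) * I01 a) _ _ _)).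
  - exact: (cmeas_comp (mPk k) (@pair2_measurable _ _ _ _ y)).
  - by move=> a; apply: le_trans (Pkdom k a y) _; rewrite mulrAC.
  - exact: intgZ.
  rewrite RintegralZl// -[leRHS]mulr1 ler_wpM2l ?mulr_ge0//.
  have := @lebesgue_measure_itv R `[0, 1[; rewrite /= lte_fin ltr01 oppr0 adde0 => h.
  by rewrite /Rintegral integral_indic// setIT; move: h => /= ->.
have CB' k y : normc (C k y) <= B.
  by apply: le_trans (CB k y) _; rewrite indicE; case: (_ \in _); rewrite ?mulr1 ?mulr0.
have C0 k y : ~ unit_cube y -> C k y = 0.
  move=> hy; have := CB k y; rewrite indicE memNset// mulr0 => h.
  by apply: eq0_normc; apply/eqP; rewrite eq_le h normc_ge0.
rewrite ge0_integral_cVr//; last 2 first.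
- by apply/measurable_EFinP; exact: cmeas_normc2.
- by move=> x; rewrite lee_fin sqr_ge0.
transitivity (\int[leb n]_y \esum_(k in [set: int]) (normc (C k y) ^+ 2)%:E)%E; last first.
  apply: eq_integral => y _; rewrite (parseval1 (B := B) (mPy y)).
  - rewrite RintegralE//; apply: (@intg_le _ _ _ mu _ (fun a => B ^+ 2 * I01 a)).
    + exact: cmeas_normc2.
    + move=> a; rewrite ger0_norm ?sqr_ge0//.
      have := Pdom a y; rewrite /I01 indicE; case: (_ \in _); last first.
        rewrite !mulr0 mul0r => h; have -> : normc (Pc (a, y)) = 0.
          by apply/eqP; rewrite eq_le h normc_ge0.
        by rewrite expr0n.
      by move=> _; rewrite mulr1 ler_sqr ?nnegrE ?normc_ge0//; exact: PB.
    + exact: intgZ.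
  - by move=> a; exact: PB.
  - move=> a ha; apply: P0 => /unit_cube_cons[h _]; by rewrite h in ha.
rewrite integral_esum//; last 2 first.
- by move=> k; apply/measurable_EFinP; exact: cmeas_normc2.
- by move=> k y; rewrite lee_fin sqr_ge0.
transitivity (\esum_(k in [set: int]) \esum_(k' in [set: 'cV[int]_n])
    (normc (cint (leb n) (fun x => C k x * cj (ekd k' x))) ^+ 2)%:E)%E; last first.
  by apply: eq_esum => k _; exact: (IH _ (mC k) (CB' k) (C0 k)).
rewrite esum_esum; last by move=> *; rewrite lee_fin sqr_ge0.
rewrite (_ : _ `*`` _ = [set: int * 'cV[int]_n]); last first.
  by apply/seteqP; split => // x.
rewrite (reindex_esum _ _ _ _ (consZ_bij n)); apply: eq_esum => -[k0 k'] _.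
apply: (congr1 (fun z => (normc z ^+ 2)%:E)).
have mPe : cmeas (fun p : measurableTypeR R * 'cV[R]_n => Pc p * cj (ek k0 p.1) * cj (ekd k' p.2)).
  apply: cmeasM => //; apply: cmeasJ.
  by apply: (cmeas_comp (cmeas_ekd k')); exact: measurable_snd.
rewrite cint_cV_prod; last by apply: cmeasM => //; apply: cmeasJ; exact: cmeas_ekd.
transitivity (cint (mu \x leb n)%E (fun p => Pc p * cj (ek k0 p.1) * cj (ekd k' p.2))).
  apply: eq_cint => -[a y]; rewrite /Pc -mulrA -cconjM; congr (_ * cj _).
  by rewrite /ekd of_Zd_cons dotp_cons mulrDr expiD.
have [|_ ->] := cint_fubini mPe _ BI0 cube0 iB (intg_unit_cube n).
  by move=> a y; rewrite normcM normcJ' normc_ekd mulr1; exact: Pkdom.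
apply: eq_cint => y; rewrite /C /= cintZr//.
apply: (@cL1_le _ _ _ mu _ (fun a => (B * \1_(@unit_cube R n) y) * I01 a)).
- exact: (cmeas_comp (mPk k0) (@pair2_measurable _ _ _ _ y)).
- by move=> a; apply: le_trans (Pkdom k0 a y) _; rewrite mulrAC.
- exact: intgZ.
Qed.

Definition ft n (f : 'cV[R]_n -> R[i]) (xi : 'cV[R]_n) : R[i] :=
  cint (leb n) (fun x => f x * expi (- (2 * pi * dotp xi x))).

Lemma cmeas_ft n (f : 'cV[R]_n -> R[i]) : cmeas f -> cmeas (ft f).
Proof.
move=> mf; apply: (@cmeas_cint_param _ _ _ _ _ (leb n) (fun p : 'cV[R]_n * 'cV[R]_n => f p.2 * expi (- (2 * pi * dotp p.1 p.2)))).
apply: cmeasM; first exact: (cmeas_comp mf measurable_snd).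
apply: cmeas_expi; apply: measurableT_comp => //; apply: measurable_funM => //.
exact: measurable_dotp2.
Qed.

(** For fixed [xi] the values of the transform at [xi + m] are the Fourier coefficients of [g]
    modulated by [xi]. By Parseval their squares sum to the energy of [g], whatever [xi], and it
    remains to integrate [xi] over the unit cube. *)
Lemma plancherel_cube n (g : 'cV[R]_n -> R[i]) (B : R) :
  cmeas g -> (forall x, normc (g x) <= B) -> (forall x, ~ unit_cube x -> g x = 0) ->
  (\int[leb n]_xi (normc (ft g xi) ^+ 2)%:E = \int[leb n]_x (normc (g x) ^+ 2)%:E)%E.
Proof.
move=> mg gB g0.
have ig : cL1 (leb n) g.
  apply: (cL1_le mg (dominated_cube gB g0)); apply: intgZ; exact: intg_unit_cube.
have mft := cmeas_ft mg.
rewrite (ge0_integral_cubes (g := fun xi => (normc (ft g xi) ^+ 2)%:E)); last 2 first.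
- by apply/measurable_EFinP; exact: cmeas_normc2.
- by move=> x; rewrite lee_fin sqr_ge0.
have me xi : cmeas (fun x : 'cV[R]_n => expi (- (2 * pi * dotp xi x))).
  apply: cmeas_expi; apply: measurableT_comp => //; apply: measurable_funM => //.
  exact: measurable_dotp.
transitivity (\int[leb n]_xi ((\1_(@unit_cube R n) xi)%:E *
    \int[leb n]_x (normc (g x) ^+ 2)%:E))%E.
  apply: eq_integral => xi _.
  rewrite esumZl//; last by move=> m; rewrite lee_fin sqr_ge0.
  congr (_ * _)%E.
  rewrite (_ : (\int[leb n]_x _)%E =
    (\int[leb n]_x (normc (g x * expi (- (2 * pi * dotp xi x))) ^+ 2)%:E)%E); last first.
    by apply: eq_integral => x _; rewrite normcM normc_expi mulr1.
  rewrite -(parsevald (B := B)).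
  - apply: eq_esum => m _; congr ((normc _ ^+ 2)%:E); apply: eq_cint => x.
    by rewrite dotpDl mulrDr opprD expiD mulrA -expiN /ekd.
  - exact: cmeasM.
  - by move=> x; rewrite normcM normc_expi mulr1.
  - by move=> x /g0 ->; rewrite mul0r.
rewrite ge0_integralZr//; last 2 first.
- by apply/measurable_EFinP; apply: measurable_indic; exact: measurable_unit_cube.
- by apply: integral_ge0 => x _; rewrite lee_fin sqr_ge0.
by rewrite -RintegralE ?Rint_unit_cube ?mul1e//; exact: intg_unit_cube.
Qed.

Lemma cL1_bounded_support n (f : 'cV[R]_n -> R[i]) (B L : R) :
  cmeas f -> (forall x, normc (f x) <= B) ->
  (forall x : 'cV[R]_n, ~ (forall i, - L <= x i ord0 < L) -> f x = 0) -> cL1 (leb n) f.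
Proof.
move=> mf fB f0; pose A : set 'cV[R]_n := [set x | forall i, `[- L, L[%classic (x i ord0)].
have mA : measurable A by apply: (measurable_box (A := fun=> `[- L, L[%classic)).
have iA : intg (leb n) (\1_A).
  apply: intg_ge0_lty => //.
  rewrite integral_indic// setIT.
  have AE : leb n A = (\prod_(i < n) (@lebesgue_measure R (`[(- L)%R, L%R[%classic)))%E.
    exact: (lebesgue_cV_box (A := fun=> `[- L, L[%classic)).
  apply: (eq_ind_r (fun z => (z < +oo)%E) _ AE); clear.
  elim: (n) => [|k IH]; first by rewrite big_ord0 ltry.
  rewrite big_ord_recl lte_mul_pinfty//.
  rewrite lebesgue_measure_itv; case: ifP => _ //.
apply: (cL1_le mf (g := fun x => B * \1_A x)); last exact: intgZ.
move=> x; rewrite indicE; case: (boolP (x \in A)) => [_|]; first by rewrite mulr1.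
rewrite notin_setE => h; rewrite f0 ?normc0 ?mulr0// => h'; exact: h.
Qed.

(** The box is mapped affinely onto the unit cube, and both integrals acquire the same factor
    [(2 * L) ^+ n]. *)
Lemma plancherel n (f : 'cV[R]_n -> R[i]) (B L : R) : 0 < L ->
  cmeas f -> (forall x, normc (f x) <= B) ->
  (forall x : 'cV[R]_n, ~ (forall i, - L <= x i ord0 < L) -> f x = 0) ->
  (\int[leb n]_xi (normc (ft f xi) ^+ 2)%:E = \int[leb n]_x (normc (f x) ^+ 2)%:E)%E.
Proof.
move=> L0 mf fB f0.
have intf := cL1_bounded_support mf fB f0.
pose D : 'M[R]_n := (2 * L)%:M; pose b : 'cV[R]_n := - const_mx L.
have L2 : 0 < 2 * L by rewrite mulr_gt0.
have uD : D \in unitmx by rewrite unitmxE det_scalar unitrX// unitfE gt_eqF.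
have detD : `|\det D| = (2 * L) ^+ n by rewrite det_scalar gtr0_norm// exprn_gt0.
pose g y := f (D *m y + b).
have mD : measurable_fun setT (fun y : 'cV[R]_n => D *m y + b) by exact: measurable_affine_cV.
have mg : cmeas g by exact: (cmeas_comp mf mD).
have gB y : normc (g y) <= B by exact: fB.
have DE y i : (D *m y + b) i ord0 = 2 * L * y i ord0 - L.
  by rewrite mxE mul_scalar_mx !mxE.
have g0 y : ~ unit_cube y -> g y = 0.
  move=> hy; apply: f0 => h; apply: hy => i; have := h i; rewrite DE => /andP[h1 h2].
  by apply/andP; split; nra.
have ig : cL1 (leb n) g.
  apply: (cL1_le mg (dominated_cube gB g0)); apply: intgZ; exact: intg_unit_cube.
have ftf xi : normc (ft f xi) = (2 * L) ^+ n * normc (ft g (D *m xi + 0)).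
  have mfe : cL1 (leb n) (fun x => f x * expi (- (2 * pi * dotp xi x))).
    apply: (cL1_le_c _ _ intf); last by move=> x; rewrite normcM normc_expi mulr1.
    apply: cmeasM => //; apply: cmeas_expi; apply: measurableT_comp => //.
    by apply: measurable_funM => //; exact: measurable_dotp.
  rewrite /ft -(cint_affine b uD mfe) detD normcM normcR ger0_norm ?exprn_ge0 ?ltW//.
  congr (_ * _).
  transitivity (normc (expi (- (2 * pi * dotp xi b)) *
     cint (leb n) (fun y => g y * expi (- (2 * pi * dotp (D *m xi + 0) y))))).
    rewrite -cintZ//; last first.
      apply: (cL1_le_c _ _ ig); last by move=> x; rewrite normcM normc_expi mulr1.
      apply: cmeasM => //; apply: cmeas_expi; apply: measurableT_comp => //.
      by apply: measurable_funM => //; exact: measurable_dotp.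
    congr normc; apply: eq_cint => y; rewrite dotpD dotp_mul tr_scalar_mx addr0.
    by rewrite -/(g y) mulrDr opprD expiD; ring.
  by rewrite normcM normc_expi mul1r.
have mftg := cmeas_ft mg.
have mG : measurable_fun setT (fun xi => (normc (ft g xi) ^+ 2)%:E).
  by apply/measurable_EFinP; exact: cmeas_normc2.
have mGf : measurable_fun setT (fun xi => (normc (f xi) ^+ 2)%:E).
  by apply/measurable_EFinP; exact: cmeas_normc2.
have sq0 (z : R[i]) : (0 <= (normc z ^+ 2)%:E)%E by rewrite lee_fin sqr_ge0.
rewrite -(ge0_integral_affine b uD mGf)// detD -(plancherel_cube mg gB g0).
rewrite -(ge0_integral_affine 0 uD mG)// detD.
rewrite -!ge0_integralZl ?lee_fin ?exprn_ge0 ?ltW//; last 2 first.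
- by move=> x _; rewrite mule_ge0// lee_fin exprn_ge0 ?ltW.
- by apply: (measurableT_comp mG); exact: measurable_affine_cV.
- by apply: eq_integral => xi _; rewrite ftf exprMn expr2 -!EFinM mulrA.
- by apply: measurable_funeM; apply: (measurableT_comp mG); exact: measurable_affine_cV.
Qed.

(** Nested finite lists exhausting the lattice, which turn lattice sums of complex numbers into
    limits of sequences; [pmap] skips the codes of no lattice point. *)
Definition first_Zd n N : seq 'cV[int]_n := pmap pickle_inv (iota 0 N).

Lemma first_Zd_uniq n N : uniq (first_Zd n N).
Proof. by apply: (pmap_uniq (@pickle_invK _)); exact: iota_uniq. Qed.

Lemma first_ZdS n N :
  first_Zd n N.+1 = first_Zd n N ++ pmap pickle_inv [:: N].
Proof. by rewrite /first_Zd -[N.+1]addn1 iotaD pmap_cat. Qed.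

Lemma mem_first_Zd n N (m : 'cV[int]_n) : (pickle m < N)%N -> m \in first_Zd n N.
Proof.
move=> h; rewrite /first_Zd mem_pmap; apply/mapP; exists (pickle m).
  by rewrite mem_iota.
by rewrite pickleK_inv.
Qed.

Lemma first_Zd_sub n (r : seq 'cV[int]_n) :
  exists N0, forall N, (N0 <= N)%N -> {subset r <= first_Zd n N}.
Proof.
exists (\sum_(m <- r) (pickle m).+1)%N => N hN m mr; apply: mem_first_Zd.
apply: leq_trans hN; rewrite (big_rem _ mr) /=; exact: leq_addr.
Qed.

Lemma sqnorm_sum_dev (I : eqType) (r : seq I) (z : I -> R[i]) : uniq r ->
  `|normc (\sum_(i <- r) z i) ^+ 2 - \sum_(i <- r) normc (z i) ^+ 2| <=
  \sum_(i <- r) \sum_(j <- r | j != i) normc (z i) * normc (z j).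
Proof.
move=> ur; rewrite -cReMJ cconj_sum mulr_suml cRe_sum -sumrB.
apply: le_trans (ler_norm_sum _ _ _) _; rewrite big_seq [leRHS]big_seq.
apply: ler_sum => i ir; rewrite mulr_sumr cRe_sum (bigD1_seq i)//= cReMJ addrAC subrr add0r.
apply: le_trans (ler_norm_sum _ _ _) _; apply: ler_sum => j _.
by apply: le_trans (normr_Re _) _; rewrite normcM normcJ'.
Qed.

(** Schur test: in the cross terms, [g i * g j] is at most half of [g i ^+ 2 + g j ^+ 2], and the
    kernel [w i * w j] is symmetric, so each [g i ^+ 2] is charged with one full row sum, bounded by
    [E i]. *)
Lemma sqnorm_sum_weight (I : eqType) (r : seq I) (z : I -> R[i]) (g w E : I -> R) :
  uniq r -> (forall i, 0 <= g i) -> (forall i, 0 <= w i) ->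
  (forall i, normc (z i) <= g i * w i) ->
  (forall i, i \in r -> w i * \sum_(j <- r | j != i) w j <= E i) ->
  `|normc (\sum_(i <- r) z i) ^+ 2 - \sum_(i <- r) normc (z i) ^+ 2| <=
  \sum_(i <- r) g i ^+ 2 * E i.
Proof.
move=> ur g0 w0 zgw wE; apply: le_trans (sqnorm_sum_dev _ ur) _.
pose S1 := \sum_(i <- r) \sum_(j <- r | j != i) (g i ^+ 2 * (w i * w j) / 2).
apply: (@le_trans _ _ (S1 + S1)).
  rewrite {2}/S1 [X in _ <= _ + X](exchange_big_dep predT)//= -big_split; apply: ler_sum => i _ /=.
  rewrite [X in _ <= _ + X](eq_bigl (fun j => j != i)); last by move=> j; rewrite eq_sym.
  rewrite -big_split; apply: ler_sum => j _ /=.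
  apply: le_trans (ler_pM _ _ (zgw i) (zgw j)) _; rewrite ?normc_ge0//.
  have wij : 0 <= w i * w j by rewrite mulr_ge0.
  have h : g i * g j <= g i ^+ 2 / 2 + g j ^+ 2 / 2.
    by have := sqr_ge0 (g i - g j); nra.
  have -> : g i * w i * (g j * w j) = (g i * g j) * (w i * w j) by ring.
  by apply: le_trans (ler_wpM2r wij h) _; rewrite le_eqVlt; apply/orP; left; apply/eqP; field.
have -> : S1 + S1 = \sum_(i <- r) g i ^+ 2 * (w i * \sum_(j <- r | j != i) w j).
  rewrite /S1 -big_split; apply: eq_bigr => i _ /=.
  rewrite -big_split mulr_sumr mulr_sumr; apply: eq_bigr => j _ /=.
  by field.
rewrite big_seq [leRHS]big_seq; apply: ler_sum => i ir.
by rewrite ler_wpM2l ?sqr_ge0// wE.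
Qed.

Lemma ccvg_near_cst (u : nat -> R[i]) (l : R[i]) N0 :
  (forall N, (N0 <= N)%N -> u N = l) -> ccvg u l.
Proof.
move=> h; split; apply: cvg_near_cst; exists N0 => // N /= /h -> //.
Qed.

Lemma big_first_Zd n N (V : nmodType) (u : 'cV[int]_n -> V) :
  \sum_(m <- first_Zd n N) u m = \sum_(0 <= k < N) oapp u 0 (pickle_inv k : option 'cV[int]_n).
Proof.
elim: N => [|N IH]; first by rewrite big_nil big_geq.
rewrite first_ZdS big_cat big_nat_recr//= IH; congr (_ + _).
by case: pickle_inv => [m|] /=; rewrite ?big_cons big_nil ?addr0.
Qed.

Lemma cvg_first_Zd n (u : 'cV[int]_n -> R) (M : R) :
  (forall r, uniq r -> \sum_(m <- r) `|u m| <= M) ->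
  cvgn (fun N => \sum_(m <- first_Zd n N) u m).
Proof.
move=> uM; pose v k := oapp u 0 (pickle_inv k : option 'cV[int]_n).
rewrite (_ : (fun N => _) = series v); last by apply/funext => N; rewrite big_first_Zd.
apply: normed_cvg; apply: nondecreasing_is_cvgn.
  by apply: nondecreasing_series => k _ _; exact: normr_ge0.
exists M => _ [N _ <-]; apply: le_trans (uM _ (first_Zd_uniq n N)).
rewrite big_first_Zd /series /=; apply: ler_sum => k _.
by rewrite /v; case: pickle_inv => [m|] //=; rewrite normr0.
Qed.

Lemma ccvg_first_Zd n (z : 'cV[int]_n -> R[i]) (M : R) :
  (forall r, uniq r -> \sum_(m <- r) normc (z m) <= M) ->
  exists l, ccvg (fun N => \sum_(m <- first_Zd n N) z m) l.
Proof.
move=> zM.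
have h1 : cvgn (fun N => \sum_(m <- first_Zd n N) cRe (z m)).
  apply: (@cvg_first_Zd _ _ M) => r ur; apply: le_trans (zM r ur).
  by apply: ler_sum => m _; exact: normr_Re.
have h2 : cvgn (fun N => \sum_(m <- first_Zd n N) cIm (z m)).
  apply: (@cvg_first_Zd _ _ M) => r ur; apply: le_trans (zM r ur).
  by apply: ler_sum => m _; exact: normr_Im.
exists ((lim ((fun N => \sum_(m <- first_Zd n N) cRe (z m)) @ \oo)) +i*
        (lim ((fun N => \sum_(m <- first_Zd n N) cIm (z m)) @ \oo))).
by split; under eq_fun do rewrite ?cRe_sum ?cIm_sum.
Qed.

Lemma unit_cube_shift n (x : 'cV[R]_n) (m : 'cV[int]_n) :
  \1_(@unit_cube R n) (x - of_Zd m) = (m == floor_cV x)%:R :> R.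
Proof.
rewrite indicE; congr (nat_of_bool _)%:R; apply/idP/eqP.
  by rewrite inE => /unit_cube_floor.
by move=> h; rewrite inE; apply/unit_cube_floor.
Qed.

Lemma sum_unit_cube_shift n N (x : 'cV[R]_n) :
  \sum_(m <- first_Zd n N) \1_(@unit_cube R n) (x - of_Zd m) =
  (floor_cV x \in first_Zd n N)%:R :> R.
Proof.
under eq_bigr do rewrite unit_cube_shift.
have ur := first_Zd_uniq n N; have [xr|xr] := boolP (_ \in _).
  rewrite (bigD1_seq _ xr ur)/= eqxx big1 ?addr0// => m /negbTE -> //.
rewrite big_seq big1// => m mr; case: eqP => // h; by rewrite -h mr in xr.
Qed.

(** Cutting space into cubes turns the integral of [|H|] into that of its periodization over one
    cube, where the latter is at most [M]. *)
Lemma cL1_periodized n (H : 'cV[R]_n -> R[i]) (M : R) : cmeas H ->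
  (forall x r, uniq r -> \sum_(m <- r) normc (H (x + of_Zd m)) <= M) -> cL1 (leb n) H.
Proof.
move=> mH HM; have M0 : 0 <= M by apply: le_trans (HM 0 [::] isT); rewrite big_nil.
have mn := cmeas_normc mH.
split => //; apply: intg_ge0_lty => //; first by move=> x; exact: normc_ge0.
rewrite (ge0_integral_cubes (g := fun x => (normc (H x))%:E)); last 2 first.
- exact/measurable_EFinP.
- by move=> x; rewrite lee_fin normc_ge0.
have ic := intgZ M (intg_unit_cube n).
apply: (@le_lt_trans _ _ (\int[leb n]_x (M * \1_(@unit_cube R n) x)%:E)%E); last first.
  by rewrite -RintegralE// ltry.
apply: ge0_le_integral => //.
- by move=> x _; apply: esum_ge0 => m _; rewrite mule_ge0 ?lee_fin ?normc_ge0// indicE.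
- apply: measurable_esum => [m|m x]; last first.
    by rewrite mule_ge0 ?lee_fin ?normc_ge0// indicE.
  apply: emeasurable_funM.
    by apply/measurable_EFinP; apply: measurable_indic; exact: measurable_unit_cube.
  by apply/measurable_EFinP; apply: (measurableT_comp mn); exact: measurable_translate.
- by apply/measurable_EFinP; exact: intg_meas ic.
move=> x _; apply: esum_le_fin => r ur _.
under eq_bigr do rewrite -EFinM.
rewrite sumEFin lee_fin -mulr_sumr mulrC ler_wpM2r ?indicE//; exact: HM.
Qed.

(** * Periodization and sampling with cross terms *)

Section sampling.
Variables (n : nat) (H : 'cV[R]_n -> R[i]) (M : R).
Hypotheses (mH : cmeas H)
  (HM : forall x r, uniq r -> \sum_(m <- r) normc (H (x + of_Zd m)) <= M).
Local Notation cube := (@unit_cube R n).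

Let PN N x : R[i] := (\1_cube x)%:C * \sum_(m <- first_Zd n N) H (x + of_Zd m).

Let HL1 : cL1 (leb n) H. Proof. exact: cL1_periodized mH HM. Qed.

Let M0 : 0 <= M. Proof. by apply: le_trans (HM 0 (isT : uniq [::])); rewrite big_nil. Qed.

Let mHm m : cmeas (fun x : 'cV[R]_n => H (x + of_Zd m)).
Proof. by apply: (cmeas_comp mH); exact: measurable_translate. Qed.

Let mcube : measurable_fun setT (\1_cube : 'cV[R]_n -> R).
Proof. by apply: measurable_indic; exact: measurable_unit_cube. Qed.

Let mPN N : cmeas (PN N).
Proof. by apply: cmeasM; [exact: cmeas_real|apply: cmeas_sum => m _; exact: mHm]. Qed.

Let PN_le N x : normc (PN N x) <= M * \1_cube x.
Proof.
rewrite normcM normcR mulrC ger0_norm ?indicE// ler_wpM2r//.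
by apply: le_trans (normc_sum_le _ _ _) _; apply: HM; exact: first_Zd_uniq.
Qed.

(** Characters with integer frequency are periodic, so shifting each term back unfolds the
    coefficient into one of [H] restricted to finitely many cubes. *)
Let coef_PN N k : cint (leb n) (fun x => PN N x * cj (ekd k x)) =
  cint (leb n) (fun x => ((floor_cV x \in first_Zd n N)%:R)%:C * (H x * cj (ekd k x))).
Proof.
have iG m : cL1 (leb n) (fun x => (\1_cube (x - of_Zd m))%:C * (H x * cj (ekd k x))).
  apply: (cL1_le_c _ _ HL1).
    apply: cmeasM; last by apply: cmeasM => //; apply: cmeasJ; exact: cmeas_ekd.
    by apply: cmeas_real; apply: (measurableT_comp mcube); exact: measurable_translate.
  move=> x; rewrite !normcM normcJ' normc_ekd mulr1 normcR ger0_norm ?indicE//.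
  by rewrite ler_piMl ?normc_ge0// lern1 leq_b1.
transitivity (\sum_(m <- first_Zd n N)
    cint (leb n) (fun x => (\1_cube (x - of_Zd m))%:C * (H x * cj (ekd k x)))).
  transitivity (\sum_(m <- first_Zd n N)
     cint (leb n) (fun x => (\1_cube x)%:C * (H (x + of_Zd m) * cj (ekd k x)))).
    rewrite -cint_sum.
      apply: eq_cint => x; rewrite /PN mulr_sumr mulr_suml.
      by apply: eq_bigr => m _; rewrite mulrA.
    move=> m _; apply: (@cL1_le _ _ _ (leb n) _ (fun x => M * \1_cube x)).
    - apply: cmeasM; first exact: cmeas_real.
      by apply: cmeasM => //; apply: cmeasJ; exact: cmeas_ekd.
    - move=> x; rewrite !normcM normcJ' normc_ekd mulr1 normcR mulrC ger0_norm ?indicE//.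
      rewrite ler_wpM2r//; have := HM x (isT : uniq [:: m]).
      by rewrite big_seq1.
    - apply: intgZ; exact: intg_unit_cube.
  apply: eq_bigr => m _; rewrite -(cint_translate (of_Zd m) (iG m)).
  by apply: eq_cint => x; rewrite addrK ekd_periodic.
rewrite -cint_sum; last by move=> m _; exact: iG.
apply: eq_cint => x; rewrite -mulr_suml; congr (_ * _).
by rewrite -(rmorph_sum (@real_complex R)) sum_unit_cube_shift.
Qed.

(** Both sides of [coef_PN] pass to the limit by dominated convergence, the periodized side under
    [M] on the cube and the unfolded side under [|H|]. *)
Lemma periodization : exists P : 'cV[R]_n -> R[i],
  [/\ forall x, ccvg (PN ^~ x) (P x), cmeas P, (forall x, normc (P x) <= M * \1_cube x) &
   forall k, cint (leb n) (fun x => P x * cj (ekd k x)) = cint (leb n) (fun x => H x * cj (ekd k x))].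
Proof.
have /choice[P PP] : forall x, exists l, ccvg (PN ^~ x) l.
  move=> x; have [l hl] := ccvg_first_Zd (HM x).
  by exists ((\1_cube x)%:C * l); exact: ccvgM.
have mP : cmeas P by exact: (cmeas_cvg mPN PP).
have ic := intgZ M (intg_unit_cube n).
exists P; split => //.
  move=> x; have h0 : 0 <= M * \1_cube x by rewrite mulr_ge0// indicE.
  rewrite -ler_sqr ?nnegrE ?normc_ge0//.
  apply: (ler_cvg_to (ccvg_normc_sqr (PP x)) (cvg_cst _)).
  by apply: nearW => N /=; rewrite ler_sqr ?nnegrE ?normc_ge0.
move=> k; have me : cmeas (fun x : 'cV[R]_n => cj (ekd k x)) by apply: cmeasJ; exact: cmeas_ekd.
apply: (@ccvg_unique _ (fun N => cint (leb n) (fun x => PN N x * cj (ekd k x)))).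
  apply: (cint_dominated (g := fun x => M * \1_cube x)) => //.
  - by move=> N; exact: cmeasM.
  - by move=> x; rewrite mulrC; under eq_fun do rewrite mulrC; exact: ccvgM.
  - by move=> N x; rewrite normcM normcJ' normc_ekd mulr1.
under eq_fun do rewrite coef_PN.
apply: (cint_dominated (g := fun x => normc (H x))).
- move=> N; apply: cmeasM; last exact: cmeasM.
  have mf : measurable_fun setT (fun x : 'cV[R]_n => (floor_cV x \in first_Zd n N)%:R : R).
    apply: (measurable_fun_eq
      (f := fun x : 'cV[R]_n => \sum_(m <- first_Zd n N) \1_cube (x - of_Zd m) : R)).
      by move=> x; exact: sum_unit_cube_shift.
    by apply: measurable_sum => m; apply: (measurableT_comp mcube); exact: measurable_translate.
  exact: cmeas_real mf.
- move=> x; have [N0 hN] := first_Zd_sub [:: floor_cV x].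
  by apply: (@ccvg_near_cst _ _ N0) => N /hN -> //; rewrite ?mem_head// mul1r.
- move=> N x; rewrite !normcM normcJ' normc_ekd mulr1 normcR.
  by case: (_ \in _); rewrite ?normr1 ?normr0 ?mul1r ?mul0r ?normc_ge0.
- by case: HL1.
Qed.

Variables (g w E : 'cV[R]_n -> R).
Hypotheses (mg : measurable_fun setT g) (mE : measurable_fun setT E)
  (g0 : forall x, 0 <= g x) (w0 : forall x, 0 <= w x)
  (Hgw : forall x, normc (H x) <= g x * w x)
  (gper : forall x r, uniq r ->
     (0 : 'cV[int]_n) \notin r -> w x * \sum_(m <- r) w (x + of_Zd m) <= E x).

Let E0 x : 0 <= E x.
Proof. by have := gper x (isT : uniq [::]) isT; rewrite big_nil mulr0. Qed.

Let of_ZdB (i j : 'cV[int]_n) : of_Zd (i - j) = of_Zd i - of_Zd j :> 'cV[R]_n.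
Proof. by apply/matrixP => a b; rewrite !mxE rmorphB. Qed.

Let dev (x : 'cV[R]_n) (r : seq 'cV[int]_n) : uniq r ->
  `|normc (\sum_(m <- r) H (x + of_Zd m)) ^+ 2 - \sum_(m <- r) normc (H (x + of_Zd m)) ^+ 2| <=
  \sum_(m <- r) g (x + of_Zd m) ^+ 2 * E (x + of_Zd m).
Proof.
move=> ur; apply: (sqnorm_sum_weight (g := fun m => g (x + of_Zd m))
  (w := fun m => w (x + of_Zd m)) (E := fun m => E (x + of_Zd m)) ur) => // i ir.
(* Recentring at [x + of_Zd i] turns the other translates into the nonzero differences [j - i], as
   [gper] requires. *)
have := @gper (x + of_Zd i) [seq j - i | j <- r & j != i]; rewrite big_map big_filter.
rewrite (eq_bigr (fun j => w (x + of_Zd j))); last first.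
  by move=> j _; rewrite of_ZdB addrACA subrr addr0.
apply; first by rewrite map_inj_uniq ?filter_uniq//; exact: addIr.
apply/mapP => -[j]; rewrite mem_filter => /andP[ji _] /eqP.
by rewrite eq_sym subr_eq0 (negbTE ji).
Qed.

Local Open Scope ereal_scope.

Let cubes (h : 'cV[R]_n -> R) x := \esum_(m in [set: 'cV[int]_n])
  ((\1_cube x)%:E * (h (x + of_Zd m))%:E).

Let cubes_out h x : ~ cube x -> cubes h x = 0.
Proof.
by move=> hx; rewrite /cubes esum1// => m _; rewrite indicE memNset ?mul0e.
Qed.

Let cubes_in h x : cube x -> cubes h x = \esum_(m in [set: 'cV[int]_n]) (h (x + of_Zd m))%:E.
Proof.
by move=> hx; apply: eq_esum => m _; rewrite indicE mem_set ?mul1e.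
Qed.

Let cubes_ge0 h x : (forall y, 0 <= h y)%R -> 0 <= cubes h x.
Proof. by move=> h0; apply: esum_ge0 => m _; rewrite mule_ge0 ?lee_fin ?indicE. Qed.

Let cubesE (h : 'cV[R]_n -> R) : measurable_fun setT h -> (forall y, 0 <= h y)%R ->
  \int[leb n]_x (h x)%:E = \int[leb n]_x cubes h x.
Proof.
move=> mh h0; rewrite (ge0_integral_cubes (g := fun x => (h x)%:E))//.
exact/measurable_EFinP.
Qed.

Let meas_cubes (h : 'cV[R]_n -> R) : measurable_fun setT h -> (forall y, 0 <= h y)%R ->
  measurable_fun setT (cubes h).
Proof.
move=> mh h0; apply: measurable_esum => [m|m x]; last by rewrite mule_ge0 ?lee_fin ?indicE.
apply: emeasurable_funM; first exact/measurable_EFinP.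
by apply/measurable_EFinP; apply: (measurableT_comp mh); exact: measurable_translate.
Qed.

Let sqH x := (normc (H x) ^+ 2)%R.
Let err x := (g x ^+ 2 * E x)%R.

Let sqH0 x : (0 <= sqH x)%R. Proof. exact: sqr_ge0. Qed.
Let err0 x : (0 <= err x)%R. Proof. by rewrite mulr_ge0 ?sqr_ge0. Qed.

Let PN_in N x : cube x -> PN N x = (\sum_(m <- first_Zd n N) H (x + of_Zd m))%R.
Proof. by move=> hx; rewrite /PN indicE mem_set// mul1r. Qed.

Let upper_pt P x : ccvg (PN ^~ x) P -> ((normc P ^+ 2)%:E <= cubes (fun y => sqH y + err y)%R x).
Proof.
move=> PP; have [hx|hx] := pselect (cube x); last first.
  rewrite cubes_out//; have -> : P = 0%R.
    apply: (ccvg_unique PP); apply: (@ccvg_near_cst _ _ 0%N) => N _.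
    by rewrite /PN indicE memNset// mul0r.
  by rewrite normc0 expr0n.
have h N : ((normc (PN N x) ^+ 2)%:E <= cubes (fun y => sqH y + err y)%R x).
  rewrite cubes_in// PN_in//.
  apply: le_trans (esum_ge_fin (r := first_Zd n N) _ (first_Zd_uniq n N) _) => //.
  rewrite sumEFin lee_fin big_split /=.
  have := dev x (first_Zd_uniq n N); move: (normc _ ^+ 2)%R => u.
  by rewrite ler_norml => /andP[_]; rewrite lerBlDl.
move: h; case: (cubes _ x) => [r| |] h; last by have := h 0%N; rewrite leNgt ltNyr.
  rewrite lee_fin; apply: (ler_cvg_to (ccvg_normc_sqr PP) (cvg_cst r)).
  by apply: nearW => N; have := h N; rewrite lee_fin.
by rewrite leey.
Qed.

(** Any finite family of translates is contained in all late partial sums. The error stands on the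
    right because it may be infinite. *)
Let lower_pt P x : ccvg (PN ^~ x) P -> cubes sqH x <= (normc P ^+ 2)%:E + cubes err x.
Proof.
move=> PP; have [hx|hx] := pselect (cube x); last first.
  by rewrite !cubes_out// adde0 lee_fin sqr_ge0.
have h N : (\sum_(m <- first_Zd n N) sqH (x + of_Zd m))%:E <=
    (normc (PN N x) ^+ 2)%:E + cubes err x.
  rewrite cubes_in// PN_in//.
  apply: (@le_trans _ _ ((normc (\sum_(m <- first_Zd n N) H (x + of_Zd m)) ^+ 2)%:E +
      \sum_(m <- first_Zd n N) (err (x + of_Zd m))%:E)).
    rewrite sumEFin -EFinD lee_fin.
    have := dev x (first_Zd_uniq n N); move: (normc _ ^+ 2)%R => u.
    rewrite ler_norml => /andP[+ _]; rewrite lerNl opprB => h.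
    by rewrite -lerBlDl.
  by rewrite leeD2l//; apply: esum_ge_fin => //; exact: first_Zd_uniq.
rewrite [leLHS]cubes_in//; apply: esum_le_fin => r ur _.
have [N0 hN] := first_Zd_sub r.
have h2 N : (N0 <= N)%N -> \sum_(m <- r) (sqH (x + of_Zd m))%:E <=
    (normc (PN N x) ^+ 2)%:E + cubes err x.
  move=> /hN rN; apply: le_trans (h N); rewrite sumEFin lee_fin.
  rewrite [leRHS](bigID (mem r))/= -[leLHS]addr0; apply: lerD; last exact: sumr_ge0.
  have pr : perm_eq [seq m <- first_Zd n N | mem r m] r.
    apply: uniq_perm => //; first by rewrite filter_uniq// first_Zd_uniq.
    by move=> m; rewrite mem_filter; apply/andP/idP => [[]|/[dup] /rN].
  by rewrite -[leRHS]big_filter (perm_big _ pr).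
move: h2; have := cubes_ge0 x err0; case: (cubes err x) => [c| |] // _ h2; last first.
  by rewrite addey// leey.
rewrite sumEFin -EFinD lee_fin -lerBlDr.
apply: (ler_cvg_to (cvg_cst _) (ccvg_normc_sqr PP)).
exists N0 => // N /= /h2; rewrite sumEFin -EFinD lee_fin -lerBlDr; exact.
Qed.

(** Parseval for the periodization [P] of [H] turns the sum into the integral of [|P|^2]; the
    diagonal of that square unfolds to the integral of [|H|^2], and the Schur test bounds the
    rest. *)
Lemma sampling :
  \esum_(k in [set: 'cV[int]_n]) (normc (cint (leb n) (fun x => H x * cj (ekd k x))) ^+ 2)%:E
    <= \int[leb n]_x (normc (H x) ^+ 2)%:E + \int[leb n]_x (g x ^+ 2 * E x)%:E /\
  \int[leb n]_x (normc (H x) ^+ 2)%:E <=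
  \esum_(k in [set: 'cV[int]_n]) (normc (cint (leb n) (fun x => H x * cj (ekd k x))) ^+ 2)%:E
    + \int[leb n]_x (g x ^+ 2 * E x)%:E.
Proof.
have [P [PP mP PM PH]] := periodization.
have msq : measurable_fun setT sqH by exact: cmeas_normc2.
have merr : measurable_fun setT err by apply: measurable_funM => //; exact: measurable_funX.
have mP2 : measurable_fun setT (fun x => (normc (P x) ^+ 2)%R) by exact: cmeas_normc2.
have -> : \esum_(k in [set: 'cV[int]_n])
    (normc (cint (leb n) (fun x => H x * cj (ekd k x))) ^+ 2)%:E =
    \int[leb n]_x (normc (P x) ^+ 2)%:E.
  rewrite -(parsevald (B := M) mP).
  - by apply: eq_esum => k _; rewrite PH.
  - move=> x; apply: le_trans (PM x) _; rewrite -[leRHS]mulr1 ler_wpM2l// indicE lern1 leq_b1 //.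
  - move=> x hx; apply: eq0_normc; apply/eqP; rewrite eq_le normc_ge0 andbT.
    by apply: le_trans (PM x) _; rewrite indicE memNset// mulr0.
split.
  rewrite -ge0_integralD//; last 4 first.
  - by move=> x _; rewrite lee_fin sqr_ge0.
  - exact/measurable_EFinP.
  - by move=> x _; rewrite lee_fin; exact: err0.
  - exact/measurable_EFinP.
  under [leRHS]eq_integral do rewrite -EFinD.
  rewrite [leRHS](cubesE (h := fun x => sqH x + err x)%R); last 2 first.
  - exact: measurable_funD.
  - by move=> x; rewrite addr_ge0.
  apply: ge0_le_integral => //.
  - by move=> x _; rewrite lee_fin sqr_ge0.
  - exact/measurable_EFinP.
  - by apply: meas_cubes; [exact: measurable_funD|move=> x; rewrite addr_ge0].
  - by move=> x _; exact: upper_pt.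
rewrite (cubesE msq sqH0) (cubesE merr err0) -ge0_integralD//; last 4 first.
- by move=> x _; rewrite lee_fin sqr_ge0.
- exact/measurable_EFinP.
- by move=> x _; exact: cubes_ge0.
- exact: meas_cubes.
apply: ge0_le_integral => //.
- by move=> x _; exact: cubes_ge0.
- exact: meas_cubes.
- by apply: emeasurable_funD; [exact/measurable_EFinP|exact: meas_cubes].
- by move=> x _; exact: lower_pt.
Qed.

End sampling.

End integrals_cV.

(** * Windows with compactly supported transform *)

Section sinc.
Context {R : realType}.
Local Notation mu := (@lebesgue_measure R).

Lemma intgR_le (f g : R -> R) : measurable_fun setT f -> (forall x, `|f x| <= g x) ->
  intg mu g -> intg mu f.
Proof. exact: (@intg_le _ _ _ mu f g). Qed.

Definition sinc (x : R) : R := if x == 0 then 1 else sin x / x.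

Lemma sincM x : sinc x * x = sin x.
Proof.
by rewrite /sinc; case: eqP => [->|/eqP x0]; rewrite ?mulr0 ?sin0// divfK.
Qed.

(** Density of the uniform law on [[-1, 1]]. That [sinc] is its characteristic function ([sinc_int])
    yields measurability, the bound by 1 and the effect on the band. *)
Let unif (y : R) : R := \1_(`[(-1), 1] : set R) y / 2.

Let unif_ge0 y : 0 <= unif y. Proof. by rewrite /unif indicE divr_ge0. Qed.

Let intg_unif : intg mu unif.
Proof.
apply: (intgR_le (g := fun y => 2^-1 * \1_(`[(-1), 1] : set R) y)).
- by apply: measurable_funM => //; exact: measurable_indic.
- by move=> y; rewrite ger0_norm // /unif mulrC.
- by apply: intgZ; exact: intg_indic_itv.
Qed.

Let Rint_unif : \int[mu]_y unif y = 1.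
Proof.
rewrite RintegralZr//; last exact: intg_indic_itv.
rewrite /Rintegral integral_indic//= setIT.
have := @lebesgue_measure_itv R `[(-1), 1]; rewrite /= lte_fin => h.
have h1 : -1 < 1 :> R by lra.
by move: h => /= ->; rewrite h1 /=; lra.
Qed.

Let intg_unifM (f : R -> R) (c : R) : measurable_fun setT f -> (forall y, `|f y| <= c) ->
  intg mu (fun y => unif y * f y).
Proof.
move=> mf fc; apply: (intgR_le (g := fun y => c * unif y)); last exact: intgZ.
  by apply: measurable_funM => //; exact: intg_meas intg_unif.
by move=> y; rewrite normrM (ger0_norm (unif_ge0 y)) mulrC ler_wpM2r.
Qed.

Let mcosM (x : R) : measurable_fun setT (fun y : R => cos (x * y)).
Proof.
apply: (measurableT_comp (continuous_measurable_fun (@continuous_cos R))).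
exact: measurable_funM.
Qed.

Let sinc_int x : sinc x = \int[mu]_y (unif y * cos (x * y)).
Proof.
rewrite /sinc; case: eqP => [->|/eqP x0].
  by rewrite -Rint_unif; apply: eq_Rintegral => y _; rewrite mul0r cos0 mulr1.
have -> : (fun y => unif y * cos (x * y)) =
    (fun y => 2^-1 * (\1_(`[(-1), 1] : set R) y * cos (x * y))).
  by apply/funext => y; rewrite /unif mulrAC mulrC.
rewrite RintegralZl//; last first.
  apply: (intgR_le (g := \1_(`[(-1), 1] : set R))); last exact: intg_indic_itv.
    by apply: measurable_funM => //; exact: measurable_indic.
  by move=> y; rewrite normrM indicE ger0_norm// ler_piMr// cos_max.
have h11 : -1 < 1 :> R by lra.
rewrite Rint_indic (Rint_cos h11 x0).
by rewrite mulr1 mulrN1 sinN opprK; field.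
Qed.

Lemma measurable_sinc : measurable_fun setT sinc.
Proof.
have -> : sinc = fun x => \int[mu]_y (unif y * cos (x * y)) by apply/funext => x; exact: sinc_int.
apply: (measurable_Rint_param mu
  (f := fun p : measurableTypeR R * measurableTypeR R => unif p.2 * cos (p.1 * p.2))).
apply: measurable_funM.
  exact: (measurableT_comp (intg_meas intg_unif) measurable_snd).
apply: (measurableT_comp (continuous_measurable_fun (@continuous_cos R))).
by apply: measurable_funM; [exact: measurable_fst|exact: measurable_snd].
Qed.

Lemma sinc_max x : `|sinc x| <= 1.
Proof.
have i1 : intg mu (fun y => unif y * cos (x * y)).
  by apply: (@intg_unifM _ 1) => // y; exact: cos_max.
rewrite sinc_int -Rint_unif; apply: le_trans (le_normr_Rintegral _ _) _ => //.
apply: le_Rintegral => //; first exact: (intg_norm i1).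
by move=> y _; rewrite normrM (ger0_norm (unif_ge0 y)) ler_piMr// cos_max.
Qed.

Lemma sinc_le_inv x : `|x| * `|sinc x| <= 1.
Proof. by rewrite -normrM mulrC sincM sin_max. Qed.

Lemma norm_sin_le (x : R) : `|sin x| <= `|x|.
Proof. by rewrite -sincM normrM ler_piMl// sinc_max. Qed.

Lemma one_sub_cos (x : R) : 1 - cos x = 2 * sin (x / 2) ^+ 2.
Proof.
have -> : cos x = cos (x / 2 *+ 2) by congr cos; rewrite -mulr_natr; field.
by rewrite cos_mulr2n cos2sin2; ring.
Qed.

Lemma cos_lb (x : R) : 1 - x ^+ 2 / 2 <= cos x.
Proof.
have := one_sub_cos x.
have : sin (x / 2) ^+ 2 <= (x / 2) ^+ 2.
  by rewrite -[leLHS]real_normK ?num_real// -[leRHS]real_normK ?num_real// ler_sqr ?nnegrE// norm_sin_le.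
by rewrite expr_div_n; lra.
Qed.

(** Averaging [cos_lb] against [unif] gives [sinc x >= 1 - x ^+ 2 / 2], which may be squared when
    [x ^+ 2 <= 1]; beyond that the left side is negative. *)
Lemma sinc_sqr_lb x : 1 - x ^+ 2 <= sinc x ^+ 2.
Proof.
have h : 1 - x ^+ 2 / 2 <= sinc x.
  have -> : 1 - x ^+ 2 / 2 = \int[mu]_y ((1 - x ^+ 2 / 2) * unif y).
    by rewrite RintegralZl// Rint_unif mulr1.
  rewrite sinc_int; apply: le_Rintegral => //.
  - by apply: intgZ; exact: intg_unif.
  - by apply: (@intg_unifM _ 1) => // y; exact: cos_max.
  move=> y _; rewrite mulrC /unif indicE; have [|_] := boolP (_ \in _); last by rewrite !mul0r.
  rewrite inE /= in_itv /= => /andP[y1 y2]; rewrite ler_wpM2l ?divr_ge0//.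
  apply: le_trans (cos_lb _); rewrite exprMn.
  have y21 : y ^+ 2 <= 1 by nra.
  have := sqr_ge0 x; nra.
have := sqr_ge0 x; have := sqr_ge0 (sinc x); have := sinc_max x.
rewrite ler_norml => /andP[_ s1] s2 x2.
have [x2l|x2l] := leP (x ^+ 2) 1; last by lra.
by nra.
Qed.

(** The Fourier transform of [f], in angular frequency, vanishes outside []-X, X[]. The free phase
    [a] covers the cosine and sine transforms at once and is stable under the product formulas. *)
Definition bandlimited (f : R -> R) (X : R) :=
  forall x a : R, X <= `|x| -> \int[mu]_s (f s * cos (x * s + a)) = 0.

Let mcosD (x a : R) : measurable_fun setT (fun s : R => cos (x * s + a)).
Proof.
apply: (measurableT_comp (continuous_measurable_fun (@continuous_cos R))).
exact: measurable_affine1.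
Qed.

Lemma intg_cos (f : R -> R) (x a : R) : intg mu f -> intg mu (fun s => f s * cos (x * s + a)).
Proof.
move=> fi; apply: (intgR_le (g := fun s => `|f s|)); last exact: intg_norm.
  apply: measurable_funM => //; exact: intg_meas fi.
by move=> s; rewrite normrM ler_piMr// cos_max.
Qed.

(** Writing [sinc] as an average of cosines and using product-to-sum formulas, the transform at [x]
    becomes an average of transforms of [f] at [x + b * y] and [x - b * y] with [|y| <= 1]. *)
Lemma bandlimited_sinc f X b : intg mu f -> 0 <= b -> bandlimited f X ->
  bandlimited (fun s => f s * sinc (b * s)) (X + b).
Proof.
move=> fi b0 fX x a xX.
pose F (p : measurableTypeR R * measurableTypeR R) : R :=
  f p.1 * (unif p.2 * cos (b * p.1 * p.2)) * cos (x * p.1 + a).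
have mF : measurable_fun setT F.
  apply: measurable_funM; last first.
    apply: (measurableT_comp (mcosD x a)); exact: measurable_fst.
  apply: measurable_funM.
    by apply: (measurableT_comp (intg_meas fi)); exact: measurable_fst.
  apply: measurable_funM.
    by apply: (measurableT_comp (intg_meas intg_unif)); exact: measurable_snd.
  apply: (measurableT_comp (continuous_measurable_fun (@continuous_cos R))).
  apply: measurable_funM; last exact: measurable_snd.
  by apply: measurable_funM => //; exact: measurable_fst.
have [|||||E1 E2] := @Rint_fubini _ _ _ _ _ mu mu F (fun s => `|f s|) unif mF.
- move=> s y; rewrite /F normrM normrM [X in _ * X * _]normrM (ger0_norm (unif_ge0 _)) -mulrA ler_wpM2l//=.
  by rewrite -mulrA ler_piMr// mulr_ile1// cos_max.
- by [].
- by [].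
- exact: intg_norm.
- exact: intg_unif.
transitivity (\int[mu]_s \int[mu]_y F (s, y)).
  apply: eq_Rintegral => s _; rewrite sinc_int.
  have iu : intg mu (fun y => unif y * cos (b * s * y)).
    by apply: (@intg_unifM _ 1) => // y; exact: cos_max.
  rewrite mulrAC -RintegralZl//; apply: eq_Rintegral => y _; rewrite /F /=; ring.
rewrite -E1 E2; transitivity (\int[mu]_(y in setT) (0 : R)); last by rewrite /Rintegral integral0.
apply: eq_Rintegral => y _.
have FE s : F (s, y) = unif y / 2 * (f s * cos ((x + b * y) * s + a)) +
    unif y / 2 * (f s * cos ((x - b * y) * s + a)).
  rewrite /F /=.
  have -> : (x + b * y) * s + a = (x * s + a) + b * s * y by ring.
  have -> : (x - b * y) * s + a = (x * s + a) - b * s * y by ring.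
  by rewrite (cosD (x * s + a) (b * s * y)) (cosB (x * s + a) (b * s * y)); field.
under eq_Rintegral do rewrite FE.
rewrite RintegralD//; [|by apply: intgZ; exact: intg_cos..].
rewrite RintegralZl ?RintegralZl//; [|exact: intg_cos..].
rewrite /unif indicE; have [|_] := boolP (_ \in _); last by rewrite !mul0r addr0.
rewrite inE /= in_itv /= => /andP[y1 y2].
have by1 : `|b * y| <= b by rewrite normrM (ger0_norm b0) ler_piMr// ler_norml y1 y2.
rewrite !fX ?mulr0 ?addr0//.
  by rewrite (le_trans _ (lerB_dist x (b * y)))// lerBrDr (le_trans _ xX)// lerD2l.
have := lerB_dist x (- (b * y)); rewrite opprK normrN; apply: le_trans.
by rewrite lerBrDr (le_trans _ xX)// lerD2l.
Qed.

Lemma intg_sinc f b : intg mu f -> intg mu (fun s => f s * sinc (b * s)).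
Proof.
move=> fi; apply: (intgR_le (g := fun s => `|f s|)); last exact: intg_norm.
  apply: measurable_funM; first exact: intg_meas fi.
  by apply: (measurableT_comp measurable_sinc); exact: measurable_funM.
by move=> s; rewrite normrM ler_piMr// sinc_max.
Qed.

Lemma bandlimited_sincX f X b n : intg mu f -> 0 <= b -> bandlimited f X ->
  intg mu (fun s => f s * sinc (b * s) ^+ n) /\
  bandlimited (fun s => f s * sinc (b * s) ^+ n) (X + n%:R * b).
Proof.
move=> fi b0 fX; elim: n => [|n [IH1 IH2]].
  rewrite mul0r addr0; split; first by under eq_fun do rewrite expr0 mulr1.
  by move=> x a /(fX _ a) <-; apply: eq_Rintegral => s _; rewrite expr0 mulr1.
have E s : f s * sinc (b * s) ^+ n.+1 = (f s * sinc (b * s) ^+ n) * sinc (b * s).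
  by rewrite exprSr mulrA.
split; first by under eq_fun do rewrite E; exact: intg_sinc.
have -> : X + n.+1%:R * b = X + n%:R * b + b by rewrite -natr1; ring.
move=> x a /(bandlimited_sinc IH1 b0 IH2 a) <-.
by apply: eq_Rintegral => s _; rewrite E.
Qed.

End sinc.

(** * The base kernel with triangular transform *)

Section base_window.
Context {R : realType}.
Local Notation mu := (@lebesgue_measure R).

Lemma intg_oneDsqrV : intg mu (fun s : R => (oneDsqr s)^-1).
Proof.
have mV : measurable_fun setT (fun s : R => (oneDsqr s)^-1).
  by apply: continuous_measurable_fun; exact: continuous_oneDsqrV.
have V0 (s : R) : 0 <= (oneDsqr s)^-1 by rewrite invr_ge0 (le_trans ler01).
pose f (s : R) : R := \1_(`[0, +oo[ : set R) s * (oneDsqr s)^-1.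
have f0 s : 0 <= f s by rewrite mulr_ge0// indicE.
have mf : measurable_fun setT f by apply: measurable_funM => //; exact: measurable_indic.
have fi : intg mu f.
  apply: intg_ge0_lty => //; have := integral0y_oneDsqr R.
  rewrite [X in X = _ -> _]integral_mkcond.
  rewrite (_ : (_ \_ _)%E = (fun s => (f s)%:E)) => [->|]; first by rewrite ltry.
  by apply/funext => s; rewrite patchE /f indicE; case: ifP; rewrite ?mul1r ?mul0r.
have fi' : intg mu (fun s => f (- s)).
  have N1 : -1 != 0 :> R by rewrite oppr_eq0 oner_neq0.
  by have := intg_affine1 0 N1 fi; under eq_fun do rewrite addr0 mulN1r.
apply: (intgR_le (g := f \+ (fun s => f (- s)))); [exact: mV| |exact: intgD].
move=> s; rewrite ger0_norm// /f /= !indicE.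
have -> : oneDsqr (- s) = oneDsqr s by rewrite /oneDsqr sqrrN.
have [s0|s0] := leP 0 s.
  by rewrite mem_set/= ?in_itv/= ?andbT// mul1r lerDl mulr_ge0.
have h : - s \in `[0, +oo[%classic by rewrite inE /= in_itv/= andbT oppr_ge0 ltW.
by rewrite [X in _ <= _ + X](_ : _ = (oneDsqr s)^-1) ?lerDr ?mulr_ge0// h mul1r.
Qed.

(** This is [(1 - cos s) / s ^+ 2] with its limit at 0: nonnegative and integrable, with a
    triangular transform supported in [[-1, 1]]. *)
Definition phi0 (s : R) : R := sinc (s / 2) ^+ 2 / 2.

Lemma phi0_ge0 s : 0 <= phi0 s. Proof. by rewrite divr_ge0 ?sqr_ge0. Qed.

Lemma phi0_sqr s : phi0 s * s ^+ 2 = 1 - cos s.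
Proof.
by rewrite one_sub_cos -(sincM (s / 2)) /phi0; field.
Qed.

Lemma phi0_le s : phi0 s <= 3 * (oneDsqr s)^-1.
Proof.
rewrite ler_pdivlMr ?(lt_le_trans ltr01)// /oneDsqr mulrDr mulr1 phi0_sqr.
have := cos_geN1 s; have := sinc_max (s / 2); rewrite /phi0 -(@ler_sqr _ `|_|) ?nnegrE//.
by rewrite real_normK ?num_real// expr1n; lra.
Qed.

Lemma phi0N s : phi0 (- s) = phi0 s.
Proof.
rewrite /phi0 mulNr; congr (_ ^+ 2 / 2); rewrite /sinc oppr_eq0; case: ifP => // _.
by rewrite sinN invrN mulrNN.
Qed.

Lemma measurable_phi0 : measurable_fun setT phi0.
Proof.
apply: measurable_funM => //; apply: measurable_funX.
by apply: (measurableT_comp measurable_sinc); exact: measurable_funM.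
Qed.

Lemma intg_phi0 : intg mu phi0.
Proof.
apply: (intgR_le (g := fun s => 3 * (oneDsqr s)^-1)).
- exact: measurable_phi0.
- by move=> s; rewrite ger0_norm ?phi0_ge0// phi0_le.
- by apply: intgZ; exact: intg_oneDsqrV.
Qed.

(* [a ^+ 2 * phi0 (a * s)] is [(1 - cos (a * s)) / s ^+ 2] extended by continuity,
   so by scaling its integral is a multiple of [`|a|]. *)
Let G (a s : R) := a ^+ 2 * phi0 (a * s).

Let intgG a : intg mu (G a).
Proof.
have [->|a0] := eqVneq a 0.
  rewrite (_ : G 0 = fun=> 0); first exact: (@integrable0 _ _ _ mu).
  by apply/funext => s; rewrite /G expr0n mul0r.
by apply: intgZ; have := intg_affine1 0 a0 intg_phi0; under eq_fun do rewrite addr0.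
Qed.

Let RintG a : \int[mu]_s G a s = `|a| * \int[mu]_s phi0 s.
Proof.
have [->|a0] := eqVneq a 0.
  rewrite normr0 mul0r (_ : G 0 = fun=> 0); first by rewrite /Rintegral integral0.
  by apply/funext => s; rewrite /G expr0n mul0r.
have ia : intg mu (fun s => phi0 (a * s)).
  by have := intg_affine1 0 a0 intg_phi0; under eq_fun do rewrite addr0.
rewrite RintegralZl// -(Rint_affine1 0 a0 intg_phi0) mulrA -expr2 real_normK ?num_real//.
by congr (_ * _); apply: eq_Rintegral => s _; rewrite addr0.
Qed.

Let phi0_cos x s : phi0 s * cos (x * s) =
  2^-1 * G (x + 1) s + 2^-1 * G (x - 1) s - G x s.
Proof.
have [->|s0] := eqVneq s 0.
  by rewrite /G /phi0 !mulr0 mul0r cos0 /sinc eqxx; field.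
have s20 : s ^+ 2 != 0 by rewrite expf_neq0.
apply: (mulIf s20); rewrite mulrAC phi0_sqr.
have GE a : G a s * s ^+ 2 = 1 - cos (a * s).
  by rewrite -phi0_sqr /G; ring.
have -> : (2^-1 * G (x + 1) s + 2^-1 * G (x - 1) s - G x s) * s ^+ 2 =
  2^-1 * (G (x + 1) s * s ^+ 2) + 2^-1 * (G (x - 1) s * s ^+ 2) - G x s * s ^+ 2 by ring.
by rewrite !GE (mulrDl x) (mulrBl s) !mul1r cosD cosB; field.
Qed.

(** By [phi0_cos] the cosine transform at [x] is a multiple of [|x + 1| + |x - 1| - 2 |x|], which
    vanishes once [|x| >= 1]; the sine transform vanishes by parity. *)
Lemma bandlimited_phi0 : bandlimited phi0 1.
Proof.
move=> x a x1.
have mc (f : R -> R) : continuous f -> (forall y, `|f y| <= 1) ->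
    intg mu (fun s => phi0 s * f (x * s)).
  move=> cf f1; apply: (intgR_le (g := phi0)); last exact: intg_phi0.
    apply: measurable_funM; first exact: measurable_phi0.
    by apply: (measurableT_comp (continuous_measurable_fun cf)); exact: measurable_funM.
  by move=> s; rewrite normrM (ger0_norm (phi0_ge0 s)) ler_piMr ?phi0_ge0.
have ic := mc _ (@continuous_cos R) (@cos_max R).
have is_ := mc _ (@continuous_sin R) (@sin_max R).
have Ec : \int[mu]_s (phi0 s * cos (x * s)) = 0.
  under eq_Rintegral do rewrite phi0_cos.
  have i1 b : intg mu (fun s => 2^-1 * G b s) by apply: intgZ; exact: intgG.
  rewrite RintegralB//; [|exact: intgD|exact: intgG].
  rewrite (RintegralD measurableT (i1 _) (i1 _)) /=.
  have EZ b : \int[mu]_s (2^-1 * G b s) = 2^-1 * (`|b| * \int[mu]_s phi0 s).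
    by rewrite (RintegralZl _ _ (intgG _))// RintG.
  rewrite !EZ RintG; set I0 := \int[mu]_s _.
  have h : `|x + 1| + `|x - 1| = 2 * `|x|.
    move: x1; have [x0|x0] := ger0P x => x1.
      by rewrite !ger0_norm; lra.
    by rewrite !ler0_norm; lra.
  have -> : `|x + 1| = 2 * `|x| - `|x - 1| by lra.
  by field.
have Es : \int[mu]_s (phi0 s * sin (x * s)) = 0.
  have N1 : -1 != 0 :> R by rewrite oppr_eq0 oner_neq0.
  have := Rint_affine1 0 N1 is_; rewrite normrN1 mul1r => h.
  suff : \int[mu]_s (phi0 s * sin (x * s)) = - \int[mu]_s (phi0 s * sin (x * s)) by lra.
  have -> : - (\int[mu]_s (phi0 s * sin (x * s))) = \int[mu]_s (-1 * (phi0 s * sin (x * s))).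
    by rewrite RintegralZl// mulN1r.
  rewrite -[LHS]h; apply: eq_Rintegral => s _.
  by rewrite addr0 !mulN1r mulrN sinN mulrN phi0N.
under eq_Rintegral do rewrite cosD mulrBr !mulrA.
have i1 : intg mu (fun s => phi0 s * cos (x * s) * cos a).
  by under eq_fun do rewrite mulrC; exact: intgZ.
have i2 : intg mu (fun s => phi0 s * sin (x * s) * sin a).
  by under eq_fun do rewrite mulrC; exact: intgZ.
by rewrite RintegralB// !RintegralZr// Ec Es !mul0r subr0.
Qed.

End base_window.

Section prod_bounds.
Context {R : realType}.

Lemma prod_le1 I (r : seq I) (P : pred I) (p : I -> R) :
  (forall i, P i -> 0 <= p i <= 1) -> \prod_(i <- r | P i) p i <= 1.
Proof.
move=> p01; suff /andP[] : 0 <= \prod_(i <- r | P i) p i <= 1 by [].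
apply: (big_ind (fun x => 0 <= x <= 1)) => //; first by rewrite ler01 lexx.
by move=> x y /andP[x0 x1] /andP[y0 y1]; rewrite mulr_ge0// mulr_ile1.
Qed.

(** The Weierstrass product inequality, used for the mass of the profile and, with equal factors,
    for powers of [sinc] and of [1 - delta]. *)
Lemma bernoulli_prod I (r : seq I) (p u : I -> R) :
  (forall i, 0 <= p i <= 1) -> (forall i, 0 <= u i) -> (forall i, 1 - u i <= p i) ->
  1 - \sum_(i <- r) u i <= \prod_(i <- r) p i.
Proof.
move=> p01 u0 up; elim: r => [|i r IH]; first by rewrite !big_nil subr0.
rewrite !big_cons; have [h1 h2] := andP (p01 i); have h3 := up i; have h4 := u0 i.
have h5 : \prod_(j <- r) p j <= 1.
  by apply: prod_le1 => j _; exact: p01.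
move: IH h5; set S := \sum_(_ <- _) _; set P := \prod_(_ <- _) _ => IH h5.
have : 0 <= (1 - p i) * (1 - P) by rewrite mulr_ge0 ?subr_ge0.
by nra.
Qed.

End prod_bounds.

(** * The infinite product of sinc powers *)

Section profile.
Context {R : realType}.
Local Notation mu := (@lebesgue_measure R).
Variables (m : nat -> nat) (M : R).
Hypothesis mM : forall N, \sum_(j < N) (m j)%:R / 2 ^+ j <= M.

Let a j : R := 2 / 2 ^+ j.
Let a_gt0 j : 0 < a j. Proof. by rewrite divr_gt0// exprn_gt0. Qed.

Let M0 : 0 <= M. Proof. by apply: le_trans (mM 0); rewrite big_ord0. Qed.

Let fac j (s : R) : R := (sinc (a j * s) ^+ 2) ^+ m j.

Let sinc2_le1 (x : R) : sinc x ^+ 2 <= 1.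
Proof.
rewrite -real_normK ?num_real//; have := sinc_max x; have := normr_ge0 (sinc x); nra.
Qed.

Let fac_ge0 j s : 0 <= fac j s. Proof. by rewrite exprn_ge0// sqr_ge0. Qed.
Let fac_le1 j s : fac j s <= 1. Proof. by rewrite exprn_ile1// sqr_ge0. Qed.

(* A factor [sinc (b * s)] is the transform of the uniform law on [[-b, b]], so it
   enlarges the band by [b]; the band stays bounded because [\sum_j m j * a j] converges. *)
Let phiN N (s : R) : R := phi0 s * \prod_(j < N) fac j s.

Let prod_ge0 N s : 0 <= \prod_(j < N) fac j s. Proof. by apply: prodr_ge0 => j _. Qed.
Let fprod_le1 N s : \prod_(j < N) fac j s <= 1.
Proof. by apply: prod_le1 => j _; rewrite fac_ge0 fac_le1. Qed.

Let phiN_ge0 N s : 0 <= phiN N s. Proof. by rewrite mulr_ge0 ?phi0_ge0. Qed.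

Let phiN_le N s : phiN N s <= phi0 s. Proof. by rewrite ler_piMr ?phi0_ge0 ?fprod_le1. Qed.

Let phiN_noninc s : nonincreasing_seq (phiN ^~ s).
Proof.
apply/nonincreasing_seqP => N; rewrite /phiN big_ord_recr /= ler_wpM2l ?phi0_ge0//.
by rewrite ler_piMr// prod_ge0.
Qed.

Definition profile (s : R) : R := lim (phiN ^~ s @ \oo).

Let cvg_profile s : phiN ^~ s @ \oo --> profile s.
Proof.
apply: nonincreasing_is_cvgn; first exact: phiN_noninc.
by exists 0 => _ [N _ <-]; exact: phiN_ge0.
Qed.

Let profile_lb c s N0 : (forall N, (N0 <= N)%N -> c <= phiN N s) -> c <= profile s.
Proof. by move=> h; apply: limr_ge; [exact: cvg_profile|exists N0 => // N /h]. Qed.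

Let profile_ub c s N0 : (forall N, (N0 <= N)%N -> phiN N s <= c) -> profile s <= c.
Proof. by move=> h; apply: limr_le; [exact: cvg_profile|exists N0 => // N /h]. Qed.

Lemma profile_ge0 s : 0 <= profile s. Proof. by apply: (@profile_lb _ _ 0). Qed.
Lemma profile_le s : profile s <= phi0 s. Proof. by apply: (@profile_ub _ _ 0). Qed.

(** One factor suffices: here [|a j * s| >= 2], so [sinc_le_inv] gives [sinc ^+ 2 <= 1/4] in factor
    [j], and all other factors are at most 1. *)
Lemma profile_decay j s : 2 ^+ j <= `|s| -> profile s <= phi0 s * 4 ^- m j.
Proof.
move=> js; apply: (@profile_ub _ _ j.+1) => N jN; rewrite /phiN ler_wpM2l ?phi0_ge0//.
rewrite (bigD1 (Ordinal jN))//= -[leRHS]mulr1; apply: ler_pM => //.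
- by apply: prodr_ge0 => i _.
- rewrite /fac -exprVn; apply: lerXn2r; rewrite ?nnegrE ?sqr_ge0 ?invr_ge0//.
  have jp : 0 < 2 ^+ j :> R by rewrite exprn_gt0.
  have h2 : 2 <= `|a j * s|.
    rewrite normrM gtr0_norm// /a mulrAC ler_pdivlMr// mulrC; nra.
  have := sinc_le_inv (a j * s); have := normr_ge0 (sinc (a j * s)).
  rewrite -[sinc _ ^+ 2]real_normK ?num_real//; set y := `|sinc _| => y0 hy.
  have y2 : y <= 2^-1 by nra.
  have -> : 4^-1 = 2^-1 * 2^-1 :> R by field.
  by rewrite expr2; nra.
- by apply: prod_le1 => i _; rewrite fac_ge0 fac_le1.
Qed.

Let measurable_phiN N : measurable_fun setT (phiN N).
Proof.
apply: measurable_funM; first exact: measurable_phi0.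
apply: measurable_prod => j _; apply: measurable_funX; apply: measurable_funX.
by apply: (measurableT_comp measurable_sinc); exact: measurable_funM.
Qed.

Lemma measurable_profile : measurable_fun setT profile.
Proof. by apply: (measurable_fun_cvg measurable_phiN) => s _; exact: cvg_profile. Qed.

Lemma intg_profile : intg mu profile.
Proof.
apply: (intgR_le (g := phi0)); last exact: intg_phi0; first exact: measurable_profile.
by move=> s; rewrite ger0_norm ?profile_ge0 ?profile_le.
Qed.

Lemma profileN s : profile (- s) = profile s.
Proof.
congr (lim (_ @ \oo)); apply/funext => N; rewrite /phiN phi0N; congr (_ * _).
apply: eq_bigr => j _; rewrite /fac mulrN; congr (_ ^+ 2 ^+ _).
by rewrite /sinc oppr_eq0; case: ifP => // _; rewrite sinN invrN mulrNN.
Qed.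

Let bandlimited_phiN N : intg mu (phiN N) /\
  bandlimited (phiN N) (1 + \sum_(j < N) (2 * m j)%:R * a j).
Proof.
elim: N => [|N [IH1 IH2]].
  have -> : phiN 0 = phi0 by apply/funext => s; rewrite /phiN big_ord0 mulr1.
  by rewrite big_ord0 addr0; split; [exact: intg_phi0|exact: bandlimited_phi0].
have -> : phiN N.+1 = fun s => phiN N s * sinc (a N * s) ^+ (2 * m N).
  by apply/funext => s; rewrite /phiN big_ord_recr /= mulrA exprM.
rewrite big_ord_recr /= addrA; apply: bandlimited_sincX => //; exact: ltW.
Qed.

(** Factor [j] widens the band by [2 * m j * a j = 4 * m j / 2 ^+ j], so all partial products share
    the band [1 + 4 * M]; the limit inherits it by dominated convergence under [phi0]. *)
Lemma bandlimited_profile : bandlimited profile (1 + 4 * M).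
Proof.
move=> x al Xx.
have h N : \int[mu]_s (phiN N s * cos (x * s + al)) = 0.
  apply: (bandlimited_phiN N).2; apply: le_trans Xx; rewrite lerD2l.
  apply: le_trans (ler_wpM2l _ (mM N)) => //.
  rewrite mulr_sumr; apply: ler_sum => j _; rewrite /a natrM.
  by rewrite le_eqVlt; apply/orP; left; apply/eqP; ring.
have mc : measurable_fun setT (fun s : R => cos (x * s + al)).
  apply: (measurableT_comp (continuous_measurable_fun (@continuous_cos R))).
  exact: measurable_affine1.
have := @Rint_dominated _ _ _ mu (fun N s => phiN N s * cos (x * s + al))
  (fun s => profile s * cos (x * s + al)) phi0.
under eq_fun do rewrite h.
move=> /(_ _ _ _ intg_phi0) hh; apply: (cvg_unique _ (hh _ _ _) (cvg_cst 0)).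
- by [].
- by move=> N; apply: measurable_funM => //; exact: measurable_phiN.
- by move=> s; apply: cvgMl; exact: cvg_profile.
- move=> N s; rewrite normrM (ger0_norm (phiN_ge0 _ _)).
  by apply: le_trans (phiN_le N s); rewrite ler_piMr// cos_max.
Qed.

Let fac_lb j s : 1 - (m j)%:R * (a j * s) ^+ 2 <= fac j s.
Proof.
have := @bernoulli_prod R _ (nseq (m j) tt) (fun=> sinc (a j * s) ^+ 2) (fun=> (a j * s) ^+ 2).
rewrite !big_const_seq !count_predT size_nseq iter_addr_0 iter_mulr_1 => h.
rewrite /fac mulr_natl; apply: h.
- by move=> _; rewrite sqr_ge0 sinc2_le1.
- by move=> _; exact: sqr_ge0.
- by move=> _; exact: sinc_sqr_lb.
Qed.

(** The mollifier is normalized by this integral. On [[0, s0]] one has [phi0 >= 1/4], and [4 * s ^+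
    2 * M <= (s * (1 + M)) ^+ 2 <= 1/4] keeps every partial product above [1/2]. *)
Lemma profile_mass : 0 < \int[mu]_s profile s.
Proof.
pose s0 : R := (2 * (1 + M))^-1.
have s0p : 0 < s0 by rewrite invr_gt0; have := M0; lra.
have s0M : s0 * (2 * (1 + M)) = 1 by rewrite mulVf// gt_eqF//; have := M0; lra.
have lb s : 0 <= s <= s0 -> 8^-1 <= profile s.
  move=> /andP[sp ss]; apply: (@profile_lb _ _ 0) => N _.
  have h1 : 4^-1 <= phi0 s.
    rewrite /phi0; have := sinc_sqr_lb (s / 2); have : s <= 2^-1 by have := M0; nra.
    by move=> h; rewrite expr_div_n; nra.
  have h2 : 2^-1 <= \prod_(j < N) fac j s.
    apply: le_trans (@bernoulli_prod R _ _ _ (fun j : 'I_N => (m j)%:R * (a j * s) ^+ 2) _ _ _).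
    - suff : \sum_(j < N) (m j)%:R * (a j * s) ^+ 2 <= 4 * s ^+ 2 * M.
        have h3 : s * (1 + M) <= 2^-1 by have := M0; nra.
        have h4 : 0 <= s * (1 + M) by rewrite mulr_ge0// addr_ge0.
        have h5 : (s * (1 + M)) ^+ 2 <= 4^-1 by nra.
        have h6 : 0 <= s ^+ 2 * (1 + M ^+ 2) by have := sqr_ge0 M; have := sqr_ge0 s; nra.
        nra.
      apply: le_trans (ler_wpM2l _ (mM N)); last by rewrite mulr_ge0// sqr_ge0.
      rewrite mulr_sumr; apply: ler_sum => j _; rewrite /a.
      have p0 : 0 < (2 : R) ^+ j by rewrite exprn_gt0.
      have p1 : 1 <= (2 : R) ^+ j by rewrite exprn_ege1//; lra.
      have q0 : 0 < ((2 : R) ^+ j)^-1 by rewrite invr_gt0.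
      have q1 : ((2 : R) ^+ j)^-1 <= 1 by rewrite invf_le1.
      move: q0 q1; set q := ((2 : R) ^+ j)^-1 => q0 q1.
      have -> : (m j)%:R * (2 * q * s) ^+ 2 = 4 * s ^+ 2 * ((m j)%:R * q) * q by ring.
      rewrite -[leRHS]mulr1 ler_wpM2l// !mulr_ge0// ?sqr_ge0// ltW//.
    - by move=> j; rewrite fac_ge0 fac_le1.
    - by move=> j; rewrite mulr_ge0 ?sqr_ge0.
    - by move=> j; exact: fac_lb.
  by rewrite /phiN; nra.
apply: (@lt_le_trans _ _ (8^-1 * s0)); first by rewrite mulr_gt0// invr_gt0.
have -> : 8^-1 * s0 = \int[mu]_s (8^-1 * \1_(`[0, s0] : set R) s).
  rewrite RintegralZl//; last exact: intg_indic_itv.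
  congr (_ * _); rewrite /Rintegral integral_indic//= setIT.
  have := @lebesgue_measure_itv R `[0, s0]; rewrite /= lte_fin s0p => h.
  by move: h => /= ->; rewrite /= subr0.
apply: le_Rintegral => //.
- by apply: intgZ; exact: intg_indic_itv.
- exact: intg_profile.
move=> s _; rewrite indicE; have [|_] := boolP (_ \in _).
  by rewrite inE /= in_itv /= mulr1; exact: lb.
by rewrite mulr0 profile_ge0.
Qed.

End profile.

(** * The mollified indicator function *)

Section window.
Context {R : realType}.
Local Notation mu := (@lebesgue_measure R).

(* [X] bounds the band, hence the support of the transform; the exponents [m] give
   the decay of [w] at dyadic distances. *)
Definition is_window (theta delta : R) (m : nat -> nat) (X : R) (w : R -> R) :=
  [/\ measurable_fun setT w, forall z, w (- z) = w z, forall z, 0 <= w z <= 1,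
      forall z, `|z| <= (1 - theta) / 2 -> 1 - delta <= w z &
      [/\ forall z, 2^-1 - theta / 4 <= `|z| -> w z <= delta * 4 ^- m 0,
          forall j z, 2 ^+ j <= `|z| -> w z <= delta * 4 ^- m j.+1 &
          bandlimited w X /\ exists c, forall z, w z <= c * (oneDsqr z)^-1]].

Variables (m : nat -> nat) (M theta : R).
Hypotheses (mM : forall N, \sum_(j < N) (m j)%:R / 2 ^+ j <= M)
  (m_incr : forall j, (m j < m j.+1)%N) (th0 : 0 < theta) (th1 : theta < 1).
Variable l : nat.

Local Notation phi := (@profile R m).
Let I := \int[mu]_s phi s.
Let I0 := \int[mu]_s @phi0 R s.
(** The margin [theta / 8] between [b] and either threshold is dilated to [2 ^+ l.+1]; these extra
    levels of decay produce the small factor [4 ^- l]. *)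
Let lam : R := 2 ^+ (l + 4) / theta.
(* The midpoint of [(1 - theta) / 2] and [2^-1 - theta / 4]. *)
Let b : R := 2^-1 - 3 * theta / 8.
Let chi (u : R) : R := \1_(`[- b, b] : set R) u.

Let Ip : 0 < I. Proof. exact: profile_mass mM. Qed.
Let lamp : 0 < lam. Proof. by rewrite divr_gt0// exprn_gt0. Qed.
Let lam1 : 1 <= lam.
Proof.
rewrite ler_pdivlMr// mul1r (le_trans (ltW th1))// exprn_ege1//; lra.
Qed.
Let chi01 u : 0 <= chi u <= 1. Proof. by rewrite /chi indicE ler0n lern1 leq_b1. Qed.

Let ker (z u : R) := phi (lam * (z - u)).

Let measurable_ker z : measurable_fun setT (ker z).
Proof.
apply: (measurableT_comp (measurable_profile m)); apply: measurable_funM => //.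
exact: measurable_funB.
Qed.

Let RintK (h : R -> R) z : intg mu h ->
  intg mu (fun u => h (lam * (z - u))) /\
  \int[mu]_u h (lam * (z - u)) = \int[mu]_s h s / lam.
Proof.
move=> hi; have Nl : - lam != 0 by rewrite oppr_eq0 gt_eqF.
have E u : lam * (z - u) = - lam * u + lam * z by ring.
have -> : (fun u => h (lam * (z - u))) = (fun u => h (- lam * u + lam * z)).
  by apply/funext => u; rewrite E.
split; first exact: intg_affine1.
have := Rint_affine1 (lam * z) Nl hi; rewrite normrN (gtr0_norm lamp) => <-.
by rewrite [RHS]mulrAC (divff (lt0r_neq0 lamp)) mul1r.
Qed.

Let mchi : measurable_fun setT chi. Proof. exact: measurable_indic. Qed.

Let intg_chiK z : intg mu (fun u => chi u * ker z u).
Proof.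
apply: (intgR_le (g := ker z)); last exact: (RintK z (intg_profile m)).1.
  exact: measurable_funM.
move=> u; have /andP[c0 c1] := chi01 u.
by rewrite ger0_norm ?mulr_ge0 ?ler_piMl//; exact: profile_ge0 m _.
Qed.

Definition window (z : R) : R := lam / I * \int[mu]_u (chi u * ker z u).

Let c0 : 0 <= lam / I. Proof. by rewrite divr_ge0// ltW. Qed.

Let window_ub z c : 0 <= c -> (forall u, `|u| <= b -> ker z u <= phi0 (lam * (z - u)) * c) ->
  window z <= I0 / I * c.
Proof.
move=> cp h; have [i1 E] := RintK z (intg_phi0 (R := R)).
rewrite /window.
have -> : I0 / I * c = lam / I * \int[mu]_u (c * phi0 (lam * (z - u))).
  rewrite RintegralZl// E -/I0; field.
  by rewrite !gt_eqF.
rewrite ler_wpM2l//; apply: le_Rintegral => //; [exact: intg_chiK|exact: intgZ|].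
move=> u _; rewrite /chi indicE; have [|_] := boolP (_ \in _).
  rewrite inE /= in_itv /= mul1r mulrC => ub; apply: le_trans (h u _) _; last by rewrite mulrC.
  by rewrite ler_norml.
by rewrite mul0r mulr_ge0// phi0_ge0.
Qed.

Let ker_le z u j : 2 ^+ j <= lam * `|z - u| -> ker z u <= phi0 (lam * (z - u)) * 4 ^- m j.
Proof.
by move=> h; apply: profile_decay; rewrite normrM gtr0_norm.
Qed.

(** The normalization makes [window z] an average of [chi], so its distance to 1 is the kernel mass
    outside [[-b, b]]. *)
Let one_sub_window z :
  1 - window z = lam / I * \int[mu]_u ((1 - chi u) * ker z u).
Proof.
have [i1 E] := RintK z (intg_profile m).
rewrite [X in X - _ = _](_ : 1 = lam / I * \int[mu]_u ker z u); last first.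
  by rewrite [X in _ * X]E -/I; field; rewrite !gt_eqF.
rewrite /window -mulrBr -RintegralB//; last exact: intg_chiK.
by congr (_ * _); apply: eq_Rintegral => u _; rewrite mulrBl mul1r.
Qed.

Let window01 z : 0 <= window z <= 1.
Proof.
apply/andP; split.
  by rewrite mulr_ge0//; apply: Rintegral_ge0 => u _; rewrite mulr_ge0// profile_ge0.
rewrite -subr_ge0 one_sub_window mulr_ge0//; apply: Rintegral_ge0 => u _; rewrite mulr_ge0//.
  by rewrite subr_ge0; case/andP: (chi01 u).
exact: profile_ge0 m _.
Qed.

(** Strict growth of the exponents: passing [l] further dyadic levels gains at least [4 ^- l] on top
    of [4 ^- m j], and this gain becomes [delta]. *)
Let m_shift j k : (m j + k <= m (j + k))%N.
Proof.
elim: k => [|k IH]; first by rewrite !addn0.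
by rewrite !addnS (leq_ltn_trans IH).
Qed.

Let pow4_le i j : (i <= j)%N -> 4 ^- j <= 4 ^- i :> R.
Proof.
move=> ij; rewrite lef_pV2 ?posrE ?exprn_gt0// ler_weXn2l//; lra.
Qed.

Let del : R := I0 / I * 4 ^- l.
Let I0p : 0 <= I0. Proof. by apply: Rintegral_ge0 => s _; exact: phi0_ge0. Qed.

Let lam_theta : lam * (theta / 8) = 2 ^+ l.+1.
Proof. by rewrite /lam exprD !exprS expr0; field; rewrite gt_eqF. Qed.

Let window_near z : `|z| <= (1 - theta) / 2 -> 1 - del <= window z.
Proof.
move=> hz; rewrite lerBlDr addrC -lerBlDr one_sub_window.
have [i1 E] := RintK z (intg_phi0 (R := R)).
have -> : del = lam / I * \int[mu]_u (4 ^- l * phi0 (lam * (z - u))).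
  rewrite RintegralZl// E -/I0 /del; field.
  by rewrite !gt_eqF ?exprn_gt0.
rewrite ler_wpM2l//; apply: le_Rintegral => //.
- apply: (intgR_le (g := ker z)); last exact: (RintK z (intg_profile m)).1.
    by apply: measurable_funM => //; exact: measurable_funB.
  move=> u; have /andP[h0 h1] := chi01 u.
  rewrite ger0_norm ?mulr_ge0 ?ler_piMl ?subr_ge0//; try exact: profile_ge0 m _.
  by rewrite lerBlDr lerDl.
- exact: intgZ.
move=> u _; rewrite /chi indicE; have [_|] := boolP (_ \in _).
  by rewrite subrr mul0r mulr_ge0 ?phi0_ge0 ?invr_ge0 ?exprn_ge0.
rewrite notin_setE /= in_itv /= => ub; rewrite subr0 mul1r mulrC.
apply: le_trans (@ker_le z u l.+1 _) _.
  rewrite -lam_theta ler_wpM2l ?(ltW lamp)//.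
  have ub' : b < `|u|.
    by rewrite ltNge; apply/negP; rewrite ler_norml => /andP[u1 u2]; apply: ub; rewrite u1 u2.
  by move: ub'; rewrite /b; have := lerB_dist u z; rewrite distrC; lra.
rewrite ler_wpM2l ?phi0_ge0// pow4_le//.
by apply: leq_trans (m_shift 0 l.+1); rewrite addnS (leq_trans (leq_addl (m 0) l)).
Qed.

Let window_far z : 2^-1 - theta / 4 <= `|z| -> window z <= del * 4 ^- m 0.
Proof.
move=> hz; have -> : del * 4 ^- m 0 = I0 / I * 4 ^- (m 0 + l).
  by rewrite /del exprD invfM; ring.
apply: window_ub; first by rewrite invr_ge0 exprn_ge0.
move=> u ub; apply: le_trans (@ker_le z u l.+1 _) _.
  rewrite -lam_theta ler_wpM2l ?(ltW lamp)//.
  by have := lerB_dist z u; move: ub; have := th0; rewrite /b; lra.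
rewrite ler_wpM2l ?phi0_ge0// pow4_le//.
by apply: leq_trans (m_shift 0 l.+1); rewrite addnS.
Qed.

Let window_decay j z : 2 ^+ j <= `|z| -> window z <= del * 4 ^- m j.+1.
Proof.
move=> hz; have -> : del * 4 ^- m j.+1 = I0 / I * 4 ^- (m j.+1 + l).
  by rewrite /del exprD invfM; ring.
apply: window_ub; first by rewrite invr_ge0 exprn_ge0.
have j1 : 1 <= 2 ^+ j :> R by rewrite exprn_ege1//; lra.
(* From [|u| <= b < 1/2] and [2 ^+ j >= 1] follows [|z - u| >= 2 ^+ j / 2], and the dilation [lam]
   supplies more than the missing [l + 2] levels. *)
move=> u ub; apply: le_trans (@ker_le z u (j.+1 + l)%N _) _.
  apply: (@le_trans _ _ (lam * (2 ^+ j / 2))).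
    rewrite /lam exprD (exprD _ l 4) !exprS expr0 !mulr1.
    have lp : 1 <= 2 ^+ l :> R by rewrite exprn_ege1//; lra.
    have ti : 1 <= theta^-1 by rewrite invf_ge1// ltW.
    have jl : 0 <= 2 ^+ j * 2 ^+ l :> R by rewrite mulr_ge0// exprn_ge0.
    have -> : 2 ^+ l * (2 * (2 * (2 * 2))) / theta * (2 ^+ j / 2) =
      8 * (2 ^+ j * 2 ^+ l) * theta^-1 :> R by field; rewrite gt_eqF.
    by nra.
  rewrite ler_wpM2l ?(ltW lamp)//.
  by have := lerB_dist z u; move: ub; have := th0; rewrite /b; lra.
rewrite ler_wpM2l ?phi0_ge0// pow4_le//.
Qed.

Let Kmeas : measurable_fun setT (fun p : measurableTypeR R * measurableTypeR R => chi p.2 * ker p.1 p.2).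
Proof.
apply: measurable_funM; first exact: (measurableT_comp mchi measurable_snd).
apply: (measurableT_comp (measurable_profile m)); apply: measurable_funM => //.
by apply: measurable_funB; [exact: measurable_fst|exact: measurable_snd].
Qed.

Let ker_dom z u : `|chi u * ker z u| <= 6 * (oneDsqr z)^-1 * chi u.
Proof.
rewrite /chi indicE; have [|_] := boolP (_ \in _); last by rewrite mul0r normr0 mulr0.
rewrite inE /= in_itv /= mul1r mulr1 => /andP[u1 u2].
rewrite ger0_norm; last exact: profile_ge0 m _.
apply: le_trans (profile_le m _) _; apply: le_trans (phi0_le _) _.
have p1 (x : R) : 0 < oneDsqr x by rewrite (lt_le_trans ltr01).
rewrite ler_pdivrMr// mulrAC ler_pdivlMr// /oneDsqr.
have b2 : b <= 2^-1 by rewrite /b; have := th0; lra.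
have u1' : - 2^-1 <= u by move: u1 b2; move: b => b'; lra.
have u2' : u <= 2^-1 by move: u2 b2; move: b => b'; lra.
have hb : u ^+ 2 <= 4^-1 by nra.
have h2 : (z - u) ^+ 2 <= (lam * (z - u)) ^+ 2.
  by rewrite exprMn ler_peMl ?sqr_ge0// exprn_ege1.
have := sqr_ge0 (z - 2 * u); nra.
Qed.

Let measurable_window : measurable_fun setT window.
Proof.
apply: measurable_funM => //.
exact: (measurable_Rint_param mu Kmeas).
Qed.

Let intg_chi : intg mu chi. Proof. exact: intg_indic_itv. Qed.

Let windowN z : window (- z) = window z.
Proof.
congr (_ * _); have N1 : -1 != 0 :> R by rewrite oppr_eq0 oner_neq0.
rewrite -(Rint_affine1 0 N1 (intg_chiK z)) normrN1 mul1r; apply: eq_Rintegral => u _.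
rewrite addr0 mulN1r; congr (_ * _).
  rewrite /chi !indicE; congr (nat_of_bool _)%:R; apply/idP/idP; rewrite !inE /= !in_itv /=.
    by move=> /andP[u1 u2]; apply/andP; split; lra.
  by move=> /andP[u1 u2]; apply/andP; split; lra.
rewrite /ker opprK; have -> : lam * (- z - u) = - (lam * (z + u)) by ring.
exact: profileN.
Qed.

Let window_dom : exists c, forall z, window z <= c * (oneDsqr z)^-1.
Proof.
exists (lam / I * (6 * \int[mu]_u chi u)) => z.
have -> : lam / I * (6 * \int[mu]_u chi u) * (oneDsqr z)^-1 =
  lam / I * (6 * (oneDsqr z)^-1 * \int[mu]_u chi u) by ring.
rewrite /window ler_wpM2l// -RintegralZl//.
apply: le_Rintegral => //; [exact: intg_chiK|exact: intgZ|].
by move=> u _; apply: le_trans (ler_norm _) (ker_dom z u).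
Qed.

(** Integrating in [z] first, the substitution [s = lam * (z - u)] turns each inner integral into
    the transform of the profile at [x / lam], which vanishes; averaging over [u] changes
    nothing. *)
Let bandlimited_window : bandlimited window (lam * (1 + 4 * M)).
Proof.
move=> x a xX; rewrite /window.
pose F (p : measurableTypeR R * measurableTypeR R) : R :=
  chi p.2 * ker p.1 p.2 * cos (x * p.1 + a).
have mc : measurable_fun setT (fun s : R => cos (x * s + a)).
  apply: (measurableT_comp (continuous_measurable_fun (@continuous_cos R))).
  exact: measurable_affine1.
have mF : measurable_fun setT F.
  by apply: measurable_funM => //; apply: (measurableT_comp mc); exact: measurable_fst.
have [|||||E1 E2] := @Rint_fubini _ _ _ _ _ mu mu F (fun z => 6 * (oneDsqr z)^-1) chi mF.
- move=> z u; rewrite /F normrM; apply: le_trans (ker_dom z u).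
  by rewrite ler_piMr// cos_max.
- by move=> z; rewrite mulr_ge0// invr_ge0 (le_trans ler01).
- by move=> u; case/andP: (chi01 u).
- by apply: intgZ; exact: intg_oneDsqrV.
- by [].
transitivity (lam / I * \int[mu]_z \int[mu]_u F (z, u)).
  have iF : intg mu (fun z => (\int[mu]_u (chi u * ker z u)) * cos (x * z + a)).
    apply: (intgR_le (g := fun z => (6 * \int[mu]_u chi u) * (oneDsqr z)^-1)).
    - by apply: measurable_funM => //; exact: (measurable_Rint_param mu Kmeas).
    - move=> z; rewrite normrM; apply: le_trans (_ : `|\int[mu]_u (chi u * ker z u)| <= _).
        by rewrite ler_piMr// cos_max.
      apply: le_trans (le_normr_Rintegral _ (intg_chiK z)) _ => //.
      rewrite mulrAC -RintegralZl//; apply: le_Rintegral => //.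
      - by apply: intg_norm; exact: intg_chiK.
      - exact: intgZ.
    - by apply: intgZ; exact: intg_oneDsqrV.
  transitivity (\int[mu]_z (lam / I * ((\int[mu]_u (chi u * ker z u)) * cos (x * z + a)))).
    by apply: eq_Rintegral => z _; rewrite mulrA.
  rewrite RintegralZl//; congr (_ * _); apply: eq_Rintegral => z _.
  by rewrite -RintegralZr//; exact: intg_chiK.
rewrite -E1 E2; rewrite (_ : (\int[mu]_y _) = 0) ?mulr0//.
transitivity (\int[mu]_(y in setT) (0 : R)); last by rewrite /Rintegral integral0.
apply: eq_Rintegral => u _; rewrite /F /=.
have band : \int[mu]_s (phi s * cos (x / lam * s + (x * u + a))) = 0.
  apply: (bandlimited_profile mM); rewrite normrM normfV [X in _ / X]gtr0_norm//.
  by rewrite ler_pdivlMr// mulrC.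
have ip : intg mu phi by exact: intg_profile.
have ii := intg_cos (x / lam) (x * u + a) ip.
have ln0 : lam != 0 by rewrite gt_eqF.
have E := Rint_affine1 (- (lam * u)) ln0 ii.
have i3 := intg_affine1 (- (lam * u)) ln0 ii.
have e3 z : phi (lam * z - lam * u) * cos (x / lam * (lam * z - lam * u) + (x * u + a)) =
    ker z u * cos (x * z + a).
  by rewrite /ker; congr (_ * cos _); [congr (phi _); ring|field].
under eq_Rintegral do rewrite -mulrA -e3.
rewrite RintegralZl//.
suff -> : \int[mu]_z (phi (lam * z - lam * u) * cos (x / lam * (lam * z - lam * u) + (x * u + a))) = 0.
  by rewrite mulr0.
move: E; rewrite band => /eqP; rewrite mulf_eq0 normr_eq0 (negbTE ln0) /= => /eqP //.
Qed.

Lemma window_is_window : is_window theta (I0 / I * 4 ^- l) m (lam * (1 + 4 * M)) window.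
Proof.
split; [exact: measurable_window|exact: windowN|exact: window01|exact: window_near|].
split; [exact: window_far|exact: window_decay|split => //; exact: bandlimited_window].
Qed.

End window.

Lemma window_exists {R : realType} (m : nat -> nat) (M theta delta : R) :
  (forall N, \sum_(j < N) (m j)%:R / 2 ^+ j <= M) -> (forall j, (m j < m j.+1)%N) ->
  0 < theta -> theta < 1 -> 0 < delta ->
  exists X w, is_window theta delta m X w.
Proof.
move=> mM mi th0 th1 d0.
move: (profile_mass mM); set I := Rintegral _ _ _ => Ip; pose I0 := \int[@lebesgue_measure R]_s @phi0 R s.
have I0p : 0 <= I0 by apply: Rintegral_ge0 => s _; exact: phi0_ge0.
(* Since [4 ^+ l >= l + 1 > I0 / I / delta], the tail constant [I0 / I * 4 ^- l] of the window is at
   most [delta]. *)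
pose l := Num.truncn (I0 / I / delta).
have hl : I0 / I * 4 ^- l <= delta.
  have h1 : I0 / I / delta < l.+1%:R by exact: truncnS_gt.
  have h2 : l.+1%:R <= 4 ^+ l :> R.
    by rewrite -natrX ler_nat; exact: ltn_expl.
  have p4 : 0 < 4 ^+ l :> R by rewrite exprn_gt0.
  move: h1; rewrite ltr_pdivrMr// => h1; rewrite ler_pdivrMr// [leRHS]mulrC.
  by apply: le_trans (ltW h1) _; rewrite ler_wpM2r// ltW.
exists (2 ^+ (l + 4) / theta * (1 + 4 * M)), (window m theta l).
have [h1 h2 h3 h4 [h5 h6 h7]] := window_is_window mM mi th0 th1 l.
have p4 n : 0 <= 4 ^- n :> R by rewrite invr_ge0 exprn_ge0.
split; [exact: h1|exact: h2|exact: h3| |split].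
- by move=> z /h4; apply: le_trans; rewrite lerD2l lerN2.
- by move=> z /h5 h; apply: (le_trans h); rewrite ler_wpM2r.
- by move=> j z /h6 h; apply: (le_trans h); rewrite ler_wpM2r.
- exact: h7.
Qed.

(** * The transform of a window *)

Section cos_transform.
Context {R : realType}.
Local Notation mu := (@lebesgue_measure R).
Variables (theta delta X : R) (m : nat -> nat) (w : R -> R).
Hypotheses (d0 : 0 < delta) (ww : is_window theta delta m X w)
  (m_sqr : forall j, (j * j <= m j)%N).

Let mw : measurable_fun setT w. Proof. by case: ww. Qed.
Let w01 z : 0 <= w z <= 1. Proof. by case: ww. Qed.
Let w_dec j z : 2 ^+ j <= `|z| -> w z <= delta * 4 ^- m j.+1.
Proof. by case: ww => _ _ _ _ [_ h _]; exact: h. Qed.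

Let dyadic (z : R) : 1 <= `|z| -> exists j, 2 ^+ j <= `|z| <= 2 ^+ j.+1.
Proof.
move=> z1.
have ex : exists n, `|z| <= 2 ^+ n.
  exists (Num.truncn `|z|).+1; apply: le_trans (ltW (truncnS_gt _)) _.
  by rewrite -natrX ler_nat ltnW// ltn_expl.
case: (ex_minnP ex) => -[|n] hn hmin.
  exists 0%N; rewrite expr0 z1/=; apply: le_trans hn _; rewrite expr0 expr1; lra.
exists n; rewrite hn andbT leNgt; apply/negP => /ltW /hmin; by rewrite ltnn.
Qed.

(** The condition [j * j <= m j] makes the decay faster than any power: [4 ^+ m j.+1] absorbs
    [2 ^+ (j.+1 * n)] up to [2 ^+ (n * n)]. All moments are finite, hence the transform is
    smooth. *)
Let w_moment n z : w z * `|z| ^+ n <= 1 + delta * 2 ^+ (n * n).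
Proof.
have /andP[w0 w1] := w01 z.
have dp : 0 <= delta * 2 ^+ (n * n) by rewrite mulr_ge0 ?exprn_ge0// ltW.
have [z1|z1] := leP `|z| 1.
  apply: (@le_trans _ _ 1); last by rewrite lerDl.
  by rewrite mulr_ile1 ?exprn_ge0 ?exprn_ile1.
have [j /andP[j1 j2]] := dyadic (ltW z1).
apply: (@le_trans _ _ (delta * 2 ^+ (n * n))); last by rewrite lerDr.
apply: (@le_trans _ _ ((delta * 4 ^- m j.+1) * (2 ^+ j.+1) ^+ n)).
  apply: ler_pM; [by []|exact: exprn_ge0|exact: w_dec|].
  by apply: lerXn2r; rewrite ?nnegrE ?exprn_ge0.
rewrite -mulrA ler_wpM2l ?(ltW d0)// mulrC ler_pdivrMr ?exprn_gt0//.
have -> : 4 = 2 ^+ 2 :> R by rewrite expr2; lra.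
rewrite -!exprM -exprD; apply: ler_weXn2l; first by lra.
have := m_sqr j.+1.
have : (j.+1 * n <= n * n + 2 * (j.+1 * j.+1))%N.
  have [h|h] := leqP j.+1 n; first by rewrite (leq_trans _ (leq_addr _ _))// leq_mul2r h orbT.
  rewrite (leq_trans _ (leq_addl _ _))// mul2n -addnn (leq_trans _ (leq_addl _ _))//.
  by rewrite leq_mul2l ltnW ?orbT.
move=> h1 h2; apply: leq_trans h1 _; rewrite leq_add2l leq_mul2l//.
Qed.

Let intg_moment n : intg mu (fun s => w s * `|s| ^+ n).
Proof.
pose c := 1 + delta * 2 ^+ (n * n) + (1 + delta * 2 ^+ (n.+2 * n.+2)).
apply: (intgR_le (g := fun s => c * (oneDsqr s)^-1)).
- by apply: measurable_funM => //; apply: measurable_funX; exact: (@normr_measurable R setT).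
- move=> s; have /andP[w0 _] := w01 s; rewrite ger0_norm ?mulr_ge0 ?exprn_ge0//.
  rewrite ler_pdivlMr ?(lt_le_trans ltr01)// /oneDsqr mulrDr mulr1 -mulrA.
  by rewrite -[s ^+ 2]real_normK ?num_real// -exprD addn2 lerD ?w_moment.
- by apply: intgZ; exact: intg_oneDsqrV.
Qed.

(** The [n]-th derivative in [x] of [w s * cos (2 * pi * s * x)]: each derivative brings out
    [2 * pi * s] and advances the phase by a quarter turn, so one formula serves every order. *)
Definition cos_tf_int (n : nat) (x s : R) : R :=
  w s * ((2 * pi * s) ^+ n * cos (2 * pi * s * x + n%:R * (pi / 2))).

Definition cos_tf (n : nat) (x : R) : R := \int[mu]_s cos_tf_int n x s.

Let intg_cos_tf n x : intg mu (cos_tf_int n x) /\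
  forall s, `|cos_tf_int n x s| <= (2 * pi) ^+ n * (w s * `|s| ^+ n).
Proof.
have dom s : `|cos_tf_int n x s| <= (2 * pi) ^+ n * (w s * `|s| ^+ n).
  have /andP[w0 _] := w01 s; have pi0 := pi_ge0 R.
  rewrite /cos_tf_int !normrM (ger0_norm w0) normrX normrM exprMn.
  rewrite [`|2 * pi|]ger0_norm ?mulr_ge0// mulrCA -[leLHS]mulrA.
  rewrite ler_wpM2l ?exprn_ge0 ?mulr_ge0// mulrCA ler_wpM2l//.
  by rewrite ler_piMr ?exprn_ge0// cos_max.
split => //; apply: (intgR_le (g := fun s => (2 * pi) ^+ n * (w s * `|s| ^+ n))) => //.
  apply: measurable_funM => //; apply: measurable_funM.
    by apply: measurable_funX; exact: measurable_funM.
  apply: (measurableT_comp (continuous_measurable_fun (@continuous_cos R))).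
  by apply: measurable_funD => //; apply: measurable_funM => //; exact: measurable_funM.
by apply: intgZ; exact: intg_moment.
Qed.

Let is_derive_int n s x : is_derive x (1 : R) (fun x => cos_tf_int n x s) (cos_tf_int n.+1 x s).
Proof.
have h1 : is_derive x 1 (fun x : R => 2 * pi * s * x + n%:R * (pi / 2)) (2 * pi * s).
  by apply: is_derive_eq; rewrite /GRing.scale /=; ring.
rewrite /cos_tf_int; apply: is_derive_eq; rewrite /GRing.scale /=.
have -> : 2 * pi * s * x + n.+1%:R * (pi / 2) = 2 * pi * s * x + n%:R * (pi / 2) + pi / 2.
  by rewrite -natr1; ring.
by rewrite cosDpihalf exprS; ring.
Qed.

Lemma derive_cos_tf n x : derivable (cos_tf n) x 1 /\ 'D_1 (cos_tf n) x = cos_tf n.+1 x.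
Proof.
pose G s := (2 * pi) ^+ n.+1 * (w s * `|s| ^+ n.+1).
have G0 s : 0 <= G s by apply: le_trans (normr_ge0 _) ((intg_cos_tf n.+1 0).2 s).
have xI : `]x - 1, x + 1[%classic x by rewrite /= in_itv /=; apply/andP; split; lra.
have iG : intg mu G by apply: intgZ; exact: intg_moment.
have hi y : `]x - 1, x + 1[%classic y -> intg mu (cos_tf_int n y) by move=> _; exact: (intg_cos_tf n y).1.
have hd y s : `]x - 1, x + 1[%classic y -> [set: R] s -> derivable (fun y => cos_tf_int n y s) y 1.
  by move=> _ _; have := is_derive_int n s y.
have hb y s : `]x - 1, x + 1[%classic y -> [set: R] s -> `|partial1of2 (cos_tf_int n) y s| <= G s.
  move=> _ _; rewrite partial1of2E; have /@derive_val -> := is_derive_int n s y.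
  exact: (intg_cos_tf n.+1 y).2.
split.
  exact: (@derivable_under_integral _ _ _ mu (cos_tf_int n) setT measurableT x _ _ xI hi hd G G0 iG hb).
rewrite -derive1E.
rewrite (@differentiation_under_integral _ _ _ mu (cos_tf_int n) setT measurableT x _ _ xI hi hd G G0 iG hb).
apply: eq_Rintegral => s _; rewrite -/(partial1of2 (cos_tf_int n) x s) partial1of2E.
by have /@derive_val -> := is_derive_int n s x.
Qed.

Lemma cos_tfN x : cos_tf 0 (- x) = cos_tf 0 x.
Proof.
apply: eq_Rintegral => s _; rewrite /cos_tf_int mul0r !addr0 !mulrN cosN //.
Qed.

Lemma cos_tf_eq0 x : X <= 2 * pi * `|x| -> cos_tf 0 x = 0.
Proof.
move=> xX; case: ww => _ _ _ _ [_ _ [/(_ (2 * pi * x) 0) band _]].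
rewrite -[RHS]band; last by rewrite normrM [`|2 * pi|]ger0_norm// mulr_ge0// pi_ge0.
by apply: eq_Rintegral => s _; rewrite /cos_tf_int expr0 mul1r mul0r [2 * pi * x * s]mulrAC.
Qed.

(** The window is even, so the sine part of its Fourier transform vanishes and the transform is
    real. *)
Lemma cos_tf_ft x : (cos_tf 0 x)%:C = cint mu (fun s => (w s)%:C * expi (2 * pi * (s * x))).
Proof.
apply: complexP; rewrite /= /cos_tf.
  by apply: eq_Rintegral => s _; rewrite /cos_tf_int expr0 mul1r mul0r addr0 mul0r subr0 -mulrA.
pose f s := w s * sin (2 * pi * (s * x)).
have fi : intg mu f.
  apply: (intgR_le (g := fun s => w s * `|s| ^+ 0)); last exact: intg_moment.
    apply: measurable_funM => //.
    apply: (measurableT_comp (continuous_measurable_fun (@continuous_sin R))).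
    by apply: measurable_funM => //; exact: measurable_funM.
  move=> s; have /andP[w0 _] := w01 s; rewrite normrM (ger0_norm w0) expr0 mulr1.
  by rewrite ler_piMr// sin_max.
have N1 : -1 != 0 :> R by rewrite oppr_eq0 oner_neq0.
have h := Rint_affine1 0 N1 fi; rewrite normrN1 mul1r in h.
have e : \int[mu]_s f (-1 * s + 0) = - \int[mu]_s f s.
  transitivity (\int[mu]_s (-1 * f s)); last by rewrite RintegralZl// mulN1r.
  apply: eq_Rintegral => s _; case: ww => _ wN _ _ _.
  by rewrite addr0 !mulN1r /f wN mulNr mulrN sinN mulrN.
have -> : \int[mu]_s (w s * sin (2 * pi * (s * x)) + 0 * cos (2 * pi * (s * x))) = \int[mu]_s f s.
  by apply: eq_Rintegral => s _; rewrite mul0r addr0.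
by move: h; rewrite e; lra.
Qed.

End cos_transform.

Section product_window.
Context {R : realType}.
Variable d : nat.
Variables (theta delta X : R) (m : nat -> nat) (w : R -> R).
Hypotheses (d0 : 0 < delta) (ww : is_window theta delta m X w)
  (m_sqr : forall j, (j * j <= m j)%N).

Local Notation h := (cos_tf w).

(** The multi-index [al] makes the family closed under partial derivatives, which reduces smoothness
    of the case [al = 0] to continuity and differentiability of every member. *)
Definition prod_cos_tf (al : 'I_d -> nat) (x : 'cV[R]_d) : R := \prod_i h (al i) (x i ord0).

Let incr (i : 'I_d) (al : 'I_d -> nat) k := if k == i then (al k).+1 else al k.

Let derive_prod i al x : derivable (prod_cos_tf al) x (delta_mx i ord0) /\
  'D_(delta_mx i ord0) (prod_cos_tf al) x = prod_cos_tf (incr i al) x.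
Proof.
pose c := \prod_(k | k != i) h (al k) (x k ord0).
have E : (fun t : R => t^-1 *: ((prod_cos_tf al \o shift x) (t *: delta_mx i ord0) - prod_cos_tf al x)) =
   (fun t : R => c * (t^-1 *: ((h (al i) \o shift (x i ord0)) (t *: 1) - h (al i) (x i ord0)))).
  apply/funext => t; rewrite /prod_cos_tf /= (bigD1 i)//= [X in _ - X](bigD1 i)//=.
  rewrite !mxE eqxx /= (eq_bigr (fun k => h (al k) (x k ord0))); last first.
    by move=> k ki; rewrite !mxE (negbTE ki) /= mulr0 add0r.
  by rewrite -/c /GRing.scale /=; ring.
have [dh Dh] := derive_cos_tf d0 ww m_sqr (al i) (x i ord0).
have cv : (fun t : R => t^-1 *: ((prod_cos_tf al \o shift x) (t *: delta_mx i ord0) - prod_cos_tf al x)) @ 0^'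
    --> c * h (al i).+1 (x i ord0).
  by rewrite E -Dh; apply: cvgMr; exact: dh.
split; first by apply/cvg_ex; eexists; exact: cv.
rewrite /derive (cvg_lim _ cv)// /prod_cos_tf [RHS](bigD1 i)//= /incr eqxx mulrC; congr (_ * _).
by apply: eq_bigr => k /negbTE ->.
Qed.

Let continuous_prod al : continuous (prod_cos_tf al).
Proof.
move=> x; rewrite /prod_cos_tf; elim: (index_enum _) => [|i r IH].
  rewrite (_ : (fun _ => _) = fun=> 1); first exact: cst_continuous.
  by apply/funext => y; rewrite big_nil.
rewrite (_ : (fun _ => _) = (fun y : 'cV[R]_d => h (al i) (y i ord0)) \*
    (fun y : 'cV[R]_d => \prod_(k <- r) h (al k) (y k ord0))); last first.
  by apply/funext => y; rewrite big_cons.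
apply: continuousM => //.
apply: (@continuous_comp _ _ _ (fun x : 'cV[R]_d => x i ord0) (h (al i))).
  exact: coord_continuous.
have [dh _] := derive_cos_tf d0 ww m_sqr (al i) (x i ord0).
exact/differentiable_continuous/derivable1_diffP.
Qed.

Lemma smooth_prod_cos_tf : smooth (prod_cos_tf (fun=> 0%N)).
Proof.
have fold (s : seq 'I_d) : exists al, foldr partial (prod_cos_tf (fun=> 0%N)) s = prod_cos_tf al.
  elim: s => [|i s [al IH]]; first by exists (fun=> 0%N).
  exists (incr i al); rewrite /= IH; apply/funext => x; exact: (derive_prod i al x).2.
move=> s; have [al ->] := fold s; split; first exact: continuous_prod.
by move=> i x; exact: (derive_prod i al x).1.
Qed.

Lemma compact_prod_cos_tf : compactly_supported (prod_cos_tf (fun=> 0%N)).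
Proof.
pose L := X / (2 * pi).
pose B := [set x : 'cV[R]_d | forall i, `[- L, L]%classic (x i ord0)].
(* Transposition carries the compact box of row vectors continuously onto the box of column
   vectors. *)
have ctr : continuous (@trmx R 1 d).
  move=> x A [P Px PA]; exists (fun i j => P j i) => [i j|v hv].
    by have := Px j i; rewrite mxE.
  by apply: PA => i j; rewrite mxE; exact: hv.
have cB : compact B.
  have -> : B = (@trmx R 1 d) @` [set v : 'rV[R]_d | forall i, `[- L, L]%classic (v ord0 i)].
    apply/seteqP; split => [x xB|_ [v hv <-] i]; last by rewrite mxE; exact: hv.
    by exists x^T; [move=> i; rewrite mxE; exact: xB|exact: trmxK].
  apply: continuous_compact; first exact: continuous_subspaceT.
  by apply: (rV_compact (A := fun=> `[- L, L]%classic)) => i; exact: segment_compact.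
apply: (subclosed_compact _ cB); first exact: closed_closure.
rewrite [X in _ `<=` X](closure_id B).1; last exact: (compact_closed _ cB).
apply: closure_subset => x /= hx i; rewrite /= in_itv /= -ler_norml.
rewrite leNgt; apply/negP => hi; move/eqP: hx; apply.
rewrite /prod_cos_tf (bigD1 i)//= (cos_tf_eq0 ww) ?mul0r//.
have pi2 : 0 < 2 * pi :> R by rewrite mulr_gt0// pi_gt0.
by move: hi; rewrite /L ltr_pdivrMr// mulrC => /ltW.
Qed.

Lemma even_prod_cos_tf : even_coords (prod_cos_tf (fun=> 0%N)).
Proof.
move=> i x; apply: eq_bigr => j _; rewrite mxE; case: eqP => // _.
exact: cos_tfN.
Qed.

Lemma perm_prod_cos_tf : perm_invariant (prod_cos_tf (fun=> 0%N)).
Proof.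
move=> s x; rewrite /prod_cos_tf [RHS](reindex_inj (@perm_inj _ s)) /=.
by apply: eq_bigr => i _; rewrite mxE.
Qed.

End product_window.

(** * Packets depend only on the tile set *)

Section tile_sets.
Context {R : realType}.

Lemma cV_norm_le n (x : 'cV[R]_n) (c : R) : 0 <= c ->
  (`|x| <= c) <-> (forall i, `|x i ord0| <= c).
Proof.
move=> c0; rewrite -[`|x|]/(mx_norm x) mx_normrE; split.
  by move=> /bigmax_leP[_ h] i; exact: (h (i, ord0)).
by move=> h; apply/bigmax_leP; split=> // -[i j] _ /=; rewrite (ord1 j).
Qed.

Lemma cV_coord_le n (x : 'cV[R]_n) i : `|x i ord0| <= `|x|.
Proof. by apply: (cV_norm_le x (normr_ge0 x)).1. Qed.

Section isometry.
Variables (n : nat) (A : 'M[R]_n).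
Hypothesis iso : forall x : 'cV[R]_n, `|A *m x| = `|x|.

Let row_sum i : \sum_j `|A i j| <= 1.
Proof.
(* On the sign vector of row [i], coordinate [i] of [A *m x] is the absolute sum of that row. *)
pose x : 'cV[R]_n := \col_j Num.sg (A i j).
have x1 : `|x| <= 1.
  apply/cV_norm_le => // j; rewrite mxE; have [->|a0] := eqVneq (A i j) 0.
    by rewrite sgr0 normr0.
  by rewrite normr_sg a0.
apply: le_trans x1; rewrite -iso; apply: le_trans (cV_coord_le _ i).
rewrite mxE; apply: le_trans (ler_norm _); apply: ler_sum => j _.
by rewrite mxE mulrC -normrEsg.
Qed.

Let col_unit j : exists i, `|A i j| = 1.
Proof.
pose ej : 'cV[R]_n := delta_mx j ord0.
have e1 : `|ej| = 1.
  apply/eqP; rewrite eq_le; apply/andP; split.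
    apply/cV_norm_le => // i; rewrite mxE eqxx andbT.
    by case: (_ == _); rewrite ?normr1 ?normr0.
  by apply: le_trans (cV_coord_le _ j); rewrite mxE !eqxx normr1.
apply: contrapT => /forallNP h.
have : `|A *m ej| = 1 by rewrite iso.
have le1 i : `|A i j| <= 1.
  apply: le_trans (row_sum i); rewrite (bigD1 j)//= lerDl; exact: sumr_ge0.
have AE i : (A *m ej) i ord0 = A i j by rewrite -colE mxE.
pose c := \big[Num.max/0]_i `|A i j|.
have c1 : c < 1.
  apply/bigmax_ltP; split=> // i _; rewrite lt_neqAle le1 andbT; apply/eqP; exact: h.
have c0 : 0 <= c by exact: bigmax_ge_id.
have : `|A *m ej| <= c.
  by apply/cV_norm_le => // i; rewrite AE; exact: le_bigmax.
by move=> h1 h2; rewrite h2 in h1; lra.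
Qed.

(** Every column has an entry of modulus 1, since basis vectors keep their norm; absolute row sums
    are at most 1, so the rest of that row is 0. Hence different columns use different rows. *)
Lemma isometry_signed_perm : exists (s : {perm 'I_n}) (e : 'I_n -> bool),
  A = \matrix_(i, j) (if i == s j then (-1) ^+ e j else 0).
Proof.
have /choice[s hs] := col_unit.
have row0 i j k : `|A i j| = 1 -> k != j -> A i k = 0.
  move=> Aij kj; have := row_sum i.
  rewrite (bigD1 j)//= (bigD1 k)//= Aij => h; apply/eqP; rewrite -normr_eq0 eq_le normr_ge0 andbT.
  have : 0 <= \sum_(l | (l != j) && (l != k)) `|A i l| by apply: sumr_ge0.
  by lra.
have sinj : injective s.
  move=> j k sjk; apply: contrapT => /eqP jk.
  have := row0 _ _ _ (hs k) jk; rewrite -sjk => h; have := hs j.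
  by rewrite h normr0 => /eqP; rewrite eq_sym oner_eq0.
exists (perm sinj), (fun j => A (s j) j < 0); apply/matrixP => i j; rewrite mxE permE.
case: eqP => [->|/eqP ij].
  have := hs j; case: (ltP (A (s j) j) 0) => h; rewrite ?expr1 ?expr0.
    by rewrite ltr0_norm// => <-; rewrite opprK.
  by rewrite ger0_norm.
have [k kE] : exists k, i = s k.
  by exists ((perm sinj)^-1 i)%g; rewrite -permE permKV.
rewrite kE in ij *; apply: (row0 _ k); first exact: hs.
by apply: contra_neq ij => ->.
Qed.

End isometry.

(** A tile set is symmetric about its center. Two centers would give two point reflections, whose
    composition is a translation preserving the set; iterating it contradicts boundedness unless it
    is trivial. *)
Lemma tile_set_center d (T1 T2 : 'M[R]_d * 'cV[R]_d) : is_tile T1 ->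
  tile_set T1 = tile_set T2 -> T1.2 = T2.2.
Proof.
move=> u1 E; pose c := T2.2 - T1.2.
have sym (T : 'M[R]_d * 'cV[R]_d) z : tile_set T z -> tile_set T (T.2 + T.2 - z).
  rewrite /tile_set /=; have -> : T.2 + T.2 - z - T.2 = - (z - T.2).
    by apply/matrixP => a b; rewrite !mxE; ring.
  by rewrite mulmxN normrN.
have shift z : tile_set T1 z -> tile_set T1 (z + (c + c)).
  move=> /sym; rewrite E => /sym; rewrite /c.
  have -> : T2.2 + T2.2 - (T1.2 + T1.2 - z) = z + (T2.2 - T1.2 + (T2.2 - T1.2)) => //.
  by apply/matrixP => a b; rewrite !mxE; ring.
have iter n : tile_set T1 (T1.2 + (c + c) *+ n).
  elim: n => [|n IH]; first by rewrite mulr0n addr0 /tile_set /= subrr mulmx0 normr0 invr_ge0.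
  by rewrite mulrSr addrA; exact: shift.
pose v := invmx T1.1 *m (c + c).
have vn n : `|v| * n%:R <= 2^-1.
  have := iter n; rewrite /tile_set /= addrC addKr.
  rewrite (_ : invmx T1.1 *m ((c + c) *+ n) = v *+ n); first by rewrite normrMn mulr_natr.
  by rewrite -scaler_nat -scalemxAr scaler_nat.
have v0 : v = 0.
  apply/eqP; rewrite -normr_eq0; apply: contraT => vN0.
  have vp : 0 < `|v| by rewrite lt_def vN0 normr_ge0.
  have := vn (Num.truncn (`|v|^-1)).+1.
  have : 1 < `|v| * (Num.truncn (`|v|^-1)).+1%:R.
    by rewrite mulrC -ltr_pdivrMr// mul1r; exact: truncnS_gt.
  by lra.
have cc : c + c = 0 by rewrite -(mulKVmx u1 (c + c)) -/v v0 mulmx0.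
have c0 : c = 0.
  apply/matrixP => i j; move/matrixP: cc => /(_ i j); rewrite !mxE; lra.
by apply/eqP; rewrite eq_sym -subr_eq0; apply/eqP; exact: c0.
Qed.

(** With equal centers, [invmx T1.1 *m T2.1] preserves the ball of radius [1/2] in both directions,
    and by homogeneity every ball of positive radius. *)
Lemma tile_set_isometry d (T1 T2 : 'M[R]_d * 'cV[R]_d) : is_tile T1 -> is_tile T2 ->
  tile_set T1 = tile_set T2 -> forall x : 'cV[R]_d, `|invmx T1.1 *m T2.1 *m x| = `|x|.
Proof.
move=> u1 u2 E; have cE := tile_set_center u1 E.
pose A := invmx T1.1 *m T2.1; rewrite -/A.
have half (x : 'cV[R]_d) : `|x| <= 2^-1 <-> `|A *m x| <= 2^-1.
  have e2 : `|x| <= 2^-1 <-> tile_set T2 (T2.2 + T2.1 *m x).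
    by rewrite /tile_set /= addrC addKr mulKmx.
  have e1 : `|A *m x| <= 2^-1 <-> tile_set T1 (T2.2 + T2.1 *m x).
    by rewrite /tile_set /= -cE addrC addKr mulmxA.
  by rewrite e2 e1 E.
have scal (x : 'cV[R]_d) (t : R) : 0 < t -> (`|x| <= t) <-> (`|A *m x| <= t).
  move=> t0; have := half ((2 * t)^-1 *: x); rewrite -scalemxAr !normrZ.
  have t2 : 0 < 2 * t by rewrite mulr_gt0.
  have hh a : ((2 * t)^-1 * a <= 2^-1) = (a <= t).
    by rewrite mulrC ler_pdivrMr// mulrA mulVf// mul1r.
  by rewrite gtr0_norm ?invr_gt0// !hh.
move=> x; apply/eqP; rewrite eq_le; apply/andP; split.
  apply/ler_addgt0Pr => e e0; apply/(scal x _ _).1; last by rewrite lerDl ltW.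
  by rewrite ltr_wpDl.
apply/ler_addgt0Pr => e e0; apply/(scal x _ _).2; last by rewrite lerDl ltW.
by rewrite ltr_wpDl.
Qed.

(** The two matrices differ by a signed permutation [A], of determinant 1 or -1; a product of equal
    even factors is invariant under [A], and [A] preserves the integer lattice. *)
Lemma packets_tile_set_sub d (h : R -> R) (T1 T2 : 'M[R]_d * 'cV[R]_d) :
  (forall x, h (- x) = h x) -> is_tile T1 -> is_tile T2 -> tile_set T1 = tile_set T2 ->
  let etaC := fun x : 'cV[R]_d => (\prod_i h (x i ord0))%:C in
  [set packet etaC T2 (of_Zd k) | k in [set: 'cV[int]_d]] `<=`
  [set packet etaC T1 (of_Zd k) | k in [set: 'cV[int]_d]].
Proof.
move=> hN u1 u2 E etaC _ [k _ <-].
have [s [e AE]] := isometry_signed_perm (tile_set_isometry u1 u2 E).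
set A := invmx T1.1 *m T2.1 in AE.
have D2 : T2.1 = T1.1 *m A by rewrite mulKVmx.
have AA : A^T *m A = 1%:M.
  apply/matrixP => i j; rewrite mxE (bigD1 (s i))//= big1 ?addr0; last first.
    by move=> l ls; rewrite [A^T _ _]mxE AE mxE (negbTE ls) mul0r.
  rewrite [A^T _ _]mxE AE !mxE eqxx (inj_eq perm_inj).
  case: eqP => [->|_]; last by rewrite mulr0.
  by rewrite -expr2 sqrr_sign.
have detA : `|\det A| = 1.
  have := congr1 determinant AA; rewrite det_mulmx det_tr det1 => dA.
  by apply/eqP; rewrite -(@eqrXn2 _ 2)// expr1n -normrX expr2 dA normr1.
(* This integer vector is the image of [k] under [A]. *)
exists (\col_i ((-1) ^+ e ((s^-1)%g i) * k ((s^-1)%g i) ord0)) => //.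
apply/funext => x; rewrite /packet (tile_set_center u1 E) D2 det_mulmx normrM detA mulr1.
congr (_ * _); rewrite /etaC trmx_mul -mulmxA; set y := T1.1^T *m x; move: y => y; congr (_%:C).
rewrite (reindex_inj (@perm_inj _ s)) /=; apply: eq_bigr => j _.
rewrite !mxE permK (bigD1 (s j))//= big1 ?addr0; last first.
  by move=> l ls; rewrite [A^T _ _]mxE AE mxE (negbTE ls) mul0r.
rewrite [A^T _ _]mxE AE mxE eqxx rmorphM rmorphXn rmorphN1 /=.
case: (e j); rewrite ?expr1 ?expr0 ?mul1r ?mulN1r//.
by rewrite -[RHS]hN opprD opprK.
Qed.

Lemma packets_tile_set d (h : R -> R) (T1 T2 : 'M[R]_d * 'cV[R]_d) :
  (forall x, h (- x) = h x) -> is_tile T1 -> is_tile T2 -> tile_set T1 = tile_set T2 ->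
  let etaC := fun x : 'cV[R]_d => (\prod_i h (x i ord0))%:C in
  [set packet etaC T1 (of_Zd k) | k in [set: 'cV[int]_d]] =
  [set packet etaC T2 (of_Zd k) | k in [set: 'cV[int]_d]].
Proof.
by move=> hN u1 u2 E etaC; apply/seteqP; split; exact: packets_tile_set_sub.
Qed.

End tile_sets.

(** * Counting the tiles near a point *)

Section layering.
Context {R : realType}.

Lemma dyadic_layer (z : R) : exists j, z <= 2 ^+ j.
Proof.
exists (Num.truncn z).+1; have [z0|z0] := leP 0 z; last first.
  by apply: le_trans (ltW z0) _; rewrite exprn_ge0.
apply: le_trans (ltW (truncnS_gt _)) _.
by rewrite -natrX ler_nat ltnW// ltn_expl.
Qed.

(** Sort the indices by the least [j] with [rho i <= 2 ^+ j]. Minimality forces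
    [2 ^+ (j - 1) < rho i] when [j > 0], so terms of layer [j] are at most [b j], and there are at
    most [N j] of them. Lattice sums and tiling sums are both of this kind. *)
Lemma layered_sum (I : eqType) (r : seq I) (rho v : I -> R) (b N : nat -> R) (M : R) :
  uniq r -> (forall j, 0 <= b j) ->
  (forall i, i \in r -> v i <= b 0%N) ->
  (forall i j, i \in r -> 2 ^+ j <= rho i -> v i <= b j.+1) ->
  (forall j (s : seq I), uniq s -> {subset s <= r} -> (forall i, i \in s -> rho i <= 2 ^+ j) ->
     (size s)%:R <= N j) ->
  (forall J, \sum_(j < J) N j * b j <= M) -> \sum_(i <- r) v i <= M.
Proof.
move=> ur b0 v0 vb sN NM.
pose ex i := dyadic_layer (rho i); pose l i := ex_minn (ex i).
have lP i : rho i <= 2 ^+ l i by rewrite /l; case: ex_minnP.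
have vl i : i \in r -> v i <= b (l i).
  move=> ir; rewrite /l; case: ex_minnP => -[|n] _ hmin; first exact: v0.
  apply: vb => //; rewrite leNgt; apply/negP => /ltW /hmin; by rewrite ltnn.
pose J := (\sum_(i <- r) (l i).+1)%N.
have lJ i : i \in r -> (l i < J)%N.
  by move=> ir; rewrite /J (big_rem _ ir) /= leq_addr.
apply: le_trans (NM J).
apply: (@le_trans _ _ (\sum_(i <- r) \sum_(j < J | l i == j) b j)).
  rewrite big_seq [leRHS]big_seq; apply: ler_sum => i ir.
  rewrite (big_pred1 (Ordinal (lJ i ir))); first exact: vl.
  by move=> j; apply/eqP/eqP => [h|-> //]; exact: val_inj.
rewrite (exchange_big_dep predT)//=; apply: ler_sum => j _.
rewrite -big_filter big_const_seq count_predT iter_addr_0 -mulr_natl ler_wpM2r//.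
apply: sN; first exact: filter_uniq.
  by move=> i; rewrite mem_filter => /andP[].
by move=> i; rewrite mem_filter => /andP[/eqP <- _].
Qed.

Lemma sum_half_pow J : \sum_(j < J) 2 ^- j <= 2 :> R.
Proof.
suff -> : \sum_(j < J) 2 ^- j = 2 - 2 * 2 ^- J :> R.
  by rewrite lerBlDr lerDl mulr_ge0// invr_ge0 exprn_ge0.
elim: J => [|J IH]; first by rewrite big_ord0 expr0; field.
rewrite big_ord_recr /= IH exprS; field.
by rewrite expf_neq0//.
Qed.

(** In each coordinate the integers allowed start at a ceiling [a i] and number at most
    [2 ^+ j.+1 + 1]; subtracting [a] embeds the list into a finite function space. *)
Lemma size_lattice_ball d (z : 'cV[R]_d) (s : seq 'cV[int]_d) j : uniq s ->
  (forall m, m \in s -> `|z + of_Zd m| <= 2 ^+ j) ->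
  (size s)%:R <= (2 ^+ j.+1 + 1) ^+ d :> R.
Proof.
move=> us hs.
pose a (i : 'I_d) : int := Num.ceil (- z i ord0 - 2 ^+ j).
have ha m i : m \in s -> 0 <= m i ord0 - a i /\ m i ord0 - a i <= 2 ^+ j.+1.
  move=> /hs /(cV_norm_le _ (exprn_ge0 _ (ler0n R 2))) /(_ i); rewrite !mxE ler_norml => /andP[h1 h2].
  have c1 : a i <= m i ord0 by rewrite /a ceil_le_int_tmp; lra.
  split; first by rewrite subr_ge0.
  have c2 : - z i ord0 - 2 ^+ j <= (a i)%:~R by exact: ceil_ge.
  rewrite -(ler_int R) rmorphB rmorphXn /= exprS; lra.
pose f (m : 'cV[int]_d) : {ffun 'I_d -> 'I_(2 ^ j.+1).+1} := [ffun i => inord `|m i ord0 - a i|].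
have finj : {in s &, injective f}.
  move=> m1 m2 h1 h2 /ffunP E; apply/matrixP => i k; rewrite (ord1 k).
  have [p1 q1] := ha _ i h1; have [p2 q2] := ha _ i h2.
  have := congr1 val (E i); rewrite !ffunE /= !inordK; last 2 first.
  - by rewrite ltnS -lez_nat gez0_abs// -natz natrX.
  - by rewrite ltnS -lez_nat gez0_abs// -natz natrX.
  by move/(congr1 Posz); rewrite !gez0_abs// => /addIr.
have : (size (map f s) <= #|{ffun 'I_d -> 'I_(2 ^ j.+1).+1}|)%N.
  by rewrite -(card_uniqP _) ?max_card// map_inj_in_uniq.
rewrite size_map card_ffun !card_ord => h.
by apply: (@le_trans _ _ ((2 ^ j.+1).+1 ^ d)%:R); rewrite ?ler_nat// natrX -natr1 natrX.
Qed.

End layering.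

Section tile_geometry.
Context {R : realType}.
Variable d : nat.
Local Notation leb := (lebesgue_cV R d).
Implicit Types (T B : 'M[R]_d * 'cV[R]_d).

Definition tcoord T (xi : 'cV[R]_d) : 'cV[R]_d := invmx T.1 *m (xi - T.2).

Lemma tile_setE T xi : tile_set T xi = (`|tcoord T xi| <= 2^-1) :> Prop.
Proof. by []. Qed.

Lemma tile_scaleE T (t : R) xi : is_tile T -> 0 < t ->
  tile_set (tile_scale t T) xi <-> `|tcoord T xi| <= t / 2.
Proof.
move=> uT t0; rewrite /tile_set /tile_scale /= invmxZ ?unitfE ?gt_eqF//.
  rewrite -scalemxAl normrZ gtr0_norm ?invr_gt0// -/(tcoord T xi).
  by rewrite mulrC ler_pdivrMr// [t / 2]mulrC.
by rewrite unitmxZ ?unitfE ?gt_eqF.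
Qed.

Lemma measurable_tcoord T : measurable_fun setT (tcoord T).
Proof.
apply: (measurable_fun_eq (f := fun x => invmx T.1 *m x + - (invmx T.1 *m T.2))).
  by move=> x; rewrite /tcoord mulmxBr.
exact: measurable_affine_cV.
Qed.

Lemma measurable_cV_norm : measurable_fun setT (fun x : 'cV[R]_d => `|x|).
Proof.
rewrite (_ : (fun x => _) = fun x : 'cV[R]_d => \big[Num.max/0]_i `|x i ord0|).
  elim: (index_enum _) => [|i r IH].
    by rewrite (_ : (fun x => _) = fun=> 0)//; apply/funext => x; rewrite big_nil.
  rewrite (_ : (fun x => _) = fun x : 'cV[R]_d =>
      Num.max `|x i ord0| (\big[Num.max/0]_(j <- r) `|x j ord0|)); last first.
    by apply/funext => x; rewrite big_cons.
  apply: measurable_maxr => //.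
  by apply: measurableT_comp => //; exact: measurable_coord.
apply/funext => x; apply/eqP; rewrite eq_le; apply/andP; split.
  apply/cV_norm_le; [exact: bigmax_ge_id|move=> i; exact: le_bigmax].
by apply/bigmax_leP; split=> // i _; exact: cV_coord_le.
Qed.

Lemma measurable_ball T (c : R) : measurable [set xi : 'cV[R]_d | `|tcoord T xi| <= c].
Proof.
have -> : [set xi : 'cV[R]_d | `|tcoord T xi| <= c] =
    (fun xi => `|tcoord T xi|) @^-1` [set` `]-oo, c]].
  by apply/seteqP; split => x /=; rewrite in_itv.
rewrite -[X in measurable X]setTI.
apply: (measurableT_comp measurable_cV_norm (measurable_tcoord T)) => //.
Qed.

Lemma lebesgue_ball T (c : R) : is_tile T -> 0 <= c ->
  leb [set xi : 'cV[R]_d | `|tcoord T xi| <= c] = (`|\det T.1| * (2 * c) ^+ d)%:E.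
Proof.
move=> uT c0; set S := [set xi | _].
have mS : measurable S by exact: measurable_ball.
transitivity (\int[leb]_x (\1_S x)%:E)%E; first by rewrite integral_indic// setIT.
rewrite -(ge0_integral_affine T.2 uT)//; last first.
  by apply/measurable_EFinP; apply: measurable_indic.
rewrite EFinM; congr (_ * _)%E.
pose S' : set 'cV[R]_d := [set x | forall i, `[- c, c]%classic (x i ord0)].
have mS' : measurable S' by apply: (measurable_box (A := fun=> `[- c, c]%classic)).
transitivity (\int[leb]_x (\1_S' x)%:E)%E.
  apply: eq_integral => x _; rewrite !indicE; congr (nat_of_bool _)%:R%:E.
  apply/idP/idP; rewrite !inE /S /S' /= /tcoord addrK mulKmx//.
    by move=> /(cV_norm_le _ c0) h i; rewrite in_itv /= -ler_norml.
  by move=> h; apply/(cV_norm_le _ c0) => i; have := h i; rewrite in_itv /= -ler_norml.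
rewrite integral_indic// setIT.
rewrite [LHS](lebesgue_cV_box (A := fun=> `[- c, c]%classic))//.
have -> : (\prod_(i < d) (@lebesgue_measure R (`[(- c)%R, c%R]%classic)) = (\prod_(i < d) (2 * c))%:E)%E.
  elim: d => [|n IH]; first by rewrite !big_ord0.
  rewrite !big_ord_recl IH EFinM; congr (_ * _)%E.
  have := @lebesgue_measure_itv R `[(- c)%R, c]; rewrite /= lte_fin => ->.
  case: ltP => h; first by rewrite -EFinB; congr EFin; ring.
  by congr EFin; lra.
by rewrite prodr_const card_ord.
Qed.

Lemma opnorm_has_sup (M : 'M[R]_d) :
  has_sup [set `|M *m y| | y in [set y : 'cV[R]_d | `|y| <= 1]].
Proof.
split; first by exists `|M *m (0 : 'cV[R]_d)|; exists 0 => //=; rewrite normr0.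
exists (\sum_i \sum_j `|M i j|) => _ [y y1 <-].
have s0 i : 0 <= \sum_j `|M i j| by apply: sumr_ge0.
apply/cV_norm_le; first exact: sumr_ge0.
move=> i; rewrite mxE; apply: le_trans (ler_norm_sum _ _ _) _.
apply: (@le_trans _ _ (\sum_j `|M i j|)).
  apply: ler_sum => j _; rewrite normrM ler_piMr//.
  exact: le_trans (cV_coord_le _ _) y1.
by rewrite [leRHS](bigD1 i)//= lerDl; apply: sumr_ge0.
Qed.

Lemma opnorm_ge0 (M : 'M[R]_d) : 0 <= opnorm M.
Proof.
apply: ub_le_sup; first by case: (opnorm_has_sup M).
by exists 0; rewrite /= ?mulmx0 normr0.
Qed.

Lemma opnorm_ub (M : 'M[R]_d) (x : 'cV[R]_d) : `|M *m x| <= opnorm M * `|x|.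
Proof.
have [->|x0] := eqVneq x 0; first by rewrite mulmx0 !normr0 mulr0.
have xp : 0 < `|x| by rewrite normr_gt0.
rewrite -ler_pdivrMr//; apply: ub_le_sup; first by case: (opnorm_has_sup M).
exists (`|x|^-1 *: x) => /=.
  by rewrite normrZ normfV normr_id mulVf// gt_eqF.
by rewrite -scalemxAr normrZ normfV normr_id mulrC.
Qed.

Lemma opnorm_tile_dist B T (C : R) :
  tile_dist (tile_center B) (tile_center T) <= C ->
  opnorm (invmx B.1 *m T.1) <= 2 `^ C /\ opnorm (invmx T.1 *m B.1) <= 2 `^ C.
Proof.
rewrite /tile_dist /tile_center /=; set M := Num.max _ _ => h.
have l2 : 0 < ln 2 :> R by rewrite ln_gt0//; lra.
suff : M <= 2 `^ C by rewrite ge_max => /andP[].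
(* For [M <= 0] the default value of [ln] carries no information, but the bound is then
   immediate. *)
have [M0|M0] := leP M 0; first exact: le_trans M0 (powR_ge0 _ _).
move: h; rewrite ler_pdivrMr// -ln_powR => h.
by rewrite -ler_ln// posrE powR_gt0.
Qed.

(* Comparability of shapes, stated so that it only involves the origin-centered
   tile set of [T]. *)
Definition comparable_to B (q : R) T :=
  (forall x, tile_set (tile_center T) x -> `|invmx B.1 *m x| <= q / 2) /\
  (forall x, `|invmx B.1 *m x| <= (2 * q)^-1 -> tile_set (tile_center T) x).

Lemma tile_dist_comparable B T (C : R) : is_tile B -> is_tile T ->
  tile_dist (tile_center B) (tile_center T) <= C -> comparable_to B (2 `^ C) T.
Proof.
move=> uB uT /opnorm_tile_dist[h1 h2]; have q0 : 0 < 2 `^ C :> R by rewrite powR_gt0.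
split => x; rewrite /tile_set /tile_center /= subr0 => hx.
  have -> : invmx B.1 *m x = invmx B.1 *m T.1 *m (invmx T.1 *m x).
    by rewrite -mulmxA mulKVmx.
  by apply: le_trans (opnorm_ub _ _) _; apply: ler_pM => //; exact: opnorm_ge0.
have -> : invmx T.1 *m x = invmx T.1 *m B.1 *m (invmx B.1 *m x).
  by rewrite -mulmxA mulKVmx.
apply: le_trans (opnorm_ub _ _) _.
have -> : 2^-1 = 2 `^ C * (2 * 2 `^ C)^-1 :> R by field; rewrite gt_eqF.
by apply: ler_pM => //; exact: opnorm_ge0.
Qed.

End tile_geometry.

Section counting.
Context {R : realType}.
Variable d : nat.
Local Notation leb := (lebesgue_cV R d).

(** Since [counting] is [+oo] on infinite sets, a finite bound forces [A] to be finite. *)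
Lemma counting_ge (I : choiceType) (A : set I) (r : seq I) (c : R) : uniq r ->
  (forall i, i \in r -> A i) -> (counting A <= c%:E)%E -> (size r)%:R <= c.
Proof.
move=> ur rA; rewrite /counting; case: ifPn => [/asboolP fA|_]; last by rewrite leye_eq.
rewrite lee_fin; apply: le_trans; rewrite ler_nat.
apply: uniq_leq_size => // i ir; rewrite in_fset_set// inE; exact: rA.
Qed.

Variables (C theta : R) (K : R -> R) (Ts : set ('M[R]_d * 'cV[R]_d)).
Hypotheses (C1 : 1 < C) (th0 : 0 < theta) (th1 : theta < 1)
  (aT : admissible_tiling C theta K Ts).

Let q : R := 2 `^ C.
Let q0 : 0 < q. Proof. exact: powR_gt0. Qed.

Definition good_point (xi : 'cV[R]_d) :=
  (exists2 T, Ts T & tile_set (tile_scale (1 - theta) T) xi) /\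
  (counting [set T | Ts T /\ tile_set T xi] <= C%:E)%E.

Lemma ae_good_point : {ae leb, forall xi, good_point xi}.
Proof. by case: aT => _ h _. Qed.

Let Ttile T : Ts T -> is_tile T. Proof. by case: aT => h _ _; exact: h. Qed.

Lemma good_point_near xi : good_point xi ->
  exists2 T, Ts T & `|tcoord T xi| <= (1 - theta) / 2.
Proof.
move=> [[T TT hT] _]; exists T => //.
by apply: (tile_scaleE (t := 1 - theta) xi (Ttile TT) _).1; rewrite ?subr_gt0.
Qed.

Lemma good_point_mult xi (r : seq ('M[R]_d * 'cV[R]_d)) : good_point xi ->
  uniq r -> (forall T, T \in r -> Ts T /\ `|tcoord T xi| <= 2^-1) -> (size r)%:R <= C.
Proof. by move=> [_ hc] ur rT; apply: (counting_ge ur _ hc) => T /rT. Qed.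

(* Comparable tiles that all come within [t / 2] of [xi] have comparable volumes
   and lie in a common box, which they cover at most [C] times. *)
Lemma comparable_count B xi t (r : seq ('M[R]_d * 'cV[R]_d)) : is_tile B -> 1 <= t ->
  uniq r ->
  (forall T, T \in r -> [/\ Ts T, `|tcoord T xi| <= t / 2 & comparable_to B q T]) ->
  (size r)%:R <= C * (q ^+ 2 * (t + 1)) ^+ d.
Proof.
move=> uB t1 ur rT; have C0 : 0 <= C by rewrite (le_trans ler01 (ltW C1)).
have detB : 0 < `|\det B.1| by rewrite normr_gt0; move: uB; rewrite /is_tile unitmxE unitfE.
pose Bx : 'M[R]_d * 'cV[R]_d := (B.1, xi).
pose box := [set eta : 'cV[R]_d | `|tcoord Bx eta| <= q * (t + 1) / 2].
have c0 : 0 <= q * (t + 1) / 2 by rewrite divr_ge0// mulr_ge0 ?(ltW q0)//; lra.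
have vbox : leb box = (`|\det B.1| * (2 * (q * (t + 1) / 2)) ^+ d)%:E by exact: lebesgue_ball.
pose S T := [set eta : 'cV[R]_d | `|tcoord T eta| <= 2^-1].
have mS T : measurable (S T) by exact: measurable_ball.
have mbox : measurable box by exact: measurable_ball.
(* Once centered, the tile contains the set of shape [B] shrunk by [q], whose volume is the
   left-hand side. *)
have vS T : T \in r -> ((`|\det B.1| / q ^+ d)%:E <= leb (S T))%E.
  move=> /rT[TT _ [_ h2]]; rewrite lebesgue_ball//; last exact: Ttile.
  pose T0 := tile_center T; pose B0 := tile_center B.
  have -> : (`|\det T.1| * (2 * 2^-1) ^+ d)%:E = leb [set eta : 'cV[R]_d | `|tcoord T0 eta| <= 2^-1].
    have uT0 : is_tile T0 by exact: Ttile TT.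
    by rewrite lebesgue_ball ?invr_ge0.
  have -> : (`|\det B.1| / q ^+ d)%:E = leb [set eta : 'cV[R]_d | `|tcoord B0 eta| <= (2 * q)^-1].
    rewrite lebesgue_ball// ?invr_ge0 ?mulr_ge0 ?(ltW q0)//.
    by congr (_ * _)%:E; rewrite -exprVn; congr (_ ^+ _); field; rewrite gt_eqF.
  apply: le_measure; rewrite ?inE; [exact: measurable_ball|exact: measurable_ball|].
  by move=> x /= hx; apply: h2; move: hx; rewrite /tcoord /= subr0.
(* In the coordinates of [T], [x - xi] has norm at most [(t + 1) / 2]; dividing by [t + 1] brings it
   into the centered tile, where comparability with [B] applies. *)
have Sbox T x : T \in r -> S T x -> box x.
  move=> /rT[TT hxi [h1 _]] hx; rewrite /box /= /tcoord /=.
  have uT := Ttile TT.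
  have -> : x - xi = T.1 *m (tcoord T x - tcoord T xi).
    rewrite mulmxBr !mulKVmx//; apply/matrixP => i j; rewrite !mxE; ring.
  set v := tcoord T x - tcoord T xi.
  have hv : `|v| <= (t + 1) / 2.
    by apply: le_trans (ler_normB _ _) _; move: hx; rewrite /S /=; lra.
  have tp : 0 < t + 1 by lra.
  have := h1 (T.1 *m ((t + 1)^-1 *: v)); rewrite /tile_set /= subr0 mulKmx//.
  rewrite normrZ gtr0_norm ?invr_gt0// mulrC ler_pdivrMr// mulrC => /(_ hv).
  rewrite -scalemxAr -scalemxAr normrZ gtr0_norm ?invr_gt0// mulrC ler_pdivrMr//.
  by rewrite mulrAC.
have lhs : (((size r)%:R * (`|\det B.1| / q ^+ d))%:E <= \sum_(T <- r) leb (S T))%E.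
  have -> : (((size r)%:R * (`|\det B.1| / q ^+ d))%:E =
      \sum_(T <- r) (`|\det B.1| / q ^+ d)%:E)%E.
    by rewrite sumEFin big_const_seq count_predT iter_addr_0 mulr_natl.
  by rewrite big_seq [leRHS]big_seq; apply: lee_sum => T /vS.
have mid : (\sum_(T <- r) leb (S T) <= C%:E * leb box)%E.
  have -> : (\sum_(T <- r) leb (S T) = \int[leb]_x \sum_(T <- r) (\1_(S T) x)%:E)%E.
    rewrite ge0_integral_sum//; last first.
      by move=> T; apply/measurable_EFinP; exact: measurable_indic.
    by apply: eq_bigr => T _; rewrite integral_indic// setIT.
  rewrite -[X in (_ * leb X)%E]setIT -integral_indic//.
  rewrite -ge0_integralZl//; last by apply/measurable_EFinP; exact: measurable_indic.
  apply: ae_ge0_le_integral => //.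
  - by move=> x _; apply: sume_ge0 => T _; rewrite lee_fin indicE.
  - by apply: emeasurable_sum => T; apply/measurable_EFinP; exact: measurable_indic.
  - by move=> x _; rewrite mule_ge0// lee_fin ?indicE.
  - by apply: measurable_funeM; apply/measurable_EFinP; exact: measurable_indic.
  have := ae_good_point; apply: filterS => x gx _.
  rewrite sumEFin -EFinM lee_fin.
  have -> : \sum_(T <- r) \1_(S T) x = (size [seq T <- r | x \in S T])%:R :> R.
    rewrite size_filter -sum1_count natr_sum [RHS]big_mkcond; apply: eq_bigr => T _.
    by rewrite indicE; case: (_ \in _).
  have [hx|hx] := boolP (x \in box).
    rewrite indicE hx mulr1; apply: (good_point_mult gx); first exact: filter_uniq.
    by move=> T; rewrite mem_filter => /andP[/set_mem h /rT[]].
  rewrite indicE (negbTE hx) mulr0 (_ : [seq T <- r | x \in S T] = [::])//.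
  apply/eqP; rewrite -(negbK (_ == _)) -has_filter; apply/hasP => -[T Tr]; rewrite inE => h.
  by move: hx; rewrite notin_setE; apply; exact: Sbox h.
have := le_trans lhs mid; rewrite vbox -EFinM lee_fin.
have qd : 0 < q ^+ d by rewrite exprn_gt0.
rewrite mulrA ler_pdivrMr//.
have -> : C * (`|\det B.1| * (2 * (q * (t + 1) / 2)) ^+ d) * q ^+ d =
    C * (q ^+ 2 * (t + 1)) ^+ d * `|\det B.1|.
  have -> : 2 * (q * (t + 1) / 2) = q * (t + 1) by field.
  have -> : q ^+ 2 * (t + 1) = q * (t + 1) * q by ring.
  by rewrite [in RHS]exprMn; ring.
by rewrite ler_pM2r.
Qed.

(** If [rho T <= t], the shape of [T] lies in one of the [K t] balls. If [rho T > t], then [xi] lies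
    in the dilate of [T] by [rho T] and in the tile [T0] covering [xi], so regularity makes [T]
    comparable to [T0]. This one extra class is the [1] in [1 + K t]. *)
Lemma tile_count xi t (r : seq ('M[R]_d * 'cV[R]_d)) : good_point xi -> 1 <= t -> uniq r ->
  (forall T, T \in r -> Ts T /\ `|tcoord T xi| <= t / 2) ->
  (size r)%:R <= C * (q ^+ 2 * (t + 1)) ^+ d * (1 + K t).
Proof.
move=> gx t1 ur rT; have [T0 TT0 hT0] := good_point_near gx.
have [_ _ [rho [rho1 hreg hcov]]] := aT.
have [s [sK su scov]] := hcov t t1.
set N := C * (q ^+ 2 * (t + 1)) ^+ d.
have N0 : 0 <= N.
  have tp : 0 <= t + 1 by lra.
  by rewrite /N mulr_ge0 ?(le_trans ler01 (ltW C1))// exprn_ge0// mulr_ge0// exprn_ge0 ?(ltW q0).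
pose grp B := [seq T <- r | `[< comparable_to B q T >]].
have hgrp B : is_tile B -> (size (grp B))%:R <= N.
  move=> uB; apply: (comparable_count (xi := xi) uB t1); first exact: filter_uniq.
  by move=> T; rewrite mem_filter => /andP[/asboolP h /rT[]].
have cover T : T \in r -> exists2 B, B \in T0 :: s & T \in grp B.
  move=> Tr; have [TT hT] := rT _ Tr; have uT := Ttile TT.
  have [h|h] := leP (rho T) t.
    have [|B Bs [T' [uT' dT'] ET']] := scov (tile_set (tile_center T)); first by exists T.
    exists B; first by rewrite in_cons (Bs : B \in s) orbT.
    rewrite mem_filter Tr andbT; apply/asboolP.
    have [h1 h2] := tile_dist_comparable (su _ Bs) uT' dT'.
    by rewrite /comparable_to -ET'; split.
  exists T0; first exact: mem_head.
  rewrite mem_filter Tr andbT; apply/asboolP.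
  have uT0 := Ttile TT0.
  apply: tile_dist_comparable => //.
  have : tile_dist (tile_center T) (tile_center T0) <= C.
    apply: hreg => //; exists xi; split.
      by rewrite tile_setE; apply: le_trans hT0 _; have := th0; lra.
    have rp : 0 < rho T by apply: lt_le_trans (rho1 _ TT); lra.
    by apply/tile_scaleE => //; apply: le_trans hT _; rewrite ler_pM2r// ltW.
  by rewrite /tile_dist maxC.
apply: (@le_trans _ _ (\sum_(B <- T0 :: s) (size (grp B))%:R)).
  rewrite -natr_sum ler_nat -[size r]/(size r).
  have -> : size r = \sum_(T <- r) 1%N by rewrite sum1_size.
  under [leqRHS]eq_bigr do rewrite size_filter -sum1_count big_mkcond.
  rewrite exchange_big /= big_seq [leqRHS]big_seq; apply: leq_sum => T Tr.
  have [B Bs] := cover T Tr; rewrite mem_filter => /andP[h _].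
  by rewrite (big_rem _ Bs) /= h leq_addr.
rewrite big_cons mulrDr mulr1 lerD//; first by apply: hgrp; exact: Ttile.
apply: (@le_trans _ _ (\sum_(B <- s) N)).
  by rewrite big_seq [leRHS]big_seq; apply: ler_sum => B Bs; apply: hgrp; exact: su.
by rewrite big_const_seq count_predT iter_addr_0 -mulr_natr ler_wpM2l.
Qed.

Lemma exists_good_point : exists xi, good_point xi.
Proof.
have [Z [mZ Z0 hZ]] := ae_good_point.
apply: contrapT => /forallNP h.
have : (leb (@unit_cube R d) <= leb Z)%E.
  apply: le_measure; rewrite ?inE//; first exact: measurable_unit_cube.
  by move=> x _; apply: hZ => /=; exact: h.
by rewrite Z0 (lebesgue_unit_cube d) leNgt lte_fin ltr01.
Qed.

(* The tiles that come close to one fixed point form finite sets that exhaust the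
   tiling; in particular an admissible tiling is countable. *)
Lemma tiling_exhaustion : exists r : nat -> seq ('M[R]_d * 'cV[R]_d),
  [/\ forall n, uniq (r n), forall n T, T \in r n -> Ts T,
      forall n, {subset r n <= r n.+1} & forall T, Ts T -> exists n, T \in r n].
Proof.
have [xi gx] := exists_good_point.
pose A (n : nat) := [set T | Ts T /\ `|tcoord T xi| <= n.+1%:R / 2].
have fA n : finite_set (A n).
  apply: contrapT => inf.
  have [N hN] : exists N : nat, C * (q ^+ 2 * (n.+1%:R + 1)) ^+ d * (1 + K n.+1%:R) < N%:R.
    by eexists; exact: truncnS_gt.
  have [B BA NB] := infinite_set_fset N inf.
  have n1 : 1 <= n.+1%:R :> R by rewrite ler1n.
  have := tile_count (r := finmap.enum_fset B) gx n1 (finmap.fset_uniq B).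
  move=> /(_ (fun T TB => BA T TB)) => h.
  have : N%:R <= (size (finmap.enum_fset B))%:R :> R by rewrite ler_nat.
  lra.
exists (fun n => finmap.enum_fset (fset_set (A n))); split.
- by move=> n; exact: finmap.fset_uniq.
- by move=> n T; rewrite in_fset_set// inE => -[].
- move=> n T; rewrite !in_fset_set// !inE => -[TT h]; split => //.
  by apply: le_trans h _; rewrite ler_pM2r// ler_nat.
- move=> T TT; exists (Num.truncn (2 * `|tcoord T xi|)); rewrite in_fset_set// inE; split => //.
  by rewrite ler_pdivlMr// mulrC ltW// truncnS_gt.
Qed.

End counting.

(** * Sums of a window over a lattice and over a tiling *)

Section window_sums.
Context {R : realType}.
Variable d : nat.
Variables (theta delta X : R) (m : nat -> nat) (w : R -> R) (K : R -> R).
Hypotheses (d_gt0 : (0 < d)%N) (th0 : 0 < theta) (th1 : theta < 1)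
  (d0 : 0 < delta) (d1 : delta <= 1) (ww : is_window theta delta m X w)
  (K_ge1 : forall t, 1 <= t -> 1 <= K t)
  (mK : forall j, (2 ^+ j.+1 + 1) ^+ d * (1 + K (2 ^+ j.+1)) * 4 ^- m j <= 2 ^- j).

Definition prod_window (z : 'cV[R]_d) : R := \prod_i w (z i ord0).

Local Notation Phi := prod_window.
Let r0 : R := 2^-1 - theta / 4.

Let w01 z : 0 <= w z <= 1. Proof. by case: ww. Qed.

Lemma prod_window01 z : 0 <= Phi z <= 1.
Proof.
apply/andP; split; first by apply: prodr_ge0 => i _; case/andP: (w01 (z i ord0)).
by apply: prod_le1 => i _.
Qed.

Let Phi_le z i : Phi z <= w (z i ord0).
Proof.
rewrite /Phi (bigD1 i)//= ler_piMr//; first by case/andP: (w01 (z i ord0)).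
by apply: prod_le1 => k _.
Qed.

Let norm_coord (z : 'cV[R]_d) : exists i, `|z| = `|z i ord0|.
Proof.
have [z0|z0] := eqVneq (mx_norm z) 0.
  exists (Ordinal d_gt0); apply/eqP; rewrite eq_le cV_coord_le andbT.
  by rewrite -[`|z|]/(mx_norm z) z0.
by have [[i j] h] := mx_norm_neq0 z0; exists i; rewrite -[LHS]/(mx_norm z) h /= (ord1 j).
Qed.

Lemma measurable_prod_window : measurable_fun setT Phi.
Proof.
apply: measurable_prod => i _; apply: (@measurableT_comp _ _ _ _ _ _ w).
  by case: ww.
exact: measurable_coord.
Qed.

Lemma prod_window_near z : `|z| <= (1 - theta) / 2 -> (1 - delta) ^+ d <= Phi z.
Proof.
move=> hz; rewrite -[X in _ ^+ X]card_ord -prodr_const; apply: ler_prod => i _.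
rewrite subr_ge0 d1 /=; case: ww => _ _ _ h _; apply: h; exact: le_trans (cV_coord_le _ _) hz.
Qed.

Let Phi_far z : r0 <= `|z| -> Phi z <= delta * 4 ^- m 0.
Proof.
have [i ->] := norm_coord z => h; apply: le_trans (Phi_le z i) _.
by case: ww => _ _ _ _ [h1 _ _]; exact: h1.
Qed.

Let Phi_dec j z : 2 ^+ j <= `|z| -> Phi z <= delta * 4 ^- m j.+1.
Proof.
have [i ->] := norm_coord z => h; apply: le_trans (Phi_le z i) _.
by case: ww => _ _ _ _ [_ h1 _]; exact: h1.
Qed.

Let pow1 j : 1 <= 2 ^+ j :> R. Proof. by rewrite exprn_ege1//; lra. Qed.
Let b0 j : 0 <= delta * 4 ^- m j.
Proof. by rewrite mulr_ge0 ?(ltW d0)// invr_ge0 exprn_ge0. Qed.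

(** Dyadic layers: lattice points within [2 ^+ j] number at most [(2 ^+ j.+1 + 1) ^+ d], which [mK]
    turns into [delta * 2 ^- j]. The factor [1 + K] of [mK] is only bounded below by 1 here. *)
Lemma prod_window_lattice_far z (r : seq 'cV[int]_d) : uniq r ->
  (forall k, k \in r -> r0 <= `|z + of_Zd k|) ->
  \sum_(k <- r) Phi (z + of_Zd k) <= 2 * delta.
Proof.
move=> ur hr; apply: (layered_sum (rho := fun k => `|z + of_Zd k|)
  (b := fun j => delta * 4 ^- m j) (N := fun j => (2 ^+ j.+1 + 1) ^+ d)) => //.
- by move=> k /hr; exact: Phi_far.
- by move=> k j _; exact: Phi_dec.
- by move=> j s us _ hs; exact: (size_lattice_ball us hs).
move=> J; apply: (@le_trans _ _ (delta * \sum_(j < J) 2 ^- j)).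
  rewrite mulr_sumr; apply: ler_sum => j _; rewrite mulrCA ler_wpM2l ?(ltW d0)//.
  apply: le_trans (mK j); rewrite ler_wpM2r ?invr_ge0 ?exprn_ge0//.
  have k1 := K_ge1 (pow1 j.+1).
  have p0 : 0 <= (2 ^+ j.+1 + 1) ^+ d :> R by rewrite exprn_ge0// addr_ge0// exprn_ge0.
  by rewrite ler_peMr//; lra.
by rewrite mulrC ler_wpM2r ?(ltW d0)// sum_half_pow.
Qed.

Let of_Zd_norm (k : 'cV[int]_d) : k != 0 -> 1 <= `|of_Zd k : 'cV[R]_d|.
Proof.
move=> k0; have [i ki] : exists i, k i ord0 != 0.
  apply: contrapT => /forallNP h; move/eqP: k0; apply; apply/matrixP => i j.
  by rewrite (ord1 j) mxE; apply/eqP; apply: contrapT => /negP; exact: h.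
apply: le_trans (cV_coord_le _ i); rewrite mxE -intr_norm ler1z.
by rewrite -gtz0_ge1 normr_gt0.
Qed.

(** Nonzero lattice points have norm at least 1 and [r0 < 1/2], so every nonzero translate of [z] is
    at distance more than [r0] from 0. *)
Lemma prod_window_lattice_near z (r : seq 'cV[int]_d) : uniq r -> 0 \notin r ->
  `|z| < r0 -> \sum_(k <- r) Phi (z + of_Zd k) <= 2 * delta.
Proof.
move=> ur r0N hz; apply: prod_window_lattice_far => // k kr.
have k0 : k != 0 by apply: contraNneq r0N => <-.
have := lerB_dist (of_Zd k) (- z); rewrite normrN opprK [_ + z]addrC.
by have := of_Zd_norm k0; move: hz; have := th0; rewrite /r0; lra.
Qed.

(** If some translate lies within [r0] of 0, recentre the sum there: it contributes at most 1 and
    all others are far. *)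
Lemma prod_window_lattice z (r : seq 'cV[int]_d) : uniq r ->
  \sum_(k <- r) Phi (z + of_Zd k) <= 1 + 2 * delta.
Proof.
move=> ur; have [/hasP[k kr hk]|/hasPn h] := boolP (has (fun k => `|z + of_Zd k| < r0) r).
  rewrite (big_rem _ kr) /= lerD//; first by case/andP: (prod_window01 (z + of_Zd k)).
  pose s := [seq l - k | l <- rem k r].
  have -> : \sum_(l <- rem k r) Phi (z + of_Zd l) = \sum_(l <- s) Phi (z + of_Zd k + of_Zd l).
    rewrite big_map; apply: eq_bigr => l _; congr Phi.
    by apply/matrixP => i j; rewrite !mxE rmorphB /=; ring.
  apply: prod_window_lattice_near => //.
    by rewrite map_inj_uniq ?rem_uniq//; exact: addIr.
  apply/mapP => -[l]; rewrite mem_rem_uniq// inE => /andP[lk _] /eqP.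
  by rewrite eq_sym subr_eq0 (negbTE lk).
apply: (@le_trans _ _ (2 * delta)); last by rewrite lerDr.
by apply: prod_window_lattice_far => // k /h; rewrite -leNgt.
Qed.

(* Dominates the contribution of the nonzero lattice translates in the sampling
   estimate: near [0] it is at most [2 * delta * Phi z], and far from [0] it is
   controlled by the tail of [Phi]. *)
Definition alias_bound (z : 'cV[R]_d) : R :=
  Phi z * (2 * delta + (1 + 2 * delta) * \1_[set y : 'cV[R]_d | r0 <= `|y|] z).

Lemma alias_bound_ge0 z : 0 <= alias_bound z.
Proof.
have /andP[p0 _] := prod_window01 z; rewrite mulr_ge0// addr_ge0 ?mulr_ge0 ?(ltW d0)//.
by rewrite addr_ge0// mulr_ge0// ltW.
Qed.

Lemma alias_boundP z (r : seq 'cV[int]_d) : uniq r -> 0 \notin r ->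
  Phi z * \sum_(k <- r) Phi (z + of_Zd k) <= alias_bound z.
Proof.
move=> ur rN; have /andP[p0 _] := prod_window01 z; rewrite ler_wpM2l// indicE.
have [h|h] := leP r0 `|z|.
  rewrite mem_set// mulr1; apply: le_trans (prod_window_lattice z ur) _.
  by rewrite lerDr mulr_ge0// ltW.
rewrite memNset /=; last by apply/negP; rewrite -ltNge.
by rewrite mulr0 addr0; exact: prod_window_lattice_near.
Qed.

Lemma measurable_alias_bound : measurable_fun setT alias_bound.
Proof.
apply: measurable_funM; first exact: measurable_prod_window.
apply: measurable_funD => //; apply: measurable_funM => //; apply: measurable_indic.
have -> : [set y : 'cV[R]_d | r0 <= `|y|] = (fun y => `|y|) @^-1` [set` `[r0, +oo[].
  by apply/seteqP; split => x /=; rewrite in_itv /= andbT.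
by rewrite -[X in measurable X]setTI; apply: measurable_cV_norm.
Qed.

Variables (C : R) (Ts : set ('M[R]_d * 'cV[R]_d)).
Hypotheses (C1 : 1 < C) (aT : admissible_tiling C theta K Ts).

(** The 2 is the sum of the series of [2 ^- j]; the rest is what [tile_count] leaves once
    [(t + 1) ^+ d] and [1 + K t] are absorbed by [mK]. *)
Definition tail_const : R := 2 * (C * (2 `^ C ^+ 2) ^+ d).
Local Notation Q := tail_const.

Let C0 : 0 <= C. Proof. by rewrite (le_trans ler01 (ltW C1)). Qed.

Let Q0 : 0 <= Q.
Proof. by rewrite mulr_ge0// mulr_ge0// exprn_ge0// exprn_ge0// powR_ge0. Qed.

(** The same layering as over the lattice, with [tile_count] at [t = 2 ^+ j.+1]: a distance [2 ^+ j]
    in tile coordinates is [t / 2]. Here [mK] is used in full. *)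
Lemma prod_window_tiles_far xi (r : seq ('M[R]_d * 'cV[R]_d)) : good_point C theta Ts xi ->
  uniq r -> (forall T, T \in r -> Ts T /\ r0 <= `|tcoord T xi|) ->
  \sum_(T <- r) Phi (tcoord T xi) <= delta * Q.
Proof.
move=> gx ur hr; apply: (layered_sum (rho := fun T => `|tcoord T xi|)
  (b := fun j => delta * 4 ^- m j)
  (N := fun j => C * (2 `^ C ^+ 2 * (2 ^+ j.+1 + 1)) ^+ d * (1 + K (2 ^+ j.+1)))) => //.
- by move=> T /hr[_]; exact: Phi_far.
- by move=> T j _; exact: Phi_dec.
- move=> j s us sr hs; apply: (tile_count C1 th0 th1 aT gx (pow1 _) us) => T Ts'.
  split; first by have [] := hr _ (sr _ Ts').
  by apply: le_trans (hs _ Ts') _; rewrite exprS mulrAC divff ?mul1r.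
move=> J; apply: (@le_trans _ _ (delta * (C * (2 `^ C ^+ 2) ^+ d) * \sum_(j < J) 2 ^- j)).
  rewrite mulr_sumr; apply: ler_sum => j _.
  rewrite (exprMn d (2 `^ C ^+ 2)).
  set A := (2 `^ C ^+ 2) ^+ d; set B := (2 ^+ j.+1 + 1) ^+ d.
  have -> : C * (A * B) * (1 + K (2 ^+ j.+1)) * (delta * 4 ^- m j) =
    delta * (C * A) * (B * (1 + K (2 ^+ j.+1)) * 4 ^- m j) by ring.
  have cA : 0 <= delta * (C * A).
    by rewrite mulr_ge0 ?(ltW d0)// mulr_ge0// exprn_ge0// exprn_ge0// powR_ge0.
  apply: ler_wpM2l => //; exact: mK.
have cA : 0 <= delta * (C * (2 `^ C ^+ 2) ^+ d).
  by rewrite mulr_ge0 ?(ltW d0)// mulr_ge0// exprn_ge0// exprn_ge0// powR_ge0.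
apply: le_trans (ler_wpM2l cA (sum_half_pow J)) _.
by rewrite le_eqVlt /Q; apply/orP; left; apply/eqP; ring.
Qed.

(** Tiles with [|tcoord T xi| < r0] contain [xi], since [r0 < 1/2]; multiplicity bounds their number
    by [C] and each contributes at most 1. *)
Lemma prod_window_tiles xi (r : seq ('M[R]_d * 'cV[R]_d)) : good_point C theta Ts xi ->
  uniq r -> (forall T, T \in r -> Ts T) ->
  \sum_(T <- r) Phi (tcoord T xi) <= C + delta * Q.
Proof.
move=> gx ur hr; rewrite (bigID (fun T => `|tcoord T xi| < r0))/= lerD//.
  rewrite -big_filter; set s := [seq T <- r | _].
  apply: (@le_trans _ _ (size s)%:R).
    rewrite -sum1_size natr_sum; apply: ler_sum => T _.
    by case/andP: (prod_window01 (tcoord T xi)).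
  apply: (good_point_mult gx); first exact: filter_uniq.
  move=> T; rewrite mem_filter => /andP[h /hr TT]; split => //.
  by apply: le_trans (ltW h) _; have := th0; rewrite /r0; lra.
rewrite -big_filter; apply: prod_window_tiles_far => //; first exact: filter_uniq.
by move=> T; rewrite mem_filter -leNgt => /andP[h /hr TT].
Qed.

(** The first part of [alias_bound] sums to at most [2 * delta * (C + delta * Q)], the tail part to
    at most [(1 + 2 * delta) * (delta * Q)]; [delta ^+ 2 <= delta] gives the constant
    [2 * C + 5 * Q]. *)
Lemma alias_bound_tiles xi (r : seq ('M[R]_d * 'cV[R]_d)) : good_point C theta Ts xi ->
  uniq r -> (forall T, T \in r -> Ts T) ->
  \sum_(T <- r) alias_bound (tcoord T xi) <= delta * (2 * C + 5 * Q).
Proof.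
move=> gx ur hr.
have -> : \sum_(T <- r) alias_bound (tcoord T xi) =
    2 * delta * \sum_(T <- r) Phi (tcoord T xi) +
    (1 + 2 * delta) * \sum_(T <- r | r0 <= `|tcoord T xi|) Phi (tcoord T xi).
  rewrite [X in _ + _ * X]big_mkcond !mulr_sumr -big_split; apply: eq_bigr => T _ /=.
  rewrite /alias_bound indicE; case: ifPn => h.
    by rewrite mem_set// mulr1; ring.
  by rewrite memNset /=; [rewrite !mulr0 addr0; ring|exact/negP].
have h1 := prod_window_tiles gx ur hr.
have h2 : \sum_(T <- r | r0 <= `|tcoord T xi|) Phi (tcoord T xi) <= delta * Q.
  rewrite -big_filter; apply: prod_window_tiles_far => //; first exact: filter_uniq.
  by move=> T; rewrite mem_filter => /andP[h /hr TT].
have dd : delta * delta <= delta by rewrite ler_piMr// ltW.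
have h3 : delta * delta * Q <= delta * Q by rewrite ler_wpM2r.
move: h1 h2; set S1 := \sum_(T <- r) _; set S2 := \sum_(T <- r | _) _ => h1 h2.
have h4 : 2 * delta * S1 <= 2 * delta * (C + delta * Q) by rewrite ler_wpM2l// mulr_ge0// ltW.
have h5 : (1 + 2 * delta) * S2 <= (1 + 2 * delta) * (delta * Q).
  by rewrite ler_wpM2l// addr_ge0// mulr_ge0// ltW.
apply: le_trans (lerD h4 h5) _; nra.
Qed.

End window_sums.

(** * Packet coefficients *)

Lemma measurable_dotpl {R : realType} n (x : 'cV[R]_n) :
  measurable_fun setT (fun z : 'cV[R]_n => dotp z x).
Proof.
rewrite (_ : (fun z => dotp z x) = dotp x); first exact: measurable_dotp.
by apply/funext => z; exact: dotpC.
Qed.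

Section prod_transform.
Context {R : realType}.
Local Notation mu := (@lebesgue_measure R).
Local Notation leb n := (lebesgue_cV R n).
Variable w : R -> R.
Hypotheses (iw : intg mu w) (w0 : forall s, 0 <= w s).

Let mw : measurable_fun setT w. Proof. exact: intg_meas iw. Qed.

Let prod_window_cons n a (y : 'cV[R]_n) : prod_window w (cons_cV (a, y)) = w a * prod_window w y.
Proof.
rewrite /prod_window big_ord_recl /cons_cV mxE unlift_none; congr (_ * _).
by apply: eq_bigr => i _; rewrite mxE liftK.
Qed.

Let prod_window0 n (z : 'cV[R]_n) : 0 <= prod_window w z.
Proof. by apply: prodr_ge0. Qed.

Let mprod n : measurable_fun setT (@prod_window R n w).
Proof.
apply: measurable_prod => i _; apply: (@measurableT_comp _ _ _ _ _ _ w) => //.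
exact: measurable_coord.
Qed.

Let mexp (x : R) : measurable_fun setT (fun s : R => 2 * pi * (s * x)).
Proof. by apply: measurable_funM => //; exact: measurable_funM. Qed.

(** Fubini, one coordinate at a time; integrability is part of the induction because each step needs
    it for the remaining coordinates. *)
Lemma prod_window_tf n (x : 'cV[R]_n) : intg (leb n) (prod_window w) /\
  cint (leb n) (fun z => (prod_window w z)%:C * expi (2 * pi * dotp z x)) =
  \prod_i cint mu (fun s => (w s)%:C * expi (2 * pi * (s * x i ord0))).
Proof.
elim: n x => [|n IH] x.
  split.
    have E0 : (\int[leb 0]_z (prod_window w z)%:E)%E = (prod_window w (0 : 'cV[R]_0))%:E.
      by rewrite ge0_integral_cV0//; apply/measurable_EFinP; exact: mprod.
    apply: intg_ge0_lty => //; first exact: mprod.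
    by apply: (eq_ind_r (fun z => (z < +oo)%E) _ E0); exact: ltry.
  rewrite cint_cV0; last first.
    apply: cmeasM; first by apply: cmeas_real; exact: mprod.
    apply: cmeas_expi; apply: measurable_funM => //; exact: measurable_dotpl.
  by rewrite big_ord0 /prod_window /dotp !big_ord0 mulr0 expi0 mulr1.
pose x' : 'cV[R]_n := \col_i x (lift ord0 i) ord0.
have [ip Ep] := IH x'.
pose F (p : measurableTypeR R * 'cV[R]_n) : R[i] :=
  (w p.1)%:C * expi (2 * pi * (p.1 * x ord0 ord0)) *
  ((prod_window w p.2)%:C * expi (2 * pi * dotp p.2 x')).
have mF : cmeas F.
  apply: cmeasM.
    apply: cmeasM; first by apply: cmeas_real; exact: (measurableT_comp mw measurable_fst).
    by apply: cmeas_expi; exact: (measurableT_comp (mexp _) measurable_fst).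
  apply: cmeasM; first by apply: cmeas_real; exact: (measurableT_comp (@mprod n) measurable_snd).
  apply: cmeas_expi; apply: measurable_funM => //.
  rewrite (_ : (fun _ => _) = (fun y => dotp x' y) \o snd).
    by apply: (measurableT_comp (measurable_dotp x')); exact: measurable_snd.
  by apply/funext => p; rewrite dotpC.
have Fdom a y : normc (F (a, y)) <= w a * prod_window w y.
  by rewrite !normcM !normc_expi !mulr1 !normcR !ger0_norm.
have [iF [F1 F2]] : cL1 (mu \x leb n)%E F /\ (
    cint (mu \x leb n)%E F = cint mu (fun a => cint (leb n) (fun y => F (a, y))) /\ True).
  split; first exact: cL1_prod mF Fdom w0 (@prod_window0 n) iw ip.
  by have [-> _] := cint_fubini mF Fdom w0 (@prod_window0 n) iw ip.
split.
  apply: intg_ge0_lty => //; first exact: mprod.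
  have E0 : (\int[leb n.+1]_z (prod_window w z)%:E = \int[mu \x leb n]_p (prod_window w (cons_cV p))%:E)%E.
    apply: (ge0_integral_cV_prod (g := fun z => (prod_window w z)%:E)).
      by apply/measurable_EFinP; exact: mprod.
    by move=> z; rewrite lee_fin prod_window0.
  apply: (eq_ind_r (fun z => (z < +oo)%E) _ E0).
  have [_ /integrableP[_]] := iF; apply: le_lt_trans; rewrite le_eqVlt; apply/orP; left; apply/eqP.
  apply: eq_integral => -[a y] _; apply: (congr1 EFin); rewrite ger0_norm ?normc_ge0//.
  by rewrite prod_window_cons /F !normcM !normc_expi !mulr1 !normcR !ger0_norm ?mulr_ge0.
rewrite cint_cV_prod; last first.
  apply: cmeasM; first by apply: cmeas_real; exact: mprod.
  apply: cmeas_expi; apply: measurable_funM => //; exact: measurable_dotpl.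
have xE : x = cons_cV (x ord0 ord0, x').
  by apply/matrixP => i j; rewrite /cons_cV (ord1 j) mxE; case: unliftP => [k ->|->] //=; rewrite mxE.
transitivity (cint (mu \x leb n)%E F).
  apply: eq_cint => -[a y]; rewrite prod_window_cons {1}xE dotp_cons mulrDr expiD /F /=.
  by rewrite rmorphM /=; ring.
rewrite F1 big_ord_recl.
rewrite [X in _ = _ * X](_ : _ =
    \prod_i cint mu (fun s => (w s)%:C * expi (2 * pi * (s * x' i ord0)))); last first.
  by apply: eq_bigr => i _; apply: eq_cint => s; rewrite mxE.
rewrite -Ep.
have iE : cL1 (leb n) (fun z => (prod_window w z)%:C * expi (2 * pi * dotp z x')).
  apply: (cL1_le (g := prod_window w)) => //.
    apply: cmeasM; first by apply: cmeas_real; exact: mprod.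
    apply: cmeas_expi; apply: measurable_funM => //; exact: measurable_dotpl.
  by move=> z; rewrite normcM normc_expi mulr1 normcR ger0_norm.
have i1 : cL1 mu (fun s => (w s)%:C * expi (2 * pi * (s * x ord0 ord0))).
  apply: (@cL1_le _ _ _ mu _ w) => //.
    by apply: cmeasM; [exact: cmeas_real|apply: cmeas_expi; exact: mexp].
  by move=> z; rewrite normcM normc_expi mulr1 normcR ger0_norm.
rewrite -cintZr//; apply: eq_cint => a.
by rewrite -cintZ.
Qed.

End prod_transform.

Section packet_coefficients.
Context {R : realType}.
Variable d : nat.
Local Notation mu := (@lebesgue_measure R).
Local Notation leb := (lebesgue_cV R d).
Variables (theta delta X : R) (m : nat -> nat) (w : R -> R) (K : R -> R).
Hypotheses (d_gt0 : (0 < d)%N) (th0 : 0 < theta) (th1 : theta < 1)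
  (d0 : 0 < delta) (d1 : delta <= 1) (ww : is_window theta delta m X w)
  (K_ge1 : forall t, 1 <= t -> 1 <= K t)
  (m_sqr : forall j, (j * j <= m j)%N)
  (mK : forall j, (2 ^+ j.+1 + 1) ^+ d * (1 + K (2 ^+ j.+1)) * 4 ^- m j <= 2 ^- j).

Local Notation Phi := (@prod_window R d w).
Local Notation eta := (@prod_cos_tf R d w (fun=> 0%N)).
Let etaC x := (eta x)%:C.
Let E := @alias_bound R d theta delta w.

Let w01 z : 0 <= w z <= 1. Proof. by case: ww. Qed.
Let wge0 z : 0 <= w z. Proof. by case/andP: (w01 z). Qed.

Lemma window_intg : intg mu w.
Proof.
case: ww => mw _ _ _ [_ _ [_ [c hc]]].
apply: (intgR_le (g := fun s => c * (oneDsqr s)^-1)) => //.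
  by move=> s; rewrite ger0_norm.
by apply: intgZ; exact: intg_oneDsqrV.
Qed.

Let iPhi : intg leb Phi. Proof. exact: (prod_window_tf window_intg wge0 0).1. Qed.
Let Phi0 z : 0 <= Phi z. Proof. by apply: prodr_ge0. Qed.
Let mPhi : measurable_fun setT Phi. Proof. exact: intg_meas iPhi. Qed.

Lemma eta_ft x : etaC x = cint leb (fun z => (Phi z)%:C * expi (2 * pi * dotp z x)).
Proof.
rewrite (prod_window_tf window_intg wge0 x).2 /etaC /prod_cos_tf rmorph_prod.
by apply: eq_bigr => i _; exact: (cos_tf_ft d0 ww m_sqr).
Qed.

Lemma innerE (f g : 'cV[R]_d -> R[i]) : inner f g = cint leb (fun x => f x * cj (g x)).
Proof. by []. Qed.

(** The transform of [f] times the window of [T], pulled back to the coordinates of [T]; the factor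
    under the root keeps the [L^2] norm under this change of variables. *)
Definition fiber (f : 'cV[R]_d -> R[i]) (T : 'M[R]_d * 'cV[R]_d) (z : 'cV[R]_d) : R[i] :=
  (Num.sqrt `|\det T.1| * Phi z)%:C * ft f (T.1 *m z + T.2).

Lemma mdotp2 (D : 'M[R]_d) (b : 'cV[R]_d) :
  measurable_fun setT (fun p : 'cV[R]_d * 'cV[R]_d => dotp (D *m p.2 + b) p.1).
Proof.
rewrite (_ : (fun _ => _) = (fun p : 'cV[R]_d * 'cV[R]_d => \sum_i (D *m p.2 + b) i ord0 * p.1 i ord0))//.
apply: measurable_sum => i; apply: measurable_funM.
  apply: (measurableT_comp (@measurable_coord _ R d i)).
  by apply: (measurableT_comp (measurable_affine_cV D b)); exact: measurable_snd.
by apply: (measurableT_comp (@measurable_coord _ R d i)); exact: measurable_fst.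
Qed.

(** Express [eta] as the Fourier integral of [Phi] by [eta_ft] and exchange the integrals: the
    translation by [k] becomes the character [ekd k] and the modulation becomes the shift by
    [T.2]. *)
Lemma inner_packet (f : 'cV[R]_d -> R[i]) T (k : 'cV[int]_d) : cL1 leb f ->
  inner f (packet etaC T (of_Zd k)) = cint leb (fun z => fiber f T z * cj (ekd k z)).
Proof.
move=> [mf fi]; set c := Num.sqrt `|\det T.1|.
have c0 : 0 <= c by exact: sqrtr_ge0.
pose G (p : 'cV[R]_d * 'cV[R]_d) : R[i] := c%:C * (f p.1 * (Phi p.2)%:C) *
  (cj (ekd k p.2) * expi (- (2 * pi * dotp (T.1 *m p.2 + T.2) p.1))).
have mG : cmeas G.
  apply: cmeasM.
    apply: cmeasM; first exact: cmeas_cst.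
    apply: cmeasM; first exact: (cmeas_comp mf measurable_fst).
    by apply: cmeas_real; exact: (measurableT_comp mPhi measurable_snd).
  apply: cmeasM; first by apply: cmeasJ; exact: (cmeas_comp (cmeas_ekd k) measurable_snd).
  apply: cmeas_expi; apply: measurableT_comp => //; apply: measurable_funM => //.
  exact: mdotp2.
have Gdom x z : normc (G (x, z)) <= (c * normc (f x)) * Phi z.
  rewrite /G /= !normcM normcJ' normc_ekd normc_expi !mulr1 !normcR !ger0_norm// mulrA //.
have icf : intg leb (fun x => c * normc (f x)) by exact: intgZ.
have cf0 x : 0 <= c * normc (f x) by rewrite mulr_ge0// normc_ge0.
have [E1 E2] := cint_fubini mG Gdom cf0 Phi0 icf iPhi.
rewrite innerE; transitivity (cint leb (fun x => cint leb (fun z => G (x, z)))).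
  apply: eq_cint => x; rewrite /packet eta_ft -/c cconjM cconjM cj_real -expiN.
  have ie y : cL1 leb (fun z => (Phi z)%:C * expi (2 * pi * dotp z y)).
    apply: (cL1_le (g := Phi)) => //.
      apply: cmeasM; first exact: cmeas_real.
      apply: cmeas_expi; apply: measurable_funM => //; exact: measurable_dotpl.
    by move=> z; rewrite normcM normc_expi mulr1 normcR ger0_norm.
  rewrite -cintJ//.
  set y := of_Zd k + _.
  have ij : cL1 leb (fun z => cj ((Phi z)%:C * expi (2 * pi * dotp z y))).
    have [m1 i1] := ie y; split; first exact: cmeasJ.
    by under eq_fun do rewrite normcJ'.
  rewrite mulrA -cintZ//; apply: eq_cint => z.
  rewrite cconjM cj_real -expiN /G /= /y dotpD dotp_mul trmxK dotpDl dotpC -[dotp (T.1 *m z) x]dotpC.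
  by rewrite /ekd -expiN (dotpC z (of_Zd k)) !mulrDr !opprD !expiD; ring.
rewrite -E1 E2; apply: eq_cint => z.
rewrite /fiber /ft /G /=.
have ifx : cL1 leb (fun x => f x * expi (- (2 * pi * dotp (T.1 *m z + T.2) x))).
  apply: (cL1_le (g := fun x => normc (f x))) => //.
    apply: cmeasM => //; apply: cmeas_expi; apply: measurableT_comp => //.
    by apply: measurable_funM => //; exact: measurable_dotp.
  by move=> x; rewrite normcM normc_expi mulr1.
rewrite [RHS]mulrAC -cintZ//; apply: eq_cint => x.
by rewrite rmorphM /=; ring.
Qed.

Definition coef_energy (f : 'cV[R]_d -> R[i]) T : \bar R :=
  (\esum_(k in [set: 'cV[int]_d]) (normc (inner f (packet etaC T (of_Zd k))) ^+ 2)%:E)%E.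

Let F (f : 'cV[R]_d -> R[i]) x : R := normc (ft f x) ^+ 2.

Lemma normc_ft_le (f : 'cV[R]_d -> R[i]) x : cL1 leb f ->
  normc (ft f x) <= \int[leb]_y normc (f y).
Proof.
move=> [mf fi]; apply: (normc_cint_le (g := fun y => normc (f y))) => //.
  apply: cmeasM => //; apply: cmeas_expi; apply: measurableT_comp => //.
  by apply: measurable_funM => //; exact: measurable_dotp.
by move=> y; rewrite normcM normc_expi mulr1.
Qed.

Let Phi01 z : 0 <= Phi z <= 1. Proof. exact: (prod_window01 ww). Qed.

Let tcoordK (T : 'M[R]_d * 'cV[R]_d) (z : 'cV[R]_d) : is_tile T -> tcoord T (T.1 *m z + T.2) = z.
Proof. by move=> uT; rewrite /tcoord addrK mulKmx. Qed.

Let cov (T : 'M[R]_d * 'cV[R]_d) (g : 'cV[R]_d -> R) : is_tile T -> measurable_fun setT g -> (forall x, 0 <= g x) ->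
  (\int[leb]_z (`|\det T.1| * g (T.1 *m z + T.2))%:E = \int[leb]_x (g x)%:E)%E.
Proof.
move=> uT mg g0; rewrite -(ge0_integral_affine T.2 uT (g := fun x => (g x)%:E)).
- rewrite -ge0_integralZl//.
    by apply/measurable_EFinP; apply: (measurableT_comp mg); exact: measurable_affine_cV.
  by move=> x _; rewrite lee_fin.
- exact/measurable_EFinP.
- by move=> x; rewrite lee_fin.
Qed.

(** Apply [sampling] to the fiber, with [w = Phi], [g] the normalized modulus of the transform of
    [f], and [alias_bound] as row bound, then return to the frequency variable. Boundedness of the
    transform gives the bounded periodization. *)
Lemma coef_energy_bounds (f : 'cV[R]_d -> R[i]) T : cL1 leb f -> is_tile T ->
  (coef_energy f T <= \int[leb]_x (F f x * Phi (tcoord T x) ^+ 2)%:E +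
     \int[leb]_x (F f x * E (tcoord T x))%:E /\
   \int[leb]_x (F f x * Phi (tcoord T x) ^+ 2)%:E <=
     coef_energy f T + \int[leb]_x (F f x * E (tcoord T x))%:E)%E.
Proof.
move=> fi uT; have [mf fi1] := fi; have mft := cmeas_ft mf.
set c := Num.sqrt `|\det T.1|; have c0 : 0 <= c by exact: sqrtr_ge0.
have c2 : c ^+ 2 = `|\det T.1| by rewrite sqr_sqrtr.
pose L := \int[leb]_y normc (f y).
have L0 : 0 <= L by apply: Rintegral_ge0 => y _; exact: normc_ge0.
pose g z := c * normc (ft f (T.1 *m z + T.2)).
have g0 z : 0 <= g z by rewrite mulr_ge0// normc_ge0.
have mftT : cmeas (fun z => ft f (T.1 *m z + T.2)).
  by apply: (cmeas_comp mft); exact: measurable_affine_cV.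
have mg : measurable_fun setT g by apply: measurable_funM => //; exact: cmeas_normc.
have mH : cmeas (fiber f T).
  by apply: cmeasM => //; apply: cmeas_real; exact: measurable_funM.
have HE z : normc (fiber f T z) = g z * Phi z.
  rewrite /fiber normcM normcR ger0_norm ?mulr_ge0// -/c /g; ring.
have HM z (r : seq 'cV[int]_d) : uniq r ->
    \sum_(k <- r) normc (fiber f T (z + of_Zd k)) <= c * L * (1 + 2 * delta).
  move=> ur; apply: (@le_trans _ _ (c * L * \sum_(k <- r) Phi (z + of_Zd k))).
    rewrite mulr_sumr; apply: ler_sum => k _; rewrite HE ler_wpM2r// /g ler_wpM2l//.
    exact: normc_ft_le.
  rewrite ler_wpM2l ?mulr_ge0//.
  exact: (prod_window_lattice d_gt0 th0 d0 ww K_ge1 mK).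
have mE : measurable_fun setT E by exact: (measurable_alias_bound ww).
have E0 z : 0 <= E z by exact: (alias_bound_ge0 d0 ww).
have Hle z : normc (fiber f T z) <= g z * Phi z by rewrite HE.
have [s1 s2] := sampling mH HM mg mE g0 Phi0 Hle
   (fun z r ur rN => alias_boundP d_gt0 th0 d0 ww K_ge1 mK z ur rN).
have mF : measurable_fun setT (F f) by exact: cmeas_normc2.
have F0 x : 0 <= F f x by exact: sqr_ge0.
have mtc := @measurable_tcoord R d T.
have e1 : (\int[leb]_z (normc (fiber f T z) ^+ 2)%:E =
    \int[leb]_x (F f x * Phi (tcoord T x) ^+ 2)%:E)%E.
  rewrite -[RHS](cov uT).
  - apply: eq_integral => z _; rewrite HE tcoordK// /g /F !exprMn c2; congr EFin; ring.
  - apply: measurable_funM => //; apply: measurable_funX; exact: (measurableT_comp mPhi mtc).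
  - by move=> x; rewrite mulr_ge0// sqr_ge0.
have e2 : (\int[leb]_z (g z ^+ 2 * E z)%:E = \int[leb]_x (F f x * E (tcoord T x))%:E)%E.
  rewrite -[RHS](cov uT).
  - apply: eq_integral => z _; rewrite tcoordK// /g /F !exprMn c2; congr EFin; ring.
  - by apply: measurable_funM => //; exact: (measurableT_comp mE mtc).
  - by move=> x; rewrite mulr_ge0.
have e3 : coef_energy f T =
    (\esum_(k in [set: 'cV[int]_d]) (normc (cint leb (fun z => fiber f T z * cj (ekd k z))) ^+ 2)%:E)%E.
  by apply: eq_esum => k _; rewrite inner_packet.
by rewrite e3 -e1 -e2.
Qed.

Definition energy (f : 'cV[R]_d -> R[i]) : \bar R := (\int[leb]_x (normc (f x) ^+ 2)%:E)%E.

Lemma energy_ge0 f : (0 <= energy f)%E.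
Proof. by apply: integral_ge0 => x _; rewrite lee_fin sqr_ge0. Qed.

(* The Fourier coefficients of [f] are only accessible directly for such [f]; the frame
   bounds extend by truncation. *)
Definition tame (f : 'cV[R]_d -> R[i]) := cmeas f /\
  exists2 BL : R * R, 0 < BL.2 & (forall x, normc (f x) <= BL.1) /\
    forall x : 'cV[R]_d, ~ (forall i, - BL.2 <= x i ord0 < BL.2) -> f x = 0.

Lemma tame_cL1 f : tame f -> cL1 leb f.
Proof. by move=> [mf [[B L] /= L0 [fB f0]]]; exact: cL1_bounded_support mf fB f0. Qed.

Let energy_ft f : tame f -> (\int[leb]_x (F f x)%:E = energy f)%E.
Proof. by move=> [mf [[B L] /= L0 [fB f0]]]; exact: plancherel L0 mf fB f0. Qed.

Section tiling.
Variables (C : R) (Ts : set ('M[R]_d * 'cV[R]_d)).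
Hypotheses (C1 : 1 < C) (aT : admissible_tiling C theta K Ts).
Local Notation Q := (tail_const d C).

Let C0 : 0 <= C. Proof. by rewrite (le_trans ler01 (ltW C1)). Qed.
Let Q0 : 0 <= Q.
Proof. by rewrite mulr_ge0// mulr_ge0// exprn_ge0// exprn_ge0// powR_ge0. Qed.
Let Ttile T : Ts T -> is_tile T. Proof. by case: aT => h _ _; exact: h. Qed.

Let mE : measurable_fun setT E. Proof. exact: (measurable_alias_bound ww). Qed.
Let E0 z : 0 <= E z. Proof. exact: (alias_bound_ge0 d0 ww). Qed.
Let mF f : cmeas f -> measurable_fun setT (F f).
Proof. by move=> mf; exact: cmeas_normc2 (cmeas_ft mf). Qed.
Let F0 f x : 0 <= F f x. Proof. exact: sqr_ge0. Qed.

Let sum_integral (f : 'cV[R]_d -> R[i]) (g : 'cV[R]_d -> R) (r : seq ('M[R]_d * 'cV[R]_d)) :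
  cmeas f -> measurable_fun setT g -> (forall z, 0 <= g z) ->
  (\sum_(T <- r) \int[leb]_x (F f x * g (tcoord T x))%:E =
   \int[leb]_x (F f x * \sum_(T <- r) g (tcoord T x))%:E)%E.
Proof.
move=> mf mg g0; rewrite -ge0_integral_sum//.
- by apply: eq_integral => x _; rewrite sumEFin -mulr_sumr.
- move=> T; apply/measurable_EFinP; apply: measurable_funM; first exact: mF.
  exact: (measurableT_comp mg (@measurable_tcoord R d T)).
- by move=> T x _; rewrite lee_fin mulr_ge0.
Qed.

(** The covering condition holds only almost everywhere, so pointwise bounds are available at good
    points alone; these have full measure. *)
Let integral_le (f : 'cV[R]_d -> R[i]) (g : 'cV[R]_d -> R) (c : R) : cmeas f ->
  measurable_fun setT g -> (forall z, 0 <= g z) -> 0 <= c ->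
  (forall x, good_point C theta Ts x -> g x <= c) ->
  (\int[leb]_x (F f x * g x)%:E <= c%:E * \int[leb]_x (F f x)%:E)%E.
Proof.
move=> mf mg g0 c0 gc; rewrite -ge0_integralZl//; last first.
- by move=> x _; rewrite lee_fin.
- by apply/measurable_EFinP; exact: mF.
apply: ae_ge0_le_integral => //.
- by move=> x _; rewrite lee_fin mulr_ge0.
- by apply/measurable_EFinP; apply: measurable_funM => //; exact: mF.
- by move=> x _; rewrite -EFinM lee_fin mulr_ge0.
- by apply: measurable_funeM; apply/measurable_EFinP; exact: mF.
have := ae_good_point aT; apply: filterS => x gx _.
by rewrite -EFinM lee_fin mulrC ler_wpM2r// gc.
Qed.

Let msum (g : 'cV[R]_d -> R) (r : seq ('M[R]_d * 'cV[R]_d)) : measurable_fun setT g ->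
  measurable_fun setT (fun x => \sum_(T <- r) g (tcoord T x)).
Proof.
by move=> mg; apply: measurable_sum => T; exact: (measurableT_comp mg (@measurable_tcoord R d T)).
Qed.

Let mPhi2 : measurable_fun setT (fun z => Phi z ^+ 2).
Proof. exact: measurable_funX. Qed.

Let Phi2_ge0 z : 0 <= Phi z ^+ 2. Proof. exact: sqr_ge0. Qed.

(** Main terms sum to at most [C + delta * Q] because [Phi ^+ 2 <= Phi]; the errors add
    [delta * (2 * C + 5 * Q)]. *)
Lemma tame_upper f (r : seq ('M[R]_d * 'cV[R]_d)) : tame f -> uniq r ->
  (forall T, T \in r -> Ts T) ->
  (\sum_(T <- r) coef_energy f T <= (C + delta * (2 * C + 6 * Q))%:E * energy f)%E.
Proof.
move=> tf ur rT; have fi := tame_cL1 tf; have [mf _] := fi.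
apply: (@le_trans _ _ (\sum_(T <- r) (\int[leb]_x (F f x * Phi (tcoord T x) ^+ 2)%:E +
    \int[leb]_x (F f x * E (tcoord T x))%:E))%E).
  rewrite big_seq [leRHS]big_seq; apply: lee_sum => T Tr.
  by have [] := coef_energy_bounds fi (Ttile (rT _ Tr)).
rewrite big_split /= (sum_integral _ mf mPhi2 Phi2_ge0) (sum_integral _ mf mE E0) -energy_ft//.
have -> : C + delta * (2 * C + 6 * Q) = (C + delta * Q) + delta * (2 * C + 5 * Q) by ring.
have F1 : (0 <= \int[leb]_x (F f x)%:E)%E by apply: integral_ge0 => x _; rewrite lee_fin.
rewrite EFinD ge0_muleDl ?lee_fin ?addr_ge0 ?mulr_ge0 ?addr_ge0 ?mulr_ge0 ?(ltW d0)//.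
apply: leeD; apply: integral_le => //.
- exact: (msum r mPhi2).
- by move=> z; apply: sumr_ge0.
- by rewrite addr_ge0// mulr_ge0// ltW.
- move=> x gx; apply: le_trans (prod_window_tiles d_gt0 th0 th1 d0 ww mK C1 aT gx ur rT).
  apply: ler_sum => T _; have /andP[p0 p1] := Phi01 (tcoord T x).
  by rewrite expr2 ler_piMr.
- exact: (msum r mE).
- by move=> z; apply: sumr_ge0.
- by rewrite mulr_ge0 ?addr_ge0 ?mulr_ge0 ?(ltW d0).
- move=> x gx; exact: (alias_bound_tiles d_gt0 th0 th1 d0 d1 ww mK C1 aT gx ur rT).
Qed.

(** Monotone convergence along the finite sets of [tiling_exhaustion]. The error stays on the right,
    so that no difference of extended reals has to make sense. *)
Lemma tame_lower f : tame f ->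
  ((((1 - delta) ^+ d) ^+ 2)%:E * energy f <=
   \esum_(T in Ts) coef_energy f T + (delta * (2 * C + 5 * Q))%:E * energy f)%E.
Proof.
move=> tf; have fi := tame_cL1 tf; have [mf _] := fi.
have [r [ur rT rS rall]] := tiling_exhaustion C1 th0 th1 aT.
set S := (\esum_(T in Ts) _)%E; set e := delta * _; set a := _ ^+ 2.
pose v n x := F f x * \sum_(T <- r n) Phi (tcoord T x) ^+ 2.
have v0 n x : 0 <= v n x by rewrite mulr_ge0// sumr_ge0.
have mv n : measurable_fun setT (v n) by apply: measurable_funM; [exact: mF|exact: (msum (r n) mPhi2)].
have vle n : (\int[leb]_x (v n x)%:E <= S + e%:E * energy f)%E.
  rewrite -(sum_integral _ mf mPhi2 Phi2_ge0).
  apply: (@le_trans _ _ (\sum_(T <- r n) (coef_energy f T +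
      \int[leb]_x (F f x * E (tcoord T x))%:E))%E).
    rewrite big_seq [leRHS]big_seq; apply: lee_sum => T Tr.
    by have [] := coef_energy_bounds fi (Ttile (rT _ _ Tr)).
  rewrite big_split /=; apply: leeD.
    by apply: esum_ge_fin => // T; exact: rT.
  rewrite (sum_integral _ mf mE E0) -energy_ft//; apply: integral_le => //.
  - exact: (msum (r n) mE).
  - by move=> z; apply: sumr_ge0.
  - by rewrite mulr_ge0 ?addr_ge0 ?mulr_ge0 ?(ltW d0).
  - move=> x gx; exact: (alias_bound_tiles d_gt0 th0 th1 d0 d1 ww mK C1 aT gx (ur n) (rT n)).
have vnd x : {homo (fun n => (v n x)%:E) : n k / (n <= k)%N >-> (n <= k)%E}.
  apply/nondecreasing_seqP => n; rewrite lee_fin /v ler_wpM2l//.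
  rewrite [leRHS](bigID (mem (r n)))/= -[leLHS]addr0; apply: lerD; last exact: sumr_ge0.
  have pr : perm_eq [seq T <- r n.+1 | mem (r n) T] (r n).
    apply: uniq_perm => //; first by rewrite filter_uniq.
    by move=> T; rewrite mem_filter; apply/andP/idP => [[]|/[dup] /rS].
  by rewrite -[leRHS]big_filter (perm_big _ pr).
apply: (@le_trans _ _ (\int[leb]_x (limn (fun n => (v n x)%:E)))%E); last first.
  rewrite monotone_convergence//.
  - apply: lime_le; last by apply: nearW => n; exact: vle.
    apply: ereal_nondecreasing_is_cvgn => n k nk; apply: ge0_le_integral => //.
    + by move=> x _; rewrite lee_fin.
    + exact/measurable_EFinP.
    + exact/measurable_EFinP.
    + by move=> x _; exact: vnd.
  - by move=> n; exact/measurable_EFinP.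
  - by move=> n x _; rewrite lee_fin.
rewrite -energy_ft// -ge0_integralZl//; last first.
- by rewrite lee_fin sqr_ge0.
- by move=> x _; rewrite lee_fin.
- by apply/measurable_EFinP; exact: mF.
apply: ae_ge0_le_integral => //.
- by move=> x _; rewrite -EFinM lee_fin mulr_ge0// sqr_ge0.
- by apply: measurable_funeM; apply/measurable_EFinP; exact: mF.
- move=> x _; apply: lime_ge; first exact: ereal_nondecreasing_is_cvgn.
  by apply: nearW => n; rewrite lee_fin.
- apply: (emeasurable_fun_cvg (fun n x => (v n x)%:E)).
    by move=> n; exact/measurable_EFinP.
  by move=> x _; exact: ereal_nondecreasing_is_cvgn.
have := ae_good_point aT; apply: filterS => x gx _.
(* One tile suffices: the one whose shrunken copy contains [x] already contributes [a], and it
   belongs to [r n] for some [n]. *)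
have [T TT hT] := good_point_near th1 aT gx; have [n Tn] := rall T TT.
apply: le_trans (_ : (v n x)%:E <= _)%E; last first.
  apply: lime_ge; first exact: ereal_nondecreasing_is_cvgn.
  by exists n => // k /= nk; exact: vnd.
rewrite -EFinM lee_fin mulrC /v ler_wpM2l// (big_rem _ Tn)/=.
apply: le_trans (_ : a <= Phi (tcoord T x) ^+ 2) _; last by rewrite lerDl sumr_ge0.
rewrite /a; have h := prod_window_near d1 ww hT.
have h0 : 0 <= (1 - delta) ^+ d by rewrite exprn_ge0// subr_ge0.
by rewrite ler_sqr ?nnegrE.
Qed.

End tiling.

End packet_coefficients.

(** * From bounded functions of bounded support to square-integrable functions *)

Section extension.
Context {R : realType}.
Variable d : nat.
Local Notation leb := (lebesgue_cV R d).
Variables (I : choiceType) (D : set I) (p : I -> 'cV[R]_d -> R[i]).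
Hypothesis pL2 : forall i, cmeas (p i) /\ intg leb (fun x => normc (p i x) ^+ 2).

Definition bessel_sum (f : 'cV[R]_d -> R[i]) : \bar R :=
  (\esum_(i in D) (normc (inner f (p i)) ^+ 2)%:E)%E.

Variables A B : R.
Hypotheses (A0 : 0 <= A) (B0 : 0 <= B)
  (upper_tame : forall f, tame f -> (bessel_sum f <= B%:E * energy f)%E)
  (lower_tame : forall f, tame f -> (A%:E * energy f <= bessel_sum f)%E).

Let L2 (f : 'cV[R]_d -> R[i]) := cmeas f /\ intg leb (fun x => normc (f x) ^+ 2).
Let sq (f : 'cV[R]_d -> R[i]) : R := \int[leb]_x normc (f x) ^+ 2.

Let energyE f : L2 f -> energy f = (sq f)%:E.
Proof. by move=> [_ i]; rewrite /energy -RintegralE. Qed.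

Section truncation.
Variable f : 'cV[R]_d -> R[i].
Hypothesis fL2 : L2 f.

Let mf : cmeas f. Proof. by case: fL2. Qed.
Let fi : intg leb (fun x => normc (f x) ^+ 2). Proof. by case: fL2. Qed.

(** Truncation in space and in height at once, which makes [trn n] tame; each point lies in all late
    [dom n], so every limit below is eventually constant pointwise. *)
Let dom n := [set x : 'cV[R]_d | forall i, `[- n.+1%:R, n.+1%:R[%classic (x i ord0)] `&`
  [set x : 'cV[R]_d | normc (f x) <= n.+1%:R].
Let chi n (x : 'cV[R]_d) : R := \1_(dom n) x.
Let trn n x : R[i] := (chi n x)%:C * f x.

Let mdom n : measurable (dom n).
Proof.
apply: measurableI.
  by apply: (measurable_box (A := fun=> `[- n.+1%:R, n.+1%:R[%classic)).
rewrite -[X in measurable X]setTI.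
have -> : [set x : 'cV[R]_d | normc (f x) <= n.+1%:R] = (fun x => normc (f x)) @^-1` [set` `]-oo, n.+1%:R]].
  by apply/seteqP; split => x /=; rewrite in_itv.
exact: (cmeas_normc mf).
Qed.

Let mchi n : measurable_fun setT (chi n).
Proof. by apply: measurable_indic; exact: mdom. Qed.

Let chi01 n x : 0 <= chi n x <= 1.
Proof. by rewrite /chi indicE ler0n lern1 leq_b1. Qed.

Let chi_eventually x : exists N, forall n, (N <= n)%N -> chi n x = 1.
Proof.
exists (Num.truncn (`|x| + normc (f x))) => n hn.
have h : `|x| + normc (f x) < n.+1%:R.
  by apply: lt_le_trans (truncnS_gt _) _; rewrite ler_nat ltnS.
rewrite /chi indicE mem_set//; split => /=.
  move=> i; rewrite in_itv /=; have := cV_coord_le x i; have := normc_ge0 (f x).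
  by move: h; rewrite ler_norml => h1 h2 /andP[h3 h4]; apply/andP; split; lra.
by have := normr_ge0 x; lra.
Qed.

Let mtrn n : cmeas (trn n).
Proof. by apply: cmeasM => //; exact: cmeas_real. Qed.

Let trn_le n x : normc (trn n x) <= normc (f x).
Proof.
have /andP[c0 c1] := chi01 n x.
by rewrite normcM normcR ger0_norm// ler_piMl ?normc_ge0.
Qed.

Let tame_trn n : tame (trn n).
Proof.
split; first exact: mtrn.
exists (n.+1%:R, n.+1%:R) => //=; split => x; rewrite /trn /chi indicE.
  have [|_] := boolP (_ \in _); last by rewrite mul0r normc0.
  by rewrite inE => -[_ h]; rewrite mul1r.
by move=> h; rewrite memNset ?mul0r// => -[h1 _]; apply: h => i; have := h1 i; rewrite /= in_itv.
Qed.

Let L2_trn n : L2 (trn n).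
Proof.
split; first exact: mtrn.
apply: (intg_le _ _ fi); first exact: cmeas_normc2.
by move=> x; rewrite ger0_norm ?sqr_ge0// ler_sqr ?nnegrE ?normc_ge0.
Qed.

Let rem n x : R[i] := f x - trn n x.

Let remE n x : rem n x = (1 - chi n x)%:C * f x.
Proof. by rewrite /rem /trn rmorphB mulrBl mul1r. Qed.

Let L2_rem n : L2 (rem n).
Proof.
split; first exact: cmeasB.
apply: (intg_le _ _ fi); first by apply: cmeas_normc2; exact: cmeasB.
move=> x; rewrite ger0_norm ?sqr_ge0// ler_sqr ?nnegrE ?normc_ge0// remE normcM normcR.
have /andP[c0 c1] := chi01 n x.
by rewrite ger0_norm ?subr_ge0// ler_piMl ?normc_ge0// lerBlDr lerDl.
Qed.

Let sq_trn_cvg : (fun n => sq (trn n)) @ \oo --> sq f.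
Proof.
apply: (Rint_dominated (g := fun x => normc (f x) ^+ 2)) => //.
- by move=> n; exact: cmeas_normc2.
- move=> x; have [N hN] := chi_eventually x; apply: cvg_near_cst.
  by exists N => // n /= /hN h; rewrite /trn h mul1r.
- by move=> n x; rewrite ger0_norm ?sqr_ge0// ler_sqr ?nnegrE ?normc_ge0.
Qed.

Let sq_rem_cvg : (fun n => sq (rem n)) @ \oo --> (0 : R).
Proof.
have -> : 0 = \int[leb]_x (0 : R) by rewrite /Rintegral integral0.
apply: (Rint_dominated (g := fun x => normc (f x) ^+ 2)) => //.
- by move=> n; apply: cmeas_normc2; exact: cmeasB.
- move=> x; have [N hN] := chi_eventually x; apply: cvg_near_cst.
  by exists N => // n /= /hN h; rewrite remE h subrr mul0r normc0 expr0n.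
- move=> n x; have /andP[c0 c1] := chi01 n x.
  rewrite ger0_norm ?sqr_ge0// ler_sqr ?nnegrE ?normc_ge0// remE normcM normcR.
  by rewrite ger0_norm ?subr_ge0// ler_piMl ?normc_ge0// lerBlDr lerDl.
Qed.

Let prod_dom i (g : 'cV[R]_d -> R[i]) x : normc (g x) <= normc (f x) ->
  normc (g x * cj (p i x)) <= normc (f x) ^+ 2 + normc (p i x) ^+ 2.
Proof.
move=> h; rewrite normcM normcJ'; have := normc_ge0 (p i x); have := normc_ge0 (g x).
move: h; set a := normc (f x); set b := normc (g x); set c := normc (p i x) => h1 h2 h3.
have := sqr_ge0 (a - c); nra.
Qed.

Let intg_dom i : intg leb (fun x => normc (f x) ^+ 2 + normc (p i x) ^+ 2).
Proof. by apply: intgD => //; case: (pL2 i). Qed.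

Let cL1_inner i (g : 'cV[R]_d -> R[i]) : cmeas g -> (forall x, normc (g x) <= normc (f x)) ->
  cL1 leb (fun x => g x * cj (p i x)).
Proof.
move=> mg gf; apply: (cL1_le _ _ (intg_dom i)).
  by apply: cmeasM => //; apply: cmeasJ; case: (pL2 i).
by move=> x; exact: prod_dom.
Qed.

Let inner_trn_cvg i : ccvg (fun n => inner (trn n) (p i)) (inner f (p i)).
Proof.
apply: (cint_dominated (g := fun x => normc (f x) ^+ 2 + normc (p i x) ^+ 2)).
- by move=> n; apply: cmeasM => //; apply: cmeasJ; case: (pL2 i).
- move=> x; have [N hN] := chi_eventually x.
  by apply: (@ccvg_near_cst _ _ _ N) => n /hN h; rewrite /trn h mul1r.
- by move=> n x; exact: prod_dom.
- exact: intg_dom.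
Qed.

Let inner_split n i : inner (trn n) (p i) = inner f (p i) - inner (rem n) (p i).
Proof.
rewrite !innerE -cintB.
- by apply: eq_cint => x; rewrite -mulrBl /rem opprB addrC subrK.
- exact: cL1_inner.
- apply: cL1_inner; first by case: (L2_rem n).
  move=> x; have /andP[c0 c1] := chi01 n x; rewrite remE normcM normcR.
  by rewrite ger0_norm ?subr_ge0// ler_piMl ?normc_ge0// lerBlDr lerDl.
Qed.

(** Upper bounds pass to the limit on finite subfamilies of indices, where each coefficient
    converges. *)
Lemma bessel_upper : (bessel_sum f <= B%:E * energy f)%E.
Proof.
rewrite energyE//; apply: esum_le_fin => r ur rD; rewrite sumEFin -EFinM lee_fin.
have cv : (fun n => \sum_(i <- r) normc (inner (trn n) (p i)) ^+ 2) @ \oo -->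
    \sum_(i <- r) normc (inner f (p i)) ^+ 2.
  elim: (r) => [|i s IH].
    by rewrite big_nil; under eq_fun do rewrite big_nil; exact: cvg_cst.
  rewrite big_cons; under eq_fun do rewrite big_cons.
  by apply: cvgD => //; apply: ccvg_normc_sqr; exact: inner_trn_cvg.
apply: (ler_cvg_to cv (cvg_cst _)); apply: nearW => n.
rewrite -lee_fin; apply: (@le_trans _ _ (bessel_sum (trn n))).
  by rewrite -sumEFin; exact: esum_ge_fin.
apply: le_trans (upper_tame (tame_trn n)) _; rewrite (energyE (L2_trn n)) -EFinM lee_fin.
rewrite ler_wpM2l//; apply: le_Rintegral => //; first by case: (L2_trn n).
by move=> x _; rewrite ler_sqr ?nnegrE ?normc_ge0.
Qed.

(** The inequality [(u + v)^2 <= (1 + t) u^2 + (1 + 1/t) v^2], applied to the coefficients of the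
    function and of the remainder. *)
Lemma bessel_approx n (t : R) : 0 < t ->
  (bessel_sum (trn n) <= (1 + t)%:E * bessel_sum f + (1 + t^-1)%:E * bessel_sum (rem n))%E.
Proof.
move=> t0.
have sq0 g i : (0 <= (normc (inner g (p i)) ^+ 2)%:E)%E by rewrite lee_fin sqr_ge0.
rewrite -!esumZl ?addr_ge0 ?invr_ge0 ?(ltW t0)// -esumD; last 2 first.
- by move=> i _; rewrite mule_ge0// lee_fin addr_ge0// ltW.
- by move=> i _; rewrite mule_ge0// lee_fin addr_ge0// invr_ge0 ltW.
apply: le_esum => i _; rewrite -!EFinM -EFinD lee_fin inner_split.
move: (inner f _) (inner (rem n) _) => a b.
have h : normc (a - b) <= normc a + normc b by rewrite -[normc b]normcN; exact: le_normcD.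
apply: (@le_trans _ _ ((normc a + normc b) ^+ 2)).
  by rewrite ler_sqr ?nnegrE ?addr_ge0 ?normc_ge0.
have := sqr_ge0 (t * normc a - normc b).
set u := normc a; set v := normc b => h1.
have e : (1 + t) * u ^+ 2 + (1 + t^-1) * v ^+ 2 - (u + v) ^+ 2 = t^-1 * (t * u - v) ^+ 2.
  by field; rewrite gt_eqF.
by rewrite -subr_ge0 e mulr_ge0// invr_ge0 ltW.
Qed.

(** Finite subfamilies do not suffice for a lower bound. The upper bound, already extended, controls
    the remainder, whose energy tends to 0 while [t] stays fixed; the loss [1 + t] is absorbed in
    [eps] at the end. *)
Lemma bessel_lower (t : R) : (forall g, L2 g -> (bessel_sum g <= B%:E * energy g)%E) -> 0 < t ->
  (A%:E * energy f <= (1 + t)%:E * bessel_sum f)%E.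
Proof.
move=> upper t0; have sf := upper _ fL2.
have s0 g : (0 <= bessel_sum g)%E by apply: esum_ge0 => i _; rewrite lee_fin sqr_ge0.
move: sf (s0 f); rewrite (energyE fL2) -EFinM.
case E : (bessel_sum f) => [s| |]//; rewrite ?leye_eq// => _ _; rewrite -!EFinM lee_fin.
have h n : A * sq (trn n) <= (1 + t) * s + (1 + t^-1) * B * sq (rem n).
  rewrite -lee_fin EFinM -(energyE (L2_trn n)); apply: le_trans (lower_tame (tame_trn n)) _.
  apply: le_trans (bessel_approx n t0) _; rewrite E.
  rewrite [leRHS]EFinD [X in (_ <= X + _)%E]EFinM leeD2l// !EFinM -muleA -(energyE (L2_rem n)); apply: lee_wpmul2l.
    by rewrite lee_fin addr_ge0// invr_ge0 ltW.
  exact: upper.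
have c1 : (fun n => A * sq (trn n)) @ \oo --> A * sq f by apply: cvgMr; exact: sq_trn_cvg.
have c2 : (fun n => (1 + t) * s + (1 + t^-1) * B * sq (rem n)) @ \oo -->
    (1 + t) * s + (1 + t^-1) * B * 0.
  by apply: cvgD; [exact: cvg_cst|apply: cvgMr; exact: sq_rem_cvg].
rewrite -[leRHS]addr0 -[X in _ + X](mulr0 ((1 + t^-1) * B)).
by apply: (ler_cvg_to c1 c2); apply: nearW.
Qed.

End truncation.

Lemma bessel_bounds f (t : R) : L2 f -> 0 < t ->
  (bessel_sum f <= B%:E * energy f)%E /\ (A%:E * energy f <= (1 + t)%:E * bessel_sum f)%E.
Proof.
by move=> fL2 t0; split; [exact: bessel_upper|apply: bessel_lower => //; exact: bessel_upper].
Qed.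

End extension.

(** * Decay exponents adapted to the complexity of the tiling *)

Section exponents.
Context {R : realType}.
Variables (d : nat) (K : R -> R).
Hypotheses (K_ge1 : forall t, 1 <= t -> 1 <= K t)
  (K_nondecr : forall s t, 1 <= s -> s <= t -> K s <= K t)
  (K_int : (\int[lebesgue_measure]_(t in `[1%R, +oo[) (ln (K t) / t ^+ 2)%:E < +oo)%E).

Local Notation mu := (@lebesgue_measure R).
(** Nothing is known of [K] below 1; extending by the value at 1 gives a monotone, hence measurable,
    function on the whole line. *)
Let L (t : R) : R := ln (K (Num.max t 1)).
Let g (t : R) : \bar R := (L t / Num.max t 1 ^+ 2)%:E.

Let max1 (t : R) : 1 <= Num.max t 1. Proof. by rewrite le_max lexx orbT. Qed.

Let L0 t : 0 <= L t. Proof. by apply: ln_ge0; exact: K_ge1. Qed.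

Let L_nondecr s t : s <= t -> L s <= L t.
Proof.
move=> st; rewrite /L ler_ln ?posrE ?(lt_le_trans ltr01) ?K_ge1//.
by apply: K_nondecr => //; rewrite ge_max !le_max st lexx orbT.
Qed.

Let g0 t : (0 <= g t)%E.
Proof. by rewrite lee_fin divr_ge0// sqr_ge0. Qed.

Let mg (D : set R) : measurable D -> measurable_fun D g.
Proof.
move=> mD; apply: measurable_funTS; apply/measurable_EFinP; apply: measurable_funM.
  by apply: nondecreasing_measurable => //; exact: L_nondecr.
apply: nonincreasing_measurable => // s t st.
have ps := lt_le_trans ltr01 (max1 s); have pt := lt_le_trans ltr01 (max1 t).
rewrite lef_pV2 ?posrE ?exprn_gt0// ler_sqr ?nnegrE ?(ltW ps) ?(ltW pt)//.
by rewrite ge_max !le_max st lexx orbT.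
Qed.

(** The interval has length [2 ^+ j.+1], and on it [1 / t ^+ 2] is at least [2 ^- (2 * j + 4)];
    their product is [8^-1 / 2 ^+ j]. *)
Let layer j : ((8^-1 * (L (2 ^+ j.+1) / 2 ^+ j))%:E <=
  \int[mu]_(t in `[(2 ^+ j.+1)%R, (2 ^+ j.+2)%R[) g t)%E.
Proof.
have p0 : 0 < 2 ^+ j.+1 :> R by rewrite exprn_gt0.
apply: (@le_trans _ _ (\int[mu]_(t in `[(2 ^+ j.+1)%R, (2 ^+ j.+2)%R[)
    (L (2 ^+ j.+1) / (2 ^+ j.+2) ^+ 2)%:E)%E).
  rewrite integral_cst//= lebesgue_measure_itv/= lte_fin.
  rewrite ltr_eXn2l ?ltr1n// ltnS leqnn -EFinD -EFinM lee_fin le_eqVlt; apply/orP; left; apply/eqP.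
  have : 0 < 2 ^+ j :> R by rewrite exprn_gt0.
   rewrite !exprS => h; field.
  by rewrite gt_eqF.
apply: ge0_le_integral => //=.
- by move=> t _; rewrite lee_fin divr_ge0// sqr_ge0.
- by apply: mg.
- move=> t /=; rewrite in_itv /= => /andP[h1 h2]; rewrite lee_fin.
  have t1 : 1 <= t by apply: le_trans h1; rewrite exprn_ege1// ler1n.
  have t0 : 0 < t := lt_le_trans p0 h1; rewrite max_l//.
  apply: ler_pM; [exact: L0|by rewrite invr_ge0 sqr_ge0| |].
    exact: L_nondecr.
  by rewrite lef_pV2 ?posrE ?exprn_gt0// ler_sqr ?nnegrE ?(ltW t0)// ?exprn_ge0// ltW.
Qed.

Let layers N : ((8^-1 * \sum_(j < N) L (2 ^+ j.+1) / 2 ^+ j)%:E <=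
  \int[mu]_(t in `[2%R, (2 ^+ N.+1)%R[) g t)%E.
Proof.
elim: N => [|N IH].
  by rewrite big_ord0 mulr0 integral_ge0.
rewrite big_ord_recr /= mulrDr EFinD.
have -> : `[2, (2 ^+ N.+2)[%classic = `[2, 2 ^+ N.+1[ `|` `[2 ^+ N.+1, 2 ^+ N.+2[ :> set R.
  apply: itv_bndbnd_setU; rewrite bnd_simp ?ler_eXn2l ?ltr1n//.
  by rewrite -[leLHS]expr1 ler_eXn2l ?ltr1n.
rewrite ge0_integral_setU//=; first by apply: leeD; [exact: IH|exact: layer].
- by apply: mg; exact: measurableU.
- apply/disj_setPS => t [/=]; rewrite !in_itv /= => /andP[_ h1] /andP[h2 _].
  by have := lt_le_trans h1 h2; rewrite ltxx.
Qed.

Let ln_sum_bounded : exists M, forall N, \sum_(j < N) ln (K (2 ^+ j.+1)) / 2 ^+ j <= M.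
Proof.
have E : (\int[mu]_(t in `[1%R, +oo[) g t = \int[mu]_(t in `[1%R, +oo[) (ln (K t) / t ^+ 2)%:E)%E.
  apply: eq_integral => t; rewrite inE /= in_itv /= andbT => t1.
  by rewrite /g /L !max_l.
have I0 : (0 <= \int[mu]_(t in `[1%R, +oo[) g t)%E by apply: integral_ge0.
move: K_int I0; rewrite -E; case E' : (integral _ _ _) => [M| |]// _ _.
exists (8 * M) => N.
have h : ((8^-1 * \sum_(j < N) L (2 ^+ j.+1) / 2 ^+ j)%:E <= M%:E)%E.
  rewrite -E'; apply: le_trans (layers N) _; apply: ge0_subset_integral => //=.
    exact: mg.
  by move=> t /=; rewrite !in_itv /= andbT => /andP[h _]; apply: le_trans h; rewrite ler1n.
rewrite (_ : \sum_(j < N) _ = \sum_(j < N) L (2 ^+ j.+1) / 2 ^+ j).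
  by move: h; rewrite lee_fin; lra.
by apply: eq_bigr => j _; rewrite /L max_l// exprn_ege1// ler1n.
Qed.

(** Telescoping: with [p y = 2 (y^2 + 2 y + 3)] one has [p y - p (y + 1) / 2 = y^2]. *)
Let sqr_sum N (a : R) : \sum_(j < N) (j%:R + a) ^+ 2 / 2 ^+ j =
  2 * (a ^+ 2 + 2 * a + 3) - 2 * ((N%:R + a) ^+ 2 + 2 * (N%:R + a) + 3) / 2 ^+ N.
Proof.
elim: N => [|N IH]; first by rewrite big_ord0 expr0 divr1 add0r subrr.
rewrite big_ord_recr /= IH -(natr1 N) (exprS 2 N); have h : 0 < 2 ^+ N :> R by rewrite exprn_gt0.
by field; rewrite gt_eqF.
Qed.

Let expR1_le4 : expR 1 <= 4 :> R.
Proof.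
have h := expR_ge1Dx (- 2^-1 : R); have p := expR_gt0 (2^-1 : R).
have e : expR (- 2^-1 : R) * expR 2^-1 = 1 by rewrite expRxMexpNx_1 || rewrite mulrC expRxMexpNx_1.
have e1 : expR (1 : R) = expR (2^-1) ^+ 2 by rewrite -expRM_natl; congr expR; field.
have h2 : 0 <= (expR (- 2^-1 : R) - 2^-1) * expR 2^-1 by rewrite mulr_ge0//; lra.
rewrite mulrBl e in h2.
by rewrite e1 -[4](_ : 2 ^+ 2 = _) ?ler_sqr ?nnegrE ?(ltW p)//; lra.
Qed.

(** One more than the integer part, so that [e] to the power [k j], and a fortiori [4 ^+ k j],
    dominates [K (2 ^+ j.+1)]. *)
Let k j := (Num.truncn (ln (K (2 ^+ j.+1)))).+1.

Let pow_ge1 j : 1 <= 2 ^+ j.+1 :> R. Proof. by rewrite exprn_ege1// ler1n. Qed.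
Let lnK_ge0 j : 0 <= ln (K (2 ^+ j.+1)). Proof. by apply/ln_ge0/K_ge1. Qed.

Let k_nondecr j : (k j <= k j.+1)%N.
Proof.
rewrite ltnS; apply: le_truncn; rewrite ler_ln ?posrE ?(lt_le_trans ltr01) ?K_ge1//.
by apply: K_nondecr => //; rewrite ler_eXn2l ?ltr1n.
Qed.

Let K_le j : K (2 ^+ j.+1) <= 4 ^+ k j.
Proof.
have K0 : 0 < K (2 ^+ j.+1) by rewrite (lt_le_trans ltr01) ?K_ge1.
rewrite -[leLHS](@lnK R) ?posrE//.
apply: (@le_trans _ _ (expR 1 ^+ k j)); last by rewrite lerXn2r ?nnegrE ?expR_ge0.
by rewrite -expRM_natl mulr1 ler_expR ltW// truncnS_gt.
Qed.

Lemma exponents_exist : exists (m : nat -> nat) (M : R),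
  [/\ forall N, \sum_(j < N) (m j)%:R / 2 ^+ j <= M, forall j, (m j < m j.+1)%N,
      forall j, (j * j <= m j)%N &
      forall j, (2 ^+ j.+1 + 1) ^+ d * (1 + K (2 ^+ j.+1)) * 4 ^- m j <= 2 ^- j].
Proof.
have [M0 hM0] := ln_sum_bounded.
pose a : R := d%:R + 3.
(* Of the exponent, [k j] pays for [K], [(j + 2) * d] for the lattice volume, and
   [(j + 2) * (j + 1)] for [2 * 2 ^+ j]. The quadratic part also gives strict growth and
   [j * j <= m j], and together with the rounding in [k j] it is at most [(j + a) ^+ 2]. *)
exists (fun j => k j + (j + 2) * (j + d + 1))%N, (M0 + 2 * (a ^+ 2 + 2 * a + 3)); split.
- move=> N; apply: (@le_trans _ _ (\sum_(j < N) (ln (K (2 ^+ j.+1)) / 2 ^+ j +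
      (j%:R + a) ^+ 2 / 2 ^+ j))).
    apply: ler_sum => j _; rewrite -mulrDl ler_pM2r ?invr_gt0 ?exprn_gt0//.
    have h : (k j)%:R <= ln (K (2 ^+ j.+1)) + 1 by rewrite -[X in X <= _]natr1 lerD2r truncn_le.
    rewrite natrD natrM !natrD /a.
    rewrite -subr_ge0 [X in 0 <= X](_ : _ = (ln (K (2 ^+ j.+1)) + 1 - (k j)%:R) +
        (d%:R * d%:R + j%:R * d%:R + 3 * j%:R + 4 * d%:R + 6)); last by ring.
    by rewrite addr_ge0 ?subr_ge0// !addr_ge0// mulr_ge0.
  rewrite big_split /=; apply: lerD; first exact: hM0.
  rewrite sqr_sum lerBlDr lerDl divr_ge0 ?exprn_ge0//.
  have y0 : 0 <= N%:R + a by rewrite !addr_ge0.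
  by rewrite mulr_ge0// addr_ge0// addr_ge0 ?sqr_ge0// mulr_ge0.
- move=> j; have := k_nondecr j => h; apply: (@leq_ltn_trans (k j.+1 + (j + 2) * (j + d + 1)))%N.
    by rewrite leq_add2r.
  by rewrite ltn_add2l; apply: ltn_mul; rewrite ?ltn_add2r ?addSn.
- by move=> j; apply: leq_trans (leq_addl _ _); apply: leq_mul; lia.
- move=> j.
  have h1 : 1 + K (2 ^+ j.+1) <= 2 * 4 ^+ k j.
    by move: (K_ge1 (pow_ge1 j)) (K_le j); move: (K _) (4 ^+ _) => a1 a2; lra.
  have h2 : (2 ^+ j.+1 + 1) ^+ d <= 4 ^+ ((j + 2) * d) :> R.
    rewrite exprM lerXn2r ?nnegrE ?addr_ge0 ?exprn_ge0//.
    have : 1 <= 2 ^+ j.+1 :> R by [].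
    have : 2 ^+ j.+2 <= 4 ^+ (j + 2) :> R.
      by rewrite addn2 lerXn2r ?nnegrE ?ler_nat.
    by rewrite [2 ^+ j.+2]exprS; move: (2 ^+ _) (4 ^+ _) {h1} => a1 a2; lra.
  rewrite ler_pdivrMr ?exprn_gt0//.
  apply: (@le_trans _ _ (4 ^+ ((j + 2) * d) * (2 * 4 ^+ k j))).
    apply: ler_pM; [| |exact: h2|exact: h1].
      by rewrite exprn_ge0// addr_ge0// exprn_ge0.
    by rewrite addr_ge0// (le_trans ler01) ?K_ge1.
  have -> : (k j + (j + 2) * (j + d + 1) = (j + 2) * d + k j + (j + 2) * (j + 1))%N by lia.
  rewrite [in leRHS]exprD [in leRHS]exprD.
  have h3 : 2 * 2 ^+ j <= 4 ^+ ((j + 2) * (j + 1)) :> R.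
    rewrite -exprS; apply: (@le_trans _ _ (4 ^+ j.+1)); first by rewrite lerXn2r ?nnegrE ?ler_nat.
    by rewrite ler_weXn2l ?ler1n//; lia.
  have p0 : 0 < 2 ^+ j :> R by rewrite exprn_gt0.
  rewrite [leRHS]mulrC ler_pdivlMr//.
  rewrite [2 * _]mulrC mulrA -[leLHS]mulrA.
  by rewrite ler_wpM2l// mulr_ge0// exprn_ge0.
Qed.

End exponents.

(** * Frame bounds *)

Section square_integrable.
Context {R : realType}.
Variable d : nat.
Local Notation leb := (lebesgue_cV R d).

Lemma energy_L2norm (f : 'cV[R]_d -> R[i]) : in_L2 f ->
  [/\ cmeas f, intg leb (fun x => normc (f x) ^+ 2) & (L2norm f ^+ 2)%E = energy f].
Proof.
move=> [mr mi fin].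
have E : (L2norm f `^ 2)%E = energy f.
  rewrite /L2norm poweR_Lnorm//; apply: eq_integral => x _ /=.
  by rewrite ger0_norm ?normc_ge0// -[2]/(2%:R) powR_mulrn// normc_ge0.
have := Lnorm_ge0 leb 2%:E (EFin \o (@normc R \o f)); rewrite -/(L2norm f).
move: fin E; case: (L2norm f) => [r| |]// _ E; rewrite lee_fin => r0.
have E2 : (r%:E ^+ 2)%E = energy f by rewrite -E poweR_EFin -[2]/(2%:R) powR_mulrn// EFin_expe.
split=> //; apply: intg_ge0_lty; first exact: cmeas_normc2.
  by move=> x; exact: sqr_ge0.
by rewrite -/(energy f) -E2 -EFin_expe ltry.
Qed.

Lemma intg_sqr_bounded_support (f : 'cV[R]_d -> R[i]) (B L : R) :
  cmeas f -> (forall x, normc (f x) <= B) ->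
  (forall x : 'cV[R]_d, ~ (forall i, - L <= x i ord0 < L) -> f x = 0) ->
  intg leb (fun x => normc (f x) ^+ 2).
Proof.
move=> mf fB f0; have [_] : cL1 leb (fun x => (normc (f x) ^+ 2)%:C).
  apply: (@cL1_bounded_support _ _ _ (B ^+ 2) L).
  - by apply: cmeas_real; exact: cmeas_normc2.
  - move=> x; have h := normc_ge0 (f x); rewrite normcR ger0_norm ?sqr_ge0//.
    by rewrite ler_sqr ?nnegrE// (le_trans h).
  - by move=> x /f0 ->; rewrite normc0 expr0n.
rewrite (_ : (fun _ => _) = (fun x => normc (f x) ^+ 2))//; apply/funext => x.
by rewrite normcR ger0_norm ?sqr_ge0.
Qed.

Lemma tame_energy (f : 'cV[R]_d -> R[i]) : tame f -> (energy f < +oo)%E.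
Proof.
move=> [mf [[B L] /= L0 [fB f0]]].
by have h := intg_sqr_bounded_support mf fB f0; rewrite /energy -RintegralE// ltry.
Qed.

Lemma packet_L2 (phi : 'cV[R]_d -> R[i]) (T : 'M[R]_d * 'cV[R]_d) (k : 'cV[R]_d) :
  is_tile T -> cmeas phi -> intg leb (fun x => normc (phi x) ^+ 2) ->
  cmeas (packet phi T k) /\ intg leb (fun x => normc (packet phi T k x) ^+ 2).
Proof.
move=> uT mphi iphi.
have mp : cmeas (packet phi T k).
  apply: cmeasM; first apply: cmeasM; first apply: cmeas_expi.
  - by apply: measurable_funM => //; exact: measurable_dotp.
  - exact: cmeas_cst.
  - rewrite (_ : (fun _ => _) = phi \o (fun x => T.1^T *m x + k)).
      by apply: cmeas_comp => //; exact: measurable_affine_cV.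
    by apply/funext => x /=; rewrite addrC.
split=> //; apply: intg_ge0_lty; [exact: cmeas_normc2|by move=> x; exact: sqr_ge0|].
have E x : normc (packet phi T k x) ^+ 2 = `|\det T.1^T| * normc (phi (T.1^T *m x + k)) ^+ 2.
  rewrite !normcM normc_expi mul1r normcR ger0_norm ?sqrtr_ge0// exprMn sqr_sqrtr//.
  by rewrite det_tr addrC.
under eq_integral do rewrite E EFinM.
have m2 : measurable_fun setT (fun x => (normc (phi x) ^+ 2)%:E).
  by apply/measurable_EFinP; exact: cmeas_normc2.
rewrite ge0_integralZl//.
- rewrite (@ge0_integral_affine _ _ _ _ (fun x => (normc (phi x) ^+ 2)%:E)) ?unitmx_tr//.
    by rewrite -RintegralE// ltry.
  by move=> x; rewrite lee_fin sqr_ge0.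
- exact: (measurableT_comp m2 (measurable_affine_cV _ _)).
- by move=> x _; rewrite lee_fin sqr_ge0.
Qed.

End square_integrable.

Section frame.
Context {R : realType}.
Variable d : nat.
Local Notation mu := (@lebesgue_measure R).
Local Notation leb := (lebesgue_cV R d).
Variables (theta delta X : R) (m : nat -> nat) (w : R -> R) (K : R -> R).
Hypotheses (d_gt0 : (0 < d)%N) (th0 : 0 < theta) (th1 : theta < 1)
  (d0 : 0 < delta) (d1 : delta <= 1) (ww : is_window theta delta m X w)
  (K_ge1 : forall t, 1 <= t -> 1 <= K t)
  (m_sqr : forall j, (j * j <= m j)%N)
  (mK : forall j, (2 ^+ j.+1 + 1) ^+ d * (1 + K (2 ^+ j.+1)) * 4 ^- m j <= 2 ^- j).

Local Notation eta := (@prod_cos_tf R d w (fun=> 0%N)).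
Let etaC x := (eta x)%:C.

Let w01 z : 0 <= w z <= 1. Proof. by case: ww. Qed.

Lemma cos_tf_le x : `|cos_tf w 0 x| <= \int[mu]_s w s.
Proof.
have iw := window_intg ww; have mw := intg_meas iw.
have dom s : `|cos_tf_int w 0 x s| <= w s.
  have /andP[w0 _] := w01 s; rewrite /cos_tf_int normrM (ger0_norm w0) expr0 mul1r.
  by rewrite ler_piMr// cos_max.
have mc : measurable_fun setT (cos_tf_int w 0 x).
  apply: measurable_funM => //; rewrite (_ : (fun _ => _) = (fun s => cos (2 * pi * x * s))).
    apply: (measurableT_comp (continuous_measurable_fun (@continuous_cos R))).
    exact: measurable_funM.
  by apply/funext => s; rewrite expr0 mul1r mul0r addr0; congr cos; ring.
have ic : intg mu (cos_tf_int w 0 x) by apply: (intgR_le (g := w)).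
apply: le_trans (le_normr_Rintegral measurableT ic) _.
apply: le_Rintegral => //; first exact: intg_norm.
Qed.

Lemma prod_cos_tf_L2 : cmeas etaC /\ intg leb (fun x => normc (etaC x) ^+ 2).
Proof.
have mh : measurable_fun setT (cos_tf w 0).
  apply: continuous_measurable_fun => x; apply: differentiable_continuous.
  by apply/derivable1_diffP; exact: (derive_cos_tf d0 ww m_sqr 0 x).1.
have me : cmeas etaC.
  apply: cmeas_real; apply: measurable_prod => i _.
  exact: (measurableT_comp mh (measurable_coord i)).
split=> //; apply: (@intg_sqr_bounded_support _ _ _ ((\int[mu]_s w s) ^+ d) `|X|) => //.
- move=> x; rewrite normcR normr_prod.
  rewrite -[d in X in _ <= X]card_ord -prodr_const; apply: ler_prod => i _.
  by rewrite normr_ge0 cos_tf_le.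
(* As [2 * pi >= 1], the vanishing for [2 * pi * |x_i| >= X] covers [|x_i| >= |X|]. *)
- move=> x hx; have [i hi] : exists i, `|X| <= `|x i ord0|.
    apply: contrapT => /forallNP h; apply: hx => i.
    by have := h i; move/negP; rewrite -ltNge ltr_norml => /andP[h1 h2]; rewrite h2 ltW.
  rewrite /etaC /prod_cos_tf (bigD1 i)//= (cos_tf_eq0 ww) ?mul0r//.
  have := pi_ge2 R; have := ler_norm X; have := normr_ge0 X; nra.
Qed.

Variables (C : R) (Ts : set ('M[R]_d * 'cV[R]_d)).
Hypotheses (C1 : 1 < C) (aT : admissible_tiling C theta K Ts).
Let Q : R := tail_const d C.

Lemma frame_bounds (f : 'cV[R]_d -> R[i]) (t : R) : in_L2 f -> 0 < t ->
  let S := (\esum_(T in Ts) \esum_(k in [set: 'cV[int]_d])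
    (normc (inner f (packet etaC T (of_Zd k))) ^+ 2)%:E)%E in
  (S <= (C + delta * (2 * C + 6 * Q))%:E * L2norm f ^+ 2)%E /\
  ((((1 - delta) ^+ d) ^+ 2 - delta * (2 * C + 5 * Q))%:E * L2norm f ^+ 2 <= (1 + t)%:E * S)%E.
Proof.
move=> /energy_L2norm[mf fi ->] t0 S.
(* The zero function replaces packets of singular matrices, so that square integrability holds for
   every index and not only on [D]. *)
pose p (i : ('M[R]_d * 'cV[R]_d) * 'cV[int]_d) :=
  if i.1.1 \in unitmx then packet etaC i.1 (of_Zd i.2) else fun=> 0.
pose D : set (('M[R]_d * 'cV[R]_d) * 'cV[int]_d) := Ts `*`` (fun=> setT).
have [Tt _ _] := aT.
have sumE g : bessel_sum D p g = (\esum_(T in Ts) coef_energy w g T)%E.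
  rewrite /coef_energy (@esum_esum _ _ _ Ts (fun=> setT)); last first.
    by move=> T k _ _; rewrite lee_fin sqr_ge0.
  apply: eq_esum => -[T k] [/= TT _]; rewrite /p /=.
  by have -> : T.1 \in unitmx by exact: Tt.
have [me ie] := prod_cos_tf_L2.
have pL2 i : cmeas (p i) /\ intg leb (fun x => normc (p i x) ^+ 2).
  rewrite /p; case: ifPn => u; first exact: packet_L2.
  split; first exact: cmeas_cst.
  rewrite (_ : (fun _ => _) = fun=> 0); last by apply/funext => x; rewrite normc0 expr0n.
  exact: integrable0.
have C0 : 0 < C := lt_trans ltr01 C1.
have Q0 : 0 <= Q by rewrite /Q /tail_const mulr_ge0// mulr_ge0 ?exprn_ge0 ?powR_ge0// ltW.
have ca0 g T : (0 <= coef_energy w g T)%E by apply: esum_ge0 => k _; rewrite lee_fin sqr_ge0.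
have up g : tame g -> (bessel_sum D p g <= (C + delta * (2 * C + 6 * Q))%:E * energy g)%E.
  move=> tg; rewrite sumE; apply: esum_le_fin => r ur rT.
  exact: (tame_upper d_gt0 th0 th1 d0 d1 ww K_ge1 m_sqr mK C1 aT tg ur rT).
have lo g : tame g -> ((((1 - delta) ^+ d) ^+ 2 - delta * (2 * C + 5 * Q))%:E * energy g <=
    bessel_sum D p g)%E.
  move=> tg; have := tame_lower d_gt0 th0 th1 d0 d1 ww K_ge1 m_sqr mK C1 aT tg.
  rewrite -sumE -/Q; have := tame_energy tg; have := energy_ge0 g.
  case: (energy g) => [e| |]// _ _; rewrite -!EFinM.
  have := ca0; have : (0 <= bessel_sum D p g)%E by apply: esum_ge0 => i _; rewrite lee_fin sqr_ge0.
  case: (bessel_sum D p g) => [s| |]// _ _; rewrite ?leey// -EFinD !lee_fin => h.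
  by rewrite mulrBl lerBlDr.
have B0 : 0 <= C + delta * (2 * C + 6 * Q).
  by rewrite addr_ge0 ?mulr_ge0 ?addr_ge0 ?mulr_ge0 ?(ltW C0) ?(ltW d0).
have [h1 h2] := bessel_bounds pL2 B0 up lo (conj mf fi) t0.
by move: h1 h2; rewrite sumE.
Qed.

End frame.

Theorem theorem2 (R : realType) (C theta : R) (d : nat) (K : R -> R)
  (C_gt1 : 1 < C) (theta_gt0 : 0 < theta) (theta_lt1 : theta < 1)
  (d_gt0 : (0 < d)%N)
  (K_ge1 : forall t, 1 <= t -> 1 <= K t)
  (K_nondecr : forall s t, 1 <= s -> s <= t -> K s <= K t)
  (K_int : (\int[lebesgue_measure]_(t in `[1%R, +oo[)
              (ln (K t) / t ^+ 2)%:E < +oo)%E) :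
  exists2 eps0 : R, 0 < eps0 &
  forall eps : R, 0 < eps -> eps < eps0 ->
  exists eta : 'cV[R]_d -> R,
    let etaC := fun x => (eta x)%:C in
    [/\ smooth eta /\ compactly_supported eta,
        even_coords eta /\ perm_invariant eta,
        forall T1 T2 : 'M[R]_d * 'cV[R]_d, is_tile T1 -> is_tile T2 ->
          tile_set T1 = tile_set T2 ->
          [set packet etaC T1 (of_Zd k) | k in [set: 'cV[int]_d]] =
          [set packet etaC T2 (of_Zd k) | k in [set: 'cV[int]_d]] &
        forall Ts : set ('M[R]_d * 'cV[R]_d), admissible_tiling C theta K Ts ->
        forall f : 'cV[R]_d -> R[i], in_L2 f ->
        let S := (\esum_(T in Ts) \esum_(k in [set: 'cV[int]_d])
          ((normc (inner f (packet etaC T (of_Zd k)))) ^+ 2)%:E)%E in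
        ((1 - eps)%:E * L2norm f ^+ 2 <= S)%E /\
        (S <= (C + eps)%:E * L2norm f ^+ 2)%E].
Proof.
pose Q : R := tail_const d C; have C0 : 0 < C := lt_trans ltr01 C_gt1.
have Q0 : 0 <= Q by rewrite /Q /tail_const mulr_ge0// mulr_ge0 ?exprn_ge0 ?powR_ge0// ltW.
have dR := ler0n R d.
(* The bound [eps < 1] ensures [delta <= 1]; no other smallness is required. *)
exists 1 => // eps eps0 eps1.
have [m [M [mM m_incr m_sqr mK]]] := exponents_exist d K_ge1 K_nondecr K_int.
(* The term [2 * d] covers the loss in [(1 - delta) ^+ d] squared, [2 * C + 6 * Q] covers the error
   constants of both frame bounds, and the final 1 gives [c >= 1]; all losses together are at most
   [delta * c = eps / 2]. *)
pose c : R := 2 * d%:R + 2 * C + 6 * Q + 1.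
have c1 : 1 <= c by rewrite /c; lra.
pose delta := eps / (2 * c).
have delta0 : 0 < delta by rewrite divr_gt0// mulr_gt0// (lt_le_trans ltr01).
have deltac : delta * c = eps / 2.
  by rewrite /delta; field; rewrite gt_eqF// (lt_le_trans ltr01).
have delta1 : delta <= 1 by nra.
have [X [w ww]] := window_exists mM m_incr theta_gt0 theta_lt1 delta0.
exists (@prod_cos_tf R d w (fun=> 0%N)) => etaC; split.
- split; first exact: (smooth_prod_cos_tf delta0 ww m_sqr).
  exact: (compact_prod_cos_tf ww).
- by split; [exact: even_prod_cos_tf|exact: perm_prod_cos_tf].
- by move=> T1 T2 u1 u2 E; apply: (packets_tile_set (h := cos_tf w 0) (@cos_tfN _ w) u1 u2 E).
move=> Ts aT f fL2 S.
have t0 : 0 < eps / 2 by rewrite divr_gt0.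
have [up lo] := frame_bounds d_gt0 theta_gt0 theta_lt1 delta0 delta1 ww K_ge1 m_sqr mK C_gt1 aT fL2 t0.
have [_ fi E] := energy_L2norm fL2.
rewrite -/S -/Q in up lo; move: up lo; rewrite E /energy -(RintegralE fi).
set e := \int[_]_x _; have e0 : 0 <= e by apply: Rintegral_ge0 => x _; exact: sqr_ge0.
have S0 : (0 <= S)%E.
  by apply: esum_ge0 => T _; apply: esum_ge0 => k _; rewrite lee_fin sqr_ge0.
move: S0; case: S => [s| |]//; rewrite -!EFinM ?lee_fin// => s0 up lo.
have bern : 1 - 2 * d%:R * delta <= ((1 - delta) ^+ d) ^+ 2.
  have := @bernoulli_prod R _ (nseq (d * 2) tt) (fun=> 1 - delta) (fun=> delta).
  rewrite !big_const_seq !count_predT size_nseq iter_addr_0 iter_mulr_1 exprM.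
  rewrite -[delta *+ _]mulr_natl natrM [d%:R * 2]mulrC; apply=> _; lra.
have dQ : 0 <= delta * Q by rewrite mulr_ge0// ltW.
have dC : 0 <= delta * C by rewrite mulr_ge0// ltW.
have dd : 0 <= delta * d%:R by rewrite mulr_ge0// ltW.
split.
  have h : (1 - eps / 2) * e <= (1 + eps / 2) * s.
    apply: le_trans lo; apply: ler_wpM2r => //; move: deltac; rewrite /c; lra.
  (* Half of [eps] went to [delta]; the other half absorbs the factor [1 + t] left by the
     truncation, with [t = eps / 2]. *)
  have h2 : (1 - eps) * (1 + eps / 2) <= 1 - eps / 2 by nra.
  have h3 : ((1 - eps) * e) * (1 + eps / 2) <= s * (1 + eps / 2).
    rewrite mulrAC [leRHS]mulrC; apply: le_trans h; exact: ler_wpM2r.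
  by move: h3; rewrite ler_pM2r//; lra.
apply: le_trans up _; apply: ler_wpM2r => //; move: deltac; rewrite /c; lra.
Qed.
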